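(* Let the interfaces $\Gamma_1,\Gamma_2$ be as in the context, let $m,E\in\mathbb{R}$ with $0<|E|<|m|$, and let $f_j\in C_c^\infty(\Omega_j;\mathbb{C}^2)$ for $j=0,1,2$. Let $\alpha>0$ and suppose $(\rho_1,\rho_2)\in L^2_\alpha(\mathbb{R};\mathbb{C}^4)\cap C^\infty(\mathbb{R};\mathbb{C}^4)$ satisfies $$\begin{pmatrix}\mathcal{L}_1&\mathcal{K}_2\\ \mathcal{K}_1&\mathcal{L}_2\end{pmatrix}\begin{pmatrix}\mathcal{P}_1&0\\0&\mathcal{P}_2\end{pmatrix}\begin{pmatrix}\rho_1\\ \rho_2\end{pmatrix}=\begin{pmatrix}V_1^*(i\hat n_1\cdot\sigma)[[u_i]]_1\\ V_2^*(i\hat n_2\cdot\sigma)[[u_i]]_2\end{pmatrix}.$$ Set $\mu_j:=V_j\mathcal{P}_j\rho_j$ for $j=1,2$, and define $u:=u_i+u_s$, where $$u_s(x)=\begin{cases}\int_{\mathbb{R}}G_2(x,\gamma_2(t))\mu_2(t)\,dt,&x\in\Omega_2,\\ \int_{\mathbb{R}}G_1(x,\gamma_2(t))\mu_2(t)\,dt+\int_{\mathbb{R}}G_1(x,\gamma_1(t))\mu_1(t)\,dt,&x\in\Omega_1,\\ \int_{\mathbb{R}}G_2(x,\gamma_1(t))\mu_1(t)\,dt,&x\in\Omega_0.\end{cases}$$ Then $$(-i\partial_{x_1}\sigma_1-i\partial_{x_2}\sigma_2+m\sigma_3-E)u=f_2\ \text{in }\Omega_2,\quad (-i\partial_{x_1}\sigma_1-i\partial_{x_2}\sigma_2-m\sigma_3-E)u=f_1\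 \text{in }\Omega_1,\quad (-i\partial_{x_1}\sigma_1-i\partial_{x_2}\sigma_2+m\sigma_3-E)u=f_0\ \text{in }\Omega_0,$$ $$\lim_{\Omega_2\ni y\to x}u(y)=\lim_{\Omega_1\ni z\to x}u(z)\ \ (x\in\Gamma_2),\qquad \lim_{\Omega_1\ni y\to x}u(y)=\lim_{\Omega_0\ni z\to x}u(z)\ \ (x\in\Gamma_1),$$ and, with $\Gamma:=\Gamma_1\cup\Gamma_2$, $$\lim_{t\to\pm\infty}(\pm\partial_t-iE)\,u(\gamma_j(t)+r\hat n_j(t))=0\ \text{ for } j=1,2 \text{ and every fixed } r\neq0,\qquad \lim_{d(x,\Gamma)\to\infty}u(x)=0.$$
   Context: Geometry. $\Gamma_1,\Gamma_2\subset\mathbb{R}^2$ are two non-intersecting smooth simple curves separating the plane into a lower region $\Omega_0$, a middle region $\Omega_1$ and an upper region $\Omega_2$; $\Gamma_1$ separates $\Omega_0$ from $\Omega_1$ and $\Gamma_2$ separates $\Omega_1$ from $\Omega_2$. For $j=1,2$, $\gamma_j\in C^\infty(\mathbb{R};\mathbb{R}^2)$ is an arclength parameterization of $\Gamma_j$, $|\gamma_j'(t)|=1$; each $\gamma=\gamma_j$ satisfies $|\gamma^{(k)}(t)|\le C_ke^{-\eta|t|}$ for $k=2,3,4,\dots$ (for some constants $C_k,\eta>0$), $\lim_{t\to\infty}|\gamma(\pm t)|=\infty$ and $\lim_{t\to\infty}|\gamma(t)-\gamma(-t)|=\infty$. In addition $\lim_{t\to\infty}|\gamma_2(\epsilon_2t)-\gamma_1(\epsilon_1t)|=\infty$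 for all $\epsilon_1,\epsilon_2\in\{-1,1\}$. $\hat n_j(t)=(n_j^{(1)}(t),n_j^{(2)}(t))$ is the unit normal to $\Gamma_j$ at $\gamma_j(t)$ pointing into $\Omega_j$, and $(\gamma_j'(t),\hat n_j(t))$ is positively oriented. $[[g]]_j$ is the jump of $g$ across $\Gamma_j$ (limit from $\Omega_j$ minus limit from $\Omega_{j-1}$), viewed as a function of $t$ through $\gamma_j(t)$. $d(x,\Gamma)$ is the distance from $x$ to $\Gamma$. Matrices. $\sigma_1=\begin{pmatrix}0&1\\1&0\end{pmatrix}$, $\sigma_2=\begin{pmatrix}0&-i\\i&0\end{pmatrix}$, $\sigma_3=\begin{pmatrix}1&0\\0&-1\end{pmatrix}$, $\hat n_j\cdot\sigma=n_j^{(1)}\sigma_1+n_j^{(2)}\sigma_2$, $$V_j=V_j(t)=\frac1{\sqrt2}\begin{pmatrix}1&in_j^{(1)}+n_j^{(2)}\\ -in_j^{(1)}+n_j^{(2)}&-1\end{pmatrix},$$ and $\mathrm{M}=\begin{pmatrix}1&0\\0&0\end{pmatrix}$ if $m<0$, $\mathrm{M}=\begin{pmatrix}0&0\\0&1\end{pmatrix}$ if $m>0$. Green's functions and incident field. With $\omega=\sqrt{m^2-E^2}>0$ and $K_0$ the modified Bessel function of the second kind, for $j=1,2$, $$G_j(x,y)=\frac1{2\pi}\big(-i\partial_{x_1}\sigma_1-i\partial_{x_2}\sigma_2+(-1)^jm\sigma_3+E\big)K_0(\omega|x-y|),$$ and $u_i(x)=\int_{\Omega_2}G_2(x,y)f_2(y)dy$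 for $x\in\Omega_2$, $u_i(x)=\int_{\Omega_1}G_1(x,y)f_1(y)dy$ for $x\in\Omega_1$, $u_i(x)=\int_{\Omega_0}G_2(x,y)f_0(y)dy$ for $x\in\Omega_0$. Operators. For $j\in\{1,2\}$ and $\ell=3-j$: $$\mathcal{L}_j[\tau](t)=\tau(t)-(-1)^j\,2m\,V_j(t)^*(i\hat n_j(t)\cdot\sigma)\sigma_3\frac1{2\pi}\int_{\mathbb{R}}K_0(\omega|\gamma_j(t)-\gamma_j(t')|)V_j(t')\tau(t')\,dt',$$ $$\mathcal{K}_j[\tau](t)=(-1)^{j-1}V_\ell(t)^*(i\hat n_\ell(t)\cdot\sigma)\int_{\mathbb{R}}G_1(\gamma_\ell(t),\gamma_j(t'))V_j(t')\tau(t')\,dt',$$ $$\mathcal{P}_1=1+2im^2(1-\mathrm{M})R,\qquad \mathcal{P}_2=1+2im^2\,\mathrm{M}R,\qquad R[\rho](t)=\frac1{2iE}\int_{\mathbb{R}}e^{iE|t-t'|}\rho(t')\,dt'.$$ Weighted space. $L^2_\alpha=\{\rho\in L^2(\mathbb{R}):e^{\alpha|t|}\rho\in L^2(\mathbb{R})\}$; $L^2_\alpha(\mathbb{R};\mathbb{C}^4)$ is its $\mathbb{C}^4$-valued version, where $(\rho_1,\rho_2)$ has each $\rho_j$ valued in $\mathbb{C}^2$. *)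

(* Defs.v *)
From mathcomp Require Export all_boot all_order all_algebra complex.
From mathcomp Require Export all_classical all_reals all_analysis.
Export Order.TTheory GRing.Theory Num.Theory numFieldNormedType.Exports.

Set Implicit Arguments.
Unset Strict Implicit.
Unset Printing Implicit Defensive.

Local Open Scope classical_set_scope.
Local Open Scope complex_scope.
Local Open Scope ring_scope.

(* The regular module R[i]^o is R[i] with the topology of its modulus. *)
Notation cplx R := (R[i]^o).
Notation spinor R := 'cV[cplx R]_2.

Section Plane.
Variable R : realType.
Implicit Types (p x y : R * R) (A S : set (R * R)).

Definition leb : {measure set (measurableTypeR R) -> \bar R} :=
  @lebesgue_measure R.

Definition leb2 : {measure set (measurableTypeR R * measurableTypeR R) -> \bar R} :=
  (@lebesgue_measure R \x @lebesgue_measure R)%E.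

(* The norm carried by the product type R * R is the sup norm. *)
Definition enorm p : R := Num.sqrt (p.1 ^+ 2 + p.2 ^+ 2).

(* Only meaningful for nonempty S. *)
Definition edist x S : R := inf [set enorm (x - p) | p in S].

Definition far S : set_system (R * R) :=
  filter_from setT (fun D : R => [set x | D < edist x S]).

Definition boundary A : set (R * R) := closure A `\` interior A.

Definition edir (b : bool) : R * R := if b then (0, 1) else (1, 0).

End Plane.
Arguments leb R : clear implicits.
Arguments leb2 R : clear implicits.
Arguments edir R b : clear implicits.

Section Smoothness.
Variable R : realType.

Definition smooth_curve (V : normedModType R) (g : R -> V) : Prop :=
  forall k t, derivable (derive1n k g) t 1.

Definition iter_partial (w : seq bool) (g : R * R -> R) : R * R -> R :=
  foldr (fun b h x => 'D_(edir R b) h x) g w.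

Definition smooth2 (g : R * R -> R) : Prop :=
  forall w, continuous (iter_partial w g) /\
    forall b x, derivable (iter_partial w g) x (edir R b).

End Smoothness.

(* Real derivatives and integrals of spinor-valued functions are taken on the
   real and imaginary parts of the two components. *)
Section Spinors.
Variable R : realType.

Definition re_part (T : Type) (g : T -> spinor R) (k : 'I_2) : T -> R :=
  fun x => complex.Re (g x k 0).
Definition im_part (T : Type) (g : T -> spinor R) (k : 'I_2) : T -> R :=
  fun x => complex.Im (g x k 0).

Definition each_part (T : Type) (P : (T -> R) -> Prop) (g : T -> spinor R) :=
  forall k, P (re_part g k) /\ P (im_part g k).

Definition sderive (V : normedModType R) (v : V) (g : V -> spinor R) (x : V)
    : spinor R :=
  \col_k ('D_v (re_part g k) x +i* 'D_v (im_part g k) x).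

Definition sint d (T : measurableType d) (mu : {measure set T -> \bar R})
    (A : set T) (g : T -> spinor R) : spinor R :=
  \col_k (Rintegral mu A (re_part g k) +i* Rintegral mu A (im_part g k)).

Definition test_spinor (A : set (R * R)) (f : R * R -> spinor R) : Prop :=
  [/\ each_part (@smooth2 R) f,
      compact (closure [set x | f x != 0]) &
      closure [set x | f x != 0] `<=` A].

Definition L2_weighted (alpha : R) (rho : R -> spinor R) : Prop :=
  each_part (fun h => h \in Lfun (leb R) 2%:E /\
    (fun t => expR (alpha * `|t|) * h t) \in Lfun (leb R) 2%:E) rho.

End Spinors.

Section Matrices.
Variable R : realType.

Definition mx22 (a b c d : cplx R) : 'M[cplx R]_2 :=
  \matrix_(i, j) if i == 0 then (if j == 0 then a else b)
                 else (if j == 0 then c else d).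

Definition imag : cplx R := 0 +i* 1.

Definition sigma1 : 'M[cplx R]_2 := mx22 0 1 1 0.
Definition sigma2 : 'M[cplx R]_2 := mx22 0 (- imag) imag 0.
Definition sigma3 : 'M[cplx R]_2 := mx22 1 0 0 (-1).

Definition adjoint (A : 'M[cplx R]_2) : 'M[cplx R]_2 :=
  map_mx (@conjc R) A^T.

Definition Mmx (m : R) : 'M[cplx R]_2 :=
  if m < 0 then mx22 1 0 0 0 else mx22 0 0 0 1.

End Matrices.

Section Interfaces.
Variable R : realType.
(* Curves are indexed by 1, 2 and regions by 0, 1, 2; other indices are unused. *)
Variables (gamma : nat -> R -> R * R) (Omega : nat -> set (R * R)).

Definition tangent (j : nat) : R -> R * R := derive1 (gamma j).

(* The unit vector making (tangent, normal) positively oriented. *)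
Definition normal (j : nat) (t : R) : R * R :=
  (- (tangent j t).2, (tangent j t).1).

Definition curve (j : nat) : set (R * R) := range (gamma j).

Definition exp_decay (g : R -> R * R) : Prop :=
  exists2 eta : R, 0 < eta & forall k, (2 <= k)%N ->
    exists C : R, forall t, enorm (derive1n k g t) <= C * expR (- eta * `|t|).

Record interfaces : Prop := Interfaces {
  gamma_smooth : forall j, (1 <= j <= 2)%N -> smooth_curve (gamma j);
  gamma_simple : forall j, (1 <= j <= 2)%N -> injective (gamma j);
  gamma_arclength : forall j t, (1 <= j <= 2)%N -> enorm (tangent j t) = 1;
  gamma_decay : forall j, (1 <= j <= 2)%N -> exp_decay (gamma j);
  gamma_infty : forall j e, (1 <= j <= 2)%N -> e \in [:: -1; 1] ->
    enorm (gamma j (e * t)) @[t --> +oo] --> +oo;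
  gamma_ends_apart : forall j, (1 <= j <= 2)%N ->
    enorm (gamma j t - gamma j (- t)) @[t --> +oo] --> +oo;
  gammas_apart : forall e1 e2, e1 \in [:: -1; 1] -> e2 \in [:: -1; 1] ->
    enorm (gamma 2%N (e2 * t) - gamma 1%N (e1 * t)) @[t --> +oo] --> +oo;
  curves_disjoint : curve 1%N `&` curve 2%N = set0;
  Omega_open : forall k, (k <= 2)%N -> open (Omega k);
  Omega_connected : forall k, (k <= 2)%N -> connected (Omega k);
  Omega_disjoint : trivIset `I_3 Omega;
  Omega_cover : \bigcup_(k in `I_3) Omega k = ~` (curve 1%N `|` curve 2%N);
  boundary_Omega0 : boundary (Omega 0%N) = curve 1%N;
  boundary_Omega1 : boundary (Omega 1%N) = curve 1%N `|` curve 2%N;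
  boundary_Omega2 : boundary (Omega 2%N) = curve 2%N;
  normal_inward : forall j t, (1 <= j <= 2)%N ->
    \forall s \near 0^'+, Omega j (gamma j t + s *: normal j t) }.

Definition jump (g : R * R -> spinor R) (j : nat) (t : R) : spinor R :=
  lim (g y @[y --> within (Omega j) (nbhs (gamma j t))])
  - lim (g y @[y --> within (Omega j.-1) (nbhs (gamma j t))]).

Definition insigma (j : nat) (t : R) : 'M[cplx R]_2 :=
  imag R *: (((normal j t).1)%:C *: sigma1 R + ((normal j t).2)%:C *: sigma2 R).

Definition Vmx (j : nat) (t : R) : 'M[cplx R]_2 :=
  let n := normal j t in
  ((Num.sqrt 2)^-1)%:C *: mx22 1 (n.2 +i* n.1) (n.2 -i* n.1) (-1).

End Interfaces.

Section DiracProblem.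
Variable R : realType.
Variables (m E : R).

Definition omega : R := Num.sqrt (m ^+ 2 - E ^+ 2).

(* The modified Bessel function K_0, for z > 0. The junk value at z = 0 only
   enters integrals on null sets. *)
Definition besselK0 (z : R) : R :=
  Rintegral (leb R) `[0, +oo[ (fun s => expR (- z * ((expR s + expR (- s)) / 2))).

Definition dirac (a : R) (u : R * R -> spinor R) (x : R * R) : spinor R :=
  - imag R *: (sigma1 R *m sderive (edir R false) u x)
  - imag R *: (sigma2 R *m sderive (edir R true) u x)
  + a%:C *: (sigma3 R *m u x).

Definition green (j : nat) (x y : R * R) : 'M[cplx R]_2 :=
  let k z := besselK0 (omega * enorm (z - y)) in
  ((2 * pi)^-1)%:C *:
    (- imag R *: (('D_(edir R false) k x)%:C *: sigma1 R)
     - imag R *: (('D_(edir R true) k x)%:C *: sigma2 R)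
     + ((-1) ^+ j * m * k x)%:C *: sigma3 R
     + (E * k x)%:C%:M).

Variables (gamma : nat -> R -> R * R) (Omega : nat -> set (R * R)).
Implicit Types (tau rho : R -> spinor R).

Definition incident (f : nat -> R * R -> spinor R) (x : R * R) : spinor R :=
  if x \in Omega 2%N then
    sint (leb2 R) (Omega 2%N) (fun y => green 2 x y *m f 2%N y)
  else if x \in Omega 1%N then
    sint (leb2 R) (Omega 1%N) (fun y => green 1 x y *m f 1%N y)
  else if x \in Omega 0%N then
    sint (leb2 R) (Omega 0%N) (fun y => green 2 x y *m f 0%N y)
  else 0.

Definition layer (k j : nat) (mu : R -> spinor R) (x : R * R) : spinor R :=
  sint (leb R) setT (fun t => green k x (gamma j t) *m mu t).

Definition scattered (mu : nat -> R -> spinor R) (x : R * R) : spinor R :=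
  if x \in Omega 2%N then layer 2 2 (mu 2%N) x
  else if x \in Omega 1%N then layer 1 2 (mu 2%N) x + layer 1 1 (mu 1%N) x
  else if x \in Omega 0%N then layer 2 1 (mu 1%N) x
  else 0.

Definition L_op (j : nat) tau (t : R) : spinor R :=
  tau t - ((-1) ^+ j * (2 * m))%:C *:
    (adjoint (Vmx gamma j t) *m insigma gamma j t *m sigma3 R *m
     (((2 * pi)^-1)%:C *: sint (leb R) setT (fun t' =>
        (besselK0 (omega * enorm (gamma j t - gamma j t')))%:C *:
          (Vmx gamma j t' *m tau t')))).

Definition K_op (j : nat) tau (t : R) : spinor R :=
  let l := (3 - j)%N in
  (-1) ^+ j.-1 *:
    (adjoint (Vmx gamma l t) *m insigma gamma l t *m
     sint (leb R) setT (fun t' =>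
       green 1 (gamma l t) (gamma j t') *m (Vmx gamma j t' *m tau t'))).

Definition expi (a : R) : cplx R := cos a +i* sin a.

Definition R_op rho (t : R) : spinor R :=
  (2 * imag R * E%:C)^-1 *:
    sint (leb R) setT (fun t' => expi (E * `|t - t'|) *: rho t').

Definition P_op (j : nat) rho (t : R) : spinor R :=
  rho t + (2 * imag R * (m ^+ 2)%:C) *:
    ((if j == 1%N then 1%:M - Mmx m else Mmx m) *m R_op rho t).

Definition incident_data (f : nat -> R * R -> spinor R) (j : nat) (t : R)
    : spinor R :=
  adjoint (Vmx gamma j t) *m insigma gamma j t *m
    jump gamma Omega (incident f) j t.

Definition integral_equation (f : nat -> R * R -> spinor R)
    (rho : nat -> R -> spinor R) : Prop :=
  forall t,
    L_op 1 (P_op 1 (rho 1%N)) t + K_op 2 (P_op 2 (rho 2%N)) t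
      = incident_data f 1 t /\
    K_op 1 (P_op 1 (rho 1%N)) t + L_op 2 (P_op 2 (rho 2%N)) t
      = incident_data f 2 t.

(* Classical solutions: 'D is total, so differentiability is required. *)
Definition solves_dirac (a : R) (A : set (R * R)) (u g : R * R -> spinor R) :=
  forall x, A x ->
    each_part (fun h => differentiable h x) u /\
    dirac a u x - E%:C *: u x = g x.

Definition continuous_across (A B S : set (R * R)) (u : R * R -> spinor R) :=
  forall x, S x -> exists l : spinor R,
    u y @[y --> within A (nbhs x)] --> l /\
    u z @[z --> within B (nbhs x)] --> l.

Definition outgoing (w : R -> spinor R) : Prop :=
  [/\ \forall t \near +oo, each_part (fun h => derivable h (t : R) 1) w,
      sderive (1 : R) w t - (imag R * E%:C) *: w t @[t --> +oo] --> (0 : spinor R),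
      \forall t \near -oo, each_part (fun h => derivable h (t : R) 1) w &
      - sderive (1 : R) w t - (imag R * E%:C) *: w t @[t --> -oo] --> (0 : spinor R)].

End DiracProblem.

(* Main.v *)
(** Writing K(z) = K_0(w|z|), all the potentials are real integrals of K and of
    its partials K_1, K_2, paired with the real and imaginary parts of the
    densities.

    Off the curves the Dirac equation holds because K_11 + K_22 = w^2 K off 0,
    while a convolution K * f satisfies K_1 * f_1 + K_2 * f_2 = w^2 K * f - 2 pi f:
    the flux of K_1 through a vertical line jumps by -2 pi at the singularity.

    On crossing a curve the potential of K is continuous and that of K_i jumps
    by -2 pi n_i times the density (near its foot point the curve is compared
    with its tangent, on which h / (h^2 + s^2) has integral pi). The jump of u is
    thus an explicit expression in mu; as V_j = V_j^*, V_j^2 = 1 and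
    (i n_j . sigma)^2 = -1, the integral equation says exactly that it vanishes.

    Since rho_j is integrable, P_j rho_j is an L^1 function plus a bounded b with
    b' -/+ iEb -> 0 at +/-oo. An integration by parts along a curve parallel to
    Gamma_j moves d/dt - iE from the exponentially decaying kernel to the density,
    which gives the outgoing condition; the kernel decay gives the limit away
    from the curves. *)

Require Import Defs.
From mathcomp Require Import ring lra measurable_realfun.

Set Implicit Arguments.
Unset Strict Implicit.
Unset Printing Implicit Defensive.

Local Open Scope classical_set_scope.
Local Open Scope complex_scope.
Local Open Scope ring_scope.

(** * Calculus and integration *)

Section RealIntegrals.
Context d (T : measurableType d) (R : realType) (mu : {measure set T -> \bar R}).
Implicit Types (f g : T -> R) (D : set T).

(** The regions are given only topologically, so a one-sided limit within [Omega k] has to be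
    translated into a signed height over a foot point; connectedness of short paths decides which
    sign belongs to which region. Near the foot point only crude facts on the kernel enter,
    [K_0 = O(z^(-1/2))] and [z K_1 = 1 + O(z)], both read off from the integral that defines
    [besselK0]; the 1 in the second fixes the size pi of the one-sided jump.

    Differentiation under the integral rests on quadratic Taylor remainders with an integrable
    constant, so each kernel comes with two further orders of derivatives under the same exponential
    bound.

    At infinity, exponentially decaying curvature makes each end of a curve asymptotic to a
    half-line. Distinct directions give linear growth of all mutual distances, which turns decay in
    the plane into decay in the parameter.

    Each region gets a formula defined on the whole plane, so that the two sides of a curve are
    instances of one expression. The flux jump behind the volume potential is the jump relation once
    more, for the vertical axis taken as a curve. *)

Definition intble D f := mu.-integrable D (EFin \o f).

Lemma intble_dom D f g : measurable D -> measurable_fun D f -> intble D g ->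
  (forall x, D x -> `|f x| <= g x) -> intble D f.
Proof.
move=> mD mf ig fg; apply: (le_integrable mD _ _ ig); first exact/measurable_EFinP.
by move=> x Dx /=; rewrite lee_fin (le_trans (fg x Dx))// ler_norm.
Qed.

Lemma intble_meas D f : intble D f -> measurable_fun D f.
Proof. by move=> /(measurable_int mu)/measurable_EFinP. Qed.

Lemma intbleD D f g : measurable D -> intble D f -> intble D g ->
  intble D (fun x => f x + g x).
Proof. by move=> mD i1 i2; have := integrableD mD i1 i2. Qed.

Lemma intbleZ D (c : R) f : measurable D -> intble D f -> intble D (fun x => c * f x).
Proof. by move=> mD i1; have := integrableZl mD c i1. Qed.

Lemma intbleN D f : measurable D -> intble D f -> intble D (fun x => - f x).
Proof.
by move=> mD /(intbleZ (-1) mD); under eq_fun do rewrite mulN1r.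
Qed.

Lemma intbleB D f g : measurable D -> intble D f -> intble D g ->
  intble D (fun x => f x - g x).
Proof. by move=> mD i1 i2; apply: intbleD => //; exact: intbleN. Qed.

Lemma intble_norm D f : measurable D -> intble D f -> intble D (fun x => `|f x|).
Proof. by move=> mD; exact: integrable_norm. Qed.

Lemma intble_sub (D B : set T) f : measurable D -> measurable B -> B `<=` D ->
  intble D f -> intble B f.
Proof. by move=> mD mB BD; exact: integrableS. Qed.

Lemma Rint_dom D f g : measurable D -> measurable_fun D f -> intble D g ->
  (forall x, D x -> `|f x| <= g x) -> `|Rintegral mu D f| <= Rintegral mu D g.
Proof.
move=> mD mf ig fg; have fi := intble_dom mD mf ig fg.
apply: le_trans (le_normr_Rintegral mD fi) _.
by apply: le_Rintegral => //; exact: intble_norm.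
Qed.

Lemma Rint_dct D (f_ : nat -> T -> R) f g : measurable D ->
  (forall n, measurable_fun D (f_ n)) -> measurable_fun D f ->
  {ae mu, forall x, D x -> f_ n x @[n --> \oo] --> f x} ->
  intble D g -> (forall n x, D x -> `|f_ n x| <= g x) ->
  Rintegral mu D (f_ n) @[n --> \oo] --> Rintegral mu D f.
Proof.
move=> mD mf_ mf cvf ig fg.
have [] := @dominated_convergence _ _ _ mu D mD (fun n => EFin \o f_ n) (EFin \o f)
  (EFin \o g).
- by move=> n; exact/measurable_EFinP.
- exact/measurable_EFinP.
- apply: filterS cvf => x cx Dx; apply: cvg_EFin => //; first exact: nearW.
  exact: cx.
- exact: ig.
- by apply: aeW => x n Dx; rewrite /= lee_fin fg.
move=> fi _ cv; apply: fine_cvg.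
rewrite /Rintegral fineK; first exact: cv.
exact: integrable_fin_num.
Qed.

End RealIntegrals.

Section SequentialLimits.
Variable R : realType.

(** If some neighbourhood B of l fails, points of A within [n.+1%:R^-1] of x with image outside B
    form a bad sequence. This makes dominated convergence, a statement on sequences, available for
    limits taken inside a region. *)
Lemma cvg_within_seq (V : pseudoMetricType R) (U : topologicalType)
    (A : set V) (x : V) (f : V -> U) (l : U) :
  (forall u : nat -> V, (forall n, A (u n)) -> u n @[n --> \oo] --> x ->
     f (u n) @[n --> \oo] --> l) ->
  f y @[y --> within A (nbhs x)] --> l.
Proof.
move=> H B Bl; apply: contrapT => nB.
have bad (n : nat) : exists y, [/\ ball x (n.+1%:R^-1) y, A y & ~ B (f y)].
  apply: contrapT => K; apply: nB.
  rewrite /nbhs/= /within/=.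
  apply/nbhs_ballP; exists n.+1%:R^-1 => //= y xy Ay.
  by apply: contrapT => nBy; apply: K; exists y.
have [u uP] := choice bad.
have /(_ B Bl) : f (u n) @[n --> \oo] --> l.
  apply: H => [n|]; first by have [] := uP n.
  apply/cvg_ballP => e e0; near=> n.
  have [xu _ _] := uP n.
  apply: le_ball xu; apply: ltW; near: n; exact: (near_infty_natSinv_lt (PosNum e0)).
case=> N _ /(_ N) /=; rewrite leqnn => /(_ isT); by have [] := uP N.
Unshelve. all: by end_near. Qed.

End SequentialLimits.

Section Continuity.
Variables (R : realType) (T : topologicalType).
Implicit Types f g : T -> R.

Lemma ctD f g : continuous f -> continuous g -> continuous (fun t => f t + g t).
Proof. by move=> cf cg x; apply: cvgD; [exact: cf|exact: cg]. Qed.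

Lemma ctB f g : continuous f -> continuous g -> continuous (fun t => f t - g t).
Proof. by move=> cf cg x; apply: cvgB; [exact: cf|exact: cg]. Qed.

Lemma ctN f : continuous f -> continuous (fun t => - f t).
Proof. by move=> cf x; apply: cvgN; exact: cf. Qed.

Lemma ctM f g : continuous f -> continuous g -> continuous (fun t => f t * g t).
Proof. by move=> cf cg x; apply: cvgM; [exact: cf|exact: cg]. Qed.

Lemma ctC (c : R) : continuous (fun _ : T => c).
Proof. by move=> x; exact: cvg_cst. Qed.

Lemma ctZ (c : R) f : continuous f -> continuous (fun t => c * f t).
Proof. by move=> cf; apply: ctM => //; exact: ctC. Qed.

Lemma ctcomp (h : R -> R) f : continuous h -> continuous f -> continuous (fun t => h (f t)).
Proof. by move=> ch cf x; apply: cvg_comp; [exact: cf|exact: ch]. Qed.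

Lemma ctnorm f : continuous f -> continuous (fun t => `|f t|).
Proof. by move=> cf; apply: ctcomp cf => x; exact: norm_continuous. Qed.

Lemma ctX (n : nat) f : continuous f -> continuous (fun t => f t ^+ n).
Proof. by move=> cf; apply: (@ctcomp (fun x => x ^+ n)) => //; exact: exprn_continuous. Qed.

End Continuity.

(** * Gradients of real functions on the plane *)

Section Gradients.
Variable R : realType.
Implicit Types (g : R * R -> R) (x h : R * R).

(** Total differentiability with prescribed partials: it yields both the differentiability demanded
    by [solves_dirac] and the chain rule along curves, which partial derivatives alone would not. *)
Definition has_grad g x (a b : R) := is_diff x g (fun h => a * h.1 + b * h.2).

Lemma has_grad_linear (a b : R) x : has_grad (fun h => a * h.1 + b * h.2) x a b.
Proof.
have d1 : is_diff x (fst : R * R -> R) (fst : R * R -> R).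
  have c1 : continuous (fst : R * R -> R) by move=> y; exact: cvg_fst.
  by constructor; [exact: linear_differentiable | exact: diff_lin].
have d2 : is_diff x (snd : R * R -> R) (snd : R * R -> R).
  have c2 : continuous (snd : R * R -> R) by move=> y; exact: cvg_snd.
  by constructor; [exact: linear_differentiable | exact: diff_lin].
have D := is_diffD (is_diffZ a d1) (is_diffZ b d2).
rewrite /has_grad.
by have -> : (fun h : R * R => a * h.1 + b * h.2) = a *: fst + b *: snd by apply/funext.
Qed.

(** Taking h = 0 forces g x = 0, and a quadratic bound is o(h). *)
Lemma small_is_diff0 g x (C e : R) : 0 < e ->
  (forall h, `|h| < e -> `|g (x + h)| <= C * `|h| ^+ 2) -> is_diff x g (cst 0).
Proof.
move=> e0 H.
have gx : g x = 0.
  have := H 0; rewrite normr0 => /(_ e0); rewrite expr0n/= mulr0 addr0 normr_le0.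
  by move/eqP.
have C0 : 0 <= `|C| + 1 by rewrite addr_ge0.
have lo : g \o shift x = cst (g x) + (\0 : R * R -> R) +o_ (0 : R * R) id.
  have E1 : \forall h \near (0 : R * R), `|h| < e by exact: nbhs0_lt.
  apply/eqaddoP => _/posnumP[k].
  have E2 : \forall h \near (0 : R * R), `|h| <= k%:num / (`|C| + 1).
    by apply: nbhs0_le; rewrite divr_gt0//; rewrite ltr_wpDl.
  near=> h.
  rewrite /= !fctE gx /= addr0 subr0 /shift /=.
  have he : `|h| < e by near: h; exact: E1.
  rewrite addrC; apply: le_trans (H h he) _.
  rewrite expr2 mulrA ler_wpM2r//.
  have hk : `|h| <= k%:num / (`|C| + 1).
    by near: h; exact: E2.
  apply: (@le_trans _ _ ((`|C|+1) * `|h|)).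
    by rewrite ler_wpM2r// (le_trans (ler_norm _))// lerDl.
  by rewrite -ler_pdivlMl ?ltr_wpDl// mulrC.
have df : 'd g x = (\0 : R * R -> R) :> (R * R -> R).
  by apply: (@diff_unique _ _ _ g \0 x _ lo) => y; exact: cvg_cst.
constructor; last by rewrite df.
apply/diff_locallyP; rewrite df; split; [by move=> y; exact: cvg_cst|].
exact: lo.
Unshelve. all: by end_near. Qed.

(** Subtracting the affine part reduces to [small_is_diff0]. A remainder of the form [C * |h| ^ 2]
    is used because, unlike o(h), it survives integration over a parameter as soon as C is
    integrable. *)
Lemma has_grad_quad g x (a b C e : R) : 0 < e ->
  (forall h, `|h| < e -> `|g (x + h) - g x - (a * h.1 + b * h.2)| <= C * `|h| ^+ 2) ->
  has_grad g x a b.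
Proof.
move=> e0 H.
pose l (y : R * R) := a * y.1 + b * y.2.
have d0 : is_diff x (fun y => g y - g x - (l y - l x)) (cst 0).
  apply: (@small_is_diff0 _ _ C e e0) => h he.
  have -> : l (x + h) - l x = a * h.1 + b * h.2 by rewrite /l /=; ring.
  exact: H.
have := is_diffD (is_diffD d0 (has_grad_linear a b x)) (is_diff_cst (g x - l x) x).
move=> D; have -> : g = (fun y => g y - g x - (l y - l x)) + (fun h => a * h.1 + b * h.2) + cst (g x - l x).
  by apply/funext => y; rewrite !fctE /= /l; ring.
by apply: is_diff_eq D _; apply/funext => h; rewrite !fctE /= add0r addr0.
Qed.

Lemma has_grad_differentiable g x a b : has_grad g x a b -> differentiable g x.
Proof. by case. Qed.

Lemma has_grad_derive g x a b v : has_grad g x a b -> 'D_v g x = a * v.1 + b * v.2.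
Proof. by case=> dg de; rewrite deriveE// de. Qed.

Lemma has_grad_continuous g x a b : has_grad g x a b -> {for x, continuous g}.
Proof. by case=> dg _; exact: differentiable_continuous. Qed.

Lemma has_grad_uniq_eq g x a b a' b' : has_grad g x a b -> a = a' -> b = b' ->
  has_grad g x a' b'.
Proof. by move=> H <- <-. Qed.

Lemma has_gradD f g x a b a' b' : has_grad f x a b -> has_grad g x a' b' ->
  has_grad (fun y => f y + g y) x (a + a') (b + b').
Proof.
move=> Hf Hg; apply: is_diff_eq (is_diffD Hf Hg) _.
by apply/funext => h; rewrite !fctE; ring.
Qed.

Lemma has_gradM f g x a b a' b' : has_grad f x a b -> has_grad g x a' b' ->
  has_grad (fun y => f y * g y) x (a * g x + f x * a') (b * g x + f x * b').
Proof.
move=> Hf Hg; apply: is_diff_eq (is_diffM Hf Hg) _.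
by apply/funext => h; rewrite !fctE /= /GRing.scale/=; ring.
Qed.

Lemma has_grad_cst (c : R) x : has_grad (fun=> c) x 0 0.
Proof.
apply: is_diff_eq (is_diff_cst c x) _.
by apply/funext => h; rewrite !mul0r addr0.
Qed.

Lemma has_grad_fst x : has_grad fst x 1 0.
Proof.
have -> : fst = (fun h : R * R => 1 * h.1 + 0 * h.2).
  by apply/funext => h; rewrite mul1r mul0r addr0.
exact: has_grad_linear.
Qed.

Lemma has_grad_snd x : has_grad snd x 0 1.
Proof.
have -> : snd = (fun h : R * R => 0 * h.1 + 1 * h.2).
  by apply/funext => h; rewrite mul1r mul0r add0r.
exact: has_grad_linear.
Qed.

Lemma has_grad_comp1 (phi : R -> R) g x a b (c : R) : has_grad g x a b ->
  is_derive (g x) 1 phi c -> has_grad (fun y => phi (g y)) x (c * a) (c * b).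
Proof.
move=> Hg [dphi phic].
have Hphi : is_diff (g x) phi (fun h : R => c * h).
  have dp : differentiable phi (g x) by apply/derivable1_diffP.
  constructor => //; apply/funext => h.
  have -> : h = h *: (1 : R) by rewrite /GRing.scale/= mulr1.
  by rewrite linearZ/= -deriveE// phic /GRing.scale/=; ring.
apply: is_diff_eq (is_diff_comp Hg Hphi) _.
by apply/funext => h; rewrite /=; ring.
Qed.

Lemma has_grad_shift g x y a b : has_grad g (x - y) a b ->
  has_grad (fun z => g (z - y)) x a b.
Proof.
move=> H.
have dy : is_diff x (fun z : R * R => z - y) id.
  have := is_diffD (is_diff_id x) (is_diff_cst (- y) x).
  by move/is_diff_eq; apply; apply/funext => z; rewrite !fctE addr0.
by apply: is_diff_eq (is_diff_comp dy H) _.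
Qed.

Lemma has_grad_curve g (c1 c2 : R -> R) t a b u v :
  has_grad g (c1 t, c2 t) a b -> is_derive t 1 c1 u -> is_derive t 1 c2 v ->
  is_derive t 1 (fun s => g (c1 s, c2 s)) (a * u + b * v).
Proof.
move=> Hg [d1 e1] [d2 e2].
have D1 : is_diff t c1 ('d c1 t) by apply/differentiableP/derivable1_diffP.
have D2 : is_diff t c2 ('d c2 t) by apply/differentiableP/derivable1_diffP.
have [H He] := is_diff_comp (is_diff_pair D1 D2) Hg.
constructor; first exact/derivable1_diffP.
rewrite deriveE//.
have -> : 'd (fun s => g (c1 s, c2 s)) t = 'd (g \o (fun y => (c1 y, c2 y))) t by [].
rewrite He /= -!deriveE ?e1 ?e2//; exact/derivable1_diffP.
Qed.

End Gradients.

(** * Mean value theorem and second-order Taylor bound *)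

Section MeanValue.
Variable R : realType.

(** The symmetric neighbourhood [|x - a| <= |b - a|] lets a and b come in either order. *)
Lemma mean_value (f df : R -> R) (a b : R) :
  (forall x, `|x - a| <= `|b - a| -> is_derive x 1 f (df x)) ->
  exists2 c, `|c - a| <= `|b - a| & f b - f a = df c * (b - a).
Proof.
move=> H.
have cf x : `|x - a| <= `|b - a| -> {for x, continuous f}.
  move=> /H[+ _]; move/derivable1_diffP; exact: differentiable_continuous.
have [ab|ba] := leP a b.
  have in_ x : x \in `[a, b] -> `|x - a| <= `|b - a|.
    by rewrite in_itv/= => /andP[? ?]; rewrite !ger0_norm ?subr_ge0// lerB.
  have [||c cab e] := @MVT_segment R f df a b ab.
  - by move=> x xab; apply/H/in_; exact: subset_itv_oo_cc.
  - apply: continuous_in_subspaceT => x /set_mem xab; exact/cf/in_.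
  - by exists c => //; exact: in_.
have in_ x : x \in `[b, a] -> `|x - a| <= `|b - a|.
  rewrite in_itv/= => /andP[? ?].
  by rewrite !ler0_norm; lra.
have [||c cab e] := @MVT_segment R f df b a (ltW ba).
- by move=> x xab; apply/H/in_; exact: subset_itv_oo_cc.
- apply: continuous_in_subspaceT => x /set_mem xab; exact/cf/in_.
- exists c; first exact: in_.
  by rewrite -opprB e; ring.
Qed.

Lemma mean_value_le (f df : R -> R) (a b M : R) :
  (forall x, `|x - a| <= `|b - a| -> is_derive x 1 f (df x)) ->
  (forall x, `|x - a| <= `|b - a| -> `|df x| <= M) ->
  `|f b - f a| <= M * `|b - a|.
Proof.
move=> H dM; have [c cab ->] := mean_value H.
by rewrite normrM ler_wpM2r// dM.
Qed.

Definition pd1 (g g1 : R * R -> R) (z : R * R) :=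
  is_derive z.1 (1:R) (fun s => g (s, z.2)) (g1 z).
Definition pd2 (g g2 : R * R -> R) (z : R * R) :=
  is_derive z.2 (1:R) (fun s => g (z.1, s)) (g2 z).

Lemma has_grad_pd1 g (g1 g2 : R * R -> R) z : has_grad g z (g1 z) (g2 z) -> pd1 g g1 z.
Proof.
case: z => x y H; rewrite /pd1 /=.
have := @has_grad_curve _ g id (fun=> y) x _ _ 1 0 H (is_derive_id x 1) (is_derive_cst y x 1).
by rewrite mulr1 mulr0 addr0.
Qed.

Lemma has_grad_pd2 g (g1 g2 : R * R -> R) z : has_grad g z (g1 z) (g2 z) -> pd2 g g2 z.
Proof.
case: z => x y H; rewrite /pd2 /=.
have := @has_grad_curve _ g (fun=> x) id y _ _ 0 1 H (is_derive_cst x y 1) (is_derive_id y 1).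
by rewrite mulr1 mulr0 add0r.
Qed.

(** The displacement is split into a vertical leg and then a horizontal one. The mean value theorem
    on each leg leaves increments of [g1] (one in each direction) and of [g2]; each is at most M
    |h|, which accounts for the factor 3. *)
Lemma taylor2 (g g1 g2 g11 g12 g22 : R * R -> R) (z : R * R) (dl M : R) :
  (forall w, `|w - z| <= dl -> [/\ pd1 g g1 w, pd2 g g2 w, pd1 g1 g11 w, pd2 g1 g12 w
     & pd2 g2 g22 w]) ->
  (forall w, `|w - z| <= dl -> [/\ `|g11 w| <= M, `|g12 w| <= M & `|g22 w| <= M]) ->
  forall h, `|h| <= dl ->
    `|g (z + h) - g z - (g1 z * h.1 + g2 z * h.2)| <= 3 * M * `|h| ^+ 2.
Proof.
move=> H HM h hd; case: z h H HM hd => z1 z2 [h1 h2] H HM hd /=.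
have [h1d h2d] : `|h1| <= `|(h1, h2)| /\ `|h2| <= `|(h1, h2)|.
  by split; rewrite prod_normE /= le_max lexx ?orbT.
set k := `|(h1, h2)| in hd h1d h2d *.
have box a b : `|a| <= k -> `|b| <= k -> `|(z1 + a, z2 + b) - (z1, z2)| <= dl.
  move=> ak bk; rewrite prod_normE /= ge_max.
  by rewrite !(addrAC _ _ (- _)) !subrr !add0r !(le_trans _ hd).
have box' x y : `|x - z1| <= k -> `|y - z2| <= k -> `|(x, y) - (z1, z2)| <= dl.
  by move=> xk yk; rewrite prod_normE /= ge_max !(le_trans _ hd).
have k0 : 0 <= k by exact: normr_ge0.
have z2h : `|z2 + h2 - z2| <= k by rewrite addrAC subrr add0r.
have zz (z : R) : `|z - z| <= k by rewrite subrr normr0.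
have M0 : 0 <= M.
  have [+ _ _] := HM (z1, z2) (box' _ _ (zz _) (zz _)).
  exact: le_trans.
have [xi xi1 e1] : exists2 c, `|c - z1| <= `|z1 + h1 - z1| &
    g (z1 + h1, z2 + h2) - g (z1, z2 + h2) = g1 (c, z2 + h2) * (z1 + h1 - z1).
  apply: (@mean_value (fun s => g (s, z2 + h2)) (fun s => g1 (s, z2 + h2))) => x xz.
  have [] := H (x, z2 + h2) => //.
  by apply: box' => //; rewrite (le_trans xz)// addrAC subrr add0r.
have [et et1 e2] : exists2 c, `|c - z2| <= `|z2 + h2 - z2| &
    g (z1, z2 + h2) - g (z1, z2) = g2 (z1, c) * (z2 + h2 - z2).
  apply: (@mean_value (fun s => g (z1, s)) (fun s => g2 (z1, s))) => y yz.
  have [] := H (z1, y) => //.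
  by apply: box' => //; rewrite (le_trans yz).
have hz1 : z1 + h1 - z1 = h1 by ring.
have hz2 : z2 + h2 - z2 = h2 by ring.
rewrite !hz1 !hz2 in xi1 e1 et1 e2.
have A1 : `|g1 (xi, z2 + h2) - g1 (z1, z2 + h2)| <= M * k.
  apply: (@le_trans _ _ (M * `|xi - z1|)).
    apply: (@mean_value_le (fun s => g1 (s, z2 + h2)) (fun s => g11 (s, z2 + h2))) => x xz.
      have [] := H (x, z2 + h2) => //; apply: box' => //.
      by rewrite (le_trans xz)// (le_trans xi1).
    have [] := HM (x, z2 + h2) => //; apply: box' => //.
    by rewrite (le_trans xz)// (le_trans xi1).
  by rewrite ler_wpM2l// (le_trans xi1).
have A2 : `|g1 (z1, z2 + h2) - g1 (z1, z2)| <= M * k.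
  apply: (@le_trans _ _ (M * `|z2 + h2 - z2|)).
    apply: (@mean_value_le (fun s => g1 (z1, s)) (fun s => g12 (z1, s))) => y yz.
      have [] := H (z1, y) => //; apply: box' => //.
      by rewrite (le_trans yz).
    have [] := HM (z1, y) => //; apply: box' => //.
    by rewrite (le_trans yz).
  by rewrite ler_wpM2l.
have A3 : `|g2 (z1, et) - g2 (z1, z2)| <= M * k.
  apply: (@le_trans _ _ (M * `|et - z2|)).
    apply: (@mean_value_le (fun s => g2 (z1, s)) (fun s => g22 (z1, s))) => y yz.
      have [] := H (z1, y) => //; apply: box' => //.
      by rewrite (le_trans yz)// (le_trans et1).
    have [] := HM (z1, y) => //; apply: box' => //.
    by rewrite (le_trans yz)// (le_trans et1).
  by rewrite ler_wpM2l// (le_trans et1).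
have -> : (z1, z2) + (h1, h2) = (z1 + h1, z2 + h2) by [].
have -> : g (z1 + h1, z2 + h2) - g (z1, z2) - (g1 (z1, z2) * h1 + g2 (z1, z2) * h2) =
  (g1 (xi, z2 + h2) - g1 (z1, z2 + h2)) * h1 + (g1 (z1, z2 + h2) - g1 (z1, z2)) * h1 +
  (g2 (z1, et) - g2 (z1, z2)) * h2.
  by rewrite !mulrBl -e1 -e2; ring.
apply: le_trans (ler_normD _ _) _; apply: le_trans (lerD (ler_normD _ _) (lexx _)) _.
rewrite !normrM.
have -> : 3 * M * k ^+ 2 = M * k * k + M * k * k + M * k * k by ring.
by rewrite !lerD// ler_pM.
Qed.

End MeanValue.

(** * Differentiation under the integral sign *)

Section DifferentiationUnderIntegral.
Context d (T : measurableType d) (R : realType) (mu : {measure set T -> \bar R}).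

(** Integrating the pointwise Taylor remainder gives again a quadratic remainder, with constant the
    integral of C. *)
Lemma Rint_has_grad (F : R * R -> T -> R) (a b C : T -> R) (D : set T) (e : R) x :
  measurable D -> 0 < e -> (forall h, `|h| < e -> intble mu D (F (x + h))) ->
  intble mu D a -> intble mu D b -> intble mu D C ->
  (forall h t, `|h| < e -> D t ->
     `|F (x + h) t - F x t - (a t * h.1 + b t * h.2)| <= C t * `|h| ^+ 2) ->
  has_grad (fun y => Rintegral mu D (F y)) x (Rintegral mu D a) (Rintegral mu D b).
Proof.
move=> mD e0 iF ia ib iC H.
have Fx : intble mu D (F x) by have := iF 0; rewrite addr0 normr0; apply.
apply: (@has_grad_quad _ _ _ _ _ (Rintegral mu D C) e e0) => h he.
have iah : intble mu D (fun t => a t * h.1).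
  by under eq_fun do rewrite mulrC; exact: intbleZ.
have ibh : intble mu D (fun t => b t * h.2).
  by under eq_fun do rewrite mulrC; exact: intbleZ.
rewrite -!RintegralZr// -RintegralD// -!RintegralB//.
  apply: Rint_dom => //.
  - apply: (@intble_meas _ _ _ mu); apply: intbleB => //; last exact: intbleD.
    by apply: intbleB => //; exact: iF.
  - by under eq_fun do rewrite mulrC; exact: intbleZ.
  - by move=> t Dt; exact: H.
- by apply: intbleB => //; exact: iF.
- exact: intbleD.
- exact: iF.
Qed.

End DifferentiationUnderIntegral.

Lemma measure_map (R : realType) d (T : measurableType d) (mu : {measure set T -> \bar R}) (phi : T -> T) (f : T -> R) :
  measurable_fun setT phi -> (forall A : set T, measurable A -> mu (phi @^-1` A) = mu A) ->
  intble mu setT f ->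
  intble mu setT (f \o phi) /\ Rintegral mu setT (f \o phi) = Rintegral mu setT f.
Proof.
move=> mphi inv fi.
have mf := intble_meas fi.
have mfphi : measurable_fun setT (f \o phi) by exact: (measurableT_comp mf mphi).
have absE : (\int[mu]_x `|(f (phi x))%:E| = \int[mu]_x `|(f x)%:E|)%E.
  have := @ge0_integral_pushforward _ _ _ _ R _ mphi mu setT (fun x => `|(f x)%:E|%E) measurableT.
  move=> /(_ _ _)/= <- //.
  - by apply: eq_measure_integral => A mA _; exact: inv.
  - by apply/measurable_EFinP; exact: measurableT_comp.
have fi' : intble mu setT (f \o phi).
  apply/integrableP; split; first exact/measurable_EFinP.
  by rewrite /= absE; case/integrableP : fi.
split=> //; rewrite /Rintegral.
have := @integral_pushforward _ _ _ _ R _ mphi mu setT (EFin \o f).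
move=> /(_ _ _ measurableT)/= <- //.
- congr fine; apply: eq_measure_integral => A mA _; exact: inv.
- exact/measurable_EFinP.
Qed.

(** * Integrals on the real line *)

Section LineIntegrals.
Variable R : realType.
Implicit Types (f g F G : R -> R) (a b c : R).

Lemma is_derive_continuous F (x : R) (d : R) : is_derive x (1 : R) F d -> {for x, continuous F}.
Proof. by case=> /derivable1_diffP dF _; exact: differentiable_continuous. Qed.

Lemma dCst c (x : R) : is_derive x (1 : R) (fun _ : R => c) 0.
Proof. exact: is_derive_cst. Qed.

Lemma dId (x : R) : is_derive x (1 : R) (fun t : R => t) 1.
Proof. exact: is_derive_id. Qed.

Lemma dAdd F G (x df dg : R) : is_derive x (1 : R) F df -> is_derive x (1 : R) G dg ->
  is_derive x (1 : R) (fun t => F t + G t) (df + dg).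
Proof. exact: is_deriveD. Qed.

Lemma dSub F G (x df dg : R) : is_derive x (1 : R) F df -> is_derive x (1 : R) G dg ->
  is_derive x (1 : R) (fun t => F t - G t) (df - dg).
Proof. exact: is_deriveB. Qed.

Lemma dNeg F (x df : R) : is_derive x (1 : R) F df ->
  is_derive x (1 : R) (fun t => - F t) (- df).
Proof. exact: is_deriveN. Qed.

Lemma dMul F G (x df dg : R) : is_derive x (1 : R) F df -> is_derive x (1 : R) G dg ->
  is_derive x (1 : R) (fun t => F t * G t) (df * G x + F x * dg).
Proof.
move=> HF HG; apply: is_derive_eq (is_deriveM HF HG) _.
by rewrite /GRing.scale/= addrC (mulrC df).
Qed.

Lemma dScale c F (x df : R) : is_derive x (1 : R) F df ->
  is_derive x (1 : R) (fun t => c * F t) (c * df).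
Proof. exact: is_deriveZ. Qed.

Lemma dComp F G (x df dg : R) : is_derive (G x : R) (1 : R) F df -> is_derive x (1 : R) G dg ->
  is_derive x (1 : R) (fun t => F (G t)) (df * dg).
Proof. exact: is_derive1_comp. Qed.

Lemma dExp F (x df : R) : is_derive x (1 : R) F df ->
  is_derive x (1 : R) (fun t => expR (F t)) (expR (F x) * df).
Proof. by move=> H; apply: dComp H; exact: is_derive_expR. Qed.

Lemma measurable_halfline : measurable (`[0, +oo[%classic : set (measurableTypeR R)).
Proof. exact: measurable_itv. Qed.

Lemma continuous_meas f : continuous f -> measurable_fun [set: measurableTypeR R] f.
Proof. by move=> /measurable_realfun.continuous_measurable_fun H; exact: H. Qed.

Lemma continuous_measR f : continuous f ->
  measurable_fun [set: measurableTypeR R] (f : measurableTypeR R -> measurableTypeR R).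
Proof. by move=> /measurable_realfun.continuous_measurable_fun H; exact: H. Qed.

Lemma continuous_itv_meas f a b : (forall x, a <= x <= b -> {for x, continuous f}) ->
  measurable_fun (`[a, b]%classic : set (measurableTypeR R)) f.
Proof.
move=> cf.
have H : measurable_fun `[a, b] f.
  apply: measurable_realfun.subspace_continuous_measurable_fun => //.
  by apply: continuous_in_subspaceT => x /set_mem; rewrite /= in_itv/=; exact: cf.
exact: H.
Qed.

Lemma FTC2E F f a b : a <= b ->
  (forall x, a <= x <= b -> is_derive (x : R) (1 : R) F (f x)) ->
  (forall x, a <= x <= b -> {for x, continuous f}) ->
  (\int[lebesgue_measure]_(x in `[a, b]) (f x)%:E = (F b - F a)%:E)%E.
Proof.
rewrite le_eqVlt => /predU1P[<- _ _|ab dF cf].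
  by rewrite set_itv1 integral_set1 subrr.
rewrite (@continuous_FTC2 R f F a b ab) ?EFinB//.
- by apply: continuous_in_subspaceT => x /set_mem; rewrite /= in_itv/=; exact: cf.
- split=> [x||].
  + by rewrite in_itv/= => /andP[ax xb]; have [] := dF x; rewrite ?ltW.
  + apply: cvg_at_right_filter; apply: (is_derive_continuous (dF a _)).
    by rewrite lexx ltW.
  + apply: cvg_at_left_filter; apply: (is_derive_continuous (dF b _)).
    by rewrite lexx ltW.
- move=> x; rewrite in_itv/= => /andP[ax xb].
  by have [|_] := dF x; rewrite ?ltW// derive1E.
Qed.

Lemma Rint_FTC2 F f a b : a <= b ->
  (forall x, a <= x <= b -> is_derive (x : R) (1 : R) F (f x)) ->
  (forall x, a <= x <= b -> {for x, continuous f}) ->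
  Rintegral (leb R) `[a, b] f = F b - F a.
Proof. by move=> ab dF cf; rewrite /Rintegral (FTC2E ab dF cf). Qed.

Lemma intble_continuous_itv f a b : (forall x, a <= x <= b -> {for x, continuous f}) ->
  intble (leb R) `[a, b] f.
Proof.
move=> cf; apply: continuous_compact_integrable; first exact: segment_compact.
by apply: continuous_in_subspaceT => x /set_mem; rewrite /= in_itv/=; exact: cf.
Qed.

(** Monotone convergence over the exhausting intervals, on each of which the integral is
    [F (v n) - F (u n)], hence at most 2 M. Integrability is thus obtained from a bounded
    primitive. *)
Lemma primitive_intble F f (D : set (measurableTypeR R)) (u v : nat -> R) (M : R) :
  (forall n, u n <= v n) -> {homo u : n m / (n <= m)%N >-> m <= n} ->
  {homo v : n m / (n <= m)%N >-> n <= m} -> D = \bigcup_n `[u n, v n]%classic ->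
  (forall x, D x -> [/\ is_derive (x : R) (1 : R) F (f x), {for x, continuous f}, 0 <= f x & `|F x| <= M]) ->
  intble (leb R) D f /\ Rintegral (leb R) D f <= 2 * M.
Proof.
move=> uv ui vi DE H.
have mD : measurable D by rewrite DE; exact: bigcup_measurable.
have DI n x : u n <= x <= v n -> D x.
  by move=> xn; rewrite DE; exists n => //=; rewrite in_itv.
have mI n : measurable_fun `[u n, v n] f.
  by apply: continuous_itv_meas => x /DI/H[].
have mf : measurable_fun D f by rewrite DE; apply/measurable_fun_bigcup.
have cv : (\int[leb R]_(x in `[u n, v n]) (f x)%:E)%E @[n --> \oo] -->
    (\int[leb R]_(x in D) (f x)%:E)%E.
  rewrite DE; apply: ge0_nondecreasing_set_cvg_integral => //.
  - move=> n m nm; apply/subsetPset => x /=; rewrite !in_itv/= => /andP[ux xv].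
    by rewrite (le_trans (ui _ _ nm))//= (le_trans xv)// vi.
  - by move=> n; apply/measurable_EFinP; exact: mI.
  - by move=> n x /=; rewrite in_itv/= lee_fin => /DI/H[].
have bd : (\int[leb R]_(x in D) (f x)%:E <= (2 * M)%:E)%E.
  rewrite -(cvg_lim _ cv)//; apply: lime_le; first by apply/cvg_ex; eexists; exact: cv.
  apply: nearW => n; have -> : (\int[leb R]_(x in `[u n, v n]) (f x)%:E = (F (v n) - F (u n))%:E)%E.
    apply: FTC2E => [//|x /DI/H[]//|x /DI/H[]//].
  rewrite lee_fin.
  have [|_ _ _ Fv] := H (v n); first by apply: (DI n); rewrite uv lexx.
  have [|_ _ _ Fu] := H (u n); first by apply: (DI n); rewrite uv lexx.
  move: Fv Fu; rewrite !ler_norml => /andP[? ?] /andP[? ?]; lra.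
have f0 x : D x -> (0 <= (f x)%:E)%E by move=> /H[_ _ + _]; rewrite lee_fin.
split.
  apply/integrableP; split; first exact/measurable_EFinP.
  rewrite (eq_integral (fun x : measurableTypeR R => (f x)%:E)).
    by rewrite (le_lt_trans bd)// ltry.
  by move=> x /set_mem Dx /=; rewrite ger0_norm//; have [] := H x Dx.
rewrite -lee_fin fineK//.
by rewrite ge0_fin_numE ?(le_lt_trans bd) ?ltry//; exact: integral_ge0.
Qed.

Lemma is_derive1V_sqr (x : R) : {for x, continuous (fun t : R => (1 + t ^+ 2)^-1)}.
Proof.
apply: (@continuousV _ _ (fun t : R => 1 + t ^+ 2)).
  by rewrite gt_eqF// ltr_wpDr// sqr_ge0.
apply: continuousD; first exact: cvg_cst.
exact: exprn_continuous.
Qed.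

Lemma intble_cauchy : intble (leb R) setT (fun t : R => (1 + t ^+ 2)^-1).
Proof.
have [] := @primitive_intble atan (fun t : R => (1 + t ^+ 2)^-1) setT (fun n => - n%:R)
   (fun n => n%:R) (pi : R) => //.
- by move=> n; rewrite ge0_cp.
- by move=> n m nm; rewrite lerN2 ler_nat.
- by move=> n m nm; rewrite ler_nat.
- apply/seteqP; split => // x _; exists (Num.truncn `|x|).+1 => //=.
  by rewrite in_itv/= -ler_norml ltW// truncnS_gt.
- move=> x _; split.
  + exact: is_derive1_atan.
  + exact: is_derive1V_sqr.
  + by rewrite invr_ge0 addr_ge0// sqr_ge0.
  + rewrite ler_norml; have := atan_gtNpi2 x; have := atan_ltpi2 x; have := pi_gt0 R.
    by lra.
Qed.

(** From e^x = (e^(x/2))^2 >= (1 + x/2)^2 >= 1 + (x/2)^2. It reduces integrability of exponentials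
    to the arctangent. *)
Lemma expRN_le_cauchy (x : R) : 0 <= x -> expR (- x) <= 4 / (4 + x ^+ 2).
Proof.
move=> x0; rewrite expRN -[4 / _]invrK lef_pV2 ?posrE ?expR_gt0//; last first.
  by rewrite invr_gt0 divr_gt0// ltr_wpDr// sqr_ge0.
rewrite invfM invrK.
have e2 : 1 + x / 2 <= expR (x / 2) by exact: expR_ge1Dx.
have -> : expR x = expR (x / 2) ^+ 2 by rewrite -expRM_natl; congr expR; field.
apply: (@le_trans _ _ ((1 + x / 2) ^+ 2)); last first.
  by rewrite lerXn2r// ?nnegrE ?expR_ge0// addr_ge0// divr_ge0.
have -> : 4^-1 * (4 + x ^+ 2) = 1 + (x / 2) ^+ 2 by field.
have -> : (1 + x / 2) ^+ 2 = 1 + (x / 2) ^+ 2 + x by field.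
by rewrite lerDl.
Qed.

Lemma continuous_exp_decay c : continuous (fun t : R => expR (- c * `|t|)).
Proof.
move=> x; apply: (@continuous_comp _ _ _ (fun t : R => - c * `|t|) expR).
  by apply: continuousM; [exact: cvg_cst | exact: norm_continuous].
exact: continuous_expR.
Qed.

Lemma exp_decay_le_cauchy c (x : R) : 0 < c ->
  expR (- c * `|x|) <= (4 + 4 / c ^+ 2) * (1 + x ^+ 2)^-1.
Proof.
move=> c0; rewrite mulNr.
apply: le_trans (expRN_le_cauchy (mulr_ge0 (ltW c0) (normr_ge0 x))) _.
rewrite exprMn real_normK ?num_real//.
have x2 : 0 <= x ^+ 2 by rewrite sqr_ge0.
have c2 : 0 < c ^+ 2 by rewrite exprn_gt0.
rewrite ler_pdivlMr; last by rewrite ltr_wpDr.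
rewrite mulrAC ler_pdivrMr; last by rewrite ltr_wpDr// mulr_ge0// ltW.
have -> : (4 + 4 / c ^+ 2) * (4 + c ^+ 2 * x ^+ 2) =
  4 * (1 + x ^+ 2) + 4 * (3 + c ^+ 2 * x ^+ 2 + 4 / c ^+ 2).
  by field; rewrite gt_eqF.
have H1 : 0 <= c ^+ 2 * x ^+ 2 by rewrite mulr_ge0// ltW.
have H2 : 0 <= 4 / c ^+ 2 by rewrite divr_ge0// ltW.
lra.
Qed.

Lemma intble_exp_decay c : 0 < c -> intble (leb R) setT (fun t : R => expR (- c * `|t|)).
Proof.
move=> c0; have := intbleZ (4 + 4 / c ^+ 2) measurableT intble_cauchy.
move/(intble_dom measurableT _); apply.
  by have H := continuous_meas (@continuous_exp_decay c); exact: H.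
by move=> x _; rewrite ger0_norm ?expR_ge0//; exact: exp_decay_le_cauchy.
Qed.

Lemma intble_invsqrt_pos c : 0 < c -> intble (leb R) `]0, c] (fun s : R => (Num.sqrt s)^-1).
Proof.
move=> c0.
have [] := @primitive_intble (fun s : R => 2 * Num.sqrt s) (fun s : R => (Num.sqrt s)^-1)
  `]0, c] (fun n => c * n.+1%:R^-1) (fun=> c) (2 * Num.sqrt c) => //.
- by move=> n; rewrite ler_piMr ?(ltW c0)// invf_le1 ?ltr0Sn// ler1n.
- by move=> n m nm; rewrite ler_wpM2l ?(ltW c0)// lef_pV2 ?posrE ?ltr0Sn// ler_nat.
- apply/seteqP; split => x /=; rewrite in_itv/=.
    move=> /andP[x0 xc]; exists (Num.truncn (c / x)) => //=; rewrite in_itv/= xc andbT.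
    rewrite ler_pdivrMr ?ltr0Sn// mulrC -ler_pdivrMr// ltW//.
    by rewrite truncnS_gt.
  move=> [n _] /=; rewrite in_itv/= => /andP[cx ->]; rewrite andbT.
  by rewrite (lt_le_trans _ cx)// divr_gt0// ltr0Sn.
- move=> x; rewrite /= in_itv/= => /andP[x0 xc]; split.
  + have := is_deriveZ (2 : R) (is_derive1_sqrt x0).
    move/is_derive_eq; apply; rewrite /GRing.scale/= invfM mulrA divff ?mul1r//.
  + apply: (@continuousV _ _ (@Num.sqrt R)); last exact: sqrt_continuous.
    by rewrite gt_eqF// sqrtr_gt0.
  + by rewrite invr_ge0 sqrtr_ge0.
  + by rewrite ger0_norm ?mulr_ge0 ?sqrtr_ge0// ler_wpM2l// ler_wsqrtr.
Qed.

Lemma leb_shift (c : R) (A : set (measurableTypeR R)) : measurable A ->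
  leb R ((fun t : R => t + c) @^-1` A) = leb R A.
Proof.
have mc : measurable_fun [set: measurableTypeR R] ((fun t : R => t + c) : _ -> measurableTypeR R).
  by apply: continuous_measR => x; apply: continuousD; [exact: cvg_id | exact: cvg_cst].
move=> mA.
suff : pushforward (leb R) ((fun t : R => t + c) : _ -> measurableTypeR R) A = leb R A by [].
apply/esym/lebesgue_measure_unique => //= _ [[a b]] _ <-.
rewrite /pushforward.
have -> : (fun t : R => t + c) @^-1` `]a, b]%classic = `](a - c), (b - c)]%classic.
  by apply/seteqP; split => t /=; rewrite !in_itv/= ltrBlDr lerBrDr.
rewrite !lebesgue_measure_itv/= !lte_fin ltrD2r; case: ifP => // _.
by rewrite -!EFinB; congr EFin; ring.
Qed.

Lemma Rint_shift c f : intble (leb R) setT f ->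
  intble (leb R) setT (fun t => f (t + c)) /\
  Rintegral (leb R) setT (fun t => f (t + c)) = Rintegral (leb R) setT f.
Proof.
move=> fi; apply: (@measure_map _ _ _ (leb R) (fun t : R => t + c)) => //.
- by apply: continuous_measR => x; apply: continuousD; [exact: cvg_id | exact: cvg_cst].
- exact: leb_shift.
Qed.

Lemma Rint_opp f : intble (leb R) setT f ->
  intble (leb R) setT (fun t => f (- t)) /\
  Rintegral (leb R) setT (fun t => f (- t)) = Rintegral (leb R) setT f.
Proof.
move=> fi; apply: (@measure_map _ _ _ (leb R) -%R) => //.
by move=> A mA; exact: lebesgue_measureN.
Qed.

Lemma Rint_mkcond (D : set (measurableTypeR R)) f : Rintegral (leb R) D f = Rintegral (leb R) setT (f \_ D).
Proof. exact: Rintegral_mkcond. Qed.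

Lemma intble_mkcond (D : set (measurableTypeR R)) f : measurable D ->
  (intble (leb R) D f <-> intble (leb R) setT (f \_ D)).
Proof.
move=> mD; rewrite /intble.
have -> : EFin \o f \_ D = (EFin \o f) \_ D by rewrite restrict_EFin.
by split=> [/(integrable_mkcond _ mD)//|H]; apply/(integrable_mkcond _ mD).
Qed.

Lemma Rint_itv_shift c a b f : intble (leb R) `[(a + c), (b + c)] f ->
  intble (leb R) `[a, b] (fun t => f (t + c)) /\
  Rintegral (leb R) `[a, b] (fun t => f (t + c)) = Rintegral (leb R) `[(a + c), (b + c)] f.
Proof.
move=> /(intble_mkcond _ (measurable_itv _))/(Rint_shift c)[i1 e1].
have E : (fun t : R => (f \_ `[(a + c), (b + c)]) (t + c)) = (fun t => f (t + c)) \_ `[a, b].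
  apply/funext => t; rewrite !patchE.
  by congr (if _ then _ else _); apply/idP/idP; rewrite !inE/= !in_itv/= !lerD2r.
rewrite E in i1 e1; split.
  exact/(intble_mkcond _ (measurable_itv _)).
by rewrite Rint_mkcond e1 -Rint_mkcond.
Qed.

Lemma intble_invsqrt c : 0 < c -> intble (leb R) `[(- c), c] (fun s : R => (Num.sqrt `|s|)^-1).
Proof.
move=> c0; have /(intble_mkcond _ (measurable_itv _)) i1 := intble_invsqrt_pos c0.
have [i2 _] := Rint_opp i1.
apply/(intble_mkcond _ (measurable_itv _)).
suff -> : (fun s : R => (Num.sqrt `|s|)^-1) \_ `[(- c), c] =
  (fun s : R => ((fun s : R => (Num.sqrt s)^-1) \_ `]0, c]) s + ((fun s : R => (Num.sqrt s)^-1) \_ `]0, c]) (- s)).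
  exact: (intbleD measurableT i1 i2).
apply/funext => s; rewrite !patchE !mem_setE !in_itv/=.
case: (ltgtP 0 s) => s0.
- have -> : (- c <= s) = true by lra.
  rewrite /=.
  have -> : (0 < - s) = false by lra.
  by rewrite /= addr0 gtr0_norm.
- have -> : (s <= c) = true by lra.
  rewrite andbT /=.
  have -> : (0 < - s) = true by lra.
  by rewrite /= add0r ltr0_norm// lerNl.
- by rewrite -s0 oppr0 ltxx/= normr0 sqrtr0 invr0 addr0 if_same.
Qed.

(** The fundamental theorem on [-n, n], with dominated convergence by |f| on the truncations. It is
    the vanishing of boundary terms behind integration by parts along a curve. *)
Lemma Rint_derivative0 F f : (forall x : R, is_derive x (1 : R) F (f x)) ->
  continuous f -> intble (leb R) setT f -> F x @[x --> +oo] --> (0 : R) ->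
  F x @[x --> -oo] --> (0 : R) -> Rintegral (leb R) setT f = 0.
Proof.
move=> dF cf fi Fp Fm.
pose f_ (n : nat) := f \_ `[(- n%:R), n%:R].
have cv1 : Rintegral (leb R) setT (f_ n) @[n --> \oo] --> Rintegral (leb R) setT f.
  apply: (@Rint_dct _ _ _ (leb R) setT f_ f (fun x => `|f x|)) => //.
  - move=> n; apply/(measurable_restrictT _ _).1 => //.
    by apply: measurable_funTS; exact: continuous_meas.
  - exact: continuous_meas.
  - apply: aeW => x _; apply: cvg_near_cst; near=> n.
    rewrite /f_ patchE mem_setE in_itv/= -ler_norml ifT//.
    by near: n; exact: nbhs_infty_ger.
  - exact: intble_norm.
  - by move=> n x _; rewrite /f_ patchE; case: ifP; rewrite ?normr0.
have cv2 : Rintegral (leb R) setT (f_ n) @[n --> \oo] --> (0 : R).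
  have E n : Rintegral (leb R) setT (f_ n) = F n%:R - F (- n%:R).
    rewrite /f_ -Rint_mkcond; apply: Rint_FTC2 => // [|x _]; last exact: cf.
    by rewrite ge0_cp.
  under eq_fun do rewrite E.
  rewrite -[0 : R]subr0; apply: cvgB.
    by apply: (cvg_comp _ _ (@cvgr_idn R) Fp).
  apply: (cvg_comp (fun n : nat => - n%:R : R) F _ Fm).
  by apply/cvgNry; rewrite opprK; exact: cvgr_idn.
exact: (cvg_unique _ cv1 cv2).
Unshelve. all: by end_near. Qed.

Lemma Rint_halfline F f (l : R) : (forall x : R, is_derive x (1 : R) F (f x)) ->
  continuous f -> intble (leb R) `[0, +oo[ f -> F x @[x --> +oo] --> l ->
  Rintegral (leb R) `[0, +oo[ f = l - F 0.
Proof.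
move=> dF cf fi Fp.
pose f_ (n : nat) := f \_ `[0, n%:R].
have cv1 : Rintegral (leb R) `[0, +oo[ (f_ n) @[n --> \oo] --> Rintegral (leb R) `[0, +oo[ f.
  apply: (@Rint_dct _ _ _ (leb R) _ f_ f (fun x => `|f x|)) => //.
  - move=> n; apply: measurable_funTS.
    apply/(measurable_restrictT _ _).1 => //.
    by apply: measurable_funTS; exact: continuous_meas.
  - by apply: measurable_funTS; exact: continuous_meas.
  - apply: aeW => x; rewrite /= in_itv/= andbT => x0; apply: cvg_near_cst; near=> n.
    rewrite /f_ patchE mem_setE in_itv/= x0/= ifT//.
    by near: n; exact: nbhs_infty_ger.
  - exact: intble_norm.
  - by move=> n x _; rewrite /f_ patchE; case: ifP; rewrite ?normr0.
have cv2 : Rintegral (leb R) `[0, +oo[ (f_ n) @[n --> \oo] --> l - F 0.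
  have E n : Rintegral (leb R) `[0, +oo[ (f_ n) = F n%:R - F 0.
    rewrite /f_ -Rintegral_mkcondr (_ : _ `&` _ = `[0, n%:R]%classic).
      by apply: Rint_FTC2 => // x _; exact: cf.
    by apply/seteqP; split => x /=; rewrite !in_itv/= andbT; [move=> []|move=> /andP[-> ->]].
  under eq_fun do rewrite E.
  by apply: cvgB; [exact: (cvg_comp _ _ (@cvgr_idn R) Fp) | exact: cvg_cst].
exact: (cvg_unique _ cv1 cv2).
Unshelve. all: by end_near. Qed.

Lemma ae_except2 (a b : R) (P : R -> Prop) : (forall x, x != a -> x != b -> P x) ->
  {ae leb R, forall x, P x}.
Proof.
move=> H; exists ([set a] `|` [set b]); split.
- exact: measurableU.
- by apply: countable_lebesgue_measure0; apply: finite_set_countable; rewrite finite_setU; split; exact: finite_set1.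
- move=> x /= nP; apply: contrapT => xab; apply: nP; apply: H.
    by apply/eqP => xa; apply: xab; left.
  by apply/eqP => xb; apply: xab; right.
Qed.

End LineIntegrals.

(** * The Bessel kernel *)

Section Bessel.
Variable R : realType.
Implicit Types (s z : R).

Definition ch s : R := (expR s + expR (- s)) / 2.
Definition sh s : R := (expR s - expR (- s)) / 2.

Lemma is_derive_expRN s : is_derive (s : R) (1 : R) (fun t : R => expR (- t)) (- expR (- s)).
Proof.
have H : is_derive s (1 : R) (@GRing.opp R) (-1) by exact: is_deriveN.
by have := is_derive1_comp (is_derive_expR (- s)) H; rewrite mulrN1.
Qed.

Lemma is_derive_ch s : is_derive (s : R) (1 : R) ch (sh s).
Proof.
have := dMul (dAdd (is_derive_expR s) (is_derive_expRN s)) (dCst 2^-1 s).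
by move/is_derive_eq; apply; rewrite mulr0 addr0.
Qed.

Lemma is_derive_sh s : is_derive (s : R) (1 : R) sh (ch s).
Proof.
have := dMul (dSub (is_derive_expR s) (is_derive_expRN s)) (dCst 2^-1 s).
by move/is_derive_eq; apply; rewrite mulr0 addr0 opprK.
Qed.

Lemma ch_ge1 s : 1 <= ch s.
Proof.
have e0 := expR_gt0 s.
rewrite /ch expRN ler_pdivlMr// mul1r -subr_ge0.
have -> : expR s + (expR s)^-1 - 2 = (expR s - 1) ^+ 2 / expR s by field; rewrite gt_eqF.
by rewrite divr_ge0 ?sqr_ge0// ltW.
Qed.

Lemma ch_gt0 s : 0 < ch s. Proof. exact: lt_le_trans (ch_ge1 s). Qed.

Lemma ch_sh s : ch s ^+ 2 = 1 + sh s ^+ 2.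
Proof. by rewrite /ch /sh expRN; field; rewrite gt_eqF// expR_gt0. Qed.

Lemma ch_sh_exp s : ch s = sh s + expR (- s).
Proof. by rewrite /ch /sh; field. Qed.

Lemma sh_le_ch s : `|sh s| <= ch s.
Proof.
have [e1 e2] := (expR_gt0 s, expR_gt0 (- s)).
by rewrite ler_norml /sh /ch; lra.
Qed.

Lemma norm_le_ch s : `|s| <= ch s.
Proof.
rewrite -(@ler_pXn2r _ 2) ?nnegrE ?(ltW (ch_gt0 _))//.
rewrite real_normK ?num_real// ch_sh.
suff : `|s| <= `|sh s|.
  move=> H; have : `|s| ^+ 2 <= `|sh s| ^+ 2 by rewrite lerXn2r ?nnegrE.
  rewrite !real_normK ?num_real//; lra.
have [c _] := @mean_value R sh ch 0 s (fun x _ => is_derive_sh x).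
rewrite subr0 /sh oppr0 subrr mul0r subr0 => ->.
by rewrite normrM ler_peMl// (le_trans (ch_ge1 c))// ler_norm.
Qed.

Lemma sh0 : sh 0 = 0.
Proof. by rewrite /sh oppr0 subrr mul0r. Qed.

Lemma ch0 : ch 0 = 1.
Proof. by rewrite /ch oppr0 expR0; field. Qed.

Lemma ch_ge_exp s : expR s / 2 <= ch s.
Proof. by rewrite /ch ler_wpM2r// lerDl expR_ge0. Qed.

Lemma ch_sqr_ge s : (1 + s ^+ 2) / 2 <= ch s ^+ 2.
Proof.
have h1 : 1 <= ch s ^+ 2 by rewrite exprn_ege1// ch_ge1.
have h2 : s ^+ 2 <= ch s ^+ 2.
  by rewrite -[s ^+ 2]real_normK ?num_real// lerXn2r ?nnegrE ?norm_le_ch// ltW// ch_gt0.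
lra.
Qed.

(** The m-th power of x / m <= e^(x / m). *)
Lemma exprn_expRN_le (m : nat) (x : R) : 0 <= x -> x ^+ m * expR (- x) <= m%:R ^+ m.
Proof.
case: m => [|m] x0; first by rewrite !expr0 mul1r -expR0 ler_expR oppr_le0.
set k : R := m.+1%:R; have k0 : 0 < k by rewrite ltr0Sn.
have H : x / k <= expR (x / k).
  by rewrite (le_trans _ (expR_ge1Dx _))// lerDr.
have E : expR x = expR (x / k) ^+ m.+1.
  by rewrite -expRM_natl; congr expR; rewrite -/k mulrC divfK// gt_eqF.
rewrite expRN ler_pdivrMr ?expR_gt0// E -exprMn lerXn2r ?nnegrE ?mulr_ge0 ?expR_ge0 ?(ltW k0)//.
by rewrite mulrC -ler_pdivrMr.
Qed.

Lemma continuous_ch : continuous ch.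
Proof. by move=> s; exact: (is_derive_continuous (is_derive_ch s)). Qed.

Lemma is_derive_expch z s :
  is_derive (s : R) (1 : R) (fun t : R => expR (- z * ch t)) (- z * sh s * expR (- z * ch s)).
Proof.
by have := dExp (dScale (- z) (is_derive_ch s)); rewrite mulrC.
Qed.

Definition Kint (n : nat) z s : R := ch s ^+ n * expR (- z * ch s).
(* Powers of cosh replace cosh (n s), so that Kn 0 and Kn 1 are K_0 and K_1. *)
Definition Kn (n : nat) z : R := Rintegral (leb R) `[0, +oo[ (Kint n z).

Lemma continuous_Kint n z : continuous (Kint n z).
Proof.
move=> s; apply: (@continuousM _ _ (fun t => ch t ^+ n)).
  apply: (@continuous_comp _ _ _ ch (fun x : R => x ^+ n)); first exact: continuous_ch.
  exact: exprn_continuous.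
exact: (is_derive_continuous (is_derive_expch z s)).
Qed.

Lemma meas_Kint n z (D : set (measurableTypeR R)) : measurable_fun D (Kint n z).
Proof. by apply: measurable_funTS; have H := continuous_meas (@continuous_Kint n z); exact: H. Qed.

(** Two more powers of z cosh s are borrowed from the exponential through [exprn_expRN_le]; the
    surplus cosh^2 s >= (1 + s^2) / 2 is the integrable weight. *)
Lemma Kint_le n z s : 0 < z ->
  `|Kint n z s| <= 2 * (n.+2%:R / z) ^+ n.+2 * (1 + s ^+ 2)^-1.
Proof.
move=> z0; have c0 := ch_gt0 s.
rewrite /Kint ger0_norm ?mulr_ge0 ?expR_ge0 ?exprn_ge0 ?(ltW c0)//.
have s1 : 0 < 1 + s ^+ 2 by rewrite ltr_wpDr ?sqr_ge0.
rewrite ler_pdivlMr//.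
have H := @exprn_expRN_le n.+2 (z * ch s) (mulr_ge0 (ltW z0) (ltW c0)).
rewrite -mulNr in H.
have -> : 2 * (n.+2%:R / z) ^+ n.+2 = 2 * n.+2%:R ^+ n.+2 / z ^+ n.+2 :> R.
  by rewrite exprMn exprVn mulrA.
rewrite ler_pdivlMr ?exprn_gt0//.
apply: (@le_trans _ _ (2 * ((z * ch s) ^+ n.+2 * expR (- z * ch s)))); last by rewrite ler_wpM2l.
rewrite (exprMn _ z).
have -> : 2 * (z ^+ n.+2 * ch s ^+ n.+2 * expR (- z * ch s)) =
  ch s ^+ n * expR (- z * ch s) * (2 * ch s ^+ 2) * z ^+ n.+2.
  by rewrite -(addn2 n) !exprD; ring.
rewrite ler_wpM2r ?exprn_ge0 ?(ltW z0)// ler_wpM2l ?mulr_ge0 ?expR_ge0 ?exprn_ge0 ?(ltW c0)//.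
by rewrite mulrC -ler_pdivrMr// ch_sqr_ge.
Qed.

Lemma intble_cauchy_half : intble (leb R) `[0, +oo[ (fun t : R => (1 + t ^+ 2)^-1).
Proof. by apply: intble_sub (@intble_cauchy R). Qed.

Lemma intble_Kint n z : 0 < z -> intble (leb R) `[0, +oo[ (Kint n z).
Proof.
move=> z0.
have := intbleZ (2 * (n.+2%:R / z) ^+ n.+2) (@measurable_halfline R) intble_cauchy_half.
move/(intble_dom _ _); apply => //; first exact: meas_Kint.
by move=> s _; exact: Kint_le.
Qed.

Lemma expR_taylor1 (x : R) : `|expR x - 1 - x| <= x ^+ 2 * expR `|x|.
Proof.
have H0 (y : R) : `|y| <= `|x| -> `|expR y - 1| <= `|x| * expR `|x|.
  move=> yx; have [c + e] := @mean_value R expR expR 0 y (fun x _ => is_derive_expR x).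
  rewrite expR0 !subr0 in e *; move=> cy; rewrite e normrM mulrC ler_pM//.
  rewrite ger0_norm ?expR_ge0// ler_expR (le_trans (ler_norm _))// (le_trans cy)//.
have [c + e] := @mean_value R (fun t => expR t - t) (fun t => expR t - 1) 0 x
   (fun x _ => is_deriveB (is_derive_expR x) (is_derive_id x 1)).
rewrite !subr0 in e * => cx.
have -> : expR x - 1 - x = expR x - x - (expR 0) by rewrite expR0; ring.
rewrite e normrM -[x ^+ 2]real_normK ?num_real// expr2 mulrAC ler_wpM2r//.
exact: H0.
Qed.

(** The remainder of the exponential costs a factor e^(|h| cosh s), which half of the exponent
    absorbs: hence the argument z / 2 in the majorant, and n + 2 for the two powers of cosh s that
    come down. *)
Lemma Kint_taylor n z s (h : R) : 0 < z -> `|h| <= z / 2 ->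
  `|Kint n (z + h) s - Kint n z s - (- Kint n.+1 z s) * h| <= Kint n.+2 (z / 2) s * `|h| ^+ 2.
Proof.
move=> z0 hz; have c0 := ch_gt0 s.
have -> : Kint n (z + h) s - Kint n z s - (- Kint n.+1 z s) * h =
   Kint n z s * (expR (- h * ch s) - 1 - (- h * ch s)).
  rewrite /Kint (_ : - (z + h) * ch s = - z * ch s + - h * ch s); last by ring.
  by rewrite expRD exprS; ring.
have K0 m y : 0 <= Kint m y s by rewrite mulr_ge0 ?expR_ge0 ?exprn_ge0 ?(ltW c0).
rewrite normrM ger0_norm//.
apply: le_trans (ler_wpM2l (K0 _ _) (expR_taylor1 _)) _.
rewrite normrM normrN (gtr0_norm c0) exprMn sqrrN.
have -> : Kint n z s * (h ^+ 2 * ch s ^+ 2 * expR (`|h| * ch s)) =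
  ch s ^+ n.+2 * h ^+ 2 * expR (- z * ch s + `|h| * ch s).
  by rewrite /Kint expRD -(addn2 n) exprD; ring.
rewrite real_normK ?num_real// /Kint [leRHS]mulrAC.
have c2 : 0 <= ch s ^+ n.+2 * h ^+ 2 by rewrite mulr_ge0 ?sqr_ge0 ?exprn_ge0 ?(ltW c0).
apply: (ler_wpM2l c2); rewrite ler_expR.
by rewrite -mulrDl ler_wpM2r ?(ltW c0)//; lra.
Qed.

Lemma is_derive_Kn n z : 0 < z -> is_derive (z : R) (1 : R) (Kn n) (- Kn n.+1 z).
Proof.
move=> z0; have z20 : 0 < z / 2 by rewrite divr_gt0.
have N (h : R * R) : `|h.1| <= `|h| by rewrite prod_normE le_max lexx.
(* The plane version of differentiation under the integral is applied with a dummy second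
   coordinate. *)
have H : has_grad (fun y : R * R => Rintegral (leb R) `[0, +oo[ (fun s => Kint n y.1 s)) (z, 0)
    (Rintegral (leb R) `[0, +oo[ (fun s => - Kint n.+1 z s)) (Rintegral (leb R) `[0, +oo[ (fun=> 0)).
  apply: (@Rint_has_grad _ _ _ (leb R) (fun (y : R * R) (s : measurableTypeR R) => Kint n y.1 s)
    (fun s => - Kint n.+1 z s) (fun=> 0) (Kint n.+2 (z / 2)) _ (z / 2)) => //.
  - move=> h hz; apply: intble_Kint => /=.
    by have := N h; rewrite ler_norml; lra.
  - by apply: intbleN => //; exact: intble_Kint.
  - have := intbleZ 0 (@measurable_halfline R) (intble_Kint 0 z0).
    by have -> : (fun x : R => 0 * Kint 0 z x) = (fun=> 0) by apply/funext => x; rewrite mul0r.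
  - exact: intble_Kint.
  - move=> h s hz _; rewrite mul0r addr0.
    apply: le_trans (Kint_taylor n s z0 _) _; first by rewrite (le_trans (N h))// ltW.
    rewrite ler_wpM2l ?lerXn2r ?nnegrE//.
    by rewrite mulr_ge0 ?expR_ge0 ?exprn_ge0 ?(ltW (ch_gt0 _)).
have := @has_grad_pd1 _ _ (fun=> _) (fun=> _) (z, 0) H.
rewrite /pd1 /=; move/is_derive_eq; apply.
rewrite -mulN1r /Kn -RintegralZl//; last exact: intble_Kint.
by apply: eq_Rintegral => s _; rewrite mulN1r.
Qed.

Lemma Kint_to0 n z : 0 < z -> Kint n z s @[s --> +oo] --> (0 : R).
Proof.
move=> z0; set C := 2 * (n.+2%:R / z) ^+ n.+2.
apply/cvgrPdist_lt => e e0; near=> s.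
rewrite sub0r normrN; apply: le_lt_trans (Kint_le n s z0) _; rewrite -/C.
have C0 : 0 <= C by rewrite mulr_ge0// exprn_ge0// divr_ge0// ltW.
have s0 : 0 < s by near: s; exact/nbhs_pinfty_gt/num_real.
have sC : C / e < s by near: s; exact/nbhs_pinfty_gt/num_real.
have s1 : 1 < s by near: s; exact/nbhs_pinfty_gt/num_real.
rewrite ltr_pdivrMr ?ltr_wpDr ?sqr_ge0//.
rewrite ltr_pdivrMr// in sC.
rewrite (lt_le_trans sC)// mulrC ler_wpM2l ?(ltW e0)//.
rewrite (@le_trans _ _ (s ^+ 2)) ?lerDr// expr2 ler_peMr// ltW//.
Unshelve. all: by end_near. Qed.

(** This is Bessel's equation K_0'' = K_0 - K_0' / z. The difference of the integrands is the
    derivative of - z^-1 sinh s e^(- z cosh s), which vanishes at s = 0 and at infinity. *)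
Lemma Kn_ode z : 0 < z -> Kn 2 z = Kn 0 z + Kn 1 z / z.
Proof.
move=> z0; have z1 : z != 0 by rewrite gt_eqF.
pose F s := - z^-1 * (sh s * expR (- z * ch s)).
pose f s := Kint 2 z s - Kint 0 z s - z^-1 * Kint 1 z s.
have dF s : is_derive (s : R) (1 : R) F (f s).
  have := dScale (- z^-1) (dMul (is_derive_sh s) (is_derive_expch z s)).
  move/is_derive_eq; apply; rewrite /f /Kint ch_sh expr0 expr1.
  by field.
have mI := @measurable_halfline R.
have i20 : intble (leb R) `[0, +oo[ (fun s => Kint 2 z s - Kint 0 z s).
  by apply: intbleB => //; exact: intble_Kint.
have i1 : intble (leb R) `[0, +oo[ (fun s => z^-1 * Kint 1 z s).
  by apply: intbleZ => //; exact: intble_Kint.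
have cf : continuous f.
  by apply: ctB; [apply: ctB|apply: ctZ]; exact: continuous_Kint.
have F0 : F s @[s --> +oo] --> (0 : R).
  rewrite -[0](mulr0 (- z^-1)); apply: cvgM; first exact: cvg_cst.
  apply/cvgrPdist_lt => e e0; have /cvgrPdist_lt /(_ _ e0) := Kint_to0 1 z0.
  apply: filterS => s; rewrite !sub0r !normrN; apply: le_lt_trans.
  rewrite /Kint expr1 (normrM (sh s)) (normrM (ch s)) ler_wpM2r// (gtr0_norm (ch_gt0 s)); exact: sh_le_ch.
have := Rint_halfline dF cf (intbleB mI i20 i1) F0.
rewrite {1}/F sh0 mul0r mulr0 subr0.
rewrite /f RintegralB// RintegralB//; try exact: intble_Kint.
rewrite (RintegralZl _ mI (intble_Kint 1 z0)).
rewrite -/(Kn 2 z) -/(Kn 0 z) -/(Kn 1 z) => H.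
by rewrite mulrC; lra.
Qed.

(** The remainder of K_1 when cosh s is split as sinh s + e^(-s): the part with z sinh s integrates
    exactly to e^(-z), so it carries the whole 1 / z singularity, and this remainder is bounded. *)
Definition Jn z : R := Rintegral (leb R) `[0, +oo[ (fun s : R => expR (- s) * expR (- z * ch s)).

Lemma intble_expN : intble (leb R) `[0, +oo[ (fun s : R => expR (- s)).
Proof.
have := intble_sub measurableT (@measurable_halfline R) (@subsetT _ _) (@intble_exp_decay R 1 ltr01).
apply: eq_integrable => // s; rewrite inE/= in_itv/= andbT => s0.
by rewrite mulN1r ger0_norm.
Qed.

Lemma Rint_expN : Rintegral (leb R) `[0, +oo[ (fun s : R => expR (- s)) = 1.
Proof.
have := @Rint_halfline R (fun s => - expR (- s)) (fun s => expR (- s)) 0.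
rewrite oppr0 expR0 sub0r opprK; apply.
- by move=> s; have := dNeg (is_derive_expRN s); rewrite opprK.
- by move=> s; exact: (is_derive_continuous (is_derive_expRN s)).
- exact: intble_expN.
- rewrite -[0]oppr0; apply: cvgN.
  apply/cvgrPdist_lt => e e0; near=> s; rewrite sub0r normrN.
  have s0 : 0 < s by near: s; exact/nbhs_pinfty_gt/num_real.
  have se : e^-1 < s by near: s; exact/nbhs_pinfty_gt/num_real.
  rewrite ger0_norm ?expR_ge0// expRN -[e]invrK ltf_pV2 ?posrE ?invr_gt0 ?expR_gt0//.
  by rewrite (lt_le_trans se)// (le_trans _ (expR_ge1Dx _))// lerDr.
Unshelve. all: by end_near. Qed.

Lemma Jn_bound z : 0 < z -> 0 <= Jn z <= expR (- z).
Proof.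
move=> z0; have mI := @measurable_halfline R.
apply/andP; split; first by apply: Rintegral_ge0 => s _; rewrite mulr_ge0 ?expR_ge0.
rewrite -[leRHS]mulr1 -Rint_expN -RintegralZl//; last exact: intble_expN.
have iR : intble (leb R) `[0, +oo[ (fun s : R => expR (- z) * expR (- s)).
  by apply: intbleZ => //; exact: intble_expN.
have le s : expR (- s) * expR (- z * ch s) <= expR (- z) * expR (- s).
  rewrite mulrC ler_wpM2r ?expR_ge0// ler_expR mulNr lerN2 ler_peMr ?ch_ge1// ltW//.
apply: le_Rintegral => //.
apply: (intble_dom mI _ iR) => [|s _].
  apply: measurable_funTS.
  have c : continuous (fun s : R => expR (- s) * expR (- z * ch s)).
    apply: ctM => s; first exact: (is_derive_continuous (is_derive_expRN s)).
    exact: (is_derive_continuous (is_derive_expch z s)).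
  by have H := continuous_meas c; exact: H.
by rewrite ger0_norm ?mulr_ge0 ?expR_ge0.
Qed.

Lemma Kn1_J z : 0 < z -> z * Kn 1 z = expR (- z) + z * Jn z.
Proof.
move=> z0; have mI := @measurable_halfline R.
pose f s := z * sh s * expR (- z * ch s).
have cf : continuous f.
  apply: ctM => [|s]; last exact: (is_derive_continuous (is_derive_expch z s)).
  by apply: ctZ => s; exact: (is_derive_continuous (is_derive_sh s)).
have fi : intble (leb R) `[0, +oo[ f.
  have := intbleZ z mI (intble_Kint 1 z0).
  move/(intble_dom mI _); apply.
    by apply: measurable_funTS; have H := continuous_meas cf; exact: H.
  move=> s _; rewrite /f (normrM (z * sh s)) (normrM z) (gtr0_norm z0) (ger0_norm (expR_ge0 _)) -mulrA.
  by rewrite ler_wpM2l ?(ltW z0)// /Kint expr1 ler_wpM2r ?expR_ge0// sh_le_ch.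
have dF s : is_derive (s : R) (1 : R) (fun t : R => - expR (- z * ch t)) (f s).
  have := dNeg (is_derive_expch z s); move/is_derive_eq; apply; rewrite /f; ring.
have F0 : - expR (- z * ch s) @[s --> +oo] --> (0 : R).
  rewrite -[0]oppr0; apply: cvgN; have := Kint_to0 0 z0.
  by under eq_fun do rewrite /Kint expr0 mul1r.
have := Rint_halfline dF cf fi F0.
rewrite ch0 mulr1 sub0r opprK => <-.
have ji : intble (leb R) `[0, +oo[ (fun s : R => expR (- s) * expR (- z * ch s)).
  apply: (intble_dom mI _ (intble_Kint 1 z0)) => [|s].
    apply: measurable_funTS.
    have c : continuous (fun s : R => expR (- s) * expR (- z * ch s)).
      apply: ctM => s; first exact: (is_derive_continuous (is_derive_expRN s)).
      exact: (is_derive_continuous (is_derive_expch z s)).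
    by have H := continuous_meas c; exact: H.
  rewrite /= in_itv/= andbT => s0.
  rewrite ger0_norm ?mulr_ge0 ?expR_ge0// /Kint expr1 ler_wpM2r ?expR_ge0//.
  by rewrite (le_trans _ (ch_ge1 s))// -expR0 ler_expR oppr_le0.
rewrite /Kn /Jn -!RintegralZl//; try exact: intble_Kint.
rewrite -RintegralD//; last by apply: intbleZ.
by apply: eq_Rintegral => s _; rewrite /f /Kint expr1 ch_sh_exp; ring.
Qed.

(** The first estimate gives the decay at infinity. The second isolates the singularity 1 / z with
    coefficient exactly 1, from which the jump of the gradient comes. *)
Lemma Kn1_bound z : 0 < z -> 0 <= z * Kn 1 z <= (1 + z) * expR (- z) /\ `|z * Kn 1 z - 1| <= z.
Proof.
move=> z0; have /andP[j0 j1] := Jn_bound z0; rewrite Kn1_J//.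
have e0 := expR_ge0 (- z).
have zj0 : 0 <= z * Jn z by rewrite mulr_ge0// ltW.
have zj1 : z * Jn z <= z * expR (- z) by rewrite ler_wpM2l// ltW.
have e1 : 1 - z <= expR (- z) by exact: expR_ge1Dx.
have e2 : expR (- z) <= 1 by rewrite -expR0 ler_expR oppr_le0 ltW.
have ze : z * expR (- z) <= z by rewrite ler_piMr// ltW.
split; first by apply/andP; split; lra.
by rewrite ler_norml; apply/andP; split; lra.
Qed.

Lemma Kn0_ge0 z : 0 <= Kn 0 z.
Proof.
by apply: Rintegral_ge0 => s _; rewrite mulr_ge0 ?expR_ge0 ?exprn_ge0 ?(ltW (ch_gt0 _)).
Qed.

Lemma Kn0_le1 z : 0 < z -> Kn 0 z <= Kn 1 z.
Proof.
move=> z0; apply: le_Rintegral; [exact: measurable_halfline|exact: intble_Kint|exact: intble_Kint|].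
by move=> s _; rewrite /Kint ler_wpM2r ?expR_ge0// expr0 expr1 ch_ge1.
Qed.

Lemma expRN_le_invsqrt (x : R) : 0 < x -> expR (- x) <= (Num.sqrt x)^-1.
Proof.
move=> x0; rewrite expRN lef_pV2 ?posrE ?sqrtr_gt0 ?expR_gt0//.
rewrite -(@ler_pXn2r _ 2) ?nnegrE ?sqrtr_ge0 ?expR_ge0// sqr_sqrtr ?(ltW x0)//.
rewrite -expRM_natl (le_trans _ (expR_ge1Dx _))//; lra.
Qed.

Definition Kconst : R :=
  Num.sqrt 2 * Rintegral (leb R) `[0, +oo[ (fun s : R => expR (- 2^-1 * `|s|)).

(** From e^(-x) <= x^(-1/2) at x = z cosh s, with cosh s >= e^s / 2 keeping the integral in s
    finite. This is weaker than the true logarithm but still integrable along a curve. *)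
Lemma Kn0_sing z : 0 < z -> Kn 0 z <= Kconst / Num.sqrt z.
Proof.
move=> z0; have mI := @measurable_halfline R.
have ie : intble (leb R) `[0, +oo[ (fun s : R => expR (- 2^-1 * `|s|)).
  by apply: (intble_sub measurableT mI) => //; apply: intble_exp_decay; rewrite invr_gt0.
rewrite /Kconst mulrAC -RintegralZl//.
apply: le_Rintegral => //; [exact: intble_Kint|exact: intbleZ|].
move=> s; rewrite /= in_itv/= andbT => s0; rewrite /Kint expr0 mul1r (ger0_norm s0) !mulNr.
have c0 := ch_gt0 s; have zc : 0 < z * ch s by rewrite mulr_gt0.
apply: le_trans (expRN_le_invsqrt zc) _.
rewrite sqrtrM ?(ltW z0)// invfM [leRHS]mulrAC mulrC ler_wpM2r ?invr_ge0 ?sqrtr_ge0//.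
rewrite -[leRHS]invrK lef_pV2; last 2 first.
- by rewrite posrE sqrtr_gt0.
- by rewrite posrE invr_gt0 mulr_gt0 ?expR_gt0 ?sqrtr_gt0.
rewrite invfM -expRN opprK.
rewrite -(@ler_pXn2r _ 2) ?nnegrE ?sqrtr_ge0 ?mulr_ge0 ?invr_ge0 ?sqrtr_ge0 ?expR_ge0//.
rewrite exprMn exprVn !sqr_sqrtr ?(ltW c0)// -expRM_natl.
have -> : 2 * (2^-1 * s) = s by field.
by rewrite mulrC ch_ge_exp.
Qed.

Lemma besselK0E z : besselK0 z = Kn 0 z.
Proof. by apply: eq_Rintegral => s _; rewrite /Kint expr0 mul1r. Qed.

End Bessel.

(** * The Euclidean norm on the plane *)

Section EuclideanNorm.
Variable R : realType.
Implicit Types z y : R * R.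

Lemma enorm_ge0 z : 0 <= enorm z. Proof. exact: sqrtr_ge0. Qed.

Lemma sqr_enorm z : enorm z ^+ 2 = z.1 ^+ 2 + z.2 ^+ 2.
Proof. by rewrite sqr_sqrtr// addr_ge0 ?sqr_ge0. Qed.

Lemma enorm0 : enorm (0 : R * R) = 0.
Proof. by rewrite /enorm /= expr0n addr0 sqrtr0. Qed.

Lemma enorm_eq0 z : enorm z = 0 -> z = 0.
Proof.
move=> z0; have := sqr_enorm z; rewrite z0 expr0n/= => /esym/eqP.
rewrite paddr_eq0 ?sqr_ge0// !sqrf_eq0 => /andP[/eqP a /eqP b].
by case: z {z0} a b => a b /= -> ->.
Qed.

Lemma enorm_gt0 z : z != 0 -> 0 < enorm z.
Proof.
by move=> z0; rewrite lt_neqAle enorm_ge0 andbT eq_sym; apply: contra_neq z0 => /enorm_eq0.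
Qed.

Lemma enormN z : enorm (- z) = enorm z.
Proof. by rewrite /enorm /= !sqrrN. Qed.

Lemma enormB z y : enorm (z - y) = enorm (y - z).
Proof. by rewrite -enormN opprB. Qed.

Lemma enorm_fst z : `|z.1| <= enorm z.
Proof. by rewrite -sqrtr_sqr ler_wsqrtr// lerDl sqr_ge0. Qed.

Lemma enorm_snd z : `|z.2| <= enorm z.
Proof. by rewrite -sqrtr_sqr ler_wsqrtr// lerDr sqr_ge0. Qed.

Lemma dot_le z y : `|z.1 * y.1 + z.2 * y.2| <= enorm z * enorm y.
Proof.
rewrite -(@ler_pXn2r _ 2) ?nnegrE ?mulr_ge0 ?enorm_ge0//.
rewrite exprMn !sqr_enorm real_normK ?num_real// -subr_ge0.
have -> : (z.1 ^+ 2 + z.2 ^+ 2) * (y.1 ^+ 2 + y.2 ^+ 2) - (z.1 * y.1 + z.2 * y.2) ^+ 2 =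
  (z.1 * y.2 - z.2 * y.1) ^+ 2 by ring.
exact: sqr_ge0.
Qed.

Lemma enormD z y : enorm (z + y) <= enorm z + enorm y.
Proof.
rewrite -(@ler_pXn2r _ 2) ?nnegrE ?addr_ge0 ?enorm_ge0//.
rewrite sqrrD !sqr_enorm /=.
have := dot_le z y; rewrite ler_norml => /andP[_].
move: (enorm z * enorm y) => p H; rewrite mulr2n.
set a := z.1 in H *; set b := z.2 in H *; set c := y.1 in H *; set d := y.2 in H *.
have -> : (a + c) ^+ 2 + (b + d) ^+ 2 = a ^+ 2 + b ^+ 2 + c ^+ 2 + d ^+ 2 + 2 * (a * c + b * d).
  by ring.
lra.
Qed.

Lemma enorm_tri z y x : enorm (z - x) <= enorm (z - y) + enorm (y - x).
Proof. by have := enormD (z - y) (y - x); rewrite addrA subrK. Qed.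

Lemma enorm_sub z y : enorm z - enorm y <= enorm (z - y).
Proof. by rewrite lerBlDr; have := enormD (z - y) y; rewrite subrK. Qed.

Lemma enorm_le_sum z : enorm z <= `|z.1| + `|z.2|.
Proof.
rewrite -(@ler_pXn2r _ 2) ?nnegrE ?addr_ge0 ?enorm_ge0//.
rewrite sqr_enorm sqrrD !real_normK ?num_real//.
by rewrite lerD2r lerDl mulrn_wge0// mulr_ge0.
Qed.

Lemma enorm_le_supnorm z : enorm z <= 2 * `|z|.
Proof.
apply: le_trans (enorm_le_sum z) _.
have : `|z.1| <= `|z| by rewrite prod_normE le_max lexx.
have : `|z.2| <= `|z| by rewrite prod_normE le_max lexx orbT.
lra.
Qed.

Lemma enormZ (c : R) z : enorm (c *: z) = `|c| * enorm z.
Proof.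
rewrite /enorm /= !exprMn -mulrDr sqrtrM ?sqr_ge0//.
by rewrite sqrtr_sqr.
Qed.

Lemma enorm_pos_neq0 z : 0 < enorm z -> z != 0.
Proof. by apply: contraTneq => ->; rewrite enorm0 ltxx. Qed.

Lemma has_grad_enorm z : z != 0 -> has_grad (@enorm R) z (z.1 / enorm z) (z.2 / enorm z).
Proof.
move=> z0; have r0 := enorm_gt0 z0.
have q0 : 0 < z.1 ^+ 2 + z.2 ^+ 2 by rewrite -sqr_enorm exprn_gt0.
have H := has_gradD (has_gradM (has_grad_fst z) (has_grad_fst z))
   (has_gradM (has_grad_snd z) (has_grad_snd z)).
have q1 : 0 < z.1 * z.1 + z.2 * z.2 by rewrite -!expr2.
have := has_grad_comp1 H (is_derive1_sqrt q1).
have -> : (fun y : R * R => Num.sqrt (y.1 * y.1 + y.2 * y.2)) = @enorm R.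
  by apply/funext => y; rewrite /enorm !expr2.
by move/has_grad_uniq_eq; apply; rewrite -!expr2 -/(enorm z); field; rewrite lt0r_neq0.
Qed.

Lemma continuous_enorm : continuous (@enorm R).
Proof.
move=> z; apply: (continuous_comp (f := fun z : R * R => z.1 ^+ 2 + z.2 ^+ 2)); last exact: sqrt_continuous.
by apply: ctD; apply: ctX => y; [exact: cvg_fst|exact: cvg_snd].
Qed.

End EuclideanNorm.

(** * Bounds shared by a function and its iterated partials *)

Section Towers.
Variable R : realType.
Implicit Types (f g : R * R -> R) (z : R * R) (P Q S : (R * R -> R) -> Prop).

(** The property P holds for g and for its partials of order up to n, with gradients off the origin.
    Bounds on derivatives then follow from closure of P under sums and products, without writing the
    derivatives out. *)
Fixpoint tower P n g : Prop :=
  P g /\ (if n is n.+1 then exists g1 g2, [/\ forall z, z != 0 -> has_grad g z (g1 z) (g2 z),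
     tower P n g1 & tower P n g2] else True).

Lemma tower_le P n g : tower P n.+1 g -> tower P n g.
Proof.
elim: n g => [|n IH] g; first by move=> [Pg _]; split.
by move=> [Pg [g1 [g2 [H H1 H2]]]]; split=> //; exists g1, g2; split => //; exact: IH.
Qed.

Lemma towerP P n g : tower P n g -> P g.
Proof. by case: n => [|n] []. Qed.

Lemma towerD P n f g : (forall f g, P f -> P g -> P (fun z => f z + g z)) ->
  tower P n f -> tower P n g -> tower P n (fun z => f z + g z).
Proof.
move=> PD; elim: n f g => [|n IH] f g; first by move=> [Pf _] [Pg _]; split=> //; exact: PD.
move=> [Pf [f1 [f2 [Hf f1t f2t]]]] [Pg [g1 [g2 [Hg g1t g2t]]]]; split; first exact: PD.
exists (fun z => f1 z + g1 z), (fun z => f2 z + g2 z); split; last 2 first.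
- exact: IH.
- exact: IH.
- by move=> z z0; apply: has_gradD; [exact: Hf|exact: Hg].
Qed.

Lemma towerM P Q n f g : (forall f g, Q f -> Q g -> Q (fun z => f z + g z)) ->
  (forall f g, P f -> Q g -> Q (fun z => f z * g z)) ->
  tower P n f -> tower Q n g -> tower Q n (fun z => f z * g z).
Proof.
move=> QD PQ; elim: n f g => [|n IH] f g; first by move=> [Pf _] [Pg _]; split=> //; exact: PQ.
move=> [Pf [f1 [f2 [Hf f1t f2t]]]] [Pg [g1 [g2 [Hg g1t g2t]]]]; split; first exact: PQ.
have ft : tower P n f by apply: tower_le; split=> //; exists f1, f2.
have gt : tower Q n g by apply: tower_le; split=> //; exists g1, g2.
exists (fun z => f1 z * g z + f z * g1 z), (fun z => f2 z * g z + f z * g2 z); split.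
- by move=> z z0; apply: has_gradM; [exact: Hf|exact: Hg].
- by apply: towerD => //; exact: IH.
- by apply: towerD => //; exact: IH.
Qed.

Lemma tower_cst P n (c : R) : (forall c, P (fun=> c)) -> tower P n (fun=> c).
Proof.
move=> Pc; elim: n c => [|n IH] c; first by split.
split=> //; exists (fun=> 0), (fun=> 0); split => // z _; exact: has_grad_cst.
Qed.

End Towers.

(** * The planar kernel and its partials *)

Section Kernels.
Variables (R : realType) (w : R).
Hypothesis w0 : 0 < w.
Implicit Types (f g : R * R -> R) (z : R * R).

Definition bounded_off0 g := forall d, 0 < d -> exists C, forall z, d <= enorm z -> `|g z| <= C.
Definition decaying g := forall d, 0 < d -> exists C, forall z, d <= enorm z ->
  `|g z| <= C * expR (- w * enorm z).

Lemma bddD f g : bounded_off0 f -> bounded_off0 g -> bounded_off0 (fun z => f z + g z).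
Proof.
move=> bf bg d d0; have [C1 H1] := bf d d0; have [C2 H2] := bg d d0.
by exists (C1 + C2) => z zd; rewrite (le_trans (ler_normD _ _))// lerD ?H1 ?H2.
Qed.

Lemma decD f g : decaying f -> decaying g -> decaying (fun z => f z + g z).
Proof.
move=> bf bg d d0; have [C1 H1] := bf d d0; have [C2 H2] := bg d d0.
by exists (C1 + C2) => z zd; rewrite (le_trans (ler_normD _ _))// mulrDl lerD ?H1 ?H2.
Qed.

Lemma bddM f g : bounded_off0 f -> bounded_off0 g -> bounded_off0 (fun z => f z * g z).
Proof.
move=> bf bg d d0; have [C1 H1] := bf d d0; have [C2 H2] := bg d d0.
by exists (C1 * C2) => z zd; rewrite normrM ler_pM ?H1 ?H2.
Qed.

Lemma bddMdec f g : bounded_off0 f -> decaying g -> decaying (fun z => f z * g z).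
Proof.
move=> bf bg d d0; have [C1 H1] := bf d d0; have [C2 H2] := bg d d0.
by exists (C1 * C2) => z zd; rewrite normrM -mulrA ler_pM ?H1 ?H2.
Qed.

Lemma bdd_cst (c : R) : bounded_off0 (fun=> c).
Proof. by move=> d _; exists `|c|. Qed.

(* At z = 0 the junk value 0^-1 = 0 makes K1 and K2 vanish, and 0 is also the
   derivative there of the even function entering [green]. *)
Definition nx z : R := z.1 / enorm z.
Definition ny z : R := z.2 / enorm z.
Definition ir z : R := (enorm z)^-1.
Definition KA z : R := Kn 0 (w * enorm z).
Definition KB z : R := Kn 1 (w * enorm z).

Lemma has_grad_ir z : z != 0 -> has_grad ir z (- (ir z * ir z * nx z)) (- (ir z * ir z * ny z)).
Proof.
move=> z0; have r0 := enorm_gt0 z0; have rn := lt0r_neq0 r0.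
have H := has_grad_comp1 (has_grad_enorm z0) (@is_deriveV R id _ 1 1 rn (is_derive_id _ _)).
by apply: has_grad_uniq_eq H _ _; rewrite /GRing.scale/= /ir /nx /ny; field.
Qed.

Lemma has_grad_nx z : z != 0 -> has_grad nx z ((1 - nx z * nx z) * ir z) (- (nx z * ny z * ir z)).
Proof.
move=> z0; have r0 := enorm_gt0 z0; have rn := lt0r_neq0 r0.
apply: has_grad_uniq_eq (has_gradM (has_grad_fst z) (has_grad_ir z0)) _ _;
  by rewrite /nx /ny /ir; field.
Qed.

Lemma has_grad_ny z : z != 0 -> has_grad ny z (- (nx z * ny z * ir z)) ((1 - ny z * ny z) * ir z).
Proof.
move=> z0; have r0 := enorm_gt0 z0; have rn := lt0r_neq0 r0.
apply: has_grad_uniq_eq (has_gradM (has_grad_snd z) (has_grad_ir z0)) _ _;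
  by rewrite /nx /ny /ir; field.
Qed.

Lemma has_grad_wr n z : z != 0 -> has_grad (fun z => Kn n (w * enorm z)) z
  (- (w * Kn n.+1 (w * enorm z) * nx z)) (- (w * Kn n.+1 (w * enorm z) * ny z)).
Proof.
move=> z0; have r0 := enorm_gt0 z0; have wr0 : 0 < w * enorm z by rewrite mulr_gt0.
have H := has_grad_comp1 (has_grad_enorm z0) (dComp (is_derive_Kn n wr0) (dScale w (dId (enorm z)))).
by apply: has_grad_uniq_eq H _ _; rewrite /nx /ny; ring.
Qed.

Definition K1 z : R := - w * (KB z * nx z).
Definition K2 z : R := - w * (KB z * ny z).
(** Bessel's equation in the form K_1' = - K_0 - K_1 / z eliminates [Kn 2], so the second partials
    are again sums of products of [nx], [ny], [ir], [KA] and [KB]. *)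
Definition K11 z : R := w ^+ 2 * (nx z * nx z * KA z) + w * ((2 * (nx z * nx z) + -1) * ir z * KB z).
Definition K12 z : R := w ^+ 2 * (nx z * ny z * KA z) + w * (2 * (nx z * ny z) * ir z * KB z).
Definition K22 z : R := w ^+ 2 * (ny z * ny z * KA z) + w * ((2 * (ny z * ny z) + -1) * ir z * KB z).

Lemma nxy1 z : z != 0 -> nx z * nx z + ny z * ny z = 1.
Proof.
move=> z0; have r0 := enorm_gt0 z0; have rn := lt0r_neq0 r0.
rewrite /nx /ny -!expr2 !expr_div_n -mulrDl -sqr_enorm divff// expf_neq0//.
Qed.

Lemma laplace_K z : z != 0 -> K11 z + K22 z = w ^+ 2 * KA z.
Proof.
move=> z0; rewrite /K11 /K22.
have -> : w ^+ 2 * (nx z * nx z * KA z) + w * ((2 * (nx z * nx z) + -1) * ir z * KB z) +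
  (w ^+ 2 * (ny z * ny z * KA z) + w * ((2 * (ny z * ny z) + -1) * ir z * KB z)) =
  w ^+ 2 * KA z * (nx z * nx z + ny z * ny z) +
  2 * w * ir z * KB z * (nx z * nx z + ny z * ny z - 1) by ring.
by rewrite nxy1// subrr mulr0 addr0 mulr1.
Qed.

Lemma has_grad_KA z : z != 0 -> has_grad KA z (K1 z) (K2 z).
Proof.
by move=> z0; apply: has_grad_uniq_eq (has_grad_wr 0 z0) _ _; rewrite /K1 /K2 /KB; ring.
Qed.

Lemma has_grad_KB z : z != 0 -> has_grad KB z (- w * (KA z * nx z) + -1 * (KB z * ir z * nx z))
   (- w * (KA z * ny z) + -1 * (KB z * ir z * ny z)).
Proof.
move=> z0; have r0 := enorm_gt0 z0; have wr0 : 0 < w * enorm z by rewrite mulr_gt0.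
have H := has_grad_wr 1 z0; rewrite Kn_ode// in H.
have rn := lt0r_neq0 r0; have wn := lt0r_neq0 w0.
by apply: has_grad_uniq_eq H _ _; rewrite /KA /KB /ir; field; rewrite rn wn.
Qed.

Lemma has_grad_K1 z : z != 0 -> has_grad K1 z (K11 z) (K12 z).
Proof.
move=> z0; have H := has_gradM (has_grad_cst (- w) z) (has_gradM (has_grad_KB z0) (has_grad_nx z0)).
apply: has_grad_uniq_eq H _ _; rewrite /K11 /K12; ring.
Qed.

Lemma has_grad_K2 z : z != 0 -> has_grad K2 z (K12 z) (K22 z).
Proof.
move=> z0; have H := has_gradM (has_grad_cst (- w) z) (has_gradM (has_grad_KB z0) (has_grad_ny z0)).
apply: has_grad_uniq_eq H _ _; rewrite /K22 /K12; ring.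
Qed.

Lemma bdd_nx : bounded_off0 nx.
Proof.
move=> d d0; exists 1 => z zd; rewrite normrM normrV ?unitfE; last by rewrite gt_eqF// (lt_le_trans d0).
rewrite ler_pdivrMr ?normr_gt0 ?gt_eqF ?(lt_le_trans d0)//.
by rewrite mul1r (ger0_norm (enorm_ge0 _)) enorm_fst.
Qed.

Lemma bdd_ny : bounded_off0 ny.
Proof.
move=> d d0; exists 1 => z zd; rewrite normrM normrV ?unitfE; last by rewrite gt_eqF// (lt_le_trans d0).
rewrite ler_pdivrMr ?normr_gt0 ?gt_eqF ?(lt_le_trans d0)//.
by rewrite mul1r (ger0_norm (enorm_ge0 _)) enorm_snd.
Qed.

Lemma bdd_ir : bounded_off0 ir.
Proof.
move=> d d0; exists d^-1 => z zd; have r0 := lt_le_trans d0 zd.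
by rewrite ger0_norm ?invr_ge0 ?enorm_ge0// lef_pV2.
Qed.

Lemma dec_KB : decaying KB.
Proof.
move=> d d0; exists ((w * d)^-1 + 1) => z zd; have r0 := lt_le_trans d0 zd.
have wr0 : 0 < w * enorm z by rewrite mulr_gt0.
have [/andP[k0 k1] _] := Kn1_bound wr0.
rewrite pmulr_rge0// in k0.
rewrite /KB ger0_norm// -(ler_pM2l wr0) (le_trans k1)// mulNr mulrA ler_wpM2r ?expR_ge0//.
rewrite mulrDr mulr1 lerD2r -ler_pdivrMl// mulr1.
by rewrite lef_pV2 ?posrE ?mulr_gt0// ler_pM2l.
Qed.

Lemma dec_KA : decaying KA.
Proof.
move=> d d0; have [C H] := dec_KB d0; exists C => z zd; have r0 := lt_le_trans d0 zd.
have wr0 : 0 < w * enorm z by rewrite mulr_gt0.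
apply: le_trans (H z zd); rewrite /KA /KB !ger0_norm ?Kn0_ge0 ?Kn0_le1//.
exact: le_trans (Kn0_ge0 _) (Kn0_le1 wr0).
Qed.

(** Induction works because the partials of [nx], [ny], [ir] are polynomials in these same three
    functions. *)
Lemma bdd_tower n : [/\ tower bounded_off0 n nx, tower bounded_off0 n ny & tower bounded_off0 n ir].
Proof.
elim: n => [|n [IHx IHy IHr]].
  by split; split=> //; [exact: bdd_nx|exact: bdd_ny|exact: bdd_ir].
have M f g : tower bounded_off0 n f -> tower bounded_off0 n g -> tower bounded_off0 n (fun z => f z * g z).
  by apply: towerM; [exact: bddD|exact: bddM].
have A f g : tower bounded_off0 n f -> tower bounded_off0 n g -> tower bounded_off0 n (fun z => f z + g z).
  by apply: towerD; exact: bddD.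
have C c : tower bounded_off0 n (fun=> c) by apply: tower_cst; exact: bdd_cst.
have N f : tower bounded_off0 n f -> tower bounded_off0 n (fun z => - f z).
  move=> H; have -> : (fun z => - f z) = (fun z => -1 * f z) by apply/funext => z; rewrite mulN1r.
  exact: M.
have D f : tower bounded_off0 n f -> tower bounded_off0 n (fun z => 1 - f z).
  by move=> H; apply: A => //; exact: N.
split.
- split; first exact: bdd_nx.
  exists (fun z => (1 - nx z * nx z) * ir z), (fun z => - (nx z * ny z * ir z)); split.
  + exact: has_grad_nx.
  + by apply: (M) => //; apply: (D); exact: M.
  + by apply: (N); apply: (M) => //; exact: M.
- split; first exact: bdd_ny.
  exists (fun z => - (nx z * ny z * ir z)), (fun z => (1 - ny z * ny z) * ir z); split.
  + exact: has_grad_ny.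
  + by apply: (N); apply: (M) => //; exact: M.
  + by apply: (M) => //; apply: (D); exact: M.
- split; first exact: bdd_ir.
  exists (fun z => - (ir z * ir z * nx z)), (fun z => - (ir z * ir z * ny z)); split.
  + exact: has_grad_ir.
  + by apply: (N); apply: (M) => //; exact: M.
  + by apply: (N); apply: (M) => //; exact: M.
Qed.

Lemma towerMd n f g : tower bounded_off0 n f -> tower decaying n g -> tower decaying n (fun z => f z * g z).
Proof. by apply: towerM; [exact: decD|exact: bddMdec]. Qed.

Lemma towerMb n f g : tower bounded_off0 n f -> tower bounded_off0 n g -> tower bounded_off0 n (fun z => f z * g z).
Proof. by apply: towerM; [exact: bddD|exact: bddM]. Qed.

Lemma towerDd n f g : tower decaying n f -> tower decaying n g -> tower decaying n (fun z => f z + g z).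
Proof. by apply: towerD; exact: decD. Qed.

Lemma towerZd n (c : R) g : tower decaying n g -> tower decaying n (fun z => c * g z).
Proof. by apply: towerMd; apply: tower_cst; exact: bdd_cst. Qed.

Lemma towerMdr n f g : tower decaying n f -> tower bounded_off0 n g -> tower decaying n (fun z => f z * g z).
Proof.
move=> tf tg; have -> : (fun z => f z * g z) = (fun z => g z * f z) by apply/funext => z; rewrite mulrC.
exact: towerMd.
Qed.

(** The partials of [KA] and [KB] are combinations of [KA] and [KB] with coefficients built from
    [nx], [ny], [ir], so exponential decay off the origin passes to every order. *)
Lemma dec_tower n : tower decaying n KA /\ tower decaying n KB.
Proof.
elim: n => [|n [IHA IHB]]; first by split; split=> //; [exact: dec_KA|exact: dec_KB].
have [tx ty tr] := bdd_tower n.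
split.
  split; first exact: dec_KA.
  exists K1, K2; split; first exact: has_grad_KA.
  - by apply: towerZd; exact: towerMdr.
  - by apply: towerZd; exact: towerMdr.
split; first exact: dec_KB.
exists (fun z => - w * (KA z * nx z) + -1 * (KB z * ir z * nx z)),
   (fun z => - w * (KA z * ny z) + -1 * (KB z * ir z * ny z)); split.
- exact: has_grad_KB.
- by apply: towerDd; apply: towerZd; do !apply: towerMdr.
- by apply: towerDd; apply: towerZd; do !apply: towerMdr.
Qed.

(** Exactly what [dker_taylor] consumes: decay of the second partials. It is met by K and by both
    its first partials, so one lemma on layers serves three kernels. *)
Definition decaying_kernel g g1 g2 := [/\ forall z, z != 0 -> has_grad g z (g1 z) (g2 z),
  decaying g, tower decaying 1 g1 & tower decaying 1 g2].

Lemma tower_K1 n : tower decaying n K1.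
Proof.
have [tA tB] := dec_tower n; have [tx ty tr] := bdd_tower n.
by apply: towerZd; exact: towerMdr.
Qed.

Lemma tower_K2 n : tower decaying n K2.
Proof.
have [tA tB] := dec_tower n; have [tx ty tr] := bdd_tower n.
by apply: towerZd; exact: towerMdr.
Qed.

Lemma tower_K3 n : [/\ tower decaying n K11, tower decaying n K12 & tower decaying n K22].
Proof.
have [tA tB] := dec_tower n; have [tx ty tr] := bdd_tower n.
have C c : tower bounded_off0 n (fun _ : R * R => c) by apply: tower_cst; exact: bdd_cst.
have A f g : tower bounded_off0 n f -> tower bounded_off0 n g -> tower bounded_off0 n (fun z => f z + g z).
  by apply: towerD; exact: bddD.
by split; apply: towerDd; apply: towerZd; apply: towerMd => //; do ?apply: A => //;
  do !apply: towerMb => //; apply: A => //; do !apply: towerMb => //.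
Qed.

Lemma dker_KA : decaying_kernel KA K1 K2.
Proof. by split; [exact: has_grad_KA|exact: dec_KA|exact: tower_K1|exact: tower_K2]. Qed.

Lemma dker_K1 : decaying_kernel K1 K11 K12.
Proof.
have [t1 t2 t3] := tower_K3 1.
by split; [exact: has_grad_K1|exact: towerP (tower_K1 0)| |].
Qed.

Lemma dker_K2 : decaying_kernel K2 K12 K22.
Proof.
have [t1 t2 t3] := tower_K3 1.
by split; [exact: has_grad_K2|exact: towerP (tower_K2 0)| |].
Qed.

Lemma KA_sing : exists C, forall z, z != 0 -> `|KA z| <= C / Num.sqrt (enorm z).
Proof.
exists (Kconst R / Num.sqrt w) => z z0; have r0 := enorm_gt0 z0.
have wr0 : 0 < w * enorm z by rewrite mulr_gt0.
rewrite /KA ger0_norm ?Kn0_ge0// (le_trans (Kn0_sing wr0))//.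
by rewrite sqrtrM ?(ltW w0)// invfM mulrA.
Qed.

(** The difference is (w r K_1(w r) - 1) times a quantity of size at most 1 / r, and the first
    factor is at most w r by [Kn1_bound]. *)
Lemma K1_sing z : z != 0 -> `|K1 z + z.1 / (z.1 ^+ 2 + z.2 ^+ 2)| <= w.
Proof.
move=> z0; have r0 := enorm_gt0 z0; have rn := lt0r_neq0 r0.
have wr0 : 0 < w * enorm z by rewrite mulr_gt0.
have [_ H] := Kn1_bound wr0; rewrite -sqr_enorm.
have -> : K1 z + z.1 / enorm z ^+ 2 = - ((w * enorm z * KB z - 1) * (z.1 / enorm z ^+ 2)).
  by rewrite /K1 /nx; field.
rewrite normrN normrM.
apply: (@le_trans _ _ (w * enorm z * (enorm z)^-1)); last by rewrite mulfK.
apply: ler_pM => //.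
rewrite normrM normrV ?unitfE ?expf_neq0// (ger0_norm (sqr_ge0 (enorm z))).
by rewrite ler_pdivrMr ?exprn_gt0// expr2 mulKf// ?enorm_fst.
Qed.

Lemma K2_sing z : z != 0 -> `|K2 z + z.2 / (z.1 ^+ 2 + z.2 ^+ 2)| <= w.
Proof.
move=> z0; have r0 := enorm_gt0 z0; have rn := lt0r_neq0 r0.
have wr0 : 0 < w * enorm z by rewrite mulr_gt0.
have [_ H] := Kn1_bound wr0; rewrite -sqr_enorm.
have -> : K2 z + z.2 / enorm z ^+ 2 = - ((w * enorm z * KB z - 1) * (z.2 / enorm z ^+ 2)).
  by rewrite /K2 /ny; field.
rewrite normrN normrM.
apply: (@le_trans _ _ (w * enorm z * (enorm z)^-1)); last by rewrite mulfK.
apply: ler_pM => //.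
rewrite normrM normrV ?unitfE ?expf_neq0// (ger0_norm (sqr_ge0 (enorm z))).
by rewrite ler_pdivrMr ?exprn_gt0// expr2 mulKf// ?enorm_snd.
Qed.

(** A sup-norm ball of radius d / 4 lies in a Euclidean ball of radius d / 2, so it stays at
    distance d / 2 from the origin, and moving within it changes the exponential by a factor at most
    e^(w d). *)
Lemma dker_taylor g g1 g2 : decaying_kernel g g1 g2 -> forall d, 0 < d -> exists C, forall z, d <= enorm z ->
  forall h, `|h| <= d / 4 ->
  `|g (z + h) - g z - (g1 z * h.1 + g2 z * h.2)| <= C * expR (- w * enorm z) * `|h| ^+ 2.
Proof.
move=> [Hg _ [_ [g11 [g12 [H1 [d11 _] [d12 _]]]]] [_ [g21 [g22 [H2 _ [d22 _]]]]]] d d0.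
have d20 : 0 < d / 2 by rewrite divr_gt0.
have [C1 b1] := d11 _ d20; have [C2 b2] := d12 _ d20; have [C3 b3] := d22 _ d20.
exists (3 * (`|C1| + `|C2| + `|C3|) * expR (w * d)) => z zd h hd.
have near y : `|y - z| <= d / 4 -> d / 2 <= enorm y /\ expR (- w * enorm y) <= expR (w * d) * expR (- w * enorm z).
  move=> yz; have e1 := enorm_le_supnorm (y - z).
  have e2 := enorm_sub z y; rewrite enormB in e2.
  split; first by lra.
  rewrite -expRD ler_expR !mulNr -mulrBr -mulrN ler_wpM2l ?(ltW w0)//; lra.
have nz y : `|y - z| <= d / 4 -> y != 0.
  by move=> /near[y2 _]; apply: enorm_pos_neq0; apply: lt_le_trans y2.
have -> : 3 * (`|C1| + `|C2| + `|C3|) * expR (w * d) * expR (- w * enorm z) =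
  3 * ((`|C1| + `|C2| + `|C3|) * (expR (w * d) * expR (- w * enorm z))) by ring.
apply: (@taylor2 _ g g1 g2 g11 g12 g22 z (d / 4)) => // y yz.
  have y0 := nz _ yz; split.
  - exact: has_grad_pd1 (Hg _ y0).
  - exact: has_grad_pd2 (Hg _ y0).
  - exact: has_grad_pd1 (H1 _ y0).
  - exact: has_grad_pd2 (H1 _ y0).
  - exact: has_grad_pd2 (H2 _ y0).
have [y2 ye] := near _ yz.
have K (C : R) (gg : R * R -> R) : `|gg y| <= C * expR (- w * enorm y) -> C <= `|C1| + `|C2| + `|C3| ->
    `|gg y| <= (`|C1| + `|C2| + `|C3|) * (expR (w * d) * expR (- w * enorm z)).
  move=> H CC; apply: le_trans H _; apply: (@le_trans _ _ ((`|C1| + `|C2| + `|C3|) * expR (- w * enorm y))).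
    by rewrite ler_wpM2r ?expR_ge0.
  by rewrite ler_wpM2l ?addr_ge0.
have [n1 n2 n3] := And3 (ler_norm C1) (ler_norm C2) (ler_norm C3).
have [m1 m2 m3] := And3 (normr_ge0 C1) (normr_ge0 C2) (normr_ge0 C3).
by split; [apply: (K C1)|apply: (K C2)|apply: (K C3)]; [exact: b1|lra|exact: b2|lra|exact: b3|lra].
Qed.

End Kernels.

(** * Curves *)

Section PlaneCurveDerivatives.
Variable R : realType.

Lemma is_derive_pair (g : R -> R * R) (t : R) : derivable g t 1 ->
  is_derive t (1 : R) (fun s => (g s).1) (derive1 g t).1 /\
  is_derive t (1 : R) (fun s => (g s).2) (derive1 g t).2.
Proof.
move=> /derivable1_diffP dg; have Dg := differentiableP dg.
have c1 : continuous (fst : R * R -> R) by move=> y; exact: cvg_fst.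
have c2 : continuous (snd : R * R -> R) by move=> y; exact: cvg_snd.
have d1 : is_diff (g t) (fst : R * R -> R) (fst : R * R -> R).
  by constructor; [exact: linear_differentiable | exact: diff_lin].
have d2 : is_diff (g t) (snd : R * R -> R) (snd : R * R -> R).
  by constructor; [exact: linear_differentiable | exact: diff_lin].
have [D1 E1] := is_diff_comp Dg d1; have [D2 E2] := is_diff_comp Dg d2.
rewrite derive1E deriveE//; split; constructor.
- exact/derivable1_diffP.
- by rewrite deriveE// (_ : (fun s => (g s).1) = fst \o g)// E1.
- exact/derivable1_diffP.
- by rewrite deriveE// (_ : (fun s => (g s).2) = snd \o g)// E2.
Qed.

(** Let e be the tail integral (C / eta) e^(- eta t) of the bound. Then h - e increases, h + e
    decreases, and every value of the former is below every value of the latter; v is the supremum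
    of the former. *)
Lemma exp_bound_limit (h k : R -> R) (C eta : R) : 0 < eta ->
  (forall t, is_derive (t : R) (1 : R) h (k t)) ->
  (forall t, `|k t| <= C * expR (- eta * t)) ->
  exists v : R, forall t, `|h t - v| <= C / eta * expR (- eta * t).
Proof.
move=> eta0 dh kC; have etan := lt0r_neq0 eta0.
pose e t := C / eta * expR (- eta * t).
have de t : is_derive (t : R) (1 : R) e (- (C * expR (- eta * t))).
  have := dScale (C / eta) (dExp (dScale (- eta) (dId t))).
  by move/is_derive_eq; apply; field.
have up a b : a <= b -> h a - e a <= h b - e b.
  move=> ab; have [c _] := @mean_value R (fun t => h t - e t) _ a b (fun x _ => dSub (dh x) (de x)).
  move=> E; rewrite -subr_ge0 E mulr_ge0 ?subr_ge0//.
  by have := kC c; rewrite ler_norml => /andP[? _]; lra.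
have dn a b : a <= b -> h b + e b <= h a + e a.
  move=> ab; have [c _] := @mean_value R (fun t => h t + e t) _ a b (fun x _ => dAdd (dh x) (de x)).
  move=> E; rewrite -subr_ge0 -opprB E -mulNr mulr_ge0 ?subr_ge0//.
  by have := kC c; rewrite ler_norml => /andP[_ ?]; lra.
have e0 t : 0 <= e t.
  have C0 : 0 <= C by have := le_trans (normr_ge0 _) (kC 0); rewrite mulr0 expR0 mulr1.
  by rewrite mulr_ge0 ?expR_ge0// divr_ge0// ltW.
have le a b : h a - e a <= h b + e b.
  have [ab|/ltW ab] := leP a b.
    by apply: le_trans (up _ _ ab) _; have := e0 b; lra.
  by apply: le_trans (dn _ _ ab); have := e0 a; lra.
pose v := sup [set h t - e t | t in [set: R]].
have H1 t : h t - e t <= v.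
  apply: ub_le_sup; last by exists t.
  by exists (h 0 + e 0) => _ [s _ <-]; exact: le.
have H2 t : v <= h t + e t.
  apply: ge_sup; first by exists (h 0 - e 0), 0.
  by move=> _ [s _ <-]; exact: le.
exists v => t; rewrite -/(e t) ler_norml; have := H1 t; have := H2 t; lra.
Qed.

Lemma expRN_small (A eta x : R) : 0 <= A -> 0 < eta -> 0 < x ->
  exists2 t : R, 0 <= t & A * expR (- eta * t) <= x.
Proof.
move=> A0 eta0 x0; exists (A / x / eta); first by rewrite !divr_ge0// ltW.
have -> : - eta * (A / x / eta) = - (A / x) by field; rewrite !lt0r_neq0.
rewrite expRN ler_pdivrMr ?expR_gt0//.
apply: le_trans (ler_wpM2l (ltW x0) (expR_ge1Dx _)).
by rewrite mulrDr mulr1 mulrC divfK ?lt0r_neq0// lerDr ltW.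
Qed.

(** The half-line may be taken from the origin because its offset is absorbed by C. *)
Definition ray (g : R -> R * R) (u : R * R) :=
  enorm u = 1 /\ exists C : R, forall t, 0 <= t -> enorm (g t - t *: u) <= C.

(** [exp_bound_limit] is used twice: the decay of e gives the limit direction u with an exponential
    rate, and that rate makes g t - t u converge in turn. As the speed is 1, so is the norm of u. *)
Lemma asymptotic_ray (g d e : R -> R * R) (C eta : R) : 0 < eta ->
  (forall t, is_derive (t : R) (1 : R) (fun s => (g s).1) (d t).1) ->
  (forall t, is_derive (t : R) (1 : R) (fun s => (g s).2) (d t).2) ->
  (forall t, is_derive (t : R) (1 : R) (fun s => (d s).1) (e t).1) ->
  (forall t, is_derive (t : R) (1 : R) (fun s => (d s).2) (e t).2) ->
  (forall t, enorm (d t) = 1) ->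
  (forall t, enorm (e t) <= C * expR (- eta * `|t|)) ->
  exists u, ray g u /\ forall t, enorm (d t - u) <= 2 * (C / eta) * expR (- eta * t).
Proof.
move=> eta0 dg1 dg2 dd1 dd2 ud eC.
have C0 : 0 <= C by have := le_trans (enorm_ge0 _) (eC 0); rewrite normr0 mulr0 expR0 mulr1.
have weak t : enorm (e t) <= C * expR (- eta * t).
  rewrite (le_trans (eC t))// ler_wpM2l// ler_expR !mulNr lerN2 ler_wpM2l ?(ltW eta0)// ler_norm//.
have [u1 H1] := exp_bound_limit eta0 dd1 (fun t => le_trans (enorm_fst _) (weak t)).
have [u2 H2] := exp_bound_limit eta0 dd2 (fun t => le_trans (enorm_snd _) (weak t)).
have dsub1 t : is_derive (t : R) (1 : R) (fun s => (g s).1 - u1 * s) ((d t).1 - u1).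
  by have := dSub (dg1 t) (dScale u1 (dId t)); rewrite mulr1.
have dsub2 t : is_derive (t : R) (1 : R) (fun s => (g s).2 - u2 * s) ((d t).2 - u2).
  by have := dSub (dg2 t) (dScale u2 (dId t)); rewrite mulr1.
have [c1 G1] := exp_bound_limit eta0 dsub1 H1.
have [c2 G2] := exp_bound_limit eta0 dsub2 H2.
have du t : enorm (d t - (u1, u2)) <= 2 * (C / eta) * expR (- eta * t).
  by apply: le_trans (enorm_le_sum _) _ => /=; have := H1 t; have := H2 t; lra.
have Ce2 : 0 <= 2 * (C / eta) by rewrite mulr_ge0// divr_ge0// ltW.
exists (u1, u2); split=> //; split.
  apply/eqP; rewrite eq_le; apply/andP; split.
  - apply/ler_addgt0Pr => x x0; have [t _ tx] := expRN_small Ce2 eta0 x0.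
    have := enorm_tri ((u1, u2) : R * R) (d t) 0; rewrite !subr0 ud enormB.
    by have := du t; lra.
  - apply/ler_addgt0Pr => x x0; have [t _ tx] := expRN_small Ce2 eta0 x0.
    have := enorm_tri (d t) (u1, u2) 0; rewrite !subr0 ud.
    by have := du t; lra.
exists (`|c1| + `|c2| + 2 * (C / eta / eta)) => t t0.
apply: le_trans (enorm_le_sum _) _ => /=.
have et : expR (- eta * t) <= 1.
  by rewrite -expR0 ler_expR mulNr oppr_le0 mulr_ge0// ltW.
have Ce : 0 <= C / eta / eta by rewrite !divr_ge0// ltW.
have X : C / eta / eta * expR (- eta * t) <= C / eta / eta by rewrite ler_piMr.
have -> : (g t).1 - t * u1 = ((g t).1 - u1 * t - c1) + c1 by ring.
have -> : (g t).2 - t * u2 = ((g t).2 - u2 * t - c2) + c2 by ring.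
have := ler_normD ((g t).1 - u1 * t - c1) c1; have := ler_normD ((g t).2 - u2 * t - c2) c2.
have := G1 t; have := G2 t; rewrite /GRing.scale/=; lra.
Qed.

(** For unit vectors with scalar product p >= -1, the identity |s u - t u'|^2 - (|u - u'| / 2)^2 (s
    + t)^2 = (1 + p) / 2 (s - t)^2 bounds the model distance below; the curves differ from the
    half-lines by constants. *)
Lemma rays_apart (a b : R -> R * R) (u u' : R * R) : ray a u -> ray b u' -> u <> u' ->
  exists c C : R, 0 < c /\ forall s t, 0 <= s -> 0 <= t -> c * (s + t) - C <= enorm (a s - b t).
Proof.
move=> [u1 [C1 H1]] [u2 [C2 H2]] uu.
have k0 : 0 < enorm (u - u').
  by apply: enorm_gt0; apply/eqP => /subr0_eq.
exists (enorm (u - u') / 2), (C1 + C2); split; first by rewrite divr_gt0.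
move=> s t s0 t0.
suff H : enorm (u - u') / 2 * (s + t) <= enorm (s *: u - t *: u').
  have := enorm_tri (s *: u) (a s) (t *: u'); rewrite (enormB _ (a s)).
  have := enorm_tri (a s) (b t) (t *: u').
  by have := H1 s s0; have := H2 t t0; lra.
rewrite -(@ler_pXn2r _ 2) ?nnegrE ?mulr_ge0 ?addr_ge0 ?enorm_ge0 ?invr_ge0//.
rewrite !exprMn !sqr_enorm /=.
have e1 := sqr_enorm u; have e2 := sqr_enorm u'; rewrite u1 u2 expr1n in e1 e2.
case: u u' e1 e2 {u1 u2 H1 H2 uu k0} => x y [x' y'] /= e1 e2; rewrite /GRing.scale/=.
have -> : ((x - x') ^+ 2 + (y - y') ^+ 2) = 2 - 2 * (x * x' + y * y').
  have -> : (x - x') ^+ 2 + (y - y') ^+ 2 = (x ^+ 2 + y ^+ 2) + (x' ^+ 2 + y' ^+ 2) - 2 * (x * x' + y * y').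
    by ring.
  by rewrite -e1 -e2; ring.
have -> : (s * x - t * x') ^+ 2 + (s * y - t * y') ^+ 2 = s ^+ 2 + t ^+ 2 - 2 * s * t * (x * x' + y * y').
  have -> : (s * x - t * x') ^+ 2 + (s * y - t * y') ^+ 2 =
    s ^+ 2 * (x ^+ 2 + y ^+ 2) + t ^+ 2 * (x' ^+ 2 + y' ^+ 2) - 2 * s * t * (x * x' + y * y') by ring.
  by rewrite -e1 -e2; ring.
have dl : - 1 <= x * x' + y * y'.
  have : 0 <= (x + x') ^+ 2 + (y + y') ^+ 2 by rewrite addr_ge0 ?sqr_ge0.
  have -> : (x + x') ^+ 2 + (y + y') ^+ 2 =
    (x ^+ 2 + y ^+ 2) + (x' ^+ 2 + y' ^+ 2) + 2 * (x * x' + y * y') by ring.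
  by rewrite -e1 -e2; lra.
rewrite -subr_ge0; set p := x * x' + y * y' in dl *.
have -> : s ^+ 2 + t ^+ 2 - 2 * s * t * p - (2 - 2 * p) * 2^-1 ^+ 2 * (s + t) ^+ 2 =
  (1 + p) / 2 * (s - t) ^+ 2 by field.
by rewrite mulr_ge0 ?sqr_ge0// divr_ge0//; lra.
Qed.

Lemma ray_same (a : R -> R * R) (u : R * R) : ray a u ->
  exists C : R, forall s t, 0 <= s -> 0 <= t -> `|s - t| - C <= enorm (a s - a t).
Proof.
move=> [u1 [C H]]; exists (C + C) => s t s0 t0.
have := enorm_tri (s *: u) (a s) (t *: u); rewrite (enormB _ (a s)).
have := enorm_tri (a s) (a t) (t *: u).
have -> : enorm (s *: u - t *: u) = `|s - t| by rewrite -scalerBl enormZ u1 mulr1.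
by have := H s s0; have := H t t0; lra.
Qed.

(** Equal directions would keep the two curves within C1 + C2 of each other at equal parameters. *)
Lemma rays_neq (a b : R -> R * R) (u u' : R * R) : ray a u -> ray b u' ->
  enorm (a t - b t) @[t --> +oo] --> +oo -> u <> u'.
Proof.
move=> [u1 [C1 H1]] [u2 [C2 H2]] /cvgryPgt lim uu.
have /near_pinfty_div2 := lim (C1 + C2).
have : \forall t \near +oo, (C1 + C2 < enorm (a t - b t)) /\ 0 <= t.
  near=> t; split; last by near: t; exact/nbhs_pinfty_ge/num_real.
  by near: t; exact: lim.
case=> M [_ /(_ (M + 1))[]]; first by rewrite ltrDl.
move=> H t0 _; have := enorm_tri (a (M + 1)) ((M + 1) *: u) (b (M + 1)).
have := H1 _ t0; have := H2 _ t0; rewrite -uu (enormB (b _)); lra.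
Unshelve. all: by end_near. Qed.

End PlaneCurveDerivatives.

(** * Unit-speed curves of linear growth *)

Section GoodCurves.
Variable R : realType.
Implicit Types g d e : R -> R * R.

(* d and e are the first two derivatives of g. *)
Record good_curve g d e : Prop := GoodCurve {
  gc_d1 : forall t, is_derive (t : R) (1 : R) (fun s => (g s).1) (d t).1;
  gc_d2 : forall t, is_derive (t : R) (1 : R) (fun s => (g s).2) (d t).2;
  gc_e1 : forall t, is_derive (t : R) (1 : R) (fun s => (d s).1) (e t).1;
  gc_e2 : forall t, is_derive (t : R) (1 : R) (fun s => (d s).2) (e t).2;
  gc_unit : forall t, enorm (d t) = 1;
  gc_decay : exists C eta : R, 0 < eta /\ forall t, enorm (e t) <= C * expR (- eta * `|t|);
  gc_growth : exists c C : R, 0 < c /\ forall s t, c * `|s - t| - C <= enorm (g s - g t);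
  gc_inj : injective g }.

(** Parameters of equal sign lie on one end, which follows a unit-speed half-line; parameters of
    opposite signs lie on ends with different directions. *)
Lemma growth_of_rays g u u' : ray g u -> ray (fun t => g (- t)) u' -> u <> u' ->
  exists c C : R, 0 < c /\ forall s t, c * `|s - t| - C <= enorm (g s - g t).
Proof.
move=> r1 r2 uu; have [c [C [c0 H]]] := rays_apart r1 r2 uu.
have [C1 H1] := ray_same r1; have [C2 H2] := ray_same r2.
exists (Num.min 1 c), (`|C| + `|C1| + `|C2|); split; first by rewrite lt_min ltr01.
have m1 : Num.min 1 c <= 1 by rewrite ge_min lexx.
have mc : Num.min 1 c <= c by rewrite ge_min lexx orbT.
have m0 : 0 <= Num.min 1 c by rewrite le_min ler01 ltW.
have [n0 n1 n2] := And3 (normr_ge0 C) (normr_ge0 C1) (normr_ge0 C2).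
have [k0 k1 k2] := And3 (ler_norm C) (ler_norm C1) (ler_norm C2).
move=> s t; have b1 : Num.min 1 c * `|s - t| <= `|s - t| by rewrite ler_piMl.
have b2 : Num.min 1 c * `|s - t| <= c * `|s - t| by rewrite ler_wpM2r.
have [s0|s0] := leP 0 s; have [t0|t0] := leP 0 t.
- by have := H1 s t s0 t0; lra.
- have := H s (- t) s0; rewrite oppr_ge0 opprK => /(_ (ltW t0)).
  have E : `|s - t| = s - t by rewrite ger0_norm//; lra.
  by move: b2; rewrite E; lra.
- have := H t (- s) t0; rewrite oppr_ge0 opprK => /(_ (ltW s0)); rewrite enormB.
  have E : `|s - t| = t - s by rewrite ler0_norm ?opprB//; lra.
  by move: b2; rewrite E; lra.
- have := H2 (- s) (- t); rewrite !oppr_ge0 !opprK => /(_ (ltW s0) (ltW t0)).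
  have -> : `|- s + t| = `|s - t| by rewrite -normrN opprD opprK.
  by lra.
Qed.

(** Reversal exchanges the two ends, so that only t -> +oo has to be analysed. *)
Lemma good_curve_flip g d e : good_curve g d e ->
  good_curve (fun t => g (- t)) (fun t => - d (- t)) (fun t => e (- t)).
Proof.
have dN (t : R) : is_derive t (1 : R) (fun s : R => - s) (- 1) by exact: dNeg (dId t).
case=> d1 d2 e1 e2 un [C [eta [eta0 eC]]] [c [C' [c0 gr]]] inj; split.
- by move=> t; have := dComp (d1 (- t)) (dN t); rewrite mulrN1.
- by move=> t; have := dComp (d2 (- t)) (dN t); rewrite mulrN1.
- by move=> t; have := dNeg (dComp (e1 (- t)) (dN t)); rewrite mulrN1 opprK.
- by move=> t; have := dNeg (dComp (e2 (- t)) (dN t)); rewrite mulrN1 opprK.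
- by move=> t; rewrite enormN.
- by exists C, eta; split=> // t; rewrite -(normrN t).
- exists c, C'; split=> // s t; have := gr (- s) (- t).
  by rewrite (_ : `|- s - - t| = `|s - t|)// -normrN; congr (`|_|); ring.
- by move=> s t /inj/oppr_inj.
Qed.

Variables g d e : R -> R * R.
Hypothesis gc : good_curve g d e.

Lemma gc_bound2 : exists M : R, 0 < M /\ forall t, `|(e t).1| <= M /\ `|(e t).2| <= M.
Proof.
have [C [eta [eta0 eC]]] := gc_decay gc; exists (`|C| + 1); split; first by rewrite ltr_wpDl.
have H t : enorm (e t) <= `|C| + 1.
  apply: le_trans (eC t) _; apply: (@le_trans _ _ (`|C| * 1)); last by rewrite mulr1 lerDl.
  apply: (@le_trans _ _ (`|C| * expR (- eta * `|t|))); first by rewrite ler_wpM2r ?expR_ge0// ler_norm.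
  by rewrite ler_wpM2l// -expR0 ler_expR mulNr oppr_le0 mulr_ge0// ltW.
by move=> t; split; apply: le_trans (H t); [exact: enorm_fst|exact: enorm_snd].
Qed.

Lemma gc_cd1 : continuous (fun t => (d t).1).
Proof. by move=> t; exact: is_derive_continuous (gc_e1 gc t). Qed.
Lemma gc_cd2 : continuous (fun t => (d t).2).
Proof. by move=> t; exact: is_derive_continuous (gc_e2 gc t). Qed.

Lemma gc_ct : continuous g.
Proof.
move=> t.
have [/derivable1_diffP/differentiableP D1 _] := gc_d1 gc t.
have [/derivable1_diffP/differentiableP D2 _] := gc_d2 gc t.
have [H _] := is_diff_pair D1 D2.
have -> : g = (fun t => ((g t).1, (g t).2)) by apply/funext => s; case: (g s).
exact: differentiable_continuous H.
Qed.

Lemma gc_cenorm (x : R * R) : continuous (fun t => enorm (x - g t)).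
Proof.
move=> t; apply: (continuous_comp (f := fun t => x - g t)); last exact: continuous_enorm.
by apply: cvgB; [exact: cvg_cst|exact: gc_ct].
Qed.

Lemma taylor_quadratic (f f' f'' : R -> R) (M t s : R) :
  (forall t, is_derive (t : R) (1 : R) f (f' t)) ->
  (forall t, is_derive (t : R) (1 : R) f' (f'' t)) -> (forall t, `|f'' t| <= M) ->
  `|f (t + s) - f t - s * f' t| <= M * s ^+ 2.
Proof.
move=> H1 H2 HM; have [c ct ->] := @mean_value R f f' t (t + s) (fun x _ => H1 x).
have E : t + s - t = s by ring.
rewrite E in ct *; rewrite (mulrC s) -mulrBl normrM -[s ^+ 2]real_normK ?num_real// expr2 mulrA.
rewrite ler_wpM2r//.
have := @mean_value_le R f' f'' t c M (fun x _ => H2 x) (fun x _ => HM x).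
move=> /le_trans; apply; rewrite ler_wpM2l// (le_trans _ (HM 0))//.
Qed.

Lemma gc_taylor : exists M : R, 0 < M /\ forall t s,
  [/\ `|(g (t + s)).1 - (g t).1 - s * (d t).1| <= M * s ^+ 2,
      `|(g (t + s)).2 - (g t).2 - s * (d t).2| <= M * s ^+ 2,
      enorm (d t - d s) <= M * `|t - s| &
      `|s| - M * s ^+ 2 <= enorm (g (t + s) - g t)].
Proof.
have [M [M0 HM]] := gc_bound2; exists (2 * M); split; first by rewrite mulr_gt0.
move=> t s.
have T1 := @taylor_quadratic _ _ _ M t s (gc_d1 gc) (gc_e1 gc) (fun t => (HM t).1).
have T2 := @taylor_quadratic _ _ _ M t s (gc_d2 gc) (gc_e2 gc) (fun t => (HM t).2).
have s2 : 0 <= M * s ^+ 2 by rewrite mulr_ge0 ?sqr_ge0// ltW.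
split; first by lra.
- by lra.
- apply: le_trans (enorm_le_sum _) _ => /=.
  have := @mean_value_le R _ _ s t M (fun x _ => gc_e1 gc x) (fun x _ => (HM x).1).
  have := @mean_value_le R _ _ s t M (fun x _ => gc_e2 gc x) (fun x _ => (HM x).2).
  lra.
- have := enorm_tri (s *: d t) (g (t + s) - g t) 0; rewrite !subr0.
  rewrite enormZ (gc_unit gc) mulr1.
  have := enorm_le_sum (s *: d t - (g (t + s) - g t)); rewrite /= /GRing.scale/=.
  rewrite (distrC (s * (d t).1)) (distrC (s * (d t).2)).
  lra.
Qed.

Lemma gc_far : exists c C : R, 0 < c /\ forall x t, c * `|t| - C - enorm (x - g 0) <= enorm (x - g t).
Proof.
have [c [C [c0 H]]] := gc_growth gc; exists c, C; split=> // x t.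
have := H t 0; rewrite subr0; have := enorm_tri (g t) x (g 0); rewrite (enormB (g t) x); lra.
Qed.

Lemma sep_itv x a b : (forall t, a <= t <= b -> x <> g t) ->
  exists dl : R, 0 < dl /\ forall t, a <= t <= b -> dl <= enorm (x - g t).
Proof.
move=> H; have [ab|ba] := leP a b; last first.
  by exists 1; split=> // t /andP[at_ tb]; have := le_trans at_ tb; rewrite leNgt ba.
have [|c cab cmin] := @EVT_min R (fun t => enorm (x - g t)) a b ab.
  by apply: continuous_subspaceT; exact: gc_cenorm.
rewrite in_itv/= in cab.
exists (enorm (x - g c)); split.
  by apply: enorm_gt0; apply/eqP => /subr0_eq; exact: H.
by move=> t tab; apply: cmin; rewrite in_itv.
Qed.

Lemma sep_tail x : exists T : R, 0 < T /\ forall t, T <= `|t| -> 1 <= enorm (x - g t).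
Proof.
have [c [C [c0 H]]] := gc_far.
exists (`|(1 + C + enorm (x - g 0)) / c| + 1); split; first by rewrite ltr_wpDl.
move=> t tT; apply: le_trans (H x t).
have : (1 + C + enorm (x - g 0)) / c <= `|t|.
  by apply: le_trans (le_trans (ler_norm _) _) tT; rewrite lerDl.
by rewrite ler_pdivrMr// mulrC; lra.
Qed.

(** Linear growth takes care of large parameters; on the two remaining compact intervals the
    distance attains a positive minimum. *)
Lemma sep_away x t0 r : 0 < r -> (forall t, r <= `|t - t0| -> x <> g t) ->
  exists dl : R, 0 < dl /\ forall t, r <= `|t - t0| -> dl <= enorm (x - g t).
Proof.
move=> r0 H; have [T [T0 HT]] := sep_tail x.
have [|d1 [d10 H1]] := @sep_itv x (- T) (t0 - r).
  by move=> t /andP[_ tr]; apply: H; rewrite ler0_norm; lra.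
have [|d2 [d20 H2]] := @sep_itv x (t0 + r) T.
  by move=> t /andP[tr _]; apply: H; rewrite ger0_norm; lra.
exists (Num.min 1 (Num.min d1 d2)); split; first by rewrite !lt_min ltr01 d10 d20.
move=> t tr; rewrite !ge_min; have [tT|tT] := leP T `|t|; first by rewrite HT.
move: tT; rewrite ltr_norml => /andP[tT1 tT2].
have [tt|tt] := leP t0 t.
  by rewrite H2 ?orbT//; move: tr; rewrite ger0_norm; lra.
by rewrite H1 ?orbT//; move: tr; rewrite ler0_norm; lra.
Qed.

Lemma sep_all x : (forall t, x <> g t) ->
  exists dl : R, 0 < dl /\ forall t, dl <= enorm (x - g t).
Proof.
move=> H; have [d1 [d10 H1]] := @sep_away x 0 1 ltr01 (fun t _ => H t).
have [d2 [d20 H2]] := @sep_itv x (-1) 1 (fun t _ => H t).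
exists (Num.min d1 d2); split; first by rewrite lt_min d10.
move=> t; rewrite ge_min; have [t1|t1] := leP 1 `|t|; first by rewrite H1// subr0.
by rewrite H2 ?orbT//; move: t1; rewrite ltr_norml; lra.
Qed.

End GoodCurves.

(** * Geometry of the two interfaces *)

Section InterfaceGeometry.
Variables (R : realType) (gamma : nat -> R -> R * R) (Omega : nat -> set (R * R)).
Hypothesis HI : interfaces gamma Omega.

Lemma interface_rays j : (1 <= j <= 2)%N ->
  (exists u, ray (gamma j) u) /\ (exists u, ray (fun t => gamma j (- t)) u).
Proof.
move=> hj; have sm := gamma_smooth HI hj.
have d0 t : derivable (gamma j) t 1 := sm 0%N t.
have d1 t : derivable (derive1 (gamma j)) t 1 := sm 1%N t.
have [eta eta0 H] := gamma_decay HI hj; have [C HC] := H 2%N isT.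
have un t := gamma_arclength HI t hj.
have dN (t : R) : is_derive t (1 : R) (fun s : R => - s) (- 1) by exact: dNeg (dId t).
split.
  have [u [r _]] := @asymptotic_ray R (gamma j) _ _ C eta eta0
    (fun t => (is_derive_pair (d0 t)).1) (fun t => (is_derive_pair (d0 t)).2)
    (fun t => (is_derive_pair (d1 t)).1) (fun t => (is_derive_pair (d1 t)).2) un HC.
  by exists u.
have [||||||u [r _]] := @asymptotic_ray R (fun t => gamma j (- t)) (fun t => - derive1 (gamma j) (- t))
  (fun t => derive1n 2 (gamma j) (- t)) C eta eta0.
- by move=> t; have := dComp (is_derive_pair (d0 (- t))).1 (dN t); rewrite mulrN1.
- by move=> t; have := dComp (is_derive_pair (d0 (- t))).2 (dN t); rewrite mulrN1.
- by move=> t; have := dNeg (dComp (is_derive_pair (d1 (- t))).1 (dN t)); rewrite mulrN1 opprK.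
- by move=> t; have := dNeg (dComp (is_derive_pair (d1 (- t))).2 (dN t)); rewrite mulrN1 opprK.
- by move=> t; rewrite enormN; exact: un.
- by move=> t; rewrite -(normrN t); exact: HC.
by exists u.
Qed.

Lemma interface_good_curve j : (1 <= j <= 2)%N ->
  good_curve (gamma j) (tangent gamma j) (derive1n 2 (gamma j)).
Proof.
move=> hj; have sm := gamma_smooth HI hj.
have d0 t : derivable (gamma j) t 1 := sm 0%N t.
have d1 t : derivable (derive1 (gamma j)) t 1 := sm 1%N t.
have [eta eta0 H] := gamma_decay HI hj; have [C HC] := H 2%N isT.
have [[u ru] [u' ru']] := interface_rays hj.
have un t := gamma_arclength HI t hj.
split.
- by move=> t; have [] := is_derive_pair (d0 t).
- by move=> t; have [] := is_derive_pair (d0 t).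
- by move=> t; have [] := is_derive_pair (d1 t).
- by move=> t; have [] := is_derive_pair (d1 t).
- by move=> t; exact: un.
- by exists C, eta.
- apply: (growth_of_rays ru ru'); apply: (rays_neq ru ru').
  exact: (gamma_ends_apart HI hj).
- exact: gamma_simple HI j hj.
Qed.

(** Each of the four pairs of ends has distinct limit directions by [gammas_apart], so [rays_apart]
    applies to each; the smallest rate is kept. *)
Lemma interface_cross_growth : exists c C : R, 0 < c /\
  forall s t, c * (`|s| + `|t|) - C <= enorm (gamma 1%N s - gamma 2%N t).
Proof.
have [[u ru] [u' ru']] := @interface_rays 1 isT.
have [[v rv] [v' rv']] := @interface_rays 2 isT.
have A e1 e2 (h1 : e1 \in [:: -1; 1]) (h2 : e2 \in [:: -1; 1]) := gammas_apart HI h1 h2.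
have m1 : (1 : R) \in [:: -1; 1] by rewrite !inE eqxx orbT.
have mN1 : (-1 : R) \in [:: -1; 1] by rewrite !inE eqxx.
have D (a b : R -> R * R) : enorm (b t - a t) @[t --> +oo] --> +oo -> enorm (a t - b t) @[t --> +oo] --> +oo.
  by under eq_fun do rewrite enormB.
have [c1 [C1 [c10 H1]]] : exists c C : R, 0 < c /\ forall s t, 0 <= s -> 0 <= t ->
    c * (s + t) - C <= enorm (gamma 1%N s - gamma 2%N t).
  apply: (rays_apart ru rv); apply: (rays_neq ru rv); apply: D.
  by have := A _ _ m1 m1; under eq_fun do rewrite !mul1r.
have [c2 [C2 [c20 H2]]] : exists c C : R, 0 < c /\ forall s t, 0 <= s -> 0 <= t ->
    c * (s + t) - C <= enorm (gamma 1%N s - gamma 2%N (- t)).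
  apply: (rays_apart ru rv'); apply: (rays_neq ru rv'); apply: D.
  by have := A _ _ m1 mN1; under eq_fun do rewrite mul1r mulN1r.
have [c3 [C3 [c30 H3]]] : exists c C : R, 0 < c /\ forall s t, 0 <= s -> 0 <= t ->
    c * (s + t) - C <= enorm (gamma 1%N (- s) - gamma 2%N t).
  apply: (rays_apart ru' rv); apply: (rays_neq ru' rv); apply: D.
  by have := A _ _ mN1 m1; under eq_fun do rewrite mul1r mulN1r.
have [c4 [C4 [c40 H4]]] : exists c C : R, 0 < c /\ forall s t, 0 <= s -> 0 <= t ->
    c * (s + t) - C <= enorm (gamma 1%N (- s) - gamma 2%N (- t)).
  apply: (rays_apart ru' rv'); apply: (rays_neq ru' rv'); apply: D.
  by have := A _ _ mN1 mN1; under eq_fun do rewrite !mulN1r.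
exists (Num.min (Num.min c1 c2) (Num.min c3 c4)), (`|C1| + `|C2| + `|C3| + `|C4|).
set m := Num.min _ _; split; first by rewrite !lt_min c10 c20 c30 c40.
have [m1' m2 m3 m4] : [/\ m <= c1, m <= c2, m <= c3 & m <= c4].
  by rewrite /m; split; rewrite !ge_min lexx ?orbT.
move=> s t; have st0 : 0 <= `|s| + `|t| by rewrite addr_ge0.
have [M1 M2 M3 M4] := And4 (ler_wpM2r st0 m1') (ler_wpM2r st0 m2) (ler_wpM2r st0 m3) (ler_wpM2r st0 m4).
have [n1 n2 n3 n4] := And4 (normr_ge0 C1) (normr_ge0 C2) (normr_ge0 C3) (normr_ge0 C4).
have [k1 k2 k3 k4] := And4 (ler_norm C1) (ler_norm C2) (ler_norm C3) (ler_norm C4).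
move: M1 M2 M3 M4; have [s0|/ltW s0] := leP 0 s; have [t0|/ltW t0] := leP 0 t.
- by rewrite (ger0_norm s0) (ger0_norm t0); have := H1 s t s0 t0; lra.
- by have := H2 s (- t) s0; rewrite oppr_ge0 opprK => /(_ t0); rewrite (ger0_norm s0) (ler0_norm t0); lra.
- by have := H3 (- s) t; rewrite oppr_ge0 opprK => /(_ s0 t0); rewrite (ler0_norm s0) (ger0_norm t0); lra.
- by have := H4 (- s) (- t); rewrite !oppr_ge0 !opprK => /(_ s0 t0); rewrite (ler0_norm s0) (ler0_norm t0); lra.
Qed.

End InterfaceGeometry.

(** * Layer potentials *)

Section Densities.
Variable R : realType.
Implicit Types p a b : R -> R.

(* An L^1 part a and a part b that is only bounded, with its derivative: the
   oscillating ends of P_j rho_j are not integrable. *)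
Record split_dens p a b b' : Prop := SplitDens {
  sd_eq : forall t, p t = a t + b t;
  sd_int : intble (leb R) setT a;
  sd_bound : exists B, forall t, `|b t| <= B /\ `|b' t| <= B;
  sd_deriv : forall t, is_derive (t : R) (1 : R) b (b' t);
  sd_cont : continuous b' }.

Definition C1fun p := exists p', (forall t, is_derive (t : R) (1 : R) p (p' t)) /\ continuous p'.

Definition dens p := C1fun p /\ exists a b b', split_dens p a b b'.

Lemma C1fun_continuous p : C1fun p -> continuous p.
Proof. by move=> [p' [H _]] t; exact: is_derive_continuous (H t). Qed.

Lemma dens_continuous p : dens p -> continuous p.
Proof. by case=> /C1fun_continuous. Qed.

Lemma intble_exp_shift (k : R) s : 0 < k -> intble (leb R) setT (fun t : R => expR (- k * `|t - s|)) /\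
  Rintegral (leb R) setT (fun t : R => expR (- k * `|t - s|)) =
  Rintegral (leb R) setT (fun t : R => expR (- k * `|t|)).
Proof. by move=> k0; have := Rint_shift (- s) (intble_exp_decay k0). Qed.

(** The integrable part is bounded by its L^1 norm, the bounded part by the integral of the
    exponential. The latter does not depend on the centre s, so B is uniform in s, as [layer_far]
    requires. *)
Lemma dens_weight p a b b' (k : R) : 0 < k -> continuous p -> split_dens p a b b' ->
  exists B, 0 <= B /\ forall s (C : R) (f : R -> R), measurable_fun [set: measurableTypeR R] f -> 0 <= C ->
  (forall t, `|f t| <= C * expR (- k * `|t - s|)) ->
  intble (leb R) setT (fun t => f t * p t) /\ `|Rintegral (leb R) setT (fun t => f t * p t)| <= C * B.
Proof.
move=> k0 cp [pE ia [B0 HB] _ _].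
have B00 : 0 <= B0 by have [H _] := HB 0; exact: le_trans H.
exists (Rintegral (leb R) setT (fun t => `|a t|) + B0 * Rintegral (leb R) setT (fun t : R => expR (- k * `|t|))).
split.
  rewrite addr_ge0 ?mulr_ge0//; apply: Rintegral_ge0 => t _//; exact: expR_ge0.
move=> s C f mf C0 fC; have [ie Ee] := intble_exp_shift s k0.
have i1 := intble_norm measurableT ia.
have i2 := intbleZ B0 measurableT ie.
have i3 := intbleD measurableT i1 i2.
have i4 := intbleZ C measurableT i3.
have dom t : `|f t * p t| <= C * (`|a t| + B0 * expR (- k * `|t - s|)).
  rewrite normrM pE.
  have e1 : expR (- k * `|t - s|) <= 1.
    by rewrite -expR0 ler_expR mulNr oppr_le0 mulr_ge0// ltW.
  apply: (@le_trans _ _ (C * expR (- k * `|t - s|) * (`|a t| + B0))).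
    apply: (ler_pM (normr_ge0 _) (normr_ge0 _) (fC t)).
    by rewrite (le_trans (ler_normD _ _))// lerD2l; have [] := HB t.
  rewrite -mulrA ler_wpM2l// mulrDr lerD//; last by rewrite mulrC.
  by rewrite ler_piMl.
have mfp : measurable_fun [set: measurableTypeR R] (fun t => f t * p t).
  by apply: measurable_funM => //; have H := continuous_meas cp; exact: H.
split; first by apply: (intble_dom measurableT mfp i4) => t _.
apply: le_trans (Rint_dom measurableT mfp i4 (fun t _ => dom t)) _.
by rewrite RintegralZl// RintegralD// RintegralZl// Ee.
Qed.

End Densities.

(** * Smoothness and decay of layer potentials off the curve *)

Section Layers.
Variables (R : realType) (w : R).
Hypothesis w0 : 0 < w.
Variables g d e : R -> R * R.
Hypothesis gc : good_curve g d e.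

Definition layer_pot (k : R * R -> R) (p : R -> R) (x : R * R) : R :=
  Rintegral (leb R) setT (fun t : R => k (x - g t) * p t).

Lemma meas_layer (k k1 k2 : R * R -> R) x : (forall z, z != 0 -> has_grad k z (k1 z) (k2 z)) ->
  (forall t, x <> g t) -> measurable_fun [set: measurableTypeR R] (fun t : R => k (x - g t)).
Proof.
move=> H xg; have c : continuous (fun t : R => k (x - g t)).
  move=> t; apply: (continuous_comp (f := fun t => x - g t)).
    by apply: cvgB; [exact: cvg_cst|exact: gc_ct gc t].
  by apply: has_grad_continuous; apply: H; apply/eqP => /subr0_eq; exact: xg.
by have H' := continuous_meas c; exact: H'.
Qed.

(** Linear growth of the curve converts decay in the plane into decay in the parameter. The term
    [t - 0] displays the centre expected by [dens_weight]. *)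
Lemma exp_layer_bound x : exists c C : R, [/\ 0 < c, 0 <= C &
  forall t, expR (- w * enorm (x - g t)) <= C * expR (- (w * c) * `|t - 0|)].
Proof.
have [c [C [c0 H]]] := gc_far gc.
exists c, (expR (w * (C + enorm (x - g 0)))); split=> //.
move=> t; rewrite subr0 -expRD ler_expR.
have := ler_wpM2l (ltW w0) (H x t); rewrite !mulNr.
have -> : w * (c * `|t| - C - enorm (x - g 0)) = w * c * `|t| - w * (C + enorm (x - g 0)) by ring.
lra.
Qed.

Lemma layer_bound (k k1 k2 : R * R -> R) (p : R -> R) x : (forall z, z != 0 -> has_grad k z (k1 z) (k2 z)) ->
  decaying w k -> dens p -> (forall t, x <> g t) -> intble (leb R) setT (fun t : R => k (x - g t) * p t).
Proof.
move=> Hk dk [C1p [a [b [b' parts_of]]]] xg.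
have [dl [dl0 sep]] := sep_all gc xg.
have [Ck HCk] := dk _ dl0.
have [c [C [c0 C0 HC]]] := exp_layer_bound x.
have wc0 : 0 < w * c by rewrite mulr_gt0.
have [B [_ HB]] := dens_weight wc0 (C1fun_continuous C1p) parts_of.
have [] := HB 0 (`|Ck| * C) (fun t => k (x - g t)) (meas_layer Hk xg) _ _ => //.
  by rewrite mulr_ge0.
move=> t; apply: le_trans (HCk _ (sep t)) _.
apply: (@le_trans _ _ (`|Ck| * expR (- w * enorm (x - g t)))).
  by rewrite ler_wpM2r ?expR_ge0// ler_norm.
by rewrite -mulrA ler_wpM2l.
Qed.

Lemma layer_has_grad (k k1 k2 : R * R -> R) (p : R -> R) x : decaying_kernel w k k1 k2 -> dens p ->
  (forall t, x <> g t) -> has_grad (layer_pot k p) x (layer_pot k1 p x) (layer_pot k2 p x).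
Proof.
move=> dk dp xg; have [Hk dk0 t1 t2] := dk.
have [dl [dl0 sep]] := sep_all gc xg.
have [Ct HCt] := dker_taylor w0 dk dl0.
have cp := dens_continuous dp.
have [d1 [k11 [k12 [H1 _ _]]]] := t1; have [d2 [k21 [k22 [H2 _ _]]]] := t2.
have [c [C [c0 C0 HC]]] := exp_layer_bound x.
have wc0 : 0 < w * c by rewrite mulr_gt0.
(* This radius is the one allowed by [dker_taylor]; it also keeps x + h off the curve. *)
have e0 : 0 < dl / 4 by rewrite divr_gt0.
have off h : `|h| < dl / 4 -> forall t, x + h <> g t.
  move=> hd t E; have := sep t; have := enorm_le_supnorm h.
  by rewrite -E opprD addrA subrr add0r enormN; lra.
apply: (@Rint_has_grad _ _ _ (leb R) (fun (y : R * R) (t : measurableTypeR R) => k (y - g t) * p t)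
   (fun t => k1 (x - g t) * p t) (fun t => k2 (x - g t) * p t)
   (fun t => `|Ct| * expR (- w * enorm (x - g t)) * `|p t|) _ (dl / 4)) => //.
- move=> h hd; apply: (layer_bound Hk) => //; exact: off.
- exact: (layer_bound H1).
- exact: (layer_bound H2).
- have [C1p [a [b [b' parts_of]]]] := dp.
  have [B [_ HB]] := dens_weight wc0 cp parts_of.
  have mE : measurable_fun [set: measurableTypeR R] (fun t : R => `|Ct| * expR (- w * enorm (x - g t))).
    have c' : continuous (fun t : R => `|Ct| * expR (- w * enorm (x - g t))).
      apply: ctZ; apply: ctcomp; first exact: continuous_expR.
      by apply: ctZ; exact: gc_cenorm gc x.
    by have H := continuous_meas c'; exact: H.
  have [] := HB 0 (`|Ct| * C) _ mE _ _.
  + by rewrite mulr_ge0.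
  + move=> t; rewrite ger0_norm ?mulr_ge0 ?expR_ge0//.
    by rewrite -mulrA ler_wpM2l.
  + move=> /(intble_norm measurableT) i1 _; move: i1.
    apply: eq_integrable => // t _ /=.
    by rewrite normrM (ger0_norm (mulr_ge0 _ _)) ?expR_ge0.
- move=> h t hd _.
  have -> : k (x + h - g t) * p t - k (x - g t) * p t - (k1 (x - g t) * p t * h.1 + k2 (x - g t) * p t * h.2) =
    (k (x - g t + h) - k (x - g t) - (k1 (x - g t) * h.1 + k2 (x - g t) * h.2)) * p t.
    by rewrite (addrAC x h); ring.
  rewrite normrM mulrAC ler_wpM2r//.
  apply: le_trans (HCt _ (sep t) h (ltW hd)) _.
  by rewrite ler_wpM2r ?sqr_ge0// ler_wpM2r ?expR_ge0// ler_norm.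
Qed.

Lemma near_minimizer x : exists ts, forall t, enorm (x - g ts) <= enorm (x - g t) + 1.
Proof.
pose S := [set enorm (x - g t) | t in [set: R]].
have hS : has_inf S.
  by split; [exists (enorm (x - g 0)), 0|exists 0 => _ [t _ <-]; exact: enorm_ge0].
have [_ [ts _ <-] H] := inf_adherent ltr01 hS.
exists ts => t; apply: le_trans (ltW H) _; rewrite lerD2r.
by apply: ge_inf; [exact: hS.2|exists t].
Qed.

(** Let ts nearly minimise the distance from x. Then |g t - g ts| <= 2 |x - g t| + 1, so half of the
    rate w pays for a weight decaying in t - ts, and the other half gives the small factor e^(- w D
    / 2). The bound of [dens_weight] is uniform in ts. *)
Lemma layer_far (k k1 k2 : R * R -> R) (p : R -> R) (eps : R) :
  (forall z, z != 0 -> has_grad k z (k1 z) (k2 z)) ->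
  decaying w k -> dens p -> 0 < eps ->
  exists D : R, forall x, (forall t, D <= enorm (x - g t)) -> `|layer_pot k p x| <= eps.
Proof.
move=> Hk dk dp eps0; have cp := dens_continuous dp; have [_ [a [b [b' parts_of]]]] := dp.
have [Ck HCk] := dk 1 ltr01.
have [c [C [c0 gr]]] := gc_growth gc.
have w20 : 0 < w / 2 by rewrite divr_gt0.
have wc0 : 0 < w / 4 * c by rewrite mulr_gt0// divr_gt0.
have [B [B0 HB]] := dens_weight wc0 cp parts_of.
pose A := `|Ck| * expR (w / 4 * (C + 1)) * B.
have A0 : 0 <= A by rewrite !mulr_ge0 ?expR_ge0.
have [D D0 HD] := expRN_small A0 w20 eps0.
exists (Num.max 1 D) => x xD.
have x1 t : 1 <= enorm (x - g t) by apply: le_trans (xD t); rewrite le_max lexx.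
have xD' t : D <= enorm (x - g t) by apply: le_trans (xD t); rewrite le_max lexx orbT.
have [ts Hts] := near_minimizer x.
have xg t : x <> g t by move=> E; have := x1 t; rewrite E subrr enorm0 ler10.
have [] := HB ts (`|Ck| * expR (w / 4 * (C + 1)) * expR (- (w / 2) * D)) _ (meas_layer Hk xg).
- by rewrite !mulr_ge0 ?expR_ge0.
- move=> t; apply: le_trans (HCk _ (x1 t)) _.
  apply: (@le_trans _ _ (`|Ck| * expR (- w * enorm (x - g t)))).
    by rewrite ler_wpM2r ?expR_ge0// ler_norm.
  rewrite -!mulrA ler_wpM2l// -!expRD ler_expR.
  have tr := enorm_tri (g t) x (g ts); rewrite (enormB (g t) x) in tr.
  have h1 : c * `|t - ts| - C - 1 <= 2 * enorm (x - g t) by have := gr t ts; have := Hts t; lra.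
  have h2 := ler_wpM2l (ltW (divr_gt0 w0 (ltr0Sn _ 3))) h1.
  have h3 := ler_wpM2l (ltW w20) (xD' t).
  rewrite !mulNr -!mulrA.
  move: h2 h3; set X := enorm (x - g t); set Y := `|t - ts|.
  rewrite !mulrBr mulr1 => h2 h3.
  have e1 : w / 4%:R * (2 * X) = w / 2 * X by field.
  rewrite e1 in h2.
  have e2 : w * X = w / 2 * X + w / 2 * X by field.
  by rewrite e2 mulrDr mulr1 mulrA; lra.
move=> _ /le_trans; apply; apply: le_trans HD; rewrite /A.
by rewrite -!mulrA (mulrC B).
Qed.

End Layers.

(** * Layer potentials along the ends of a curve *)

Section ConvolutionDecay.
Variable R : realType.

Lemma cvg_pinfty_seq (f : R -> R) (l : R) :
  (forall u : nat -> R, u n @[n --> \oo] --> +oo -> f (u n) @[n --> \oo] --> l) ->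
  f x @[x --> +oo] --> l.
Proof. by move=> H; apply/cvg_pinftyP. Qed.

Lemma norm_cvg0 (T : Type) (F : set_system T) (FF : Filter F) (f h : T -> R) :
  (\forall t \near F, `|f t| <= h t) -> h t @[t --> F] --> (0 : R) -> f t @[t --> F] --> (0 : R).
Proof.
move=> fh h0; apply/cvgrPdist_le => eps eps0.
move/cvgrPdist_le : h0 => /(_ eps eps0); apply: filterS2 fh => t ft; rewrite !sub0r !normrN => ht.
by apply: le_trans ft (le_trans (ler_norm _) ht).
Qed.

(** Dominated convergence with majorant |a|: the exponential is at most 1 and tends to 0 at each
    fixed s. *)
Lemma exp_conv_L1 (a : R -> R) (k : R) : 0 < k -> intble (leb R) setT a ->
  Rintegral (leb R) setT (fun s : R => expR (- k * `|t - s|) * `|a s|) @[t --> +oo] --> (0 : R).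
Proof.
move=> k0 ia; apply: cvg_pinfty_seq => u uoo.
have ma := intble_meas ia.
rewrite -[0](_ : Rintegral (leb R) setT (fun=> 0) = 0); last first.
  by rewrite Rintegral_cst ?mul0r.
have cE (t : R) : measurable_fun [set: measurableTypeR R] (fun s : R => expR (- k * `|t - s|)).
  have c : continuous (fun s : R => expR (- k * `|t - s|)).
    apply: ctcomp; first exact: continuous_expR.
    by apply: ctZ; apply: ctnorm; apply: ctB => // x; [exact: cvg_cst|exact: cvg_id].
  by have H := continuous_meas c; exact: H.
apply: (@Rint_dct _ _ _ (leb R) setT (fun n (s : R) => expR (- k * `|u n - s|) * `|a s|) (fun=> 0)
   (fun s => `|a s|)) => //.
- move=> n; apply: measurable_funM; first exact: cE.
  by apply: measurableT_comp => //; exact: ma.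
- apply: aeW => s _; rewrite -[0](mul0r `|a s|); apply: cvgM; last exact: cvg_cst.
  apply: (@norm_cvg0 _ _ _ _ (fun n => 4 / (4 + (k * `|u n - s|) ^+ 2))).
    apply: nearW => n; rewrite ger0_norm ?expR_ge0// mulNr.
    by apply: expRN_le_cauchy; rewrite mulr_ge0// ltW.
  apply/cvgrPdist_le => e e0; near=> n.
  rewrite sub0r normrN ger0_norm; last by rewrite divr_ge0// addr_ge0// sqr_ge0.
  have D0 : 0 < 4 + (k * `|u n - s|) ^+ 2 by rewrite ltr_wpDr// sqr_ge0.
  rewrite ler_pdivrMr// -ler_pdivrMl//.
  have L : `|e^-1 * 4| / k + 1 + s <= u n.
    by near: n; move/cvgryPge : uoo; apply.
  have L1 : `|e^-1 * 4| / k + 1 <= `|u n - s|.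
    by rewrite (le_trans _ (ler_norm _))//; lra.
  have L2 : `|e^-1 * 4| + k <= k * `|u n - s|.
    have := ler_wpM2l (ltW k0) L1; rewrite mulrDr mulr1 (mulrC k) divfK ?lt0r_neq0//.
  set X := k * `|u n - s| in L2 *.
  have Y0 := ler_norm (e^-1 * 4); have Y1 := normr_ge0 (e^-1 * 4).
  set Y := `|e^-1 * 4| in Y0 Y1 L2.
  apply: (le_trans Y0); have X0 : Y <= X by lra.
  have : Y ^+ 2 <= X ^+ 2 by rewrite lerXn2r ?nnegrE//; lra.
  by have : 0 <= (Y - 2) ^+ 2 := sqr_ge0 _; rewrite sqrrB; lra.
- exact: intble_norm.
- move=> n s _; rewrite normrM normr_id ler_piMl//.
  by rewrite ger0_norm ?expR_ge0// -expR0 ler_expR mulNr oppr_le0 mulr_ge0// ltW.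
Unshelve. all: by end_near. Qed.

(** The translation s -> s + t moves the limit from the exponential to b, leaving the integrable
    majorant B e^(- k |s|). *)
Lemma exp_conv_bounded (b : R -> R) (k B : R) : 0 < k -> continuous b -> (forall t, `|b t| <= B) ->
  b t @[t --> +oo] --> (0 : R) ->
  Rintegral (leb R) setT (fun s : R => expR (- k * `|t - s|) * `|b s|) @[t --> +oo] --> (0 : R).
Proof.
move=> k0 cb bB b0; apply: cvg_pinfty_seq => u uoo.
have B0 : 0 <= B := le_trans (normr_ge0 _) (bB 0).
have ie := intble_exp_decay k0.
have cE (t : R) : continuous (fun s : R => expR (- k * `|t - s|)).
  apply: ctcomp; first exact: continuous_expR.
  by apply: ctZ; apply: ctnorm; apply: ctB => // x; [exact: cvg_cst|exact: cvg_id].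
have mE (t : R) : measurable_fun [set: measurableTypeR R] (fun s : R => expR (- k * `|t - s|) * `|b s|).
  have c : continuous (fun s : R => expR (- k * `|t - s|) * `|b s|).
    by apply: ctM; [exact: cE|exact: ctnorm].
  by have H := continuous_meas c; exact: H.
have shift (t : R) : Rintegral (leb R) setT (fun s : R => expR (- k * `|t - s|) * `|b s|) =
    Rintegral (leb R) setT (fun s : R => expR (- k * `|s|) * `|b (s + t)|).
  have i1 : intble (leb R) setT (fun s : R => expR (- k * `|t - s|) * `|b s|).
    have [i0 _] := intble_exp_shift t k0.
    apply: (intble_dom measurableT (mE t) (intbleZ B measurableT i0)) => s _.
    rewrite normrM normr_id ger0_norm ?expR_ge0// mulrC distrC ler_wpM2r ?expR_ge0//.
  have [_ <-] := Rint_shift t i1; apply: eq_Rintegral => s _.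
  by rewrite (_ : t - (s + t) = - s) ?normrN//; ring.
under eq_fun do rewrite shift.
rewrite -[0](_ : Rintegral (leb R) setT (fun=> 0) = 0); last first.
  by rewrite Rintegral_cst ?mul0r.
apply: (@Rint_dct _ _ _ (leb R) setT (fun n (s : R) => expR (- k * `|s|) * `|b (s + u n)|) (fun=> 0)
   (fun s : R => B * expR (- k * `|s|))) => //.
- move=> n; have c : continuous (fun s : R => expR (- k * `|s|) * `|b (s + u n)|).
    apply: ctM; first exact: continuous_exp_decay.
    apply: ctnorm; apply: ctcomp => //.
    by apply: ctD => // x; [exact: cvg_id|exact: cvg_cst].
  by have H := continuous_meas c; exact: H.
- apply: aeW => s _; rewrite -[0](mulr0 (expR (- k * `|s|))); apply: cvgM; first exact: cvg_cst.
  have uoo' : s + u n @[n --> \oo] --> +oo.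
    apply/cvgryPge => A; move/cvgryPge : uoo => /(_ (A - s)).
    by apply: filterS => n; rewrite lerBlDl.
  by move/cvg_pinftyP : b0 => /(_ _ uoo') /cvg_norm; rewrite normr0.
- exact: intbleZ.
- move=> n s _; rewrite normrM normr_id ger0_norm ?expR_ge0// mulrC ler_wpM2r ?expR_ge0//.
Qed.

Lemma exp_conv_decay (a b p : R -> R) (k B C T : R) (f : R -> R -> R) : 0 < k -> 0 <= C ->
  intble (leb R) setT a -> continuous b -> (forall t, `|b t| <= B) ->
  b t @[t --> +oo] --> (0 : R) -> (forall s, p s = a s + b s) ->
  (forall t, T <= t -> measurable_fun [set: measurableTypeR R] (f t)) ->
  (forall t s, T <= t -> `|f t s| <= C * expR (- k * `|t - s|)) ->
  Rintegral (leb R) setT (fun s : R => f t s * p s) @[t --> +oo] --> (0 : R).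
Proof.
move=> k0 C0 ia cb bB b0 pE mf fC.
have B0 : 0 <= B := le_trans (normr_ge0 _) (bB 0).
have ma := intble_meas ia.
have mb : measurable_fun [set: measurableTypeR R] b by have H := continuous_meas cb; exact: H.
have cE (t : R) : measurable_fun [set: measurableTypeR R] (fun s : R => expR (- k * `|t - s|)).
  have c : continuous (fun s : R => expR (- k * `|t - s|)).
    apply: ctcomp; first exact: continuous_expR.
    by apply: ctZ; apply: ctnorm; apply: ctB => // x; [exact: cvg_cst|exact: cvg_id].
  by have H := continuous_meas c; exact: H.
have i1 t : intble (leb R) setT (fun s : R => expR (- k * `|t - s|) * `|a s|).
  apply: (intble_dom measurableT _ (intble_norm measurableT ia)).
    apply: measurable_funM; first exact: cE.
    by apply: measurableT_comp => //; exact: ma.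
  move=> s _; rewrite normrM normr_id ler_piMl//.
  by rewrite ger0_norm ?expR_ge0// -expR0 ler_expR mulNr oppr_le0 mulr_ge0// ltW.
have i2 t : intble (leb R) setT (fun s : R => expR (- k * `|t - s|) * `|b s|).
  have [i0 _] := intble_exp_shift t k0.
  apply: (intble_dom measurableT _ (intbleZ B measurableT i0)).
    apply: measurable_funM; first exact: cE.
    by apply: measurableT_comp => //; exact: mb.
  by move=> s _; rewrite normrM normr_id ger0_norm ?expR_ge0// mulrC distrC ler_wpM2r ?expR_ge0.
apply: (@norm_cvg0 _ _ _ _ (fun t => C * (Rintegral (leb R) setT (fun s : R => expR (- k * `|t - s|) * `|a s|) +
    Rintegral (leb R) setT (fun s : R => expR (- k * `|t - s|) * `|b s|)))).
  near=> t; have tT : T <= t by near: t; exact/nbhs_pinfty_ge/num_real.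
  rewrite -(RintegralD measurableT (i1 t) (i2 t)).
  rewrite -(RintegralZl C measurableT (intbleD measurableT (i1 t) (i2 t))).
  apply: Rint_dom => //.
  - apply: measurable_funM; first exact: mf.
    have -> : p = (fun s => a s + b s) by apply/funext.
    exact: measurable_funD.
  - apply: intbleZ => //; exact: (intbleD measurableT (i1 t) (i2 t)).
  - move=> s _; rewrite normrM -mulrDr mulrA ler_pM// ?fC//.
    by rewrite pE ler_normD.
rewrite -[0](mulr0 C) -[X in C * X](addr0 0); apply: cvgM; first exact: cvg_cst.
by apply: cvgD; [exact: exp_conv_L1|exact: exp_conv_bounded b0].
Unshelve. all: by end_near. Qed.

Lemma exp_kernel_L1 (f h : R -> R) (k C t : R) : 0 < k -> 0 <= C ->
  measurable_fun [set: measurableTypeR R] f -> (forall s, `|f s| <= C * expR (- k * `|t - s|)) ->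
  intble (leb R) setT h -> intble (leb R) setT (fun s => f s * h s).
Proof.
move=> k0 C0 mf fC ih.
apply: (intble_dom measurableT _ (intbleZ C measurableT (intble_norm measurableT ih))).
  by apply: measurable_funM => //; exact: intble_meas ih.
move=> s _; rewrite normrM ler_wpM2r//; apply: le_trans (fC s) _.
by rewrite ler_piMr// -expR0 ler_expR mulNr oppr_le0 mulr_ge0// ltW.
Qed.

Lemma exp_kernel_bounded (f h : R -> R) (k C B t : R) : 0 < k -> 0 <= C ->
  measurable_fun [set: measurableTypeR R] f -> (forall s, `|f s| <= C * expR (- k * `|t - s|)) ->
  continuous h -> (forall s, `|h s| <= B) ->
  intble (leb R) setT (fun s => f s * h s) /\
  `|Rintegral (leb R) setT (fun s => f s * h s)| <=
    C * B * Rintegral (leb R) setT (fun s : R => expR (- k * `|s|)).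
Proof.
move=> k0 C0 mf fC ch hB; have [ie Ee] := intble_exp_shift t k0.
have mfh : measurable_fun [set: measurableTypeR R] (fun s => f s * h s).
  by apply: measurable_funM => //; have H := continuous_meas ch; exact: H.
have dom s : `|f s * h s| <= C * B * expR (- k * `|s - t|).
  rewrite normrM mulrAC; apply: ler_pM => //; by rewrite distrC.
split; first by apply: (intble_dom measurableT mfh (intbleZ (C * B) measurableT ie)) => s _.
rewrite -Ee -RintegralZl//; apply: Rint_dom => //; exact: intbleZ.
Qed.

End ConvolutionDecay.

(** * The outgoing condition along a parallel curve *)

Section Outgoing.
Variables (R : realType) (w : R).
Hypothesis w0 : 0 < w.
Variables g d e : R -> R * R.
Hypothesis gc : good_curve g d e.
Variable r : R.
Hypothesis r0 : r != 0.

(** When d is the tangent of an interface this is convertible to [normal], and the two are used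
    interchangeably below. *)
Definition rot90 (t : R) : R * R := (- (d t).2, (d t).1).
Definition offset (t : R) : R * R := g t + r *: rot90 t.
Definition offset_d1 (t : R) : R := (d t).1 - r * (e t).2.
Definition offset_d2 (t : R) : R := (d t).2 + r * (e t).1.

Lemma is_derive_par1 t : is_derive (t : R) (1 : R) (fun s => (offset s).1) (offset_d1 t).
Proof.
have := dAdd (gc_d1 gc t) (dScale r (dNeg (gc_e2 gc t))).
by rewrite mulrN.
Qed.

Lemma is_derive_par2 t : is_derive (t : R) (1 : R) (fun s => (offset s).2) (offset_d2 t).
Proof. exact: dAdd (gc_d2 gc t) (dScale r (gc_e1 gc t)). Qed.

Lemma enorm_nrm t : enorm (rot90 t) = 1.
Proof. by rewrite -(gc_unit gc t) /enorm /= sqrrN addrC. Qed.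

Lemma tangent_limit : exists u : R * R, exists D eta : R, [/\ 0 < eta, 0 <= D &
  forall t, enorm (d t - u) <= D * expR (- eta * t)].
Proof.
have [C [eta [eta0 H]]] := gc_decay gc.
have [u [_ Hu]] := asymptotic_ray eta0 (gc_d1 gc) (gc_d2 gc) (gc_e1 gc) (gc_e2 gc) (gc_unit gc) H.
exists u, (2 * (C / eta)), eta; split=> //.
have := le_trans (enorm_ge0 _) (Hu 0); by rewrite mulr0 expR0 mulr1.
Qed.

Lemma par_growth : exists c C : R, 0 < c /\ forall t s, c * `|t - s| - C <= enorm (offset t - g s).
Proof.
have [c [C [c0 H]]] := gc_growth gc; exists c, (C + `|r|); split=> // t s.
have := H t s; have := enorm_tri (g t) (offset t) (g s).
have -> : enorm (g t - offset t) = `|r|.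
  by rewrite /offset opprD addrA subrr add0r enormN enormZ enorm_nrm mulr1.
lra.
Qed.

(** A parallel curve may meet the curve where the curvature is large, hence only t >= T. If |t - s|
    >= S, growth separates the points. Otherwise the curve is nearly straight between t and s: the
    corresponding vector v for a straight line is at least |r| long, and the error is at most |r| /
    2. *)
Lemma par_sep : exists T dl : R, 0 < dl /\ forall t s, T <= t -> dl <= enorm (offset t - g s).
Proof.
have [c [C [c0 H]]] := par_growth.
have [u [D [eta [eta0 D0 Hu]]]] := tangent_limit.
pose S := (`|C| + 1) / c.
have S0 : 0 <= S by rewrite divr_ge0 ?addr_ge0// ltW.
have r1 : 0 < `|r| / 2 by rewrite divr_gt0// normr_gt0.
(* Beyond T0, two tangents at parameters within S differ by at most 2 D e^(- eta T0); multiplying by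
   S and adding the two components gives the factor 4 D S. *)
have A0 : 0 <= 4 * D * S by rewrite (mulr_ge0 _ S0)// mulr_ge0.
have [T0 T00 HT] := expRN_small A0 eta0 r1.
exists (T0 + S), (Num.min 1 (`|r| / 2)); split; first by rewrite lt_min ltr01.
move=> t s tT; rewrite ge_min; have [ts|ts] := leP S `|t - s|.
  apply/orP; left; apply: le_trans (H t s).
  have : `|C| + 1 <= c * `|t - s| by rewrite mulrC -ler_pdivrMr.
  by have := ler_norm C; lra.
apply/orP; right.
have near x : `|x - t| <= S -> enorm (d x - d t) <= 2 * (D * expR (- eta * T0)).
  move=> xt; have lo y : T0 <= y -> enorm (d y - u) <= D * expR (- eta * T0).
    move=> yT; apply: le_trans (Hu y) _; rewrite ler_wpM2l// ler_expR !mulNr lerN2 ler_wpM2l// ltW//.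
  have := enorm_tri (d x) u (d t); rewrite (enormB u).
  have h1 : T0 <= x by move: xt; rewrite ler_norml => /andP[]; lra.
  have h2 : T0 <= t by lra.
  by have := lo _ h1; have := lo _ h2; lra.
rewrite distrC in ts.
have [x1 h1 E1] := @mean_value R _ _ t s (fun x _ => gc_d1 gc x).
have [x2 h2 E2] := @mean_value R _ _ t s (fun x _ => gc_d2 gc x).
have n1 := le_trans (enorm_fst _) (near _ (le_trans h1 (ltW ts))).
have n2 := le_trans (enorm_snd _) (near _ (le_trans h2 (ltW ts))).
pose v : R * R := r *: rot90 t - (s - t) *: d t.
have lv : `|r| <= enorm v.
  rewrite -(@ler_pXn2r _ 2) ?nnegrE ?enorm_ge0// sqr_enorm real_normK ?num_real// /v /= /GRing.scale/=.
  have := sqr_enorm (d t); rewrite (gc_unit gc) expr1n.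
  case: (d t) => x y /= E.
  have -> : (r * - y - (s - t) * x) ^+ 2 + (r * x - (s - t) * y) ^+ 2 =
    (r ^+ 2 + (s - t) ^+ 2) * (x ^+ 2 + y ^+ 2) by ring.
  by rewrite -E mulr1 lerDl sqr_ge0.
have err : enorm (v - (offset t - g s)) <= `|r| / 2.
  apply: le_trans (enorm_le_sum _) _; rewrite /v /offset /= /GRing.scale/=.
  have -> : r * - (d t).2 - (s - t) * (d t).1 - ((g t).1 + r * - (d t).2 - (g s).1) = ((d x1).1 - (d t).1) * (s - t).
    have -> : (g s).1 = (g t).1 + (d x1).1 * (s - t) by rewrite -E1; ring.
    by ring.
  have -> : r * (d t).1 - (s - t) * (d t).2 - ((g t).2 + r * (d t).1 - (g s).2) = ((d x2).2 - (d t).2) * (s - t).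
    have -> : (g s).2 = (g t).2 + (d x2).2 * (s - t) by rewrite -E2; ring.
    by ring.
  rewrite !normrM; apply: le_trans HT.
  have e0 := mulr_ge0 D0 (expR_ge0 (- eta * T0)).
  have m1 := ler_pM (normr_ge0 _) (normr_ge0 _) n1 (ltW ts).
  have m2 := ler_pM (normr_ge0 _) (normr_ge0 _) n2 (ltW ts).
  have -> : 4 * D * S * expR (- eta * T0) = 2 * (D * expR (- eta * T0)) * S + 2 * (D * expR (- eta * T0)) * S by ring.
  exact: lerD.
by have := enorm_tri v (offset t - g s) 0; rewrite !subr0; lra.
Qed.

Lemma par_kernel (k : R * R -> R) : decaying w k -> exists T c C : R, [/\ 0 < c, 0 <= C &
  forall t s, T <= t -> `|k (offset t - g s)| <= C * expR (- c * `|t - s|)].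
Proof.
move=> dk; have [T [dl [dl0 sep]]] := par_sep; have [Ck HCk] := dk _ dl0.
have [c [C [c0 H]]] := par_growth.
exists T, (w * c), (`|Ck| * expR (w * C)); split; rewrite ?mulr_gt0 ?mulr_ge0 ?expR_ge0//.
move=> t s tT; apply: le_trans (HCk _ (sep _ _ tT)) _.
apply: (@le_trans _ _ (`|Ck| * expR (- w * enorm (offset t - g s)))).
  by rewrite ler_wpM2r ?expR_ge0// ler_norm.
rewrite -mulrA ler_wpM2l// -expRD ler_expR.
have := ler_wpM2l (ltW w0) (H t s); rewrite mulrBr !mulNr mulrA; lra.
Qed.

Lemma par_off t T dl : 0 < dl -> (forall t s, T <= t -> dl <= enorm (offset t - g s)) -> T <= t ->
  forall s, offset t <> g s.
Proof. by move=> dl0 sep tT s E; have := sep t s tT; rewrite E subrr enorm0 leNgt dl0. Qed.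

Lemma par1_cvg u D eta : 0 < eta -> (forall t, enorm (d t - u) <= D * expR (- eta * t)) ->
  offset_d1 t @[t --> +oo] --> u.1 /\ offset_d2 t @[t --> +oo] --> u.2.
Proof.
move=> eta0 Hu; have [C [et [et0 HC]]] := gc_decay gc.
have exp0 (k A : R) : 0 < k -> A * expR (- k * t) @[t --> +oo] --> (0 : R).
  move=> k0; rewrite -[0](mulr0 A); apply: cvgM; first exact: cvg_cst.
  apply/cvgrPdist_le => x x0; have [T T0 HT] := expRN_small ler01 k0 x0.
  near=> t; have tT : T <= t by near: t; exact/nbhs_pinfty_ge/num_real.
  rewrite sub0r normrN ger0_norm ?expR_ge0//; apply: le_trans HT; rewrite mul1r.
  by rewrite ler_expR !mulNr lerN2 ler_wpM2l// ltW.
have e0 : enorm (e t) @[t --> +oo] --> (0 : R).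
  apply: (@norm_cvg0 _ _ _ _ _ (fun t => C * expR (- et * t))); last exact: exp0.
  near=> t; have t0 : 0 <= t by near: t; exact/nbhs_pinfty_ge/num_real.
  by have := HC t; rewrite (ger0_norm t0) ger0_norm ?enorm_ge0.
have du0 : enorm (d t - u) @[t --> +oo] --> (0 : R).
  apply: (@norm_cvg0 _ _ _ _ _ (fun t => D * expR (- eta * t))); last exact: exp0.
  by apply: nearW => t; rewrite ger0_norm ?enorm_ge0.
have c0 (f h : R -> R) : (forall t, `|f t| <= h t) -> h t @[t --> +oo] --> (0 : R) -> f t @[t --> +oo] --> (0 : R).
  by move=> fh; apply: norm_cvg0; exact: nearW.
split.
- have H : ((d t).1 - u.1) + u.1 - r * (e t).2 @[t --> +oo] --> 0 + u.1 - r * 0.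
    apply: cvgB; last by apply: cvgM; [exact: cvg_cst|apply: (c0 _ _ (fun t => enorm_snd (e t)) e0)].
    apply: cvgD; last exact: cvg_cst.
    exact: (c0 _ _ (fun t => enorm_fst (d t - u)) du0).
  rewrite add0r mulr0 subr0 in H; apply: cvg_trans H; apply: near_eq_cvg; apply: nearW => t.
  by rewrite /offset_d1 subrK.
- have H : ((d t).2 - u.2) + u.2 + r * (e t).1 @[t --> +oo] --> 0 + u.2 + r * 0.
    apply: cvgD; last by apply: cvgM; [exact: cvg_cst|apply: (c0 _ _ (fun t => enorm_fst (e t)) e0)].
    apply: cvgD; last exact: cvg_cst.
    exact: (c0 _ _ (fun t => enorm_snd (d t - u)) du0).
  rewrite add0r mulr0 addr0 in H; apply: cvg_trans H; apply: near_eq_cvg; apply: nearW => t.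
  by rewrite /offset_d2 subrK.
Unshelve. all: by end_near. Qed.

Lemma cont_kernel (k k1 k2 : R * R -> R) x : (forall z, z != 0 -> has_grad k z (k1 z) (k2 z)) ->
  (forall t, x <> g t) -> continuous (fun t : R => k (x - g t)).
Proof.
move=> H xg t; apply: (continuous_comp (f := fun t => x - g t)).
  by apply: cvgB; [exact: cvg_cst|exact: gc_ct gc t].
by apply: has_grad_continuous; apply: H; apply/eqP => /subr0_eq; exact: xg.
Qed.

Lemma is_derive_kernel (k k1 k2 : R * R -> R) x t : (forall z, z != 0 -> has_grad k z (k1 z) (k2 z)) ->
  (forall t, x <> g t) -> is_derive (t : R) (1 : R) (fun s : R => k (x - g s))
     (- (k1 (x - g t) * (d t).1 + k2 (x - g t) * (d t).2)).
Proof.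
move=> H xg; have z0 : x - g t != 0 by apply/eqP => /subr0_eq; exact: xg.
have E : (fun s : R => k (x - g s)) = (fun s => k (x.1 - (g s).1, x.2 - (g s).2)).
  by apply/funext => s; congr k; case: x {H xg z0} => a b; case: (g s).
have H1 : has_grad k (x.1 - (g t).1, x.2 - (g t).2) (k1 (x - g t)) (k2 (x - g t)).
  have -> : (x.1 - (g t).1, x.2 - (g t).2) = x - g t by case: x {H xg z0 E} => a b; case: (g t).
  exact: H.
rewrite E.
have := @has_grad_curve _ k (fun s => x.1 - (g s).1) (fun s => x.2 - (g s).2) t _ _ _ _ H1
  (dSub (dCst x.1 t) (gc_d1 gc t)) (dSub (dCst x.2 t) (gc_d2 gc t)).
by move/is_derive_eq; apply; ring.
Qed.

(** Differentiating [k (offset t - g s) * b s] in s brings out minus the tangential derivative of k;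
    the boundary terms vanish exponentially at both ends. *)
Lemma kernel_by_parts (k k1 k2 : R * R -> R) (b b' : R -> R) (c C B t : R) : 0 < c -> 0 <= C ->
  (forall z, z != 0 -> has_grad k z (k1 z) (k2 z)) ->
  (forall s, offset t <> g s) ->
  continuous (fun s : R => k1 (offset t - g s)) -> continuous (fun s : R => k2 (offset t - g s)) ->
  (forall s, [/\ `|k (offset t - g s)| <= C * expR (- c * `|t - s|),
    `|k1 (offset t - g s)| <= C * expR (- c * `|t - s|) & `|k2 (offset t - g s)| <= C * expR (- c * `|t - s|)]) ->
  (forall s, is_derive (s : R) (1 : R) b (b' s)) -> continuous b' ->
  (forall s, `|b s| <= B /\ `|b' s| <= B) ->
  Rintegral (leb R) setT (fun s => k1 (offset t - g s) * ((d s).1 * b s)) +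
  Rintegral (leb R) setT (fun s => k2 (offset t - g s) * ((d s).2 * b s)) =
  Rintegral (leb R) setT (fun s => k (offset t - g s) * b' s).
Proof.
move=> c0 C0 Hk off ck1 ck2 HC db cb' bB.
have B0 : 0 <= B by have [H _] := bB 0; exact: le_trans H.
have ck := cont_kernel Hk off.
have cb : continuous b by move=> s; exact: is_derive_continuous (db s).
have m (f : R -> R) : continuous f -> measurable_fun [set: measurableTypeR R] f.
  by move=> cf; have H := continuous_meas cf; exact: H.
have db1 s : `|(d s).1 * b s| <= B.
  rewrite normrM (le_trans (ler_wpM2r _ (enorm_fst _)))// (gc_unit gc) mul1r; exact: (bB s).1.
have db2 s : `|(d s).2 * b s| <= B.
  rewrite normrM (le_trans (ler_wpM2r _ (enorm_snd _)))// (gc_unit gc) mul1r; exact: (bB s).1.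
have cd1 : continuous (fun s => (d s).1 * b s) by apply: ctM => //; exact: gc_cd1 gc.
have cd2 : continuous (fun s => (d s).2 * b s) by apply: ctM => //; exact: gc_cd2 gc.
have k1C s : `|k1 (offset t - g s)| <= C * expR (- c * `|t - s|) by case: (HC s).
have k2C s : `|k2 (offset t - g s)| <= C * expR (- c * `|t - s|) by case: (HC s).
have kC s : `|k (offset t - g s)| <= C * expR (- c * `|t - s|) by case: (HC s).
have [i1 _] := exp_kernel_bounded c0 C0 (m _ ck1) k1C cd1 db1.
have [i2 _] := exp_kernel_bounded c0 C0 (m _ ck2) k2C cd2 db2.
have [i3 _] := exp_kernel_bounded c0 C0 (m _ ck) kC cb' (fun s => (bB s).2).
apply/esym/eqP; rewrite -subr_eq0; apply/eqP.
rewrite -RintegralD// -RintegralB//; last exact: (intbleD measurableT i1 i2).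
apply: (@Rint_derivative0 R (fun s => k (offset t - g s) * b s)).
- move=> s; have := dMul (is_derive_kernel s Hk off) (db s).
  by move/is_derive_eq; apply; ring.
- by apply: ctB; [exact: ctM|apply: ctD; exact: ctM].
- exact: (intbleB measurableT i3 (intbleD measurableT i1 i2)).
- apply: (@norm_cvg0 _ _ _ _ _ (fun s => C * B * expR (c * t) * expR (- c * s))).
    near=> s; rewrite normrM.
    have ts : t <= s by near: s; exact/nbhs_pinfty_ge/num_real.
    have -> : C * B * expR (c * t) * expR (- c * s) = C * expR (- c * `|t - s|) * B.
      rewrite ler0_norm ?subr_le0// -mulrA -expRD mulrAC; congr (_ * expR _ * _); ring.
    by apply: ler_pM => //; exact: (bB s).1.
  rewrite -[0](mulr0 (C * B * expR (c * t))); apply: cvgM; first exact: cvg_cst.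
  apply/cvgrPdist_le => x x0; have [S S0 HS] := expRN_small ler01 c0 x0.
  near=> s; have sS : S <= s by near: s; exact/nbhs_pinfty_ge/num_real.
  rewrite sub0r normrN ger0_norm ?expR_ge0//; apply: le_trans HS; rewrite mul1r.
  by rewrite ler_expR !mulNr lerN2 ler_wpM2l// ltW.
- apply/cvgNy_compNP => /=.
  apply: (@norm_cvg0 _ _ _ _ _ (fun s => C * B * expR (- c * t) * expR (- c * s))).
    near=> s; rewrite /= normrM.
    have ts : - t <= s by near: s; exact/nbhs_pinfty_ge/num_real.
    have -> : C * B * expR (- c * t) * expR (- c * s) = C * expR (- c * `|t - - s|) * B.
      rewrite opprK ger0_norm; last by lra.
      rewrite -mulrA -expRD mulrAC; congr (_ * expR _ * _); ring.
    by apply: ler_pM => //; exact: (bB (- s)).1.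
  rewrite -[0](mulr0 (C * B * expR (- c * t))); apply: cvgM; first exact: cvg_cst.
  apply/cvgrPdist_le => x x0; have [S S0 HS] := expRN_small ler01 c0 x0.
  near=> s; have sS : S <= s by near: s; exact/nbhs_pinfty_ge/num_real.
  rewrite sub0r normrN ger0_norm ?expR_ge0//; apply: le_trans HS; rewrite mul1r.
  by rewrite ler_expR !mulNr lerN2 ler_wpM2l// ltW.
Unshelve. all: by end_near. Qed.

Lemma par_kernel3 (k k1 k2 : R * R -> R) : decaying w k -> decaying w k1 -> decaying w k2 ->
  exists T c C : R, [/\ 0 < c, 0 <= C, forall t s, T <= t -> offset t <> g s &
  forall t s, T <= t -> [/\ `|k (offset t - g s)| <= C * expR (- c * `|t - s|),
    `|k1 (offset t - g s)| <= C * expR (- c * `|t - s|) & `|k2 (offset t - g s)| <= C * expR (- c * `|t - s|)]].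
Proof.
move=> d0 d1 d2; have [T [dl [dl0 sep]]] := par_sep.
have [T0 [c0 [C0 [c00 C00 HC0]]]] := par_kernel d0.
have [T1 [c1 [C1 [c10 C10 HC1]]]] := par_kernel d1.
have [T2 [c2 [C2 [c20 C20 HC2]]]] := par_kernel d2.
exists (Num.max (Num.max T T0) (Num.max T1 T2)), (Num.min c0 (Num.min c1 c2)), (C0 + C1 + C2).
split; rewrite ?lt_min ?c00 ?c10 ?c20 ?addr_ge0//.
  by move=> t s; rewrite !ge_max => /andP[/andP[tT _] _]; exact: (par_off dl0 sep tT).
move=> t s; rewrite !ge_max => /andP[/andP[tT tT0] /andP[tT1 tT2]].
have K (c C f : R) : 0 < c -> 0 <= C -> Num.min c0 (Num.min c1 c2) <= c -> C <= C0 + C1 + C2 ->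
    f <= C * expR (- c * `|t - s|) -> f <= (C0 + C1 + C2) * expR (- Num.min c0 (Num.min c1 c2) * `|t - s|).
  move=> cp Cp cm Cm /le_trans; apply; apply: ler_pM => //.
  by rewrite ler_expR !mulNr lerN2 ler_wpM2r.
split.
- by apply: (K c0 C0) => //; [rewrite ge_min lexx|lra|exact: HC0].
- by apply: (K c1 C1) => //; [rewrite !ge_min lexx orbT|lra|exact: HC1].
- by apply: (K c2 C2) => //; [rewrite !ge_min lexx !orbT|lra|exact: HC2].
Qed.

(** Here p and q stand for the real and imaginary parts of a density, in either order, with c = E or
    - E. The velocity of the parallel curve is replaced by its limit u, and u by the tangent at the
    integration point. Both errors vanish because the kernel localises s near t, where the tangent
    is close to u. What is left is a tangential derivative of the kernel, which integration by parts
    moves onto b. *)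
Lemma outgoing_layer (k k1 k2 : R * R -> R) (p q a b b' a2 b2 b2' : R -> R) (c : R) :
  decaying_kernel w k k1 k2 -> split_dens p a b b' -> split_dens q a2 b2 b2' ->
  b' t - c * b2 t @[t --> +oo] --> (0 : R) ->
  layer_pot g k1 p (offset t) * offset_d1 t + layer_pot g k2 p (offset t) * offset_d2 t - c * layer_pot g k q (offset t)
    @[t --> +oo] --> (0 : R).
Proof.
move=> dk [pE ia [B HB] db cb'] [qE ia2 [B2 HB2] db2 cb2'] lim; have [Hk dk0 t1 t2] := dk.
have [d1 [k11 [k12 [H1 _ _]]]] := t1; have [d2 [k21 [k22 [H2 _ _]]]] := t2.
have [T [c0 [C [c00 C0 off HC]]]] := par_kernel3 dk0 d1 d2.
have [u [D [eta [eta0 D0 Hu]]]] := tangent_limit.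
have [p1 p2] := par1_cvg eta0 Hu.
have B0 : 0 <= B by have [H _] := HB 0; exact: le_trans H.
have cb : continuous b by move=> s; exact: is_derive_continuous (db s).
have cb2 : continuous b2 by move=> s; exact: is_derive_continuous (db2 s).
have m (f : R -> R) : continuous f -> measurable_fun [set: measurableTypeR R] f.
  by move=> cf; have H := continuous_meas cf; exact: H.
have ck t : T <= t -> continuous (fun s : R => k (offset t - g s)) by move=> tT; apply: (cont_kernel Hk) => s; exact: off.
have ck1 t : T <= t -> continuous (fun s : R => k1 (offset t - g s)) by move=> tT; apply: (cont_kernel H1) => s; exact: off.
have ck2 t : T <= t -> continuous (fun s : R => k2 (offset t - g s)) by move=> tT; apply: (cont_kernel H2) => s; exact: off.
have kC t s : T <= t -> `|k (offset t - g s)| <= C * expR (- c0 * `|t - s|) by move=> /(HC t s)[].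
have k1C t s : T <= t -> `|k1 (offset t - g s)| <= C * expR (- c0 * `|t - s|) by move=> /(HC t s)[].
have k2C t s : T <= t -> `|k2 (offset t - g s)| <= C * expR (- c0 * `|t - s|) by move=> /(HC t s)[].
pose I f (h : R -> R) t := Rintegral (leb R) setT (fun s : R => f (offset t - g s) * h s).
have z0 : continuous (fun _ : R => 0 : R) by exact: ctC.
have zB : forall t : R, `|(fun _ : R => 0 : R) t| <= 0 by move=> t; rewrite normr0.
have zc : (fun _ : R => 0 : R) t @[t --> +oo] --> (0 : R) by exact: cvg_cst.
have La (f : R * R -> R) (h : R -> R) : (forall t s, T <= t -> `|f (offset t - g s)| <= C * expR (- c0 * `|t - s|)) ->
    (forall t, T <= t -> continuous (fun s : R => f (offset t - g s))) -> intble (leb R) setT h ->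
    I f h t @[t --> +oo] --> (0 : R).
  move=> fC cf ih; apply: (exp_conv_decay c00 C0 ih z0 zB zc) fC.
    by move=> s; rewrite addr0.
  by move=> t tT; apply: m; exact: cf.
have Lb (f : R * R -> R) (h : R -> R) (Bh : R) : (forall t s, T <= t -> `|f (offset t - g s)| <= C * expR (- c0 * `|t - s|)) ->
    (forall t, T <= t -> continuous (fun s : R => f (offset t - g s))) -> continuous h ->
    (forall s, `|h s| <= Bh) -> h t @[t --> +oo] --> (0 : R) ->
    I f h t @[t --> +oo] --> (0 : R).
  move=> fC cf ch hB h0; have iz : intble (leb R) setT (fun _ : R => 0 : R).
    by have := intbleZ 0 measurableT ia; under eq_fun do rewrite mul0r.
  apply: (exp_conv_decay c00 C0 iz ch hB h0) fC.
    by move=> s; rewrite add0r.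
  by move=> t tT; apply: m; exact: cf.
have Ia (f : R * R -> R) (h : R -> R) t : T <= t -> (forall t s, T <= t -> `|f (offset t - g s)| <= C * expR (- c0 * `|t - s|)) ->
    (forall t, T <= t -> continuous (fun s : R => f (offset t - g s))) -> intble (leb R) setT h ->
    intble (leb R) setT (fun s : R => f (offset t - g s) * h s).
  by move=> tT fC cf ih; apply: (exp_kernel_L1 c00 C0 (m _ (cf _ tT)) (fun s => fC t s tT)).
have Ib (f : R * R -> R) (h : R -> R) (Bh t : R) : T <= t -> (forall t s, T <= t -> `|f (offset t - g s)| <= C * expR (- c0 * `|t - s|)) ->
    (forall t, T <= t -> continuous (fun s : R => f (offset t - g s))) -> continuous h -> (forall s, `|h s| <= Bh) ->
    intble (leb R) setT (fun s : R => f (offset t - g s) * h s) /\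
    `|I f h t| <= C * Bh * Rintegral (leb R) setT (fun s : R => expR (- c0 * `|s|)).
  by move=> tT fC cf ch hB; apply: (exp_kernel_bounded c00 C0 (m _ (cf _ tT)) (fun s => fC t s tT)).
have bB s := (HB s).1; have b'B s := (HB s).2; have b2B s := (HB2 s).1.
have du1 s : `|u.1 - (d s).1| <= enorm u + 1.
  rewrite -(gc_unit gc s) (le_trans (ler_normB _ _))// lerD ?enorm_fst//.
have du2 s : `|u.2 - (d s).2| <= enorm u + 1.
  rewrite -(gc_unit gc s) (le_trans (ler_normB _ _))// lerD ?enorm_snd//.
(* The error of replacing the limit tangent u by the tangent at the integration point; it tends to 0
   because d tends to u. *)
pose h1 s := (u.1 - (d s).1) * b s; pose h2 s := (u.2 - (d s).2) * b s.
have h1B s : `|h1 s| <= (enorm u + 1) * B by rewrite normrM ler_pM.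
have h2B s : `|h2 s| <= (enorm u + 1) * B by rewrite normrM ler_pM.
have ch1 : continuous h1 by apply: ctM => //; apply: ctB; [exact: ctC|exact: gc_cd1 gc].
have ch2 : continuous h2 by apply: ctM => //; apply: ctB; [exact: ctC|exact: gc_cd2 gc].
have exp0 : D * expR (- eta * t) * B @[t --> +oo] --> (0 : R).
  rewrite -[0](mul0r B); apply: cvgM; last exact: cvg_cst.
  apply/cvgrPdist_le => x x0; have [S S0 HS] := expRN_small D0 eta0 x0.
  near=> s; have sS : S <= s by near: s; exact/nbhs_pinfty_ge/num_real.
  rewrite sub0r normrN ger0_norm ?mulr_ge0 ?expR_ge0//; apply: le_trans HS.
  by rewrite ler_wpM2l// ler_expR !mulNr lerN2 ler_wpM2l// ltW.
have h10 : h1 t @[t --> +oo] --> (0 : R).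
  apply: norm_cvg0 exp0; apply: nearW => t; rewrite normrM ler_pM//.
  by apply: le_trans (Hu t); rewrite distrC (enorm_fst (d t - u)).
have h20 : h2 t @[t --> +oo] --> (0 : R).
  apply: norm_cvg0 exp0; apply: nearW => t; rewrite normrM ler_pM//.
  by apply: le_trans (Hu t); rewrite distrC (enorm_snd (d t - u)).
pose h3 s := b' s - c * b2 s.
have ch3 : continuous h3 by apply: ctB => //; exact: ctZ.
have h3B s : `|h3 s| <= B + `|c| * B2.
  by rewrite (le_trans (ler_normB _ _))// lerD// normrM ler_wpM2l.
(* The quantity of the goal, regrouped for t >= T into pieces that vanish separately: the L^1 parts,
   the error in the velocity, the error in the tangent, and the residue [h3] of the oscillation. *)
pose E t := I k1 a t * offset_d1 t + I k2 a t * offset_d2 t + (I k1 b t * (offset_d1 t - u.1) + I k2 b t * (offset_d2 t - u.2))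
  + (I k1 h1 t + I k2 h2 t) + I k h3 t - c * I k a2 t.
have bdd0 (f : R * R -> R) (v : R -> R) : (forall t s, T <= t -> `|f (offset t - g s)| <= C * expR (- c0 * `|t - s|)) ->
    (forall t, T <= t -> continuous (fun s : R => f (offset t - g s))) -> v t @[t --> +oo] --> (0 : R) ->
    I f b t * v t @[t --> +oo] --> (0 : R).
  move=> fC cf v0.
  apply: (@norm_cvg0 _ _ _ _ _ (fun t => C * B * Rintegral (leb R) setT (fun s : R => expR (- c0 * `|s|)) * `|v t|)).
    near=> t; have tT : T <= t by near: t; exact/nbhs_pinfty_ge/num_real.
    by rewrite normrM ler_wpM2r//; have [] := Ib f b B t tT fC cf cb bB.
  rewrite -[0](mulr0 (C * B * Rintegral (leb R) setT (fun s : R => expR (- c0 * `|s|)))).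
  by apply: cvgM; [exact: cvg_cst|move/cvg_norm : v0; rewrite normr0].
have p10 : offset_d1 t - u.1 @[t --> +oo] --> (0 : R) by rewrite -(subrr u.1); apply: cvgB => //; exact: cvg_cst.
have p20 : offset_d2 t - u.2 @[t --> +oo] --> (0 : R) by rewrite -(subrr u.2); apply: cvgB => //; exact: cvg_cst.
have E0 : E t @[t --> +oo] --> 0 * u.1 + 0 * u.2 + (0 + 0) + (0 + 0) + 0 - c * 0.
  apply: cvgB; last by apply: cvgM; [exact: cvg_cst|exact: La].
  apply: cvgD; last exact: (Lb _ _ _ kC ck ch3 h3B lim).
  apply: cvgD; last by apply: cvgD; [exact: (Lb _ _ _ k1C ck1 ch1 h1B h10)|exact: (Lb _ _ _ k2C ck2 ch2 h2B h20)].
  apply: cvgD; last by apply: cvgD; [exact: (bdd0 _ _ k1C ck1 p10)|exact: (bdd0 _ _ k2C ck2 p20)].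
  by apply: cvgD; apply: cvgM => //; exact: La.
rewrite !mul0r mulr0 !addr0 subr0 in E0.
apply: cvg_trans E0; apply: near_eq_cvg; near=> t.
have tT : T <= t by near: t; exact/nbhs_pinfty_ge/num_real.
have lin (f : R * R -> R) (x y : R -> R) : intble (leb R) setT (fun s : R => f (offset t - g s) * x s) ->
   intble (leb R) setT (fun s : R => f (offset t - g s) * y s) ->
   I f (fun s => x s + y s) t = I f x t + I f y t.
  by move=> ix iy; rewrite /I -RintegralD//; apply: eq_Rintegral => s _; rewrite mulrDr.
have scl (f : R * R -> R) (x : R -> R) (y : R) : intble (leb R) setT (fun s : R => f (offset t - g s) * x s) ->
   I f (fun s => y * x s) t = y * I f x t.
  by move=> ix; rewrite /I -RintegralZl//; apply: eq_Rintegral => s _; rewrite mulrCA.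
have LE (f : R * R -> R) (x y z : R -> R) : (forall s, x s = y s + z s) -> layer_pot g f x (offset t) = I f (fun s => y s + z s) t.
  by move=> xE; apply: eq_Rintegral => s _; rewrite xE.
have Ik1a := Ia k1 a t tT k1C ck1 ia; have Ik2a := Ia k2 a t tT k2C ck2 ia.
have Ika2 := Ia k a2 t tT kC ck ia2.
have [Ik1b _] := Ib k1 b B t tT k1C ck1 cb bB; have [Ik2b _] := Ib k2 b B t tT k2C ck2 cb bB.
have [Ikb2 _] := Ib k b2 B2 t tT kC ck cb2 b2B; have [Ikb' _] := Ib k b' B t tT kC ck cb' b'B.
have cd1 : continuous (fun s => (d s).1 * b s) by apply: ctM => //; exact: gc_cd1 gc.
have cd2 : continuous (fun s => (d s).2 * b s) by apply: ctM => //; exact: gc_cd2 gc.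
have db1 s : `|(d s).1 * b s| <= B.
  by rewrite normrM (le_trans (ler_wpM2r _ (enorm_fst _)))// (gc_unit gc) mul1r.
have db2' s : `|(d s).2 * b s| <= B.
  by rewrite normrM (le_trans (ler_wpM2r _ (enorm_snd _)))// (gc_unit gc) mul1r.
have [Id1 _] := Ib k1 _ B t tT k1C ck1 cd1 db1; have [Id2 _] := Ib k2 _ B t tT k2C ck2 cd2 db2'.
have [Ih1 _] := Ib k1 h1 _ t tT k1C ck1 ch1 h1B; have [Ih2 _] := Ib k2 h2 _ t tT k2C ck2 ch2 h2B.
have bp := kernel_by_parts c00 C0 Hk (fun s => off t s tT) (ck1 _ tT) (ck2 _ tT) (fun s => HC t s tT) db cb' HB.
have S1 : I k1 h1 t + I k1 (fun s => (d s).1 * b s) t = u.1 * I k1 b t.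
  rewrite -lin// -scl//; congr (Rintegral _ _ _); apply/funext => s; rewrite /h1; congr (_ * _); ring.
have S2 : I k2 h2 t + I k2 (fun s => (d s).2 * b s) t = u.2 * I k2 b t.
  rewrite -lin// -scl//; congr (Rintegral _ _ _); apply/funext => s; rewrite /h2; congr (_ * _); ring.
have S3 : I k h3 t = I k b' t - c * I k b2 t.
  have i' : intble (leb R) setT (fun s : R => k (offset t - g s) * (- c * b2 s)).
    by have := intbleZ (- c) measurableT Ikb2; under eq_fun do rewrite mulrCA.
  by rewrite -mulNr -scl// -lin//; congr (Rintegral _ _ _); apply/funext => s; rewrite /h3 mulNr.
rewrite (LE _ _ _ _ pE) (LE k2 _ _ _ pE) (LE _ _ _ _ qE) !lin// /E S3.
have bp' : I k1 (fun s => (d s).1 * b s) t + I k2 (fun s => (d s).2 * b s) t = I k b' t by exact: bp.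
rewrite -bp'.
have -> : I k1 h1 t = u.1 * I k1 b t - I k1 (fun s => (d s).1 * b s) t by rewrite -S1; ring.
have -> : I k2 h2 t = u.2 * I k2 b t - I k2 (fun s => (d s).2 * b s) t by rewrite -S2; ring.
ring.
Unshelve. all: by end_near. Qed.

End Outgoing.

(** * Jump relations *)

Section PunctureMeasurability.
Variable R : realType.

Lemma meas_except1 (f : R -> R) (a : R) : (forall t, t != a -> {for t, continuous f}) ->
  measurable_fun [set: measurableTypeR R] f.
Proof.
move=> cf.
have E : [set: measurableTypeR R] = `]-oo, a[%classic `|` ([set a] `|` `]a, +oo[%classic).
  apply/seteqP; split => // x _; rewrite /= !in_itv/= andbT.
  by case: (ltgtP x a); [left|right; right|right; left].
have op (A : set R) : open A -> (forall x, A x -> x != a) -> measurable_fun (A : set (measurableTypeR R)) f.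
  move=> oA Aa; have H : measurable_fun A f.
    by apply: open_continuous_measurable_fun => // x /set_mem Ax; apply: cf; exact: Aa.
  exact: H.
rewrite E; apply/measurable_funU => //; first exact: measurableU.
split.
  by apply: op; [exact: interval_open|move=> x; rewrite /= in_itv/= => xa; rewrite lt_eqF].
apply/measurable_funU => //; split; first exact: measurable_fun_set1.
by apply: op; [exact: interval_open|move=> x; rewrite /= in_itv/= andbT => xa; rewrite gt_eqF].
Qed.

Lemma Rint_dct_near d (T : measurableType d) (mu : {measure set T -> \bar R}) (D : set T)
    (f_ : nat -> T -> R) (f h : T -> R) : measurable D ->
  (\forall n \near \oo, measurable_fun D (f_ n) /\ forall x, D x -> `|f_ n x| <= h x) ->
  measurable_fun D f ->
  {ae mu, forall x, D x -> f_ n x @[n --> \oo] --> f x} -> intble mu D h ->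
  Rintegral mu D (f_ n) @[n --> \oo] --> Rintegral mu D f.
Proof.
move=> mD [N _ HN] mf cv ih; rewrite -(cvg_shiftn N).
apply: (@Rint_dct _ _ _ mu D (fun n => f_ (n + N)%N) f h) => //.
- by move=> n; have [] := HN (n + N)%N (leq_addl _ _).
- by apply: filterS cv => x + Dx => /(_ Dx); rewrite -(cvg_shiftn N).
- by move=> n x Dx; have [_] := HN (n + N)%N (leq_addl _ _); exact.
Qed.

(** At the coincident parameter the kernel has a default value and no bound is available, so that
    point is removed as a null set. *)
Lemma Rint_dct_except (D : set (measurableTypeR R)) (a : R) (f_ : nat -> R -> R) (f h : R -> R) :
  measurable D ->
  (\forall n \near \oo, measurable_fun D (f_ n) /\ forall x, D x -> x != a -> `|f_ n x| <= h x) ->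
  measurable_fun D f -> (forall x, D x -> x != a -> f_ n x @[n --> \oo] --> f x) ->
  intble (leb R) D h ->
  Rintegral (leb R) D (f_ n) @[n --> \oo] --> Rintegral (leb R) D f.
Proof.
move=> mD H mf cv ih; pose D' : set (measurableTypeR R) := D `\ a.
have mD' : measurable (D' : set (measurableTypeR R)) by apply: measurableD.
have DD : D' `<=` D by move=> x [].
have E (k : R -> R) : measurable_fun D k -> Rintegral (leb R) D' k = Rintegral (leb R) D k.
  move=> spinor_of; rewrite /Rintegral; congr fine; apply: (integral_setD1 (f := EFin \o k)) => //.
  by apply/measurable_EFinP; exact: measurable_funS spinor_of.
rewrite -E//; have cvD : Rintegral (leb R) D' (f_ n) @[n --> \oo] --> Rintegral (leb R) D' f.
  have K := @Rint_dct_near _ (measurableTypeR R) (leb R) D' f_ f h mD'.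
  apply: K => //.
  - apply: filterS H => n [mn Hn]; split; first exact: measurable_funS mn.
    by move=> x [Dx /eqP xa]; exact: Hn.
  - exact: measurable_funS mf.
  - by apply: aeW => x [Dx /eqP xa]; exact: cv.
  - exact: intble_sub ih.
apply: cvg_trans cvD; apply: near_eq_cvg; apply: filterS H => n [mn _]; exact: E.
Qed.

Lemma Rint_splitC d (T : measurableType d) (mu : {measure set T -> \bar R}) (D : set T) (f : T -> R) :
  measurable D -> intble mu setT f ->
  Rintegral mu setT f = Rintegral mu D f + Rintegral mu setT (f \_ (~` D)).
Proof.
move=> mD fi; rewrite -Rintegral_mkcond -Rintegral_setU//.
- by rewrite setUv.
- exact: measurableC.
- by rewrite setUv.
- by apply/disj_setPS; rewrite setICr.
Qed.

Lemma open_setC_itv (a b : R) : open (~` `[a, b]%classic).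
Proof. by apply: closed_openC; exact: interval_closed. Qed.

Lemma nrm_cont (d : R -> R * R) (t : R) : {for t, continuous (fun t => (d t).1)} ->
  {for t, continuous (fun t => (d t).2)} -> {for t, continuous (rot90 d)}.
Proof.
move=> c1 c2; have c2' : - (d x).2 @[x --> t] --> - (d t).2 by apply: cvgN; exact: c2.
exact: (cvg_pair c2' c1).
Qed.

End PunctureMeasurability.

(** * Inversion of the plane and the model integral of the jump *)

Section Inversion.
Variable R : realType.
Implicit Types z y : R * R.

(** z / |z|^2 is inversion in the unit circle, which changes distances exactly by the factor 1 /
    (|z| |y|); each component is bounded by the norm. *)
Lemma inversion_le z y : z != 0 -> y != 0 ->
  `|z.1 / (z.1 ^+ 2 + z.2 ^+ 2) - y.1 / (y.1 ^+ 2 + y.2 ^+ 2)| <= enorm (z - y) / (enorm z * enorm y) /\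
  `|z.2 / (z.1 ^+ 2 + z.2 ^+ 2) - y.2 / (y.1 ^+ 2 + y.2 ^+ 2)| <= enorm (z - y) / (enorm z * enorm y).
Proof.
move=> z0 y0; have rz := enorm_gt0 z0; have ry := enorm_gt0 y0.
pose v : R * R := (z.1 / (z.1 ^+ 2 + z.2 ^+ 2) - y.1 / (y.1 ^+ 2 + y.2 ^+ 2),
  z.2 / (z.1 ^+ 2 + z.2 ^+ 2) - y.2 / (y.1 ^+ 2 + y.2 ^+ 2)).
suff E : enorm v = enorm (z - y) / (enorm z * enorm y).
  by rewrite -E; split; [exact: (enorm_fst v)|exact: (enorm_snd v)].
have qz : 0 < z.1 ^+ 2 + z.2 ^+ 2 by rewrite -sqr_enorm exprn_gt0.
have qy : 0 < y.1 ^+ 2 + y.2 ^+ 2 by rewrite -sqr_enorm exprn_gt0.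
apply/eqP; rewrite -(@eqrXn2 _ 2) ?enorm_ge0 ?divr_ge0 ?mulr_ge0 ?enorm_ge0//.
apply/eqP; rewrite expr_div_n exprMn !sqr_enorm /v /=.
by field; rewrite !lt0r_neq0.
Qed.

Lemma unit_inversion_le z : z != 0 ->
  `|z.1 / (z.1 ^+ 2 + z.2 ^+ 2)| <= (enorm z)^-1 /\ `|z.2 / (z.1 ^+ 2 + z.2 ^+ 2)| <= (enorm z)^-1.
Proof.
move=> z0; have rz := enorm_gt0 z0; rewrite -sqr_enorm.
have E (x : R) : `|x| <= enorm z -> `|x / enorm z ^+ 2| <= (enorm z)^-1.
  move=> xz; rewrite normrM normrV ?unitfE ?expf_neq0 ?lt0r_neq0// (ger0_norm (sqr_ge0 (enorm z))).
  by rewrite ler_pdivrMr ?exprn_gt0// expr2 mulKf ?lt0r_neq0.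
by split; apply: E; [exact: enorm_fst|exact: enorm_snd].
Qed.

(** A primitive is n atan (s / h) - (t / 2) ln (h^2 + s^2), and the logarithm cancels on a symmetric
    interval. As h -> 0 the value tends to pi n or - pi n according to the sign of h. *)
Lemma poisson_integral (h dl n t : R) : h != 0 -> 0 < dl ->
  Rintegral (leb R) `[(- dl), dl] (fun s : R => (h * n - s * t) / (h ^+ 2 + s ^+ 2)) = n * (2 * atan (dl / h)).
Proof.
move=> h0 dl0; have q0 (s : R) : 0 < h ^+ 2 + s ^+ 2.
  by rewrite ltr_wpDr ?sqr_ge0// exprn_even_gt0.
pose F (s : R) := n * atan (h^-1 * s) - t / 2 * ln (h ^+ 2 + s ^+ 2).
have dF (s : R) : is_derive s (1 : R) F ((h * n - s * t) / (h ^+ 2 + s ^+ 2)).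
  have H1 := dScale n (dComp (is_derive1_atan (h^-1 * s)) (dScale h^-1 (dId s))).
  have q1 : 0 < h ^+ 2 + s * s by rewrite -expr2.
  have H2 := dScale (t / 2) (@dComp R (@ln R) (fun s => h ^+ 2 + s * s) s _ _ (is_derive1_ln q1)
    (dAdd (dCst (h ^+ 2) s) (dMul (dId s) (dId s)))).
  have -> : F = (fun s => n * atan (h^-1 * s) - t / 2 * ln (h ^+ 2 + s * s)).
    by apply/funext => y; rewrite /F expr2.
  move: (dSub H1 H2) => /is_derive_eq; apply.
  have -> : (1 + (h^-1 * s) ^+ 2)^-1 = h ^+ 2 / (h ^+ 2 + s ^+ 2).
    have e1 : 1 + (h^-1 * s) ^+ 2 != 0 by rewrite lt0r_neq0// ltr_wpDr ?sqr_ge0.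
    have e2 := lt0r_neq0 (q0 s).
    apply: (mulfI e1); rewrite divff// exprMn exprVn; field; by rewrite h0 e2.
  rewrite -expr2; have e2 := lt0r_neq0 (q0 s); field; by rewrite h0 e2.
rewrite (@Rint_FTC2 R F _ (- dl) dl _ (fun s _ => dF s)); first last.
- move=> s _; apply: ctM => [|y].
    apply: ctB; first exact: ctC.
    by apply: ctM; [move=> y; exact: cvg_id|exact: ctC].
  apply: cvgV; first by rewrite lt0r_neq0.
  by apply: cvgD; [exact: cvg_cst|exact: exprn_continuous].
- by rewrite ge0_cp// ltW.
rewrite /F sqrrN mulrN atanN (mulrC h^-1); ring.
Qed.

End Inversion.

(** * Traces of layer potentials along sequences *)

Section JumpRelation.
Variables (R : realType) (w : R).
Hypothesis w0 : 0 < w.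
Variables g d e : R -> R * R.
Hypothesis gc : good_curve g d e.

(** The vector [zt] is [z] for the tangent line instead of the curve; orthonormality of tangent and
    normal gives its norm. The interval is short enough for the quadratic error to be at most |s| /
    2, hence at most half of the norm of [zt]. *)
Lemma near_geometry : exists dl M : R, [/\ 0 < dl, 0 < M & forall t h s, `|s| <= dl ->
  let z := g t + h *: rot90 d t - g (t + s) in let zt := h *: rot90 d t - s *: d t in
  [/\ enorm (z - zt) <= M * s ^+ 2, enorm zt <= 2 * enorm z, `|s| <= enorm zt, `|h| <= enorm zt &
      zt.1 ^+ 2 + zt.2 ^+ 2 = h ^+ 2 + s ^+ 2]].
Proof.
have [M [M0 HM]] := gc_taylor gc.
exists (4 * M)^-1, (2 * M); split; rewrite ?invr_gt0 ?mulr_gt0//.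
move=> t h s sd z zt.
have [T1 T2 _ _] := HM t s.
have q : zt.1 ^+ 2 + zt.2 ^+ 2 = h ^+ 2 + s ^+ 2.
  have := sqr_enorm (d t); rewrite (gc_unit gc) expr1n /zt /rot90 /= /GRing.scale/= => E.
  have -> : (h * - (d t).2 - s * (d t).1) ^+ 2 + (h * (d t).1 - s * (d t).2) ^+ 2 =
    (h ^+ 2 + s ^+ 2) * ((d t).1 ^+ 2 + (d t).2 ^+ 2) by ring.
  by rewrite -E mulr1.
have sz : `|s| <= enorm zt.
  rewrite -(@ler_pXn2r _ 2) ?nnegrE ?enorm_ge0// sqr_enorm real_normK ?num_real// q.
  by rewrite lerDr sqr_ge0.
have hz : `|h| <= enorm zt.
  rewrite -(@ler_pXn2r _ 2) ?nnegrE ?enorm_ge0// sqr_enorm real_normK ?num_real// q.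
  by rewrite lerDl sqr_ge0.
have dz : enorm (z - zt) <= 2 * M * s ^+ 2.
  apply: le_trans (enorm_le_sum _) _; rewrite /z /zt /= /GRing.scale/=.
  have -> : (g t).1 + h * - (d t).2 - (g (t + s)).1 - (h * - (d t).2 - s * (d t).1) =
     - ((g (t + s)).1 - (g t).1 - s * (d t).1) by ring.
  have -> : (g t).2 + h * (d t).1 - (g (t + s)).2 - (h * (d t).1 - s * (d t).2) =
     - ((g (t + s)).2 - (g t).2 - s * (d t).2) by ring.
  by rewrite !normrN; lra.
split => //.
have := enorm_sub zt z; rewrite (enormB zt z).
have : 2 * M * s ^+ 2 <= `|s| / 2.
  rewrite -[s ^+ 2]real_normK ?num_real// expr2 mulrA ler_pdivlMr// mulrAC ler_piMl//.
  have := ler_wpM2l (ltW M0) sd.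
  have -> : M * (4 * M)^-1 = 4^-1 by field; rewrite lt0r_neq0.
  lra.
lra.
Qed.

Lemma C1_local (p : R -> R) (t0 dl : R) : C1fun p -> exists P : R, 0 <= P /\
  forall t s, `|t - t0| <= dl -> `|s| <= dl -> `|p (t + s)| <= P /\ `|p (t + s) - p t| <= P * `|s|.
Proof.
move=> C1p; have cp := C1fun_continuous C1p; have [p' [dp cp']] := C1p.
have bd (f : R -> R) : continuous f -> exists B, 0 <= B /\ forall x, `|x - t0| <= 2 * dl -> `|f x| <= B.
  move=> cf; have [dl0|dl0] := leP 0 dl; last first.
    by exists 0; split=> // x H; have := normr_ge0 (x - t0); lra.
  have ab : t0 - 2 * dl <= t0 + 2 * dl by lra.
  have [c cab H] := EVT_max ab (continuous_subspaceT (ctnorm cf)).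
  exists `|f c|; split=> // x xt; apply: H; rewrite in_itv/=.
  by move: xt; rewrite ler_norml; lra.
have [B1 [B10 H1]] := bd _ cp; have [B2 [B20 H2]] := bd _ cp'.
exists (B1 + B2); split; first exact: addr_ge0.
move=> t s td sd; split.
  apply: (@le_trans _ _ B1); last by rewrite lerDl.
  apply: H1; rewrite (_ : t + s - t0 = (t - t0) + s); last by ring.
  by rewrite (le_trans (ler_normD _ _))//; lra.
have E : t + s - t = s by ring.
have := @mean_value_le R p p' t (t + s) B2 (fun x _ => dp x).
rewrite E => H; apply: le_trans (H _) _; last by rewrite ler_wpM2r// lerDr.
move=> x xs; apply: H2; rewrite (_ : x - t0 = (x - t) + (t - t0)); last by ring.
by rewrite (le_trans (ler_normD _ _))//; lra.
Qed.

(** Since the curve is simple, parameters at distance dl / 2 from t0 stay at distance ka from the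
    limit point, so the kernel is regular there and one majorant serves all x n close to g t0. *)
Lemma far_part (k k1 k2 : R * R -> R) (p : R -> R) (t0 dl : R) (x : nat -> R * R) (t : nat -> R) :
  0 < dl -> (forall z, z != 0 -> has_grad k z (k1 z) (k2 z)) -> decaying w k -> dens p ->
  x n @[n --> \oo] --> g t0 -> t n @[n --> \oo] --> t0 ->
  Rintegral (leb R) setT ((fun s : R => k (x n - g s) * p s) \_ (~` `[t n - dl, t n + dl])) @[n --> \oo] -->
  Rintegral (leb R) setT ((fun s : R => k (g t0 - g s) * p s) \_ (~` `[t0 - dl, t0 + dl])) /\
  intble (leb R) setT ((fun s : R => k (g t0 - g s) * p s) \_ (~` `[t0 - dl, t0 + dl])).
Proof.
move=> dl0 Hk dk dp xc tc; have cp := dens_continuous dp; have [_ [a [b [b' parts_of]]]] := dp.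
have dl20 : 0 < dl / 2 by rewrite divr_gt0.
have [|ka [ka0 sep]] := sep_away gc dl20 (x := g t0) (t0 := t0).
  by move=> s ds /(gc_inj gc) E; move: ds; rewrite E subrr normr0; lra.
have ka20 : 0 < ka / 2 by rewrite divr_gt0.
have [Ck HCk] := dk _ ka20.
have [c [C [c0 C0 HC]]] := exp_layer_bound w0 gc (g t0).
have wc0 : 0 < w * c by rewrite mulr_gt0.
have [B [_ HB]] := dens_weight wc0 cp parts_of.
pose CK := `|Ck|; pose dom (s : R) := `|CK * expR (w * (ka / 2)) * C * expR (- (w * c) * `|s - 0|) * p s|.
have idom : intble (leb R) setT dom.
  have c' : continuous (fun s : R => `|Ck| * expR (w * (ka / 2)) * C * expR (- (w * c) * `|s - 0|)).
    apply: ctZ; apply: ctcomp; first exact: continuous_expR.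
    by apply: ctZ; apply: ctnorm; apply: ctB; [move=> y; exact: cvg_id|exact: ctC].
  have m' : measurable_fun [set: measurableTypeR R] (fun s : R => `|Ck| * expR (w * (ka / 2)) * C * expR (- (w * c) * `|s - 0|)).
    by have H := continuous_meas c'; exact: H.
  have [] := HB 0 (`|Ck| * expR (w * (ka / 2)) * C) _ m' _ _.
  - by rewrite !mulr_ge0 ?expR_ge0.
  - by move=> s; rewrite ger0_norm// !mulr_ge0 ?expR_ge0.
  - by move=> /(intble_norm measurableT).
have bound y u s : enorm (y - g t0) <= ka / 2 -> `|u - t0| <= dl / 2 -> (~` `[u - dl, u + dl]%classic) s ->
    ka / 2 <= enorm (y - g s) /\ `|k (y - g s) * p s| <= dom s.
  move=> yx ut; rewrite /= in_itv/= => us.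
  have st : dl / 2 <= `|s - t0|.
    rewrite leNgt; apply/negP => st; apply: us.
    by move: ut st; rewrite ler_norml ltr_norml; clear -gc w0; lra.
  have s1 := sep _ st; have tr := enorm_tri (g t0) y (g s); rewrite (enormB (g t0) y) in tr.
  have ys : ka / 2 <= enorm (y - g s) by move: s1 tr yx; clear -gc w0; lra.
  split=> //; rewrite /dom !normrM ler_wpM2r// (ger0_norm C0) (ger0_norm (expR_ge0 _)) normr_id (ger0_norm (expR_ge0 _)).
  apply: le_trans (HCk _ ys) _; apply: (@le_trans _ _ (`|Ck| * expR (- w * enorm (y - g s)))).
    by rewrite ler_wpM2r ?expR_ge0// ler_norm.
  rewrite -!mulrA ler_wpM2l//; apply: (@le_trans _ _ (expR (w * (ka / 2)) * expR (- w * enorm (g t0 - g s)))).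
    rewrite -expRD ler_expR !mulNr -mulrBr -mulrN ler_wpM2l ?(ltW w0)//; lra.
  by rewrite ler_wpM2l ?expR_ge0.
have mI u : measurable (~` `[u - dl, u + dl]%classic : set (measurableTypeR R)) by apply: measurableC; exact: measurable_itv.
have spinor_of y u : enorm (y - g t0) <= ka / 2 -> `|u - t0| <= dl / 2 ->
    measurable_fun [set: measurableTypeR R] ((fun s : R => k (y - g s) * p s) \_ (~` `[u - dl, u + dl])).
  move=> yx ut.
  have op := @open_setC_itv R (u - dl) (u + dl).
  have H : measurable_fun (~` `[u - dl, u + dl]%classic : set R) (fun s : R => k (y - g s) * p s).
    apply: open_continuous_measurable_fun => // s /set_mem us.
    apply: cvgM; last exact: cp.
    apply: (continuous_comp (f := fun s => y - g s)).
      by apply: cvgB; [exact: cvg_cst|exact: gc_ct gc s].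
    apply: has_grad_continuous; apply: Hk; apply: enorm_pos_neq0.
    by have [H _] := bound y u s yx ut us; exact: lt_le_trans H.
  have H' : measurable_fun (~` `[u - dl, u + dl]%classic : set (measurableTypeR R)) (fun s : R => k (y - g s) * p s) by exact: H.
  exact: (iffLR (measurable_restrictT _ (mI u)) H').
have z1 : enorm (g t0 - g t0) <= ka / 2 by rewrite subrr enorm0 ltW.
have z2 : `|t0 - t0| <= dl / 2 by rewrite subrr normr0 ltW.
have dm y u : enorm (y - g t0) <= ka / 2 -> `|u - t0| <= dl / 2 -> forall s,
    `|((fun s : R => k (y - g s) * p s) \_ (~` `[u - dl, u + dl])) s| <= dom s.
  move=> yx ut s; rewrite patchE; case: ifPn => [/set_mem us|_]; last by rewrite normr0 normr_ge0.
  exact: (bound y u s yx ut us).2.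
split; last by apply: (intble_dom measurableT (spinor_of _ _ z1 z2) idom) => s _; exact: dm.
apply: (@Rint_dct_near _ _ _ (leb R) setT _ _ dom) => //.
- near=> n.
  have xn : enorm (x n - g t0) <= ka / 2.
    rewrite (le_trans (enorm_le_supnorm _))// -ler_pdivlMl// distrC.
    near: n; move/cvgrPdist_le : xc; apply; rewrite mulr_gt0//.
  have tn : `|t n - t0| <= dl / 2 by rewrite distrC; near: n; move/cvgrPdist_le : tc; exact.
  by split; [exact: spinor_of|move=> s _; exact: dm].
- exact: spinor_of.
(* The excised interval moves with t n, so its indicator converges at every s except possibly at the
   two limiting endpoints. *)
- apply: (ae_except2 (a := t0 - dl) (b := t0 + dl)) => s s1 s2 _.
  rewrite [X in _ --> X]patchE; case: ifPn => [/set_mem st|].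
    have := st; rewrite /= in_itv/= => /negP; rewrite negb_and -!ltNge => st'.
    have cv : k (x n - g s) * p s @[n --> \oo] --> k (g t0 - g s) * p s.
      apply: cvgM; last exact: cvg_cst.
      have [pos _] := bound _ _ s z1 z2 st.
      have ck : {for (g t0 - g s), continuous k}.
        by apply: has_grad_continuous; apply: Hk; apply: enorm_pos_neq0; exact: lt_le_trans pos.
      apply: (cvg_comp (fun n => x n - g s) k _ ck).
      by apply: cvgB => //; exact: cvg_cst.
    case/orP : st' => st'; apply: cvg_trans cv; apply: near_eq_cvg; near=> n; rewrite patchE ifT// inE/= in_itv/=;
        apply/negP; rewrite negb_and -!ltNge; apply/orP; [left|right].
      by rewrite ltrBrDr; near: n; apply: (cvgr_gt t0 tc); rewrite -ltrBrDr.
    by rewrite -ltrBrDr; near: n; apply: (cvgr_lt t0 tc); rewrite ltrBrDr.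
  rewrite notin_setE /= in_itv/= => /contrapT/andP[sa sb].
  have sa' : t0 - dl < s by rewrite lt_neqAle eq_sym s1.
  have sb' : s < t0 + dl by rewrite lt_neqAle s2.
  apply: cvg_near_cst; near=> n; rewrite patchE ifF//; apply/negbTE.
  apply/negP => /set_mem; rewrite /= in_itv/=; apply; apply/andP; split.
    rewrite lerBlDr ltW//; near: n; apply: (cvgr_lt t0 tc); by rewrite -ltrBlDr.
  rewrite -lerBlDr ltW//; near: n; apply: (cvgr_gt t0 tc); by rewrite ltrBlDr.
Unshelve. all: by end_near. Qed.


Definition proj (b : bool) (z : R * R) := if b then z.2 else z.1.

Lemma continuous_near (k : R * R -> R) (p : R -> R) (x : R * R) (t s : R) :
  {for (x - g (t + s)), continuous k} -> continuous p ->
  {for s, continuous (fun s => k (x - g (t + s)) * p (t + s))}.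
Proof.
move=> ck cp.
have cts : {for s, continuous (fun s : R => t + s)}.
  by apply: ctD; [exact: ctC|move=> y; exact: cvg_id].
apply: cvgM; last by apply: (continuous_comp cts); exact: cp.
apply: (continuous_comp (f := fun s => x - g (t + s))); last exact: ck.
by apply: cvgB; [exact: cvg_cst|apply: (continuous_comp cts); exact: gc_ct gc _].
Qed.

Lemma meas_near_curve (k : R * R -> R) (p : R -> R) (t0 : R) (D : set (measurableTypeR R)) :
  measurable D -> (forall z, z != 0 -> {for z, continuous k}) -> continuous p ->
  measurable_fun D (fun s : R => k (g t0 - g (t0 + s)) * p (t0 + s)).
Proof.
move=> mD ck cp; apply: measurable_funTS.
have H : measurable_fun [set: measurableTypeR R] (fun s : R => k (g t0 - g (t0 + s)) * p (t0 + s)).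
  apply: (@meas_except1 R _ 0) => s s0; apply: continuous_near => //; apply: ck.
  by rewrite subr_eq0; apply/eqP => /(gc_inj gc) E; move/eqP: s0; apply; move: E; clear -gc w0; lra.
exact: H.
Qed.

Lemma cvg_near (k : R * R -> R) (p : R -> R) (t0 s : R) (t h : nat -> R) :
  {for (g t0 - g (t0 + s)), continuous k} -> continuous p ->
  t n @[n --> \oo] --> t0 -> h n @[n --> \oo] --> 0 ->
  k (g (t n) + h n *: rot90 d (t n) - g (t n + s)) * p (t n + s) @[n --> \oo] -->
  k (g t0 - g (t0 + s)) * p (t0 + s).
Proof.
move=> ck cp tc hc.
have ts : t n + s @[n --> \oo] --> t0 + s by apply: cvgD => //; exact: cvg_cst.
apply: cvgM; last by apply: (cvg_comp _ _ ts); exact: cp.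
apply: (cvg_comp (fun n => g (t n) + h n *: rot90 d (t n) - g (t n + s)) k _ ck).
apply: cvgB; last by apply: (cvg_comp _ _ ts); exact: gc_ct gc _.
rewrite -[X in _ --> X]addr0; apply: cvgD; first by apply: (cvg_comp _ _ tc); exact: gc_ct gc _.
rewrite -(scale0r (rot90 d t0)); apply: cvgZ => //.
by apply: (cvg_comp _ _ tc); apply: nrm_cont; [exact: gc_cd1 gc _|exact: gc_cd2 gc _].
Qed.

Lemma near_weak_bound (p : R -> R) (t0 : R) : dens p -> exists dl : R, 0 < dl /\ exists C : R,
  forall t h s, `|t - t0| <= dl -> `|s| <= dl -> s != 0 ->
   g t + h *: rot90 d t - g (t + s) != 0 /\
   `|KA w (g t + h *: rot90 d t - g (t + s)) * p (t + s)| <= C * (Num.sqrt `|s|)^-1.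
Proof.
move=> [C1p _]; have [dl [M [dl0 M0 geo]]] := near_geometry.
have [P [P0 HP]] := C1_local t0 dl C1p; have [CK HK] := KA_sing w0.
exists dl; split=> //; exists (2 * `|CK| * P) => t h s td sd s0.
have [_ G2 G3 _ _] := geo t h s sd.
have [p1 _] := HP t s td sd.
move: G2 G3; set z := g t + _ - _ => G2 G3.
have sz : `|s| <= 2 * enorm z by exact: le_trans G2.
have s0' : 0 < `|s| by rewrite normr_gt0.
have z0 : 0 < enorm z by move: sz s0'; clear -gc w0; lra.
have zn := enorm_pos_neq0 z0.
split=> //; rewrite normrM; apply: (@le_trans _ _ (2 * `|CK| * (Num.sqrt `|s|)^-1 * P)); last by rewrite mulrAC.
apply: ler_pM => //; apply: le_trans (HK z zn) _.
apply: (@le_trans _ _ (`|CK| / Num.sqrt (enorm z))).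
  by rewrite ler_wpM2r ?invr_ge0 ?sqrtr_ge0// ler_norm.
have ss0 : 0 < Num.sqrt `|s| by rewrite (sqrtr_gt0 `|s|).
have sz0 : 0 < Num.sqrt (enorm z) by rewrite (sqrtr_gt0 (enorm z)).
rewrite (mulrC 2) -mulrA ler_wpM2l// ler_pdivlMr// mulrC ler_pdivrMr//.
rewrite -(@ler_pXn2r _ 2) ?nnegrE ?(ltW ss0) ?mulr_ge0 ?(ltW sz0)// exprMn.
rewrite (sqr_sqrtr (ltW s0')) (sqr_sqrtr (ltW z0)).
by apply: le_trans sz _; rewrite ler_pM2r// expr2; clear -gc w0; lra.
Qed.

Lemma split_near (f : R -> R) (t0 dl : R) : intble (leb R) `[(- dl), dl] (fun s => f (t0 + s)) ->
  intble (leb R) setT (f \_ (~` `[t0 - dl, t0 + dl])) ->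
  intble (leb R) setT f /\
  Rintegral (leb R) setT f = Rintegral (leb R) `[(- dl), dl] (fun s => f (t0 + s)) +
    Rintegral (leb R) setT (f \_ (~` `[t0 - dl, t0 + dl])).
Proof.
move=> i1 i2; have mI : measurable (`[t0 - dl, t0 + dl]%classic : set (measurableTypeR R)) by exact: measurable_itv.
have [] := @Rint_itv_shift R (- t0) (t0 - dl) (t0 + dl) (fun s => f (t0 + s)).
  by rewrite (_ : t0 - dl - t0 = - dl) 1?(_ : t0 + dl - t0 = dl)//; ring.
have -> : (fun t => f (t0 + (t - t0))) = f by apply/funext => t; congr f; ring.
rewrite (_ : t0 - dl - t0 = - dl) 1?(_ : t0 + dl - t0 = dl); [|by ring|by ring].
move=> i3 <-; have i4 : intble (leb R) setT f.
  have := intbleD measurableT ((intble_mkcond _ mI).1 i3) i2.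
  congr intble; apply/funext => t; rewrite !patchE in_setC.
  by case: (t \in _) => /=; rewrite ?addr0 ?add0r.
by split=> //; exact: Rint_splitC.
Qed.

Lemma split_near_off (k k1 k2 : R * R -> R) (p : R -> R) (t dl : R) (x : R * R) : 0 < dl ->
  (forall z, z != 0 -> has_grad k z (k1 z) (k2 z)) -> decaying w k -> dens p -> (forall s, x <> g s) ->
  layer_pot g k p x = Rintegral (leb R) `[(- dl), dl] (fun s => k (x - g (t + s)) * p (t + s)) +
    Rintegral (leb R) setT ((fun s => k (x - g s) * p s) \_ (~` `[t - dl, t + dl])).
Proof.
move=> dl0 Hk dk dp xg; have i1 := layer_bound w0 gc Hk dk dp xg.
have mI : measurable (`[t - dl, t + dl]%classic : set (measurableTypeR R)) by exact: measurable_itv.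
have i2 : intble (leb R) `[t - dl, t + dl] (fun s : R => k (x - g s) * p s) by exact: intble_sub i1.
have i3 : intble (leb R) `[(- dl), dl] (fun s : R => k (x - g (t + s)) * p (t + s)).
  have [] := @Rint_itv_shift R t (- dl) dl (fun s : R => k (x - g s) * p s).
    by rewrite (addrC (- dl)) (addrC dl).
  move=> i3 _; have -> // : (fun s : R => k (x - g (t + s)) * p (t + s)) = (fun s => k (x - g (s + t)) * p (s + t)).
  by apply/funext => s; rewrite (addrC t).
have [||_] := @split_near (fun s : R => k (x - g s) * p s) t dl => //.
apply/(intble_mkcond _ _).1; first exact: measurableC.
by apply: intble_sub i1 => //; exact: measurableC.
Qed.

(** Near the foot point the kernel is at most C |s|^(-1/2) uniformly in the height, so dominated
    convergence applies across the curve and there is no jump. *)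
Lemma layer_trace_weak (p : R -> R) (t0 : R) (t h : nat -> R) : dens p ->
  t n @[n --> \oo] --> t0 -> h n @[n --> \oo] --> 0 ->
  (forall n s, g (t n) + h n *: rot90 d (t n) <> g s) ->
  layer_pot g (KA w) p (g (t n) + h n *: rot90 d (t n)) @[n --> \oo] --> layer_pot g (KA w) p (g t0).
Proof.
move=> dp tc hc off; have [dl [dl0 [C HC]]] := near_weak_bound t0 dp.
have [Hk dk _ _] := dker_KA w0; have cp := dens_continuous dp.
have ck z : z != 0 -> {for z, continuous (KA w)} by move=> z0; exact: has_grad_continuous (Hk z z0).
set x := fun n => g (t n) + h n *: rot90 d (t n).
have xc : x n @[n --> \oo] --> g t0.
  rewrite /x -[X in _ --> X]addr0; apply: cvgD; first by apply: (cvg_comp _ _ tc); exact: gc_ct gc _.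
  rewrite -(scale0r (rot90 d t0)); apply: cvgZ => //.
  by apply: (cvg_comp _ _ tc); apply: nrm_cont; [exact: gc_cd1 gc _|exact: gc_cd2 gc _].
have [farc ifar] := far_part dl0 Hk dk dp xc tc.
have mI : measurable (`[(- dl), dl]%classic : set (measurableTypeR R)) by exact: measurable_itv.
have ih : intble (leb R) `[(- dl), dl] (fun s : R => C * (Num.sqrt `|s|)^-1) by apply: intbleZ => //; exact: intble_invsqrt.
have m0 := meas_near_curve t0 mI ck cp.
have z0 : `|t0 - t0| <= dl by rewrite subrr normr0 ltW.
have inear : intble (leb R) `[(- dl), dl] (fun s : R => KA w (g t0 - g (t0 + s)) * p (t0 + s)).
  (* The added constant covers s = 0, where the bound reads 0 because the inverse of 0 is 0. *)
  have ih' : intble (leb R) `[(- dl), dl] (fun s : R => C * (Num.sqrt `|s|)^-1 + `|KA w 0 * p t0|).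
    by apply: intbleD => //; apply: intble_continuous_itv => s _; exact: cvg_cst.
  apply: (intble_dom mI m0 ih') => s; rewrite /= in_itv/= => sI.
  have [->|s0] := eqVneq s 0.
    by rewrite addr0 subrr normr0 sqrtr0 invr0 mulr0 add0r.
  have sd : `|s| <= dl by rewrite ler_norml.
  have [_] := HC t0 0 s z0 sd s0; rewrite scale0r addr0 => H.
  by rewrite (le_trans H)// lerDl.
have [_ E] := split_near inear ifar; have {E}-> : layer_pot g (KA w) p (g t0) = _ := E.
under eq_cvg => n do rewrite (split_near_off (t n) dl0 Hk dk dp (off n)).
apply: cvgD; last exact: farc.
apply: (@Rint_dct_except R `[(- dl), dl] 0 _ _ (fun s : R => C * (Num.sqrt `|s|)^-1)) => //.
- near=> n.
  have tn : `|t n - t0| <= dl by rewrite distrC; near: n; move/cvgrPdist_le : tc; exact.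
  have hn : h n != 0 by apply/eqP => h0; have := off n (t n); rewrite h0 scale0r addr0.
  split; last first.
    by move=> s; rewrite /= in_itv/= => sI s0; have [|_] := HC (t n) (h n) s tn _ s0 => //; rewrite ler_norml.
  apply: continuous_itv_meas => s sI; apply: continuous_near => //; apply: ck.
  by rewrite subr_eq0; apply/eqP; exact: off.
- move=> s; rewrite /= in_itv/= => sI s0; apply: cvg_near => //; apply: ck.
  have [|] := HC t0 0 s z0 _ s0; first by rewrite ler_norml.
  by rewrite scale0r addr0.
Unshelve. all: by end_near. Qed.

Definition K_partial b := if b then K2 w else K1 w.

Lemma proj_inversion b z y : z != 0 -> y != 0 ->
  `|proj b z / (z.1 ^+ 2 + z.2 ^+ 2) - proj b y / (y.1 ^+ 2 + y.2 ^+ 2)| <= enorm (z - y) / (enorm z * enorm y) /\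
  `|proj b z / (z.1 ^+ 2 + z.2 ^+ 2)| <= (enorm z)^-1.
Proof.
by move=> z0 y0; have [] := inversion_le z0 y0; have [] := unit_inversion_le z0; case: b.
Qed.

(** K_i behaves like - z_i / |z|^2. The second term removes that singularity in the flat model: the
    curve is replaced by its tangent and the density is frozen at t. *)
Definition bracket b (p : R -> R) (t h s : R) :=
  K_partial b (g t + h *: rot90 d t - g (t + s)) * p (t + s) +
  p t * ((h * proj b (rot90 d t) - s * proj b (d t)) / (h ^+ 2 + s ^+ 2)).

(** The three summands of the bound answer three replacements: of the kernel by its singular part,
    of p (t + s) by p t (the Lipschitz gain |s| against 1 / |z|), and of the curve by its tangent
    (an error of order s^2 against |z| |zt| >= s^2 / 2). *)
Lemma near_strong_bound b (p : R -> R) (t0 : R) : dens p -> exists dl : R, 0 < dl /\ exists C : R,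
  forall t h s, `|t - t0| <= dl -> `|s| <= dl -> s != 0 ->
   g t + h *: rot90 d t - g (t + s) != 0 /\ `|bracket b p t h s| <= C.
Proof.
move=> [C1p _]; have [dl [M [dl0 M0 geo]]] := near_geometry.
have [P [P0 HP]] := C1_local t0 dl C1p.
exists dl; split=> //; exists (w * P + 2 * P + P * (2 * M)) => t h s td sd s0.
have [G1 G2 G3 _ G5] := geo t h s sd.
have [p1 p2] := HP t s td sd.
have z0' : `|0 : R| <= dl by rewrite normr0 ltW.
have [p3 _] := HP t 0 td z0'; rewrite addr0 in p3.
have -> : bracket b p t h s = K_partial b (g t + h *: rot90 d t - g (t + s)) * p (t + s) +
   p t * (proj b (h *: rot90 d t - s *: d t) / ((h *: rot90 d t - s *: d t).1 ^+ 2 + (h *: rot90 d t - s *: d t).2 ^+ 2)).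
  by rewrite G5 /bracket /proj; case: (b).
move: G1 G2 G3 {G5}; set z := g t + _ - _; set zt := h *: _ - _ => G1 G2 G3.
have s0' : 0 < `|s| by rewrite normr_gt0.
have t0' : 0 < enorm zt by exact: lt_le_trans G3.
have z0 : 0 < enorm z by move: G2 t0'; clear -gc w0; lra.
have zn := enorm_pos_neq0 z0; have tn := enorm_pos_neq0 t0'.
split=> //.
have [I1 I2] := proj_inversion b zn tn.
have KS : `|K_partial b z + proj b z / (z.1 ^+ 2 + z.2 ^+ 2)| <= w.
  by rewrite /K_partial /proj; case: (b); [exact: K2_sing|exact: K1_sing].
move: I1 I2 KS; set fz := proj b z / _; set ft := proj b zt / _ => I1 I2 KS.
have -> : K_partial b z * p (t + s) + p t * ft = (K_partial b z + fz) * p (t + s) - fz * (p (t + s) - p t) - p t * (fz - ft) by ring.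
rewrite (le_trans (ler_normB _ _))// lerD//.
  rewrite (le_trans (ler_normB _ _))// lerD//; first by rewrite normrM ler_pM.
  rewrite normrM; apply: (@le_trans _ _ ((enorm z)^-1 * (P * `|s|))); first exact: ler_pM.
  rewrite mulrC ler_pdivrMr//; have -> : 2 * P * enorm z = P * (2 * enorm z) by rewrite mulrCA mulrA.
  by rewrite ler_wpM2l//; exact: le_trans G2.
rewrite normrM ler_pM//; apply: le_trans I1 _.
rewrite ler_pdivrMr ?mulr_gt0//; apply: le_trans G1 _.
rewrite (mulrC 2) -!mulrA ler_wpM2l ?(ltW M0)// mulrA -[s ^+ 2]real_normK ?num_real// expr2.
apply: ler_pM => //; exact: le_trans G2.
Qed.

(** The bracket converges boundedly to its value at height 0, where the flat term is odd in s; PV is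
    thus a principal value. It is fixed before the side eps because both one-sided limits must share
    it. *)
Lemma layer_trace_strong b (p : R -> R) (t0 : R) : dens p -> exists PV : R,
  forall (eps : R) (t h : nat -> R), eps = 1 \/ eps = -1 ->
  t n @[n --> \oo] --> t0 -> h n @[n --> \oo] --> 0 -> (forall n, 0 < eps * h n) ->
  (forall n s, g (t n) + h n *: rot90 d (t n) <> g s) ->
  layer_pot g (K_partial b) p (g (t n) + h n *: rot90 d (t n)) @[n --> \oo] --> PV - eps * pi * proj b (rot90 d t0) * p t0.
Proof.
move=> dp; have [dl [dl0 [C HC]]] := near_strong_bound b t0 dp.
have [k1 [k2 [Hk dk _ _]]] : exists k1 k2, decaying_kernel w (K_partial b) k1 k2.
  by rewrite /K_partial; case: (b); do 2 eexists; [exact: dker_K2|exact: dker_K1].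
have cp := dens_continuous dp.
have ck z : z != 0 -> {for z, continuous (K_partial b)} by move=> z0; exact: has_grad_continuous (Hk z z0).
pose far0 := Rintegral (leb R) setT ((fun s : R => K_partial b (g t0 - g s) * p s) \_ (~` `[t0 - dl, t0 + dl])).
exists (Rintegral (leb R) `[(- dl), dl] (bracket b p t0 0) + far0) => eps t h Heps tc hc hpos off.
set x := fun n => g (t n) + h n *: rot90 d (t n).
have nc : rot90 d (t n) @[n --> \oo] --> rot90 d t0.
  by apply: (cvg_comp _ _ tc); apply: nrm_cont; [exact: gc_cd1 gc _|exact: gc_cd2 gc _].
have xc : x n @[n --> \oo] --> g t0.
  rewrite /x -[X in _ --> X]addr0; apply: cvgD; first by apply: (cvg_comp _ _ tc); exact: gc_ct gc _.
  by rewrite -(scale0r (rot90 d t0)); apply: cvgZ.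
have [farc _] := far_part dl0 Hk dk dp xc tc.
have mI : measurable (`[(- dl), dl]%classic : set (measurableTypeR R)) by exact: measurable_itv.
have z0 : `|t0 - t0| <= dl by rewrite subrr normr0 ltW.
have ep : eps != 0 by case: Heps => ->; rewrite ?oppr_eq0 oner_eq0.
have h0 n : h n != 0 by apply/eqP => E; have := hpos n; rewrite E mulr0 ltxx.
have pc : p (t n) @[n --> \oo] --> p t0 by apply: (cvg_comp _ _ tc); exact: cp.
have prc (v : R -> R * R) : continuous (fun t => (v t).1) -> continuous (fun t => (v t).2) ->
    proj b (v (t n)) @[n --> \oo] --> proj b (v t0).
  move=> c1 c2; rewrite /proj; case: (b); first exact: (cvg_comp t (fun t => (v t).2) tc (c2 t0)).
  exact: (cvg_comp t (fun t => (v t).1) tc (c1 t0)).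
have pn : proj b (rot90 d (t n)) @[n --> \oo] --> proj b (rot90 d t0).
  by apply: prc; [apply: ctN; exact: gc_cd2 gc|exact: gc_cd1 gc].
have pd : proj b (d (t n)) @[n --> \oo] --> proj b (d t0).
  by apply: prc; [exact: gc_cd1 gc|exact: gc_cd2 gc].
have cflat n (s : R) : {for s, continuous (fun s : R => p (t n) * ((h n * proj b (rot90 d (t n)) - s * proj b (d (t n))) / (h n ^+ 2 + s ^+ 2)))}.
  apply: cvgM; first exact: cvg_cst.
  apply: cvgM.
    by apply: cvgB; [exact: cvg_cst|apply: cvgM; [exact: cvg_id|exact: cvg_cst]].
  apply: cvgV; first by rewrite lt0r_neq0// ltr_wpDr ?sqr_ge0// exprn_even_gt0//= h0.
  by apply: cvgD; [exact: cvg_cst|exact: exprn_continuous].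
have cnear n (s : R) : {for s, continuous (fun s : R => K_partial b (x n - g (t n + s)) * p (t n + s))}.
  by apply: continuous_near => //; apply: ck; rewrite subr_eq0; apply/eqP; exact: off.
have Enear n : Rintegral (leb R) `[(- dl), dl] (fun s : R => K_partial b (x n - g (t n + s)) * p (t n + s)) =
    Rintegral (leb R) `[(- dl), dl] (bracket b p (t n) (h n)) - p (t n) * (proj b (rot90 d (t n)) * (2 * atan (dl / h n))).
  rewrite -(@poisson_integral R (h n) dl (proj b (rot90 d (t n))) (proj b (d (t n))))//.
  have i1 := intble_continuous_itv (a := - dl) (b := dl) (fun s _ => cnear n s).
  have i2 := intble_continuous_itv (a := - dl) (b := dl) (fun s _ => cflat n s).
  have i3 : intble (leb R) `[(- dl), dl] (fun s : R => (h n * proj b (rot90 d (t n)) - s * proj b (d (t n))) / (h n ^+ 2 + s ^+ 2)).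
    apply: intble_continuous_itv => s _.
    apply: cvgM.
      by apply: cvgB; [exact: cvg_cst|apply: cvgM; [exact: cvg_id|exact: cvg_cst]].
    apply: cvgV; first by rewrite lt0r_neq0// ltr_wpDr ?sqr_ge0// exprn_even_gt0//= h0.
    by apply: cvgD; [exact: cvg_cst|exact: exprn_continuous].
  have e3 : Rintegral (leb R) `[(- dl), dl] (fun s : R => p (t n) * ((h n * proj b (rot90 d (t n)) - s * proj b (d (t n))) / (h n ^+ 2 + s ^+ 2))) = _
    := RintegralZl (p (t n)) mI i3.
  have e4 : Rintegral (leb R) `[(- dl), dl] (bracket b p (t n) (h n)) = _ := RintegralD mI i1 i2.
  by apply/eqP; rewrite eq_sym subr_eq -e3; apply/eqP.
(* The only place where the side matters: [dl / h n] tends to infinity with the sign of eps. *)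
have atc : atan (dl / h n) @[n --> \oo] --> eps * (pi / 2).
  have ehc : eps * h n @[n --> \oo] --> 0 by rewrite -(mulr0 eps); apply: cvgM => //; exact: cvg_cst.
  have ec : atan (dl / (eps * h n)) @[n --> \oo] --> (pi / 2 : R).
    apply: (cvg_comp (fun n => dl / (eps * h n)) (@atan R) _ (@cvgy_atan R)).
    apply/cvgryPge => A; have [A0|A0] := leP A 0.
      by near=> n; rewrite ler_pdivlMr ?hpos// (le_trans _ (ltW dl0))// mulr_le0_ge0// ltW.
    near=> n; rewrite ler_pdivlMr ?hpos// -(ler_pdivlMl _ _ A0).
    by near: n; apply: (cvgr_le 0 ehc); rewrite mulr_gt0 ?invr_gt0.
  have -> : (fun n => atan (dl / h n)) = (fun n => eps * atan (dl / (eps * h n))).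
    apply/funext => n; case: Heps => ->; first by rewrite !mul1r.
    by rewrite !mulN1r invrN mulrN atanN opprK.
  by apply: cvgM => //; exact: cvg_cst.
under eq_cvg => n do rewrite (split_near_off (t n) dl0 Hk dk dp (off n)) Enear.
have -> : Rintegral (leb R) `[(- dl), dl] (bracket b p t0 0) + far0 - eps * pi * proj b (rot90 d t0) * p t0 =
   Rintegral (leb R) `[(- dl), dl] (bracket b p t0 0) - p t0 * (proj b (rot90 d t0) * (2 * (eps * (pi / 2)))) + far0.
  by field.
apply: cvgD; last exact: farc.
apply: cvgB; last first.
  by apply: cvgM => //; apply: cvgM => //; apply: cvgM => //; exact: cvg_cst.
have mb0 : measurable_fun (`[(- dl), dl] : set (measurableTypeR R)) (bracket b p t0 0).
  apply: measurable_funD; first by rewrite scale0r addr0; exact: meas_near_curve.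
  apply: measurable_funTS.
  have H : measurable_fun [set: measurableTypeR R] (fun s : R => p t0 * ((0 * proj b (rot90 d t0) - s * proj b (d t0)) / (0 ^+ 2 + s ^+ 2))).
    apply: (@meas_except1 R _ 0) => s s0.
    apply: cvgM; first exact: cvg_cst.
    apply: cvgM.
      by apply: cvgB; [exact: cvg_cst|apply: cvgM; [exact: cvg_id|exact: cvg_cst]].
    apply: cvgV; first by rewrite expr0n/= add0r expf_neq0.
    by apply: cvgD; [exact: cvg_cst|exact: exprn_continuous].
  exact: H.
apply: (@Rint_dct_except R `[(- dl), dl] 0 _ _ (fun=> C)) => //.
- near=> n.
  have tn : `|t n - t0| <= dl by rewrite distrC; near: n; move/cvgrPdist_le : tc; exact.
  split; last first.
    by move=> s; rewrite /= in_itv/= => sI s0; have [|_] := HC (t n) (h n) s tn _ s0 => //; rewrite ler_norml.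
  by apply: continuous_itv_meas => s sI; apply: cvgD; [exact: cnear|exact: cflat].
- move=> s; rewrite /= in_itv/= => sI s0; apply: cvgD.
    rewrite /bracket scale0r addr0; apply: cvg_near => //; apply: ck.
    have [|] := HC t0 0 s z0 _ s0; first by rewrite ler_norml.
    by rewrite scale0r addr0.
  apply: cvgM => //; apply: cvgM.
    apply: cvgB; first by apply: cvgM.
    by apply: cvgM => //; exact: cvg_cst.
  apply: cvgV; first by rewrite expr0n/= add0r expf_neq0.
  apply: cvgD; last exact: cvg_cst.
  exact: (cvg_comp h (fun y : R => y ^+ 2) hc (@exprn_continuous _ 2 0)).
- by apply: intble_continuous_itv => s _; exact: cvg_cst.
Unshelve. all: by end_near. Qed.

End JumpRelation.

(** * Foot points on a curve *)

Section Foot.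
Variable R : realType.
Variables g d e : R -> R * R.
Hypothesis gc : good_curve g d e.

Lemma orthonormal_split (t : R) (v : R * R) :
  v = (v.1 * (d t).1 + v.2 * (d t).2) *: d t + (v.1 * (rot90 d t).1 + v.2 * (rot90 d t).2) *: rot90 d t.
Proof.
have := sqr_enorm (d t); rewrite (gc_unit gc) expr1n => E.
case: v => v1 v2; apply/pair_equal_spec; rewrite /rot90 /= /GRing.scale/=.
split; [rewrite -[LHS]mulr1|rewrite -[LHS]mulr1]; rewrite E; ring.
Qed.

(** The squared distance is minimised over the parameters within dl of t0. Chords there are at least
    half as long as the parameter interval, so the minimiser c satisfies |c - t0| <= 4 rho <= dl / 2
    and is interior; the vanishing derivative says that x - g c is normal. *)
Lemma foot t0 : exists r0 : R, 0 < r0 /\ forall x, enorm (x - g t0) <= r0 -> exists t1 h : R,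
  [/\ x = g t1 + h *: rot90 d t1, `|t1 - t0| <= 4 * enorm (x - g t0) & `|h| <= enorm (x - g t0)].
Proof.
have [M [M0 HM]] := gc_taylor gc.
pose dl := (2 * M)^-1; have dl0 : 0 < dl by rewrite invr_gt0 mulr_gt0.
have near s : `|s| <= dl -> `|s| <= 2 * enorm (g (t0 + s) - g t0).
  move=> sd; have [_ _ _ H] := HM t0 s.
  have : M * s ^+ 2 <= `|s| / 2.
    rewrite -[s ^+ 2]real_normK ?num_real// expr2 mulrA ler_pdivlMr// mulrAC ler_piMl//.
    have := ler_wpM2l (ltW M0) sd.
    have -> : M * dl = 2^-1 by rewrite /dl; field; rewrite lt0r_neq0.
    by clear -gc; lra.
  by move: H; clear -gc; lra.
exists (dl / 8); split; first by rewrite divr_gt0.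
move=> x; set rho := enorm (x - g t0) => xr.
pose phi (t : R) := (x.1 - (g t).1) * (x.1 - (g t).1) + (x.2 - (g t).2) * (x.2 - (g t).2).
have phiE t : phi t = enorm (x - g t) ^+ 2 by rewrite sqr_enorm /phi -!expr2.
have dphi (t : R) : is_derive t (1 : R) phi
   (((x.1 - (g t).1) * (0 - (d t).1) + (0 - (d t).1) * (x.1 - (g t).1)) +
    ((x.2 - (g t).2) * (0 - (d t).2) + (0 - (d t).2) * (x.2 - (g t).2))).
  have D1 := dSub (dCst x.1 t) (gc_d1 gc t); have D2 := dSub (dCst x.2 t) (gc_d2 gc t).
  apply: is_derive_eq (dAdd (dMul D1 D1) (dMul D2 D2)) _; ring.
have ab : t0 - dl <= t0 + dl by move: dl0; clear -gc; lra.
have cphi : {within `[t0 - dl, t0 + dl], continuous phi}.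
  by apply: continuous_subspaceT => t; exact: is_derive_continuous (dphi t).
have [c cI Hc] := EVT_min ab cphi.
have cr : enorm (x - g c) <= rho.
  rewrite -(@ler_pXn2r _ 2) ?nnegrE ?enorm_ge0// -!phiE; apply: Hc.
  by rewrite in_itv/=; move: dl0; clear -gc; lra.
have c4 : `|c - t0| <= 4 * rho.
  have := near (c - t0); rewrite (_ : t0 + (c - t0) = c); last by ring.
  move=> H; have : `|c - t0| <= dl by move: cI; rewrite in_itv/= ler_norml; clear -gc; lra.
  move/H => {}H; apply: le_trans H _; have := enorm_tri (g c) x (g t0).
  by rewrite (enormB (g c) x) -/rho; move: cr; clear -gc; lra.
have cin : c \in `]t0 - dl, t0 + dl[%R.
  by rewrite in_itv/=; move: c4 xr dl0; rewrite ler_norml; clear -gc; lra.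
have D0 : is_derive (c : R) (1 : R) phi 0.
  apply: (derive1_at_min ab) => //.
  by move=> t; rewrite in_itv/= => tI; apply: Hc; rewrite in_itv/=; move: tI; clear -gc; lra.
pose v := x - g c.
have vd : v.1 * (d c).1 + v.2 * (d c).2 = 0.
  have [_ E1] := dphi c; have [_ E2] := D0; rewrite E1 in E2.
  by move: E2; rewrite /v /=; clear -gc; lra.
exists c, (v.1 * (rot90 d c).1 + v.2 * (rot90 d c).2); split => //.
  have := orthonormal_split c v; rewrite vd scale0r add0r => <-; by rewrite /v addrC subrK.
by have := dot_le v (rot90 d c); rewrite (enorm_nrm gc) mulr1 => /le_trans; apply.
Qed.

Lemma foot_seq (t0 r : R) (u : nat -> R * R) : 0 < r -> u n @[n --> \oo] --> g t0 ->
  exists (N : nat) (t h : nat -> R), [/\ forall n, u (n + N)%N = g (t n) + h n *: rot90 d (t n),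
   t n @[n --> \oo] --> t0, h n @[n --> \oo] --> 0 & forall n, `|t n - t0| <= r /\ `|h n| <= r].
Proof.
move=> r0 uc; have [r1 [r10 Hf]] := foot t0.
pose r2 := Num.min r1 (r / 4).
have r20 : 0 < r2 by rewrite lt_min r10 divr_gt0.
have r22 : 0 < r2 / 2 by rewrite divr_gt0.
have m1 : r2 <= r1 by rewrite ge_min lexx.
have m2 : r2 <= r / 4 by rewrite ge_min lexx orbT.
have /cvgrPdist_le/(_ _ r22)[N _ HN] := uc.
have uN n : enorm (u (n + N)%N - g t0) <= r2.
  rewrite (le_trans (enorm_le_supnorm _))// -ler_pdivlMl// mulrC distrC.
  by apply: HN; rewrite /= leq_addl.
have ex n : exists th : R * R, [/\ u (n + N)%N = g th.1 + th.2 *: rot90 d th.1,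
    `|th.1 - t0| <= 4 * enorm (u (n + N)%N - g t0) & `|th.2| <= enorm (u (n + N)%N - g t0)].
  by have [t [h H]] := Hf _ (le_trans (uN n) m1); exists (t, h).
have [th Hth] := boolp.choice ex.
have ec : enorm (u (n + N)%N - g t0) @[n --> \oo] --> (0 : R).
  suff ec0 : enorm (u n - g t0) @[n --> \oo] --> (0 : R) by rewrite -(cvg_shiftn N) in ec0.
  rewrite -[X in _ --> X](@enorm0 R) -(subrr (g t0)).
  apply: (cvg_comp (fun n => u n - g t0) (@enorm R)); last exact: continuous_enorm.
  by apply: cvgB => //; exact: cvg_cst.
exists N, (fun n => (th n).1), (fun n => (th n).2); split.
- by move=> n; have [] := Hth n.
- apply/subr_cvg0; apply: (norm_cvg0 _ (h := fun n => 4 * enorm (u (n + N)%N - g t0))).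
    by apply: nearW => n; have [] := Hth n.
  by rewrite -(mulr0 4); apply: cvgM => //; exact: cvg_cst.
- apply: (norm_cvg0 _ (h := fun n => enorm (u (n + N)%N - g t0))) => //; by apply: nearW => n; have [] := Hth n.
- move=> n; have [_ H1 H2] := Hth n; have := uN n.
  by move: H1 H2 m2 r0; clear -gc; split; lra.
Qed.

End Foot.

(** * Regions on the two sides of a curve *)

Section Sides.
Variables (R : realType) (gamma : nat -> R -> R * R) (Omega : nat -> set (R * R)).
Hypothesis HI : interfaces gamma Omega.

Definition off_curves (x : R * R) := forall j t, (1 <= j <= 2)%N -> x <> gamma j t.

Lemma offGE x : off_curves x <-> exists2 k, (k <= 2)%N & Omega k x.
Proof.
have C := Omega_cover HI; split.
  move=> o; have : (\bigcup_(k in `I_3) Omega k) x.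
    by rewrite C => -[[t _ E]|[t _ E]]; [exact: (o 1%N t)|exact: (o 2%N t)].
  by case=> k /= k3 kx; exists k.
move=> [k k2 kx]; have : (\bigcup_(k in `I_3) Omega k) x by exists k.
rewrite C => H j t hj E; apply: H; rewrite E.
have : j = 1%N \/ j = 2%N by case: j hj {E} => [|[|[|]]]//; auto.
by case=> ->; [left|right]; exists t.
Qed.

Lemma Omega_off k x : (k <= 2)%N -> Omega k x -> off_curves x.
Proof. by move=> k2 kx; apply/offGE; exists k. Qed.

Lemma Omega_uniq k l x : (k <= 2)%N -> (l <= 2)%N -> Omega k x -> Omega l x -> k = l.
Proof. by move=> k2 l2 kx lx; apply: (Omega_disjoint HI) => //; exists x. Qed.

(** The image of the path is connected. Its part in [Omega k] is open, and also closed, since the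
    other regions cover the rest of the path and are open. *)
Lemma path_region k (c : R -> R * R) : (k <= 2)%N -> continuous c ->
  (forall s, 0 <= s <= 1 -> off_curves (c s)) -> Omega k (c 0) -> Omega k (c 1).
Proof.
move=> k2 cc off c0.
have cI : connected (c @` `[0, 1]%classic).
  apply: connected_continuous_connected; last exact: continuous_subspaceT.
  by apply/connected_intervalP; exact: interval_is_interval.
pose A := c @` `[0, 1]%classic.
have c1A : A (c 1) by exists 1 => //; rewrite /= in_itv/= ler01 lexx.
suff E : A `&` Omega k = A by have : A (c 1) by []; rewrite -E => -[].
apply: cI.
- by exists (c 0); split=> //; exists 0 => //; rewrite /= in_itv/= ler01 lexx.
- by exists (Omega k) => //; exact: (Omega_open HI).
- exists (~` (\bigcup_(l in [set l | (l <= 2)%N /\ l <> k]) Omega l)).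
    by apply: open_closedC; apply: bigcup_open => l [l2 _]; exact: (Omega_open HI).
  apply/seteqP; split => x [xA].
    by move=> kx; split=> // -[l [l2 lk] lx]; apply: lk; exact: Omega_uniq lx kx.
  move=> H; split => //; case: xA => s sI sx; move: sI; rewrite /= in_itv/= => /off; rewrite sx.
  move=> /offGE[l l2 lx]; have [<-//|lk] := eqVneq l k.
  by exfalso; apply: H; exists l => //; split=> //; apply/eqP.
Qed.

(** The other curve and the distant part of the same curve keep a positive distance from
    [gamma j t0]. Close in parameter, meeting the curve would force |h| <= 0 by [near_geometry]. *)
Lemma near_off j (t0 : R) : (1 <= j <= 2)%N -> exists r : R, 0 < r /\ forall t h,
  `|t - t0| <= r -> `|h| <= r -> h != 0 -> off_curves (gamma j t + h *: normal gamma j t).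
Proof.
move=> hj; have gc := interface_good_curve HI hj.
have hl : (1 <= 3 - j <= 2)%N by case: j hj gc => [|[|[|]]].
have gl := interface_good_curve HI hl.
have [dl [M [dl0 M0 geo]]] := near_geometry gc.
have dl20 : 0 < dl / 2 by rewrite divr_gt0.
have disj i s : (1 <= i <= 2)%N -> i != j -> gamma j t0 <> gamma i s.
  move=> hi ij E; have := curves_disjoint HI; apply/eqP; apply/set0P; exists (gamma j t0).
  have : j = 1%N \/ j = 2%N by case: (j) hj => [|[|[|]]]//; auto.
  have : i = 1%N \/ i = 2%N by case: (i) hi => [|[|[|]]]//; auto.
  case=> Ei; case=> Ej; move: ij E; rewrite Ei Ej ?eqxx// => _ E.
    by split; [rewrite E; exists s|exists t0].
  by split; [exists t0|rewrite E; exists s].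
have [|ka [ka0 sep]] := sep_away gc dl20 (x := gamma j t0) (t0 := t0).
  by move=> s ds /(gc_inj gc) E; move: ds; rewrite E subrr normr0 leNgt dl20.
have [|kb [kb0 sepb]] := sep_all gl (x := gamma j t0).
  by move=> s; apply: disj => //; case: (j) hj => [|[|[|]]].
have kmin : 0 < Num.min ka kb / 2 by rewrite divr_gt0// lt_min ka0.
have cg : (fun t => enorm (gamma j t - gamma j t0)) t @[t --> t0] --> (0 : R).
  rewrite -[X in _ --> X](@enorm0 R) -(subrr (gamma j t0)).
  apply: (cvg_comp (fun t => gamma j t - gamma j t0) (@enorm R)); last exact: continuous_enorm.
  by apply: cvgB; [exact: gc_ct gc t0|exact: cvg_cst].
have /(cvgr_lt 0)/(_ _ kmin)[r1 /= r10 H1] := cg.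
exists (Num.min (Num.min (r1 / 2) (dl / 2)) (Num.min ka kb / 4)); split.
  by rewrite !lt_min !divr_gt0// lt_min ka0.
move=> t h; rewrite !le_min => /andP[/andP[t1 t2] _] /andP[_ h3] h0.
have tn : enorm (gamma j t - gamma j t0) < Num.min ka kb / 2.
  by apply: H1; rewrite /= distrC (le_lt_trans t1)// gtr_pMr// invf_lt1 ?ltr1n.
have xn : enorm (gamma j t + h *: normal gamma j t - gamma j t0) < Num.min ka kb.
  rewrite addrAC (le_lt_trans (enormD _ _))// enormZ (enorm_nrm gc) mulr1.
  by move: tn h3 kmin; clear -HI; lra.
have mka : Num.min ka kb <= ka by rewrite ge_min lexx.
have mkb : Num.min ka kb <= kb by rewrite ge_min lexx orbT.
move=> i s hi E; have [ij|ij] := eqVneq i j; last first.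
  have il : i = (3 - j)%N by move: hi hj ij; case: (i) => [|[|[|]]]//; case: (j) => [|[|[|]]].
  have := sepb s; rewrite -il -E enormB; move: xn mkb; clear -HI; lra.
rewrite ij in E; have [sd|sd] := leP `|s - t| dl.
  have [_ G2 _ G4 _] := geo t h (s - t) sd.
  move: G2; rewrite (_ : t + (s - t) = s); last by ring.
  rewrite -E subrr enorm0 mulr0 => G2.
  have := le_trans G4 G2; rewrite normr_le0 => /eqP hh; by rewrite hh eqxx in h0.
have : dl / 2 <= `|s - t0|.
  have := ler_distD t0 s t; rewrite (distrC t0 t); move: sd t2; clear -HI; lra.
by move/sep; rewrite -E enormB; move: xn mka; clear -HI; lra.
Qed.

Lemma affine_path (a b : R) : continuous (fun s : R => a + s * (b - a)).
Proof.
by apply: ctD; [exact: ctC|apply: ctM; [move=> y; exact: cvg_id|exact: ctC]].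
Qed.

(** Paths in the coordinates (t, h) that keep the sign of h stay off the curves. For h > 0 they
    start from a point given by [normal_inward]. For h < 0 a starting point comes from the closure
    of [Omega j.-1]: its height cannot be positive, since positive heights already lie in
    [Omega j]. *)
Lemma sides j (t0 : R) : (1 <= j <= 2)%N -> exists r : R, 0 < r /\ forall t h,
  `|t - t0| <= r -> `|h| <= r ->
  (0 < h -> Omega j (gamma j t + h *: normal gamma j t)) /\
  (h < 0 -> Omega j.-1 (gamma j t + h *: normal gamma j t)).
Proof.
move=> hj; have gc := interface_good_curve HI hj; have j2 : (j <= 2)%N by case/andP: hj.
have j1 : (j.-1 <= 2)%N by rewrite (leq_trans (leq_pred _)).
have [r [r0 Hr]] := near_off t0 hj; exists r; split=> //.
have path k t h t' h' : (k <= 2)%N -> `|t - t0| <= r -> `|t' - t0| <= r -> `|h| <= r -> `|h'| <= r -> 0 < h * h' ->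
    Omega k (gamma j t + h *: normal gamma j t) -> Omega k (gamma j t' + h' *: normal gamma j t').
  move=> k2 tr tr' hr hr' hh.
  pose T (s : R) := t + s * (t' - t); pose H (s : R) := h + s * (h' - h).
  pose c (s : R) := gamma j (T s) + H s *: normal gamma j (T s).
  have cT := @affine_path t t'; have cH := @affine_path h h'.
  have cc : continuous c.
    move=> s; apply: cvgD; first by apply: (continuous_comp (cT s)); exact: gc_ct gc _.
    apply: cvgZ; first exact: cH.
    apply: (continuous_comp (cT s)).
    by apply: (@nrm_cont R (tangent gamma j)); [exact: gc_cd1 gc _|exact: gc_cd2 gc _].
  have conv (a b B s : R) : 0 <= s <= 1 -> `|a| <= B -> `|b| <= B -> `|a + s * (b - a)| <= B.
    move=> /andP[s0 s1] aB bB; have -> : a + s * (b - a) = (1 - s) * a + s * b by ring.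
    rewrite (le_trans (ler_normD _ _))// !normrM (ger0_norm s0) ger0_norm ?subr_ge0//.
    have s1' : 0 <= 1 - s by rewrite subr_ge0.
    have := ler_wpM2l s1' aB; have := ler_wpM2l s0 bB; clear -HI; lra.
  have T0 : T 0 = t by rewrite /T mul0r addr0.
  have E0 : H 0 = h by rewrite /H mul0r addr0.
  have T1 : T 1 = t' by rewrite /T mul1r addrC subrK.
  have E1 : H 1 = h' by rewrite /H mul1r addrC subrK.
  move=> H0; rewrite -T1 -E1; apply: (@path_region k c k2 cc); last by rewrite /c T0 E0.
  move=> s sI; apply: Hr.
  - have -> : T s - t0 = (t - t0) + s * ((t' - t0) - (t - t0)) by rewrite /T; ring.
    exact: conv.
  - exact: conv.
  - move: sI => /andP[s0 s1]; have s1' : 0 <= 1 - s by rewrite subr_ge0.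
    have HE : H s = (1 - s) * h + s * h' by rewrite /H; ring.
    (* [h * H s] is a convex combination of the positive numbers [h * h] and [h * h'], so [H s]
       cannot vanish. *)
    apply/eqP => Hs0; have : 0 < (1 - s) * (h * h) + s * (h * h').
      have hn : h != 0 by apply/eqP => hz; move: hh; rewrite hz mul0r ltxx.
      have hq : 0 < h * h by rewrite -expr2 exprn_even_gt0.
      have [->|sn] := eqVneq s 0; first by rewrite subr0 mul1r mul0r addr0.
      have s0' : 0 < s by rewrite lt0r sn.
      by apply: (ltr_wpDl (mulr_ge0 s1' (ltW hq))); exact: mulr_gt0.
    have -> : (1 - s) * (h * h) + s * (h * h') = h * H s by rewrite HE; ring.
    by rewrite Hs0 mulr0 ltxx.
have z0 : `|t0 - t0| <= r by rewrite subrr normr0 ltW.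
have pos t h : `|t - t0| <= r -> `|h| <= r -> 0 < h -> Omega j (gamma j t + h *: normal gamma j t).
  move=> tr hr h0; have [e /= e0 He] := normal_inward HI t0 hj.
  pose h1 := Num.min (e / 2) r.
  have h10 : 0 < h1 by rewrite lt_min divr_gt0.
  apply: (path j t0 h1 t h) => //.
  - by rewrite gtr0_norm// ge_min lexx orbT.
  - by rewrite mulr_gt0.
  apply: He => //=; rewrite sub0r normrN gtr0_norm//.
  by rewrite (le_lt_trans (_ : _ <= e / 2)) ?ge_min ?lexx// gtr_pMr// invf_lt1 ?ltr1n.
have [r1 [r10 Hf]] := foot gc t0.
have : closure (Omega j.-1) (gamma j t0).
  have : j = 1%N \/ j = 2%N by case: (j) hj => [|[|[|]]]//; auto.
  case=> E; rewrite E /=.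
    have : boundary (Omega 0%N) (gamma 1%N t0) by rewrite (boundary_Omega0 HI); exists t0.
    by case.
  have : boundary (Omega 1%N) (gamma 2%N t0) by rewrite (boundary_Omega1 HI); right; exists t0.
  by case.
pose r2 := Num.min r1 (r / 4).
have r20 : 0 < r2 by rewrite lt_min r10 divr_gt0.
move=> /(_ (ball (gamma j t0) (r2 / 2)))[|y [yO yb]].
  by apply: nbhsx_ballx; rewrite divr_gt0.
have yr : enorm (y - gamma j t0) <= r2.
  rewrite (le_trans (enorm_le_supnorm _))// -ler_pdivlMl// mulrC.
  by move: yb; rewrite -ball_normE /= distrC => /ltW.
have m1 : r2 <= r1 by rewrite ge_min lexx.
have m2 : r2 <= r / 4 by rewrite ge_min lexx orbT.
have [t1 [h1 [yE t1r h1r]]] := Hf y (le_trans yr m1).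
have t1r' : `|t1 - t0| <= r by move: t1r yr m2; clear -HI; lra.
have h1r' : `|h1| <= r by move: h1r yr m2 r0; clear -HI; lra.
have h1n : h1 < 0.
  rewrite lt_neqAle; apply/andP; split.
    by apply/eqP => hz; apply: (Omega_off j1 yO hj (t := t1)); rewrite yE hz scale0r addr0.
  rewrite leNgt; apply/negP => hp; have := pos t1 h1 t1r' h1r' hp; rewrite -[_ + _]yE => yO'.
  have := Omega_uniq j1 j2 yO yO'; case: (j) hj => // n _ /= /eqP; by rewrite ltn_eqF.
move=> t h tr hr; split; first exact: pos.
move=> hn; apply: (path j.-1 t1 h1 t h) => //; first by rewrite nmulr_rgt0.
by rewrite -[_ + _]yE.
Qed.

Variables (w : R).
Hypothesis w0 : 0 < w.

(** A sequence in the region is rewritten by foot points, and the region fixes the sign of the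
    heights: eps = 1 stands for [Omega j] and eps = -1 for [Omega j.-1]. *)
Lemma trace_seq j t0 (k : R * R -> R) (p : R -> R) (eps l : R) : (1 <= j <= 2)%N -> eps = 1 \/ eps = -1 ->
  (forall t h : nat -> R, t n @[n --> \oo] --> t0 -> h n @[n --> \oo] --> 0 ->
    (forall n, 0 < eps * h n) -> (forall n s, gamma j (t n) + h n *: rot90 (tangent gamma j) (t n) <> gamma j s) ->
    layer_pot (gamma j) k p (gamma j (t n) + h n *: rot90 (tangent gamma j) (t n)) @[n --> \oo] --> l) ->
  layer_pot (gamma j) k p y @[y --> within (Omega (if eps == 1 then j else j.-1)) (nbhs (gamma j t0))] --> l.
Proof.
move=> hj Heps H; have gc := interface_good_curve HI hj; have j2 : (j <= 2)%N by case/andP: hj.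
have j1 : (j.-1 <= 2)%N by rewrite (leq_trans (leq_pred _)).
have jj : j.-1 <> j by case: (j) hj => // n _ /= /eqP; rewrite ltn_eqF.
have [r [r0 Hr]] := sides t0 hj.
apply: cvg_within_seq => u uO uc; have [N [t [h [E tc hc th]]]] := foot_seq gc r0 uc.
rewrite -(cvg_shiftn N (fun n => layer_pot (gamma j) k p (u n))).
have i2 : ((if (eps == 1)%R then j else j.-1) <= 2)%N by case: ifP.
have off n s : gamma j (t n) + h n *: rot90 (tangent gamma j) (t n) <> gamma j s.
  by rewrite -E; exact: Omega_off i2 (uO _) _ _ hj.
apply: cvg_trans (H t h tc hc _ off); first by apply: near_eq_cvg; apply: nearW => n /=; rewrite E.
move=> n; have [t1 h1] := th n; have [Hp Hn] := Hr _ _ t1 h1.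
have h0 : h n != 0 by apply/eqP => hz; apply: (off n (t n)); rewrite hz scale0r addr0.
have := uO (n + N)%N; rewrite E; case: Heps => -> /=.
  rewrite eqxx mul1r => O; rewrite lt0r h0 leNgt; apply/negP => /Hn O'.
  by apply: jj; exact: Omega_uniq O' O.
rewrite (_ : (-1 == 1 :> R) = false) ?mulN1r ?oppr_gt0; last first.
  by apply/negbTE; rewrite lt_eqF// (lt_trans (ltrN10 R))// ltr01.
move=> O; rewrite lt_neqAle h0 leNgt; apply/negP => /Hp O'.
by apply: jj; exact: Omega_uniq O O'.
Qed.

Lemma within_side (Q : nat -> R -> Prop) j : Q (if (1 : R) == 1 then j else j.-1) 1 ->
  Q (if (-1 : R) == 1 then j else j.-1) (-1) -> Q j 1 /\ Q j.-1 (-1).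
Proof.
rewrite eqxx (_ : (-1 == 1 :> R) = false)//.
by apply/negbTE; rewrite lt_eqF// (lt_trans (ltrN10 R))// ltr01.
Qed.

Lemma trace_weak j t0 (p : R -> R) : (1 <= j <= 2)%N -> dens p ->
  layer_pot (gamma j) (KA w) p y @[y --> within (Omega j) (nbhs (gamma j t0))] --> layer_pot (gamma j) (KA w) p (gamma j t0) /\
  layer_pot (gamma j) (KA w) p y @[y --> within (Omega j.-1) (nbhs (gamma j t0))] --> layer_pot (gamma j) (KA w) p (gamma j t0).
Proof.
move=> hj dp; have gc := interface_good_curve HI hj.
apply: (within_side (Q := fun i _ => layer_pot (gamma j) (KA w) p y @[y --> within (Omega i) (nbhs (gamma j t0))] --> layer_pot (gamma j) (KA w) p (gamma j t0))).
  by apply: trace_seq => //; [left|move=> t h tc hc _ off; exact: (@layer_trace_weak R w w0 _ _ _ gc p t0 t h dp tc hc off)].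
by apply: trace_seq => //; [right|move=> t h tc hc _ off; exact: (@layer_trace_weak R w w0 _ _ _ gc p t0 t h dp tc hc off)].
Qed.

Lemma trace_strong b j t0 (p : R -> R) : (1 <= j <= 2)%N -> dens p -> exists PV : R,
  layer_pot (gamma j) (K_partial w b) p y @[y --> within (Omega j) (nbhs (gamma j t0))] -->
    PV - pi * proj b (normal gamma j t0) * p t0 /\
  layer_pot (gamma j) (K_partial w b) p y @[y --> within (Omega j.-1) (nbhs (gamma j t0))] -->
    PV + pi * proj b (normal gamma j t0) * p t0.
Proof.
move=> hj dp; have gc := interface_good_curve HI hj.
have [PV H] := layer_trace_strong w0 gc b t0 dp; exists PV.
have := @within_side (fun i eps => layer_pot (gamma j) (K_partial w b) p y @[y --> within (Omega i) (nbhs (gamma j t0))] --> PV - eps * pi * proj b (normal gamma j t0) * p t0) j.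
rewrite mul1r mulN1r !mulNr opprK; apply.
  apply: trace_seq => //; first by left.
  by move=> t h tc hc hp off; have := H 1 t h (or_introl erefl) tc hc hp off; rewrite mul1r.
apply: trace_seq => //; first by right.
by move=> t h tc hc hp off; have := H (-1) t h (or_intror erefl) tc hc hp off; rewrite mulN1r !mulNr opprK.
Qed.

End Sides.

(** * Volume potentials *)

Section PlaneMeasure.
Variable R : realType.
Notation mR := (measurableTypeR R).
Notation mR2 := (measurableTypeR R * measurableTypeR R)%type.

(** An open set is the countable union of the squares with rational centre and side of the form 2 /
    n that it contains; each square is a product of intervals, hence in the product
    sigma-algebra. *)
Lemma open2_measurable (U : set (R * R)) : open U -> measurable (U : set mR2).
Proof.
move=> oU.
pose B (i : rat * rat * nat) : set mR2 :=
  [set z : R * R | `|ratr i.1.1 - z.1| < i.2.+1%:R^-1 /\ `|ratr i.1.2 - z.2| < i.2.+1%:R^-1].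
have mB i : measurable (B i).
  have m1 (c e : R) : measurable ([set x : R | `|c - x| < e] : set mR).
    apply: open_measurable; rewrite (_ : [set x | _] = ball c e) ?ball_normE//.
    exact: ball_open.
  have -> : B i = [set x : R | `|ratr i.1.1 - x| < i.2.+1%:R^-1] `*` [set x : R | `|ratr i.1.2 - x| < i.2.+1%:R^-1].
    by apply/seteqP; split.
  exact: measurableX.
have -> : (U : set mR2) = \bigcup_(i in [set i | B i `<=` U]) B i.
  apply/seteqP; split => [z Uz|z [i Bi iz]]; last exact: Bi.
  have /nbhs_ballP[r /= r0 Hr] : nbhs z U by apply: open_nbhs_nbhs.
  pose n := Num.truncn (2 / r).
  have nr : n.+1%:R^-1 < r / 2 :> R.
    rewrite -[ltRHS]invrK ltf_pV2 ?posrE ?invr_gt0 ?divr_gt0 ?ltr0Sn// invf_div.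
    by rewrite truncnS_gt// divr_ge0// ltW.
  have n0 : 0 < n.+1%:R^-1 :> R by rewrite invr_gt0 ltr0Sn.
  have ap (c : R) : exists q : rat, `|ratr q - c| < n.+1%:R^-1.
    have [|q] := @rat_in_itvoo R (c - n.+1%:R^-1) (c + n.+1%:R^-1); first by move: n0; move: (n.+1%:R^-1) => a; lra.
    rewrite in_itv/= => qI; exists q; move: qI; rewrite ltr_norml; move: (n.+1%:R^-1) => a; lra.
  have [q1 H1] := ap z.1; have [q2 H2] := ap z.2.
  exists (q1, q2, n) => // y [/= y1 y2]; apply: Hr.
  have t (a b q : R) : `|q - a| < n.+1%:R^-1 -> `|q - b| < n.+1%:R^-1 -> `|a - b| < r.
    move=> qa qb; have := ler_distD q a b; rewrite (distrC a q); move: qa qb nr; move: (n.+1%:R^-1) => c; lra.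
  by split; rewrite /= -ball_normE /=; [exact: t H1 y1|exact: t H2 y2].
rewrite bigcup_mkcond; apply: countable_bigcupT_measurable => // i.
by case: ifP.
Qed.

Lemma continuous2_meas (f : R * R -> R) : continuous f -> measurable_fun [set: mR2] f.
Proof.
move=> /continuousP cf; apply: (measurability _ (RGenOpens.measurableE R)).
move=> _ [_ [a [b ->] <-]]; rewrite setTI; apply: open2_measurable.
exact/cf/interval_open.
Qed.

Lemma Rint_eq_except (k h : R -> R) (a : R) : measurable_fun [set: mR] k -> measurable_fun [set: mR] h ->
  (forall x, x != a -> k x = h x) -> Rintegral (leb R) setT k = Rintegral (leb R) setT h.
Proof.
move=> spinor_of mh kh; have mD : measurable ([set: mR] `\ a) by apply: measurableD.
have E (f : R -> R) : measurable_fun [set: mR] f -> Rintegral (leb R) ([set: mR] `\ a) f = Rintegral (leb R) setT f.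
  move=> mf; rewrite /Rintegral; congr fine; apply: (integral_setD1 (f := EFin \o f)) => //.
  by apply/measurable_EFinP; exact: measurable_funTS.
rewrite -E// -(E h)//; apply: eq_Rintegral => x; rewrite inE => -[_ /eqP]; exact: kh.
Qed.

Lemma Rint2_fst (F : R * R -> R) : intble (leb2 R) setT F ->
  let G x := Rintegral (leb R) setT (fun y : R => F (x, y)) in
  measurable_fun [set: mR] G /\ Rintegral (leb2 R) setT F = Rintegral (leb R) setT G.
Proof.
move=> iF G.
have H := @integral12_prod_meas1 _ _ mR mR R (@lebesgue_measure R) (@lebesgue_measure R) _ iF.
have M := @measurable_fubini_F _ _ mR mR R (@lebesgue_measure R) (@lebesgue_measure R) _ iF.
have I := @integrable_fubini_F _ _ mR mR R (@lebesgue_measure R) (@lebesgue_measure R) _ iF.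
have mG : measurable_fun [set: mR] G by apply: measurableT_comp M.
split=> //; rewrite /Rintegral; congr fine; rewrite -[LHS]H.
apply: ae_eq_integral => //; first exact/measurable_EFinP.
have := integrable_ae measurableT I; apply: filterS => x /(_ Logic.I) + _.
by rewrite /= => fn; rewrite /G /Rintegral fineK.
Qed.

Lemma Rint2_snd (F : R * R -> R) : intble (leb2 R) setT F ->
  let G y := Rintegral (leb R) setT (fun x : R => F (x, y)) in
  measurable_fun [set: mR] G /\ Rintegral (leb2 R) setT F = Rintegral (leb R) setT G.
Proof.
move=> iF G.
have H := @integral21_prod_meas1 _ _ mR mR R (@lebesgue_measure R) (@lebesgue_measure R) _ iF.
have M := @measurable_fubini_G _ _ mR mR R (@lebesgue_measure R) (@lebesgue_measure R) _ iF.
have AE := @ae_integrable2 _ _ mR mR R (@lebesgue_measure R) (@lebesgue_measure R) _ iF.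
have mG : measurable_fun [set: mR] G by apply: measurableT_comp M.
split=> //; rewrite /Rintegral; congr fine; rewrite -[LHS]H.
apply: ae_eq_integral => //; first exact/measurable_EFinP.
move: AE; apply: filterS => x fx _.
by rewrite /= /G /Rintegral fineK//; exact: integrable_fin_num.
Qed.

Lemma intble_ae_dom d (T : measurableType d) (mu : {measure set T -> \bar R}) (f g : T -> R) :
  measurable_fun setT f -> intble mu setT g -> {ae mu, forall x, `|f x| <= g x} -> intble mu setT f.
Proof.
move=> mf ig fg; apply/integrableP; split; first exact/measurable_EFinP.
case/integrableP : ig => mg; apply: le_lt_trans; apply: ae_ge0_le_integral => //.
- by apply: measurableT_comp => //; exact/measurable_EFinP.
- by apply: measurableT_comp.
- by move: fg; apply: filterS => x H _ /=; rewrite lee_fin (le_trans H)// ler_norm.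
Qed.

Lemma intble_prod (f g : R -> R) : intble (leb R) setT f -> intble (leb R) setT g ->
  intble (leb2 R) setT (fun z : mR2 => f z.1 * g z.2).
Proof.
move=> fi gi; have mf := intble_meas fi; have mg := intble_meas gi.
have m : measurable_fun [set: mR2] (fun z : mR2 => f z.1 * g z.2).
  apply: measurable_funM; first exact: (measurableT_comp mf (@measurable_fst _ _ mR mR)).
  exact: (measurableT_comp mg (@measurable_snd _ _ mR mR)).
apply/(@integrable12ltyP _ _ mR mR R (@lebesgue_measure R) (@lebesgue_measure R)); first exact/measurable_EFinP.
case/integrableP : fi => _ f1; case/integrableP : gi => mg' g1.
have mg2 : measurable_fun [set: mR] (fun x => `|(g x)%:E|%E) by apply: measurableT_comp.
rewrite (eq_integral (fun x : mR => `|(f x)%:E| * \int[leb R]_y `|(g y)%:E|)%E).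
  have gfin : (\int[leb R]_y `|(g y)%:E|)%E \is a fin_num.
    by rewrite ge0_fin_numE//; exact: integral_ge0.
  rewrite -(fineK gfin) ge0_integralZr//.
  - by rewrite muleC lte_mul_pinfty// lee_fin fine_ge0// integral_ge0.
  - by apply: measurableT_comp => //; exact/measurable_EFinP.
  - by rewrite lee_fin fine_ge0// integral_ge0.
move=> x _; rewrite -ge0_integralZl//.
by apply: eq_integral => y _; rewrite -abseM -EFinM.
Qed.

(** On the axes the product majorant of [isq_ge] fails, and the coincident point lies on them. *)
Lemma axes_null : {ae leb2 R, forall z : mR2, z.1 != 0 /\ z.2 != 0}.
Proof.
exists ([set 0] `*` setT `|` setT `*` [set 0]); split.
- by apply: measurableU; exact: measurableX.
- have z0 : leb R [set 0%R : R] = 0%E := lebesgue_measure_set1 0.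
  have n1 : leb2 R ([set 0] `*` setT) = (leb R [set 0%R : R] * leb R setT)%E := @product_measure1E _ _ mR mR R (@lebesgue_measure R) (@lebesgue_measure R) [set 0%R] setT (measurable_set1 _) measurableT.
  have n2 : leb2 R (setT `*` [set 0]) = (leb R setT * leb R [set 0%R : R])%E := @product_measure1E _ _ mR mR R (@lebesgue_measure R) (@lebesgue_measure R) setT [set 0%R] measurableT (measurable_set1 _).
  rewrite z0 mul0e in n1; rewrite z0 mule0 in n2.
  have mm1 : measurable (([set 0] `*` setT) : set mR2) by exact: measurableX.
  have mm2 : measurable ((setT `*` [set 0]) : set mR2) by exact: measurableX.
  by apply: (null_set_setU mm1 mm2); [exact: n1|exact: n2].
- move=> z /= H; apply: contrapT => K; apply: H; split; apply/eqP => z0; apply: K; [left|right]; by split.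
Qed.

(** The image measure agrees with the product measure on rectangles, by translation and reflection
    in each coordinate, and this determines it. *)
Lemma leb2_reflect (x : R * R) (F : R * R -> R) : intble (leb2 R) setT F ->
  intble (leb2 R) setT (fun y : mR2 => F (x - y)) /\
  Rintegral (leb2 R) setT (fun y : mR2 => F (x - y)) = Rintegral (leb2 R) setT F.
Proof.
pose phi (y : mR2) : mR2 := x - y.
have m1 (c : R) : measurable_fun [set: mR] ((fun t : R => c - t) : mR -> mR).
  by apply: continuous_measR; apply: ctB; [exact: ctC|move=> y; exact: cvg_id].
have mphi : measurable_fun [set: mR2] phi.
  apply: (@measurable_fun_pair _ _ _ mR2 mR mR (fun y => x.1 - y.1) (fun y => x.2 - y.2)).
    exact: (measurableT_comp (m1 x.1) (@measurable_fst _ _ mR mR)).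
  exact: (measurableT_comp (m1 x.2) (@measurable_snd _ _ mR mR)).
have i1 (c : R) (A : set mR) : measurable A -> leb R ((fun t : R => c - t) @^-1` A) = leb R A.
  move=> mA; rewrite -[RHS](leb_shift c mA).
  have mA' : measurable ((fun t : R => t + c) @^-1` A : set mR).
    rewrite -[X in measurable X]setTI; apply: (continuous_measR (f := fun t : R => t + c)) => //.
    by apply: ctD; [move=> y; exact: cvg_id|exact: ctC].
  rewrite -[RHS](lebesgue_measureN mA'); congr (_ _); apply/seteqP; split => t /=; by rewrite addrC.
have inv (A : set mR2) : measurable A -> leb2 R (phi @^-1` A) = leb2 R A.
  move=> mA; have E := @product_measure_unique _ _ mR mR R (@lebesgue_measure R) (@lebesgue_measure R) (pushforward (leb2 R) phi).
  suff : (leb2 R A = pushforward (leb2 R) phi A)%E by move=> ->.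
  apply: E => // B C mB mC; rewrite /pushforward.
  have E : phi @^-1` (B `*` C) = ((fun t : R => x.1 - t) @^-1` B) `*` ((fun t : R => x.2 - t) @^-1` C).
    by apply/seteqP; split.
  rewrite [X in leb2 R X = _]E [LHS]product_measure1E; first by rewrite -(i1 x.1 _ mB) -(i1 x.2 _ mC).
    by rewrite -[X in measurable X]setTI; apply: m1.
  by rewrite -[X in measurable X]setTI; apply: m1.
exact: measure_map.
Qed.

End PlaneMeasure.

(** * Test functions and symmetry of their mixed partials *)

Section TestFunctions.
Variable R : realType.
Implicit Types f : R * R -> R.
Notation D1 f := ('D_(edir R false) f : R * R -> R).
Notation D2 f := ('D_(edir R true) f : R * R -> R).

Definition bump f := smooth2 f /\ exists K : set (R * R), compact K /\ forall z, ~ K z -> f z = 0.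

(** A single constant serves as bound of the values and as radius of the support. *)
Definition bounded_support f := exists B : R, forall z, `|f z| <= B /\ (B < `|z| -> f z = 0).

Lemma smooth2_partial b f : smooth2 f -> smooth2 ('D_(edir R b) f).
Proof.
move=> sf w; have := sf (rcons w b).
by rewrite /iter_partial foldr_rcons.
Qed.

Lemma derive_zero_out (K : set (R * R)) f v z : closed K -> (forall z, ~ K z -> f z = 0) -> ~ K z -> 'D_v f z = 0.
Proof.
move=> cK f0 nK; have nb : \forall y \near z, f y = cst 0 y.
  have : nbhs z (~` K) by apply: open_nbhs_nbhs; split => //; exact: closed_openC.
  by apply: filterS => y; exact: f0.
by rewrite (near_eq_derive _ nb) derive_cst.
Qed.

Lemma bump_partial b f : bump f -> bump ('D_(edir R b) f).
Proof.
move=> [sf [K [cK f0]]]; split; first exact: smooth2_partial.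
exists K; split=> // z nK; apply: (derive_zero_out (K := K)) => //; apply: compact_closed => //; exact: norm_hausdorff.
Qed.

Lemma bump_continuous f : bump f -> continuous f.
Proof. by move=> [sf _]; have [] := sf [::]. Qed.

Lemma bump_bcs f : bump f -> bounded_support f.
Proof.
move=> bf; have cf := bump_continuous bf; have [_ [K [cK f0]]] := bf.
have /compact_bounded[M1 [_ H1]] := cK.
have : compact (f @` K) by apply: continuous_compact => //; exact: continuous_subspaceT.
move=> /compact_bounded[M2 [_ H2]].
pose B := `|M1| + `|M2| + 1; exists B => z; split.
  have [Kz|nK] := pselect (K z); last first.
    by rewrite f0// normr0 /B; have := normr_ge0 M1; have := normr_ge0 M2; lra.
  apply: (H2 B); last by exists z.
  by rewrite /B; have := normr_ge0 M1; have := ler_norm M2; lra.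
move=> zB; apply: f0 => Kz.
have : `|z| <= B.
  by apply: (H1 B) => //; rewrite /B; have := normr_ge0 M2; have := ler_norm M1; lra.
by rewrite leNgt zB.
Qed.

Lemma smooth2_pd f z : smooth2 f -> pd1 f (D1 f) z /\ pd2 f (D2 f) z.
Proof.
move=> sf; have [_ df] := sf [::]; case: z => a b; split.
- have := df false (a, b); rewrite /= /derivable => H.
  have E : (fun h : R => h^-1 *: (f (h *: (1, 0) + (a, b)) - f (a, b))) =
           (fun h : R => h^-1 *: (f (h *: 1 + a, b) - f (a, b))).
    apply/funext => h; rewrite (_ : h *: (1, 0) + (a, b) = (h *: 1 + a, b))//.
    by apply/pair_equal_spec; split; rewrite /= ?scaler0 ?add0r.
  by apply: DeriveDef; rewrite /= /derivable /derive -?E.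
- have := df true (a, b); rewrite /= /derivable => H.
  have E : (fun h : R => h^-1 *: (f (h *: (0, 1) + (a, b)) - f (a, b))) =
           (fun h : R => h^-1 *: (f (a, h *: 1 + b) - f (a, b))).
    apply/funext => h; rewrite (_ : h *: (0, 1) + (a, b) = (a, h *: 1 + b))//.
    by apply/pair_equal_spec; split; rewrite /= ?scaler0 ?add0r.
  by apply: DeriveDef; rewrite /= /derivable /derive -?E.
Qed.

Lemma double_difference (f f1 f12 : R * R -> R) (a b h : R) : 0 < h ->
  (forall z, pd1 f f1 z) -> (forall z, pd2 f1 f12 z) ->
  exists z : R * R, `|z - (a, b)| <= h /\
    f (a + h, b + h) - f (a + h, b) - (f (a, b + h) - f (a, b)) = f12 z * (h * h).
Proof.
move=> h0 H1 H2.
pose F (s : R) := f (s, b + h) - f (s, b).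
have dF (s : R) : is_derive s (1 : R) F (f1 (s, b + h) - f1 (s, b)).
  exact: dSub (H1 (s, b + h)) (H1 (s, b)).
have [c ca E1] := @mean_value R F _ a (a + h) (fun s _ => dF s).
have [c2 cb E2] := @mean_value R (fun s => f1 (c, s)) (fun s => f12 (c, s)) b (b + h) (fun s _ => H2 (c, s)).
have hh (x : R) : x + h - x = h by ring.
rewrite hh in E1 ca; rewrite hh in E2 cb.
rewrite (gtr0_norm h0) in ca; rewrite (gtr0_norm h0) in cb.
exists (c, c2); split; first by rewrite prod_normE /= ge_max ca cb.
by rewrite -/(F (a + h)) -/(F a) E1 E2 mulrA.
Qed.

(** The double difference over a square of side h is h^2 times [f12] at one point and, after
    exchanging the coordinates, h^2 times [f21] at another; then h -> 0. It supplies the common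
    mixed partial required by [compact_C2]. *)
Lemma clairaut (f f1 f2 f12 f21 : R * R -> R) z :
  (forall z, pd1 f f1 z) -> (forall z, pd2 f f2 z) -> (forall z, pd2 f1 f12 z) -> (forall z, pd1 f2 f21 z) ->
  continuous f12 -> continuous f21 -> f21 z = f12 z.
Proof.
move=> p1 p2 p12 p21 c12 c21; case: z => a b.
have sw (h : R) : 0 < h -> exists z z' : R * R, [/\ `|z - (a, b)| <= h, `|z' - (a, b)| <= h & f21 z = f12 z'].
  move=> h0; have [z' [z'h E']] := @double_difference f f1 f12 a b h h0 p1 p12.
  have [[z2 z1] [zh E]] := @double_difference (fun z => f (z.2, z.1)) (fun z => f2 (z.2, z.1)) (fun z => f21 (z.2, z.1)) b a h h0
    (fun z => p2 (z.2, z.1)) (fun z => p21 (z.2, z.1)).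
  exists (z1, z2), z'; split; [|exact: z'h|].
    by move: zh; rewrite !prod_normE /= maxC.
  have hh : h * h != 0 by rewrite mulf_neq0// lt0r_neq0.
  apply: (mulIf hh); rewrite -E'; rewrite /= in E; rewrite -E; ring.
pose u n : R := n.+1%:R^-1; have u0 n : 0 < u n by rewrite invr_gt0 ltr0Sn.
have [v Hv] := boolp.choice (fun n => sw (u n) (u0 n)).
have [v' Hv'] := boolp.choice Hv.
have cvz (y : nat -> R * R) : (forall n, `|y n - (a, b)| <= u n) -> y n @[n --> \oo] --> (a, b).
  move=> H; apply/cvgrPdist_le => e e0; near=> n.
  rewrite distrC (le_trans (H n))//; near: n.
  by have /cvgrPdist_le/(_ _ e0) := @cvg_harmonic R; apply: filterS => n; rewrite sub0r normrN gtr0_norm.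
have L1 : f21 (v n) @[n --> \oo] --> f21 (a, b).
  by apply: (cvg_comp v _ (cvz v _)); [move=> n; have [] := Hv' n|exact: c21].
have L2 : f12 (v' n) @[n --> \oo] --> f12 (a, b).
  by apply: (cvg_comp v' _ (cvz v' _)); [move=> n; have [] := Hv' n|exact: c12].
have E : (fun n => f21 (v n)) = (fun n => f12 (v' n)) by apply/funext => n; have [] := Hv' n.
by rewrite E in L1; exact: (cvg_unique _ L1 L2).
Unshelve. all: by end_near. Qed.

End TestFunctions.

(** * Weakly singular kernels and volume potentials *)

Section LocallyIntegrable.
Variable R : realType.
Notation mR := (measurableTypeR R).
Notation mR2 := (measurableTypeR R * measurableTypeR R)%type.

Lemma meas2_except0 (k : R * R -> R) : (forall z, z != 0 -> {for z, continuous k}) ->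
  measurable_fun [set: mR2] k.
Proof.
move=> ck; have m0 : measurable ([set 0] : set mR2).
  rewrite (_ : [set 0] = [set (0 : R)] `*` [set (0 : R)]); first exact: measurableX.
  by apply/seteqP; split => -[a b] /= [-> ->].
apply: (measurability _ (RGenOpens.measurableE R)).
move=> _ [_ [a [b ->] <-]]; rewrite setTI.
rewrite -[X in measurable X](setIT (k @^-1` _)) -(setUv ([set 0] : set mR2)) setIUr.
apply: measurableU.
  have [k0|k0] := pselect ((k @^-1` `]a, b[%classic) (0 : R * R)).
    rewrite (_ : _ `&` _ = [set 0])//; apply/seteqP; split => z; first by case.
    by move=> ->; split.
  by rewrite (_ : _ `&` _ = set0)//; apply/seteqP; split => z // -[/= kz z0]; apply: k0; rewrite -z0.
apply: open2_measurable; rewrite openE => z [kz z0].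
have zn : z != 0 by apply/eqP.
apply: filterI.
  by apply: ck => //; apply: open_nbhs_nbhs; split => //; exact: interval_open.
apply: open_nbhs_nbhs; split => //; apply: closed_openC.
exact: (compact_closed (@norm_hausdorff R (R * R)%type) (@compact_set1 _ (0 : R * R))).
Qed.

Definition weakly_singular (k : R * R -> R) := (forall z, z != 0 -> {for z, continuous k}) /\
  exists C : R, 0 <= C /\ forall z, z != 0 -> `|k z| <= C * (1 + (enorm z)^-1).

Definition invsqrt_cut (B s : R) : R := ((fun s : R => 1 + (Num.sqrt `|s|)^-1) \_ `[(- B), B]) s.

Lemma intble_isq B : 0 < B -> intble (leb R) setT (invsqrt_cut B).
Proof.
move=> B0; apply/(intble_mkcond _ _).1 => //.
apply: intbleD => //; last exact: intble_invsqrt.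
by apply: intble_continuous_itv => s _; exact: cvg_cst.
Qed.

(** Since |z_1| |z_2| <= |z|^2, one has 1 / |z| <= |z_1|^(-1/2) |z_2|^(-1/2). The majorant is a
    product of one-variable functions, so local integrability follows from Tonelli without polar
    coordinates. *)
Lemma isq_ge (B : R) (z : R * R) : `|z| <= B -> z.1 != 0 -> z.2 != 0 ->
  1 + (enorm z)^-1 <= invsqrt_cut B z.1 * invsqrt_cut B z.2.
Proof.
move=> zB z1 z2.
have [B1 B2] : `|z.1| <= B /\ `|z.2| <= B.
  by move: zB; rewrite prod_normE ge_max => /andP.
rewrite /invsqrt_cut !patchE !ifT ?inE/= ?in_itv/= -?ler_norml//.
have s1 : 0 < Num.sqrt `|z.1| by rewrite (sqrtr_gt0 `|z.1|) normr_gt0.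
have s2 : 0 < Num.sqrt `|z.2| by rewrite (sqrtr_gt0 `|z.2|) normr_gt0.
have H : (enorm z)^-1 <= (Num.sqrt `|z.1|)^-1 * (Num.sqrt `|z.2|)^-1.
  have z0 : 0 < enorm z by apply: lt_le_trans (enorm_fst z); rewrite normr_gt0.
  rewrite -invfM lef_pV2 ?posrE ?mulr_gt0// -(@ler_pXn2r _ 2) ?nnegrE ?mulr_ge0 ?(ltW s1) ?(ltW s2) ?enorm_ge0//.
  rewrite exprMn (sqr_sqrtr (normr_ge0 z.1)) (sqr_sqrtr (normr_ge0 z.2)) expr2.
  by apply: ler_pM; rewrite ?normr_ge0//; [exact: enorm_fst|exact: enorm_snd].
have := invr_gt0 (Num.sqrt `|z.1|); rewrite s1 => i1.
have := invr_gt0 (Num.sqrt `|z.2|); rewrite s2 => i2.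
by move: H i1 i2; clear; move: (_^-1) (_^-1) (_^-1) => u v x; lra.
Qed.

Lemma intble_locker (k f : R * R -> R) : weakly_singular k -> measurable_fun [set: mR2] f -> bounded_support f ->
  intble (leb2 R) setT (fun z : mR2 => k z * f z).
Proof.
move=> [ck [C [C0 HC]]] mf [B HB].
have B0 : 0 <= B by have [+ _] := HB 0; apply: le_trans.
pose B' := B + 1; have B'0 : 0 < B' by rewrite /B'; lra.
have ii := intble_prod (intble_isq B'0) (intble_isq B'0).
apply: (@intble_ae_dom R _ _ (leb2 R) _ (fun z : mR2 => C * B * (invsqrt_cut B' z.1 * invsqrt_cut B' z.2))).
- by apply: measurable_funM => //; exact: meas2_except0.
- exact: intbleZ.
- apply: filterS (@axes_null R) => z [z1 z2].
  have z0 : z != 0 by apply/eqP => zz; rewrite zz eqxx in z1.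
  have isq0 s : 0 <= invsqrt_cut B' s.
    by rewrite /invsqrt_cut patchE; case: ifP => // _; rewrite addr_ge0// invr_ge0 sqrtr_ge0.
  have [fB f0] := HB z; have [zB|zB] := leP `|z| B; last first.
    by rewrite f0// mulr0 normr0 !mulr_ge0.
  rewrite normrM [leRHS]mulrAC; apply: ler_pM => //.
  apply: le_trans (HC z z0) _; rewrite ler_wpM2l//; apply: isq_ge => //.
  by rewrite (le_trans zB)// /B' lerDl.
Qed.

Lemma locker_KA (w : R) : 0 < w -> weakly_singular (KA w).
Proof.
move=> w0; have [H _ _ _] := dker_KA w0; split; first by move=> z z0; exact: has_grad_continuous (H z z0).
have [C HC] := KA_sing w0; exists `|C|; split=> // z z0.
have r0 := enorm_gt0 z0; apply: le_trans (HC z z0) _.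
apply: (@le_trans _ _ (`|C| / Num.sqrt (enorm z))); first by rewrite ler_wpM2r ?invr_ge0 ?sqrtr_ge0// ler_norm.
rewrite ler_wpM2l//; have s0 : 0 < Num.sqrt (enorm z) by rewrite (sqrtr_gt0 (enorm z)).
have E := sqr_sqrtr (ltW r0); move: s0; rewrite -[in X in _ -> _ <= X]E; move: (Num.sqrt _) => y y0.
have -> : 1 + (y ^+ 2)^-1 = y^-1 + ((y^-1 - 2^-1) ^+ 2 + 3 / 4) by field; rewrite lt0r_neq0.
by rewrite lerDl addr_ge0 ?sqr_ge0.
Qed.

Lemma locker_Kp (w : R) b : 0 < w -> weakly_singular (K_partial w b).
Proof.
move=> w0; have [k1 [k2 [H _ _ _]]] : exists k1 k2, decaying_kernel w (K_partial w b) k1 k2.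
  by rewrite /K_partial; case: (b); do 2 eexists; [exact: dker_K2|exact: dker_K1].
split; first by move=> z z0; exact: has_grad_continuous (H z z0).
exists (w + 1); split; first by rewrite ltW// addr_gt0.
move=> z z0; have r0 := enorm_gt0 z0.
have KS : `|K_partial w b z + proj b z / (z.1 ^+ 2 + z.2 ^+ 2)| <= w.
  by rewrite /K_partial /proj; case: (b); [exact: K2_sing|exact: K1_sing].
have [_ I] := proj_inversion b z0 z0.
have := ler_normB (K_partial w b z + proj b z / (z.1 ^+ 2 + z.2 ^+ 2)) (proj b z / (z.1 ^+ 2 + z.2 ^+ 2)).
rewrite addrK; move: KS I; move: (`|_ / _|) (`|_ + _|) => u v; move=> Hv Hu H'.
have i0 : 0 < (enorm z)^-1 by rewrite invr_gt0.
have m0 : 0 < w * (enorm z)^-1 by rewrite mulr_gt0.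
rewrite mulrDr mulr1 mulrDl mul1r; move: Hv Hu H' i0 m0; clear; move: (enorm z)^-1 => r; lra.
Qed.

(** The argument of f carries the variable x, so derivatives fall on the smooth factor and never on
    the singular kernel. *)
Definition volume_pot (k f : R * R -> R) (x : R * R) : R := Rintegral (leb2 R) setT (fun z : mR2 => k z * f (x - z)).

Definition compact_cont (f : R * R -> R) := continuous f /\ bounded_support f.

Lemma ccs_reflect (f : R * R -> R) (x : R * R) : compact_cont f -> compact_cont (fun z => f (x - z)).
Proof.
move=> [cf [B HB]]; split.
  move=> z; have cz : {for z, continuous (fun z : R * R => x - z)} by apply: cvgB; [exact: cvg_cst|exact: cvg_id].
  exact: (continuous_comp cz (cf (x - z))).
exists (B + `|x|) => z; have [b1 _] := HB (x - z); split; first by rewrite (le_trans b1)// lerDl.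
move=> zB; apply: (HB (x - z)).2; have := ler_normB x (x - z).
by rewrite opprB addrC subrK; move: zB; clear; lra.
Qed.

Lemma ccs_intble (k f : R * R -> R) : weakly_singular k -> compact_cont f -> intble (leb2 R) setT (fun z : mR2 => k z * f z).
Proof. by move=> lk [cf bf]; apply: intble_locker => //; exact: continuous2_meas. Qed.

Lemma intble_vol (k f : R * R -> R) x : weakly_singular k -> compact_cont f ->
  intble (leb2 R) setT (fun z : mR2 => k z * f (x - z)).
Proof. by move=> lk bf; apply: (ccs_intble lk); exact: ccs_reflect. Qed.

Record compact_C2 (f f1 f2 f11 f12 f22 : R * R -> R) : Prop := Smoothc {
  sc_ccs : compact_cont f; sc_ccs1 : compact_cont f1; sc_ccs2 : compact_cont f2;
  sc_ccs11 : compact_cont f11; sc_ccs12 : compact_cont f12; sc_ccs22 : compact_cont f22;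
  sc_pd1 : forall z, pd1 f f1 z; sc_pd2 : forall z, pd2 f f2 z;
  sc_pd11 : forall z, pd1 f1 f11 z; sc_pd12 : forall z, pd2 f1 f12 z;
  sc_pd21 : forall z, pd1 f2 f12 z; sc_pd22 : forall z, pd2 f2 f22 z }.

Lemma ler_norm_sum3 (a b c x : R) : x <= a \/ x <= b \/ x <= c -> x <= `|a| + `|b| + `|c|.
Proof.
have := normr_ge0 a; have := normr_ge0 b; have := normr_ge0 c.
have := ler_norm a; have := ler_norm b; have := ler_norm c; move=> ? ? ? ? ? ? [|[]]; lra.
Qed.

(** The Taylor remainder of f is at most 3 M |h|^2, and for |h| < 1 it vanishes when |z| exceeds L,
    which adds the support radii, |x| and 1. The majorant is therefore the kernel cut off to a
    box. *)
Lemma vol_has_grad (k f f1 f2 f11 f12 f22 : R * R -> R) x : weakly_singular k -> compact_C2 f f1 f2 f11 f12 f22 ->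
  has_grad (volume_pot k f) x (volume_pot k f1 x) (volume_pot k f2 x).
Proof.
case=> ck HC sc; have lk : weakly_singular k by [].
have [cf [B0 H0]] := sc_ccs sc; have [c1 [Ba Ha]] := sc_ccs1 sc; have [c2 [Bb Hb]] := sc_ccs2 sc.
have [_ [B1 H1]] := sc_ccs11 sc; have [_ [B2 H2]] := sc_ccs12 sc; have [_ [B3 H3]] := sc_ccs22 sc.
pose M := `|B1| + `|B2| + `|B3|; pose L := `|B0| + `|Ba| + `|Bb| + `|x| + 1.
have M0 : 0 <= M by rewrite !addr_ge0.
have L0 : 0 <= L by rewrite !addr_ge0.
have T z h : `|f (z + h) - f z - (f1 z * h.1 + f2 z * h.2)| <= 3 * M * `|h| ^+ 2.
  apply: (@taylor2 R f f1 f2 f11 f12 f22 z `|h| M) => //.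
    by move=> y _; split; [exact: sc_pd1 sc y|exact: sc_pd2 sc y|exact: sc_pd11 sc y|exact: sc_pd12 sc y|exact: sc_pd22 sc y].
  move=> y _; have [b1 _] := H1 y; have [b2 _] := H2 y; have [b3 _] := H3 y.
  by split; apply: ler_norm_sum3; auto.
pose box : set mR2 := `[(- L), L]%classic `*` `[(- L), L]%classic.
have boxE z : box z <-> `|z| <= L.
  rewrite /box prod_normE ge_max /= !in_itv/= -!ler_norml; split; first by move=> [-> ->].
  by move=> /andP.
have mbox : measurable box by exact: measurableX.
pose ind : mR2 -> R := (fun=> 3 * M) \_ box.
have iC : intble (leb2 R) setT (fun z : mR2 => `|k z * ind z|).
  apply: intble_norm => //; apply: intble_locker => //.
    by apply/(measurable_restrictT _ _).1.
  exists (3 * M + L) => z; rewrite /ind patchE; split.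
    case: ifP => _; first by rewrite ger0_norm ?mulr_ge0// lerDl.
    by rewrite normr0 addr_ge0// mulr_ge0.
  move=> zL; rewrite ifF//; apply/negbTE; rewrite notin_setE boxE; apply/negP; rewrite -ltNge.
  by apply: le_lt_trans zL; rewrite lerDr mulr_ge0.
apply: (@Rint_has_grad _ _ _ (leb2 R) (fun x (z : mR2) => k z * f (x - z)) (fun z : mR2 => k z * f1 (x - z))
  (fun z : mR2 => k z * f2 (x - z)) (fun z : mR2 => `|k z * ind z|) setT 1) => //.
- by move=> h _; apply: intble_vol => //; exact: sc_ccs sc.
- by apply: intble_vol => //; exact: sc_ccs1 sc.
- by apply: intble_vol => //; exact: sc_ccs2 sc.
move=> h z h1 _.
have -> : k z * f (x + h - z) - k z * f (x - z) - (k z * f1 (x - z) * h.1 + k z * f2 (x - z) * h.2) =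
  k z * (f (x - z + h) - f (x - z) - (f1 (x - z) * h.1 + f2 (x - z) * h.2)).
  by rewrite (addrAC x); ring.
rewrite !normrM -mulrA; apply: ler_wpM2l => //.
rewrite /ind patchE; case: ifPn => [_|]; first by rewrite (ger0_norm (_ : 0 <= 3 * M)) ?mulr_ge0.
rewrite notin_setE boxE => /negP; rewrite -ltNge => zL.
have big y : `|y - (x - z)| < 1 -> `|B0| + `|Ba| + `|Bb| < `|y|.
  move=> yh; have := ler_normB x (x - z); rewrite opprB addrC subrK.
  have := ler_distD y (x - z) 0; rewrite !subr0 (distrC _ y).
  by move: yh zL; rewrite /L; clear; lra.
have lt3 y (B : R) : B <= `|B0| + `|Ba| + `|Bb| -> `|y - (x - z)| < 1 -> B < `|y|.
  by move=> BB /big; exact: le_lt_trans.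
have e0 : `|(x - z) - (x - z)| < 1 by rewrite subrr normr0.
have eh : `|(x - z + h) - (x - z)| < 1 by rewrite addrAC subrr add0r.
have g0 : B0 <= `|B0| + `|Ba| + `|Bb| by apply: ler_norm_sum3; auto.
have ga : Ba <= `|B0| + `|Ba| + `|Bb| by apply: ler_norm_sum3; auto.
have gb : Bb <= `|B0| + `|Ba| + `|Bb| by apply: ler_norm_sum3; auto.
rewrite ((H0 _).2 (lt3 _ _ g0 eh)) ((H0 _).2 (lt3 _ _ g0 e0)) ((Ha _).2 (lt3 _ _ ga e0)) ((Hb _).2 (lt3 _ _ gb e0)).
by rewrite !mul0r addr0 !subr0 !normr0 mul0r.
Qed.

Lemma vol_decay (w : R) (k f : R * R -> R) (eps : R) : 0 < w -> decaying w k -> weakly_singular k -> compact_cont f -> 0 < eps ->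
  exists D : R, forall x, D <= enorm x -> `|volume_pot k f x| <= eps.
Proof.
move=> w0 dk lk cf e0; have [cof [B HB]] := cf.
have [Ck HCk] := dk 1 ltr01.
have B0 : 0 <= B by have [+ _] := HB 0; apply: le_trans.
have if_ : intble (leb2 R) setT (fun y : mR2 => `|f y|).
  have l1 : weakly_singular (fun=> 1).
    split; first by move=> z _; exact: cvg_cst.
    by exists 1; split=> // z _; rewrite normr1 mul1r lerDl invr_ge0 enorm_ge0.
  by apply: intble_norm => //; have := ccs_intble l1 cf; under eq_fun do rewrite mul1r.
set I := Rintegral (leb2 R) setT (fun y : mR2 => `|f y|).
have I0 : 0 <= I by apply: Rintegral_ge0.
have A0 : 0 <= `|Ck| * expR (w * (2 * B)) * I by rewrite !mulr_ge0// expR_ge0.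
have [t t0 Ht] := expRN_small A0 w0 e0.
exists (t + 2 * B + 1) => x xD.
(* Reflection moves the kernel to x - y with y in the support of f, where it is exponentially
   small. *)
have [i1 e1] := leb2_reflect x (intble_vol x lk cf).
have E y : x - (x - y) = y by rewrite opprB addrC subrK.
have Ef : (fun y : mR2 => k (x - y) * f (x - (x - y))) = (fun y : mR2 => k (x - y) * f y).
  by apply/funext => y; rewrite E.
rewrite Ef in i1 e1; rewrite /volume_pot -e1.
apply: (@le_trans _ _ (Rintegral (leb2 R) setT (fun y : mR2 => `|Ck| * expR (w * (2 * B)) * expR (- w * t) * `|f y|))); last first.
  by rewrite RintegralZl// -/I mulrAC.
apply: Rint_dom => //; first exact: intble_meas i1.
  exact: intbleZ.
move=> y _; rewrite normrM; have [fB f0] := HB y.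
have [yB|yB] := leP `|y| B; last by rewrite f0// normr0 !mulr0.
apply: ler_wpM2r => //.
have ye : enorm y <= 2 * B by rewrite (le_trans (enorm_le_supnorm y))// ler_wpM2l.
have tr := enorm_sub x y.
have d1 : 1 <= enorm (x - y) by move: tr ye xD t0; clear; lra.
apply: le_trans (HCk _ d1) _; apply: (@le_trans _ _ (`|Ck| * expR (- w * enorm (x - y)))).
  by rewrite ler_wpM2r ?expR_ge0// ler_norm.
rewrite -mulrA ler_wpM2l// -expRD ler_expR !mulNr -mulrBr -mulrN ler_wpM2l ?(ltW w0)//.
by move: tr ye xD t0 B0; clear; lra.
Qed.

Lemma bump_smoothc f : bump f -> exists f1 f2 f11 f12 f22, compact_C2 f f1 f2 f11 f12 f22.
Proof.
move=> bf; have cc g : bump g -> compact_cont g by move=> bg; split; [exact: bump_continuous|exact: bump_bcs].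
have ex (g : R * R -> R) : bump g -> exists g1 g2 : R * R -> R, [/\ bump g1, bump g2, forall z, pd1 g g1 z & forall z, pd2 g g2 z].
  move=> bg; exists ('D_(edir R false) g), ('D_(edir R true) g).
  by split; [exact: bump_partial|exact: bump_partial|move=> z; exact: (smooth2_pd z bg.1).1|move=> z; exact: (smooth2_pd z bg.1).2].
have [f1 [f2 [b1 b2 p1 p2]]] := ex f bf.
have [f11 [f12 [b11 b12 p11 p12]]] := ex f1 b1.
have [f21 [f22 [b21 b22 p21 p22]]] := ex f2 b2.
have E z : f21 z = f12 z by apply: (clairaut z p1 p2 p12 p21); exact: bump_continuous.
have {}E : f21 = f12 by apply/funext.
rewrite E in p21; exists f1, f2, f11, f12, f22.
by split => //; exact: cc.
Qed.

End LocallyIntegrable.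

(** * Integration along horizontal and vertical lines *)

Section Lines.
Variable R : realType.
Notation mR := (measurableTypeR R).
Notation mR2 := (measurableTypeR R * measurableTypeR R)%type.

Lemma Rint_supp (f : R -> R) (a b : R) : (forall x, ~ (a <= x <= b) -> f x = 0) ->
  Rintegral (leb R) setT f = Rintegral (leb R) `[a, b] f.
Proof.
move=> f0; rewrite [RHS]Rint_mkcond; congr Rintegral; apply/funext => x; rewrite patchE.
case: ifPn => //; rewrite notin_setE /= in_itv/=; exact: f0.
Qed.

Lemma Rint_line0 (F f : R -> R) (L : R) : (forall x, is_derive (x : R) (1 : R) F (f x)) -> continuous f ->
  (forall x, L < `|x| -> F x = 0 /\ f x = 0) -> Rintegral (leb R) setT f = 0.
Proof.
move=> dF cf H; pose L' := `|L| + 1.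
have LL : L < L' by rewrite /L' (le_lt_trans (ler_norm L))// ltrDl.
have L0 : 0 < L' by rewrite /L' ltr_wpDl.
rewrite (@Rint_supp f (- L') L'); last first.
  move=> x /negP; rewrite -ler_norml -ltNge => xL.
  by have [|_ ->] := H x; first exact: lt_trans xL.
rewrite (@Rint_FTC2 R F f (- L') L'); first last.
- by move=> x _; exact: cf.
- by rewrite ge0_cp// ltW.
have [|-> _] := H L'; first by rewrite gtr0_norm.
by have [|-> _] := H (- L'); rewrite ?subrr// normrN gtr0_norm.
Qed.

Lemma kernel_line1 (k k1 f f1 : R * R -> R) x (y s : R) : pd1 k k1 (s, y) -> (forall z, pd1 f f1 z) ->
  is_derive (s : R) (1 : R) (fun s => k (s, y) * f (x - (s, y)))
    (k1 (s, y) * f (x - (s, y)) - k (s, y) * f1 (x - (s, y))).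
Proof.
move=> dk df.
have D2 := @dComp R (fun u => f (u, x.2 - y)) (fun s => x.1 - s) s _ _ (df (x.1 - s, x.2 - y)) (dSub (dCst x.1 s) (dId s)).
apply: is_derive_eq (dMul dk D2) _ => /=; ring.
Qed.

Lemma kernel_line2 (k k2 f f2 : R * R -> R) x (y s : R) : pd2 k k2 (s, y) -> (forall z, pd2 f f2 z) ->
  is_derive (y : R) (1 : R) (fun y => k (s, y) * f (x - (s, y)))
    (k2 (s, y) * f (x - (s, y)) - k (s, y) * f2 (x - (s, y))).
Proof.
move=> dk df.
have D2 := @dComp R (fun u => f (x.1 - s, u)) (fun y => x.2 - y) y _ _ (df (x.1 - s, x.2 - y)) (dSub (dCst x.2 y) (dId y)).
apply: is_derive_eq (dMul dk D2) _ => /=; ring.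
Qed.

Lemma continuous_line1 (k : R * R -> R) (y s : R) : {for (s, y), continuous k} -> {for s, continuous (fun s => k (s, y))}.
Proof.
move=> ck; have c : {for s, continuous (fun s : R => (s, y))}.
  by apply: (@cvg_pair _ _ _ _ (nbhs s) (nbhs y) _ _ _ id (fun=> y)); [exact: cvg_id|exact: cvg_cst].
exact: (continuous_comp c ck).
Qed.

Lemma continuous_line2 (k : R * R -> R) (y s : R) : {for (s, y), continuous k} -> {for y, continuous (fun y => k (s, y))}.
Proof.
move=> ck; have c : {for y, continuous (fun y : R => (s, y))}.
  by apply: (@cvg_pair _ _ _ _ (nbhs s) (nbhs y) _ _ _ (fun=> s) id); [exact: cvg_cst|exact: cvg_id].
exact: (continuous_comp c ck).
Qed.

Lemma ccs_supp (f : R * R -> R) x : compact_cont f -> exists L : R, 0 <= L /\ forall s y, (L < `|s|) || (L < `|y|) -> f (x - (s, y)) = 0.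
Proof.
move=> cf; have [_ [B HB]] := ccs_reflect x cf.
have B0 : 0 <= B by have [+ _] := HB 0; apply: le_trans.
exists B; split=> // s y H; apply: (HB (s, y)).2; rewrite prod_normE /= lt_max.
by case/orP: H => ->; rewrite ?orbT.
Qed.

End Lines.

(** * Integration by parts against the singular kernel *)

Section ByParts.
Variables (R : realType) (w : R).
Hypothesis w0 : 0 < w.
Notation mR := (measurableTypeR R).
Notation mR2 := (measurableTypeR R * measurableTypeR R)%type.
Lemma pair_neq0 (s y : R) : (s != 0) || (y != 0) -> (s, y) != (0 : R * R).
Proof. by case/orP => H; apply/eqP => -[E1 E2]; [rewrite E1 eqxx in H|rewrite E2 eqxx in H]. Qed.

Lemma continuous_ccs_reflect (g : R * R -> R) x : compact_cont g -> continuous (fun z : R * R => g (x - z)).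
Proof. by move=> cg; have [] := ccs_reflect x cg. Qed.

(** On every horizontal line but one, which is a null set, the singularity is missed and the
    difference of the integrands is the derivative of a compactly supported function. *)
Lemma vol_parts1 (f f1 : R * R -> R) x : compact_cont f -> compact_cont f1 -> (forall z, pd1 f f1 z) ->
  volume_pot (KA w) f1 x = volume_pot (K1 w) f x.
Proof.
move=> sf sf1 df; have lA := locker_KA w0; have l1 : weakly_singular (K1 w) := locker_Kp false w0.
have i1 := intble_vol x l1 sf; have i2 := intble_vol x lA sf1.
apply/esym/eqP; rewrite -subr_eq0; apply/eqP; rewrite /volume_pot -(RintegralB measurableT i1 i2).
have iF := intbleB measurableT i1 i2.
have [mG ->] := Rint2_snd iF.
rewrite (@Rint_eq_except R _ (fun=> 0) 0) ?Rintegral_cst ?mul0r//.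
move=> y y0; have [L [L0 HL]] := ccs_supp x sf; have [L1 [L10 HL1]] := ccs_supp x sf1.
have [HA _ _ _] := dker_KA w0; have [H1 _ _ _] := dker_K1 w0.
have nz s : (s, y) != (0 : R * R) by apply: pair_neq0; rewrite y0 orbT.
apply: (@Rint_line0 R (fun s => KA w (s, y) * f (x - (s, y))) _ (L + L1)).
- move=> s; apply: kernel_line1; first exact: has_grad_pd1 (HA _ (nz s)).
  exact: df.
- move=> s; apply: (@continuous_line1 R (fun z => K1 w z * f (x - z) - KA w z * f1 (x - z))).
  apply: cvgB; apply: cvgM.
  + exact: has_grad_continuous (H1 _ (nz s)).
  + exact: continuous_ccs_reflect sf _.
  + exact: has_grad_continuous (HA _ (nz s)).
  + exact: continuous_ccs_reflect sf1 _.
- move=> s sL; rewrite HL ?HL1 ?mulr0 ?subr0//; apply/orP; left; apply: le_lt_trans sL; by rewrite ?lerDl ?lerDr.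
Qed.

Lemma vol_parts2 (f f2 : R * R -> R) x : compact_cont f -> compact_cont f2 -> (forall z, pd2 f f2 z) ->
  volume_pot (KA w) f2 x = volume_pot (K2 w) f x.
Proof.
move=> sf sf2 df; have lA := locker_KA w0; have l1 : weakly_singular (K2 w) := locker_Kp true w0.
have i1 := intble_vol x l1 sf; have i2 := intble_vol x lA sf2.
apply/esym/eqP; rewrite -subr_eq0; apply/eqP; rewrite /volume_pot -(RintegralB measurableT i1 i2).
have iF := intbleB measurableT i1 i2.
have [mG ->] := Rint2_fst iF.
rewrite (@Rint_eq_except R _ (fun=> 0) 0) ?Rintegral_cst ?mul0r//.
move=> s s0; have [L [L0 HL]] := ccs_supp x sf; have [L1 [L10 HL1]] := ccs_supp x sf2.
have [HA _ _ _] := dker_KA w0; have [H1 _ _ _] := dker_K2 w0.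
have nz y : (s, y) != (0 : R * R) by apply: pair_neq0; rewrite s0.
apply: (@Rint_line0 R (fun y => KA w (s, y) * f (x - (s, y))) _ (L + L1)).
- move=> y; apply: kernel_line2; first exact: has_grad_pd2 (HA _ (nz y)).
  exact: df.
- move=> y; apply: (@continuous_line2 R (fun z => K2 w z * f (x - z) - KA w z * f2 (x - z))).
  apply: cvgB; apply: cvgM.
  + exact: has_grad_continuous (H1 _ (nz y)).
  + exact: continuous_ccs_reflect sf _.
  + exact: has_grad_continuous (HA _ (nz y)).
  + exact: continuous_ccs_reflect sf2 _.
- move=> y sL; rewrite HL ?HL1 ?mulr0 ?subr0//; apply/orP; right; apply: le_lt_trans sL; by rewrite ?lerDl ?lerDr.
Qed.

Variables (f f1 f2 f11 f12 f22 : R * R -> R).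
Hypothesis sc : compact_C2 f f1 f2 f11 f12 f22.

Variable x : R * R.

(** Off the origin this is minus the divergence in z of the field f (x - z) (K_1, K_2), because K_11
    + K_22 = w^2 K. *)
Definition flux_density (z : R * R) := K1 w z * f1 (x - z) + K2 w z * f2 (x - z) - w ^+ 2 * (KA w z * f (x - z)).

(* The flux of f K_1 through the line z.1 = t; it jumps at t = 0. *)
Definition flux_line (t : R) := Rintegral (leb R) setT (fun y : R => K1 w (t, y) * f (x - (t, y))).

Lemma intble_flux_density : intble (leb2 R) setT flux_density.
Proof.
apply: intbleB => //; last by apply: intbleZ => //; exact: intble_vol (locker_KA w0) (sc_ccs sc).
apply: intbleD => //; first exact: intble_vol (locker_Kp false w0) (sc_ccs1 sc).
exact: intble_vol (locker_Kp true w0) (sc_ccs2 sc).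
Qed.

Lemma intble_compact_line (g : R -> R) (L : R) : continuous g -> (forall y, L < `|y| -> g y = 0) ->
  intble (leb R) setT g.
Proof.
move=> cg g0; have -> : g = g \_ `[(- L), L].
  apply/funext => y; rewrite patchE; case: ifPn => //; rewrite notin_setE /= in_itv/= => /negP.
  by rewrite -ler_norml -ltNge => /g0.
by apply/(intble_mkcond _ _).1 => //; apply: intble_continuous_itv => y _; exact: cg.
Qed.

Lemma intble_flux_line t : t != 0 -> intble (leb R) setT (fun y : R => K1 w (t, y) * f (x - (t, y))).
Proof.
move=> t0; have [L [L0 HL]] := ccs_supp x (sc_ccs sc); have [H1 _ _ _] := dker_K1 w0.
apply: (@intble_compact_line _ L).
  move=> y; apply: (@continuous_line2 R (fun z => K1 w z * f (x - z))); apply: cvgM.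
    by apply: has_grad_continuous; apply: H1; apply: pair_neq0; rewrite t0.
  exact: continuous_ccs_reflect (sc_ccs sc) _.
by move=> y yL; rewrite HL ?mulr0// yL orbT.
Qed.

(** The divergence theorem on a vertical strip that avoids the singularity: the second component
    integrates to 0 along vertical lines, the first gives the difference of the fluxes through the
    two sides. *)
Lemma flux_strip (a b : R) : a <= b -> 0 < a \/ b < 0 ->
  Rintegral (leb2 R) setT (flux_density \_ (`[a, b]%classic `*` setT)) = flux_line a - flux_line b.
Proof.
move=> ab ab0; set A := `[a, b]%classic `*` setT.
have mA : measurable (A : set mR2) by exact: measurableX.
have AE s y : ((s, y) \in A) = (a <= s <= b) by apply/idP/idP; rewrite inE /A /= in_itv/=; [case|].
have [dl [dl0 Hdl]] : exists dl : R, 0 < dl /\ forall s, a <= s <= b -> dl <= `|s|.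
  case: ab0 => H; [exists a; split => // s /andP[s1 _]|exists (- b); split => [|s /andP[_ s1]]; rewrite ?oppr_gt0//].
    by rewrite (le_trans s1)// ler_norm.
  by rewrite -normrN (le_trans _ (ler_norm _))// lerN2.
have s0 s : a <= s <= b -> s != 0 by move=> /Hdl H; rewrite -normr_gt0 (lt_le_trans dl0).
have nz s y : a <= s <= b -> (s, y) != (0 : R * R) by move=> /s0 H; apply: pair_neq0; rewrite H.
have [H1 _ T11 _] := dker_K1 w0; have [H2 _ _ T22] := dker_K2 w0.
pose F (k kk g : R * R -> R) (z : R * R) := kk z * f (x - z) - k z * g (x - z).
have iFA (k kk k1 k2 g : R * R -> R) : weakly_singular k -> (forall z, z != 0 -> has_grad kk z (k1 z) (k2 z)) -> decaying w kk -> compact_cont g ->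
    intble (leb2 R) setT (F k kk g \_ A).
  move=> lk Hkk dkk cg; have [C HC] := dkk _ dl0.
  have l1 : weakly_singular (fun=> 1 : R).
    split; first by move=> z _; exact: cvg_cst.
    by exists 1; split=> // z _; rewrite normr1 mul1r lerDl invr_ge0 enorm_ge0.
  have if_ : intble (leb2 R) setT (fun z : mR2 => `|C| * `|f (x - z)|).
    apply: intbleZ => //; apply: intble_norm => //.
    by have := intble_vol x l1 (sc_ccs sc); under eq_fun do rewrite mul1r.
  have ig := intble_norm measurableT (intble_vol x lk cg).
  apply: (intble_dom measurableT _ (intbleD measurableT if_ ig)).
    apply/(measurable_restrictT _ _).1 => //; apply: measurable_funTS; apply: measurable_funB; last exact: intble_meas (intble_vol x lk cg).
    apply: measurable_funM; first by apply: meas2_except0 => z z0; exact: has_grad_continuous (Hkk z z0).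
    by apply: continuous2_meas; exact: continuous_ccs_reflect (sc_ccs sc).
  move=> [s y] _; rewrite patchE; case: ifPn => [|_]; last by rewrite normr0 addr_ge0// mulr_ge0.
  rewrite AE => sab; rewrite /F (le_trans (ler_normB _ _))// lerD// normrM ler_wpM2r//.
  have dz : dl <= enorm (s, y) by rewrite (le_trans (Hdl s sab))//; exact: (enorm_fst (s, y)).
  apply: le_trans (HC _ dz) _; apply: (@le_trans _ _ (`|C| * expR (- w * enorm (s, y)))).
    by rewrite ler_wpM2r ?expR_ge0// ler_norm.
  by rewrite ler_piMr// -expR0 ler_expR mulNr oppr_le0 mulr_ge0 ?enorm_ge0// ltW.
have [H11 d11] : (exists k1 k2, forall z, z != 0 -> has_grad (K11 w) z (k1 z) (k2 z)) /\ decaying w (K11 w).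
  by case: T11 => d [k1 [k2 [H _ _]]]; split=> //; exists k1, k2.
have [H22 d22] : (exists k1 k2, forall z, z != 0 -> has_grad (K22 w) z (k1 z) (k2 z)) /\ decaying w (K22 w).
  by case: T22 => d [k1 [k2 [H _ _]]]; split=> //; exists k1, k2.
case: H11 => k111 [k112 H11]; case: H22 => k221 [k222 H22].
have i1 := iFA _ _ _ _ _ (locker_Kp false w0) H11 d11 (sc_ccs1 sc).
have i2 := iFA _ _ _ _ _ (locker_Kp true w0) H22 d22 (sc_ccs2 sc).
have -> : flux_density \_ A = (fun z => - ((F (K1 w) (K11 w) f1 \_ A) z + (F (K2 w) (K22 w) f2 \_ A) z)).
  apply/funext => -[s y]; rewrite !patchE; case: ifPn; last by rewrite addr0 oppr0.
  rewrite AE => sab; rewrite /F /flux_density; have := laplace_K w (nz s y sab).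
  move=> L; have -> : K11 w (s, y) = w ^+ 2 * KA w (s, y) - K22 w (s, y) by rewrite -L addrK.
  ring.
rewrite (_ : Rintegral _ _ _ = - (Rintegral (leb2 R) setT (F (K1 w) (K11 w) f1 \_ A) + Rintegral (leb2 R) setT (F (K2 w) (K22 w) f2 \_ A))); last first.
  rewrite -(RintegralD measurableT i1 i2).
  have := RintegralZl (-1) measurableT (intbleD measurableT i1 i2); rewrite mulN1r => <-.
  by congr Rintegral; apply/funext => z; rewrite mulN1r.
have -> : Rintegral (leb2 R) setT (F (K2 w) (K22 w) f2 \_ A) = 0.
  have [_ ->] := Rint2_fst i2.
  rewrite (_ : (fun s : R => _) = (fun=> 0)); first by rewrite Rintegral_cst// mul0r.
  apply/funext => s; have [sab|nsab] := boolP (a <= s <= b); last first.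
    rewrite (_ : (fun y : R => _) = (fun=> 0)); first by rewrite Rintegral_cst// mul0r.
    by apply/funext => y; rewrite patchE AE (negbTE nsab).
  rewrite (_ : (fun y : R => _) = (fun y => F (K2 w) (K22 w) f2 (s, y))); last first.
    by apply/funext => y; rewrite patchE AE sab.
  have [L [L0 HL]] := ccs_supp x (sc_ccs sc); have [L1 [L10 HL1]] := ccs_supp x (sc_ccs2 sc).
  apply: (@Rint_line0 R (fun y => K2 w (s, y) * f (x - (s, y))) _ (L + L1)).
  - move=> y; apply: kernel_line2; first exact: has_grad_pd2 (H2 _ (nz s y sab)).
    exact: sc_pd2 sc.
  - move=> y; apply: (@continuous_line2 R (F (K2 w) (K22 w) f2)).
    apply: cvgB; apply: cvgM.
    + exact: has_grad_continuous (H22 _ (nz s y sab)).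
    + exact: continuous_ccs_reflect (sc_ccs sc) _.
    + exact: has_grad_continuous (H2 _ (nz s y sab)).
    + exact: continuous_ccs_reflect (sc_ccs2 sc) _.
  - move=> y sL; rewrite /F HL ?HL1 ?mulr0 ?subr0//; apply/orP; right; apply: le_lt_trans sL; by rewrite ?lerDl ?lerDr.
have aI : a <= a <= b by rewrite lexx.
have bI : a <= b <= b by rewrite lexx ab.
have [_ ->] := Rint2_snd i1.
rewrite (_ : (fun y : R => _) = (fun y => K1 w (b, y) * f (x - (b, y)) - K1 w (a, y) * f (x - (a, y)))); last first.
  apply/funext => y; rewrite (@Rint_supp R _ a b); last first.
    by move=> s /negP nsab; rewrite patchE AE (negbTE nsab).
  rewrite (_ : Rintegral _ _ _ = Rintegral (leb R) `[a, b] (fun s => F (K1 w) (K11 w) f1 (s, y))); last first.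
    by apply: eq_Rintegral => s; rewrite inE /= in_itv/= => sab; rewrite patchE AE sab.
  apply: (@Rint_FTC2 R (fun s => K1 w (s, y) * f (x - (s, y))) (fun s => F (K1 w) (K11 w) f1 (s, y)) a b ab).
  - move=> s sab; apply: kernel_line1; first exact: has_grad_pd1 (H1 _ (nz s y sab)).
    exact: sc_pd1 sc.
  - move=> s sab; apply: (@continuous_line1 R (F (K1 w) (K11 w) f1)).
    apply: cvgB; apply: cvgM.
    + exact: has_grad_continuous (H11 _ (nz s y sab)).
    + exact: continuous_ccs_reflect (sc_ccs sc) _.
    + exact: has_grad_continuous (H1 _ (nz s y sab)).
    + exact: continuous_ccs_reflect (sc_ccs1 sc) _.
rewrite (RintegralB measurableT (intble_flux_line (s0 b bI)) (intble_flux_line (s0 a aI))).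
by rewrite -/(flux_line a) -/(flux_line b) addr0 opprB.
Qed.


(** The flux through a vertical line is compared with a layer potential on this axis, so its jump
    comes from [layer_trace_strong] and no second singular limit is needed. *)
Lemma straight_line : good_curve (fun t : R => (0, t)) (fun=> (0, 1)) (fun=> 0).
Proof.
split => /=; try by move=> t; first [exact: dCst | exact: dId].
- by move=> t; rewrite /enorm /= expr0n/= add0r expr1n sqrtr1.
- by exists 0, 1; split=> // t; rewrite enorm0 mul0r.
- exists 1, 0; split=> // s t; rewrite mul1r subr0; exact: (enorm_snd ((0, s) - (0, t))).
- by move=> s t [].
Qed.

(** The sign matches (t, 0) - (0, s) = (t, - s), the argument of the kernel in [layer_pot]. *)
Lemma line_dens : dens (fun s : R => f (x - (0, - s))).
Proof.
have D (s : R) : is_derive (s : R) (1 : R) (fun s => f (x - (0, - s))) (f2 (x - (0, - s))).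
  have D2 := @dComp R (fun u => f (x.1 - 0, u)) (fun y => x.2 - - y) s _ _ (sc_pd2 sc (x.1 - 0, x.2 - - s)) (dSub (dCst x.2 s) (dNeg (dId s))).
  apply: is_derive_eq D2 _ => /=; ring.
have c : continuous (fun s : R => f2 (x - (0, - s))).
  move=> s; have cN : {for s, continuous (fun s : R => - s)} by apply: cvgN; exact: cvg_id.
  apply: (continuous_comp (f := fun s : R => - s) (g := fun y : R => f2 (x - (0, y)))); first exact: cN.
  by apply: (@continuous_line2 R (fun z => f2 (x - z))); exact: continuous_ccs_reflect (sc_ccs2 sc) _.
split; first by exists (fun s => f2 (x - (0, - s))).
exists (fun=> 0), (fun s => f (x - (0, - s))), (fun s => f2 (x - (0, - s))); split => //.
- by move=> t; rewrite add0r.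
- apply: (@intble_compact_line _ 0) => //; exact: ctC.
- have [_ [B HB]] := sc_ccs sc; have [_ [B2 HB2]] := sc_ccs2 sc.
  exists (`|B| + `|B2|) => t; split.
    by rewrite (le_trans (HB _).1)// (le_trans (ler_norm B))// lerDl.
  by rewrite (le_trans (HB2 _).1)// (le_trans (ler_norm B2))// lerDr.
Qed.

Lemma frozen_line_trace : exists PV : R, forall (eps : R) (t : nat -> R), eps = 1 \/ eps = -1 ->
  t n @[n --> \oo] --> 0 -> (forall n, 0 < eps * t n) ->
  Rintegral (leb R) setT (fun y : R => K1 w (t n, y) * f (x - (0, y))) @[n --> \oo] --> PV - eps * pi * f x.
Proof.
have [PV H] := layer_trace_strong w0 straight_line false 0 line_dens.
exists PV => eps t He tc tp; have [L [L0 HL]] := ccs_supp x (sc_ccs sc).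
have [H1 _ _ _] := dker_K1 w0.
have pt n : (fun u : nat -> R => ((0 : R, 0 : R) + (- u n) *: rot90 (fun=> (0, 1)) 0)) t = (t n, 0).
  by apply/pair_equal_spec; rewrite /rot90 /= /GRing.scale/=; split; ring.
have t0 n : t n != 0 by apply/eqP => E; have := tp n; rewrite E mulr0 ltxx.
(* The normal of the upward axis is (-1, 0): the point (t n, 0) has height [- t n], on side [- eps],
   and the sign of the normal restores the stated jump. *)
have K := H (- eps) (fun=> 0) (fun n => - t n) _ (cvg_cst _) _ _ _; move: K.
have -> : PV - - eps * pi * proj false (rot90 (fun=> (0, 1)) 0) * f (x - (0, - 0)) = PV - eps * pi * f x.
  rewrite /proj /rot90 /= oppr0 (_ : x - (0, 0) = x); last by rewrite -[(0, 0)]/(0 : R * R) subr0.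
  ring.
move=> K; have {}K : layer_pot [eta pair 0] (K_partial w false) (fun s : R => f (x - (0, - s)))
      ((0, 0) + (- t n) *: rot90 (fun=> (0, 1)) 0) @[n --> \oo] --> PV - eps * pi * f x.
  apply: K.
  - by case: He => ->; [right|left; rewrite opprK].
  - by rewrite -oppr0; apply: cvgN.
  - by move=> n; rewrite mulrNN.
  - move=> n s; rewrite pt => -[E _]; by move: (t0 n); rewrite E eqxx.
apply: cvg_trans K; apply: near_eq_cvg; apply: nearW => n; rewrite pt /layer_pot /K_partial.
  have ii : intble (leb R) setT (fun y : R => K1 w (t n, y) * f (x - (0, y))).
    apply: (@intble_compact_line _ L).
      move=> y; apply: cvgM.
        apply: (@continuous_line2 R (K1 w)).
        by apply: has_grad_continuous; apply: H1; apply: pair_neq0; rewrite t0.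
      apply: (@continuous_line2 R (fun z => f (x - z))); exact: continuous_ccs_reflect (sc_ccs sc) _.
    by move=> y yL; rewrite HL ?mulr0// yL orbT.
  have [_ <-] := Rint_opp ii; congr Rintegral; apply/funext => s.
  by congr (K1 w _ * _); apply/pair_equal_spec; rewrite /= subr0 sub0r.
Qed.

(** Freezing the first coordinate of f costs at most B |t n|, which compensates the singularity: |t
    n| <= |(t n, y)| keeps the integrand bounded, and it tends to 0 for y != 0. *)
Lemma unfreeze_line (t : nat -> R) : t n @[n --> \oo] --> 0 -> (forall n, t n != 0) ->
  flux_line (t n) - Rintegral (leb R) setT (fun y : R => K1 w (t n, y) * f (x - (0, y))) @[n --> \oo] --> (0 : R).
Proof.
move=> tc t0; have [L [L0 HL]] := ccs_supp x (sc_ccs sc).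
have [H1 _ _ _] := dker_K1 w0; have [_ [C [C0 HC]]] := locker_Kp false w0.
have [_ [B HB]] := sc_ccs1 sc; have B0 : 0 <= B by have [+ _] := HB 0; apply: le_trans.
have iL (g : R -> R * R) n : continuous (fun y => f (x - g y)) -> (forall y, L < `|y| -> f (x - g y) = 0) ->
    intble (leb R) setT (fun y : R => K1 w (t n, y) * f (x - g y)).
  move=> cg g0; apply: (@intble_compact_line _ L).
    move=> y; apply: cvgM; last exact: cg.
    apply: (@continuous_line2 R (K1 w)).
    by apply: has_grad_continuous; apply: H1; apply: pair_neq0; rewrite t0.
  by move=> y yL; rewrite g0 ?mulr0.
have cs s : continuous (fun y : R => f (x - (s, y))).
  move=> y; apply: (@continuous_line2 R (fun z => f (x - z))); exact: continuous_ccs_reflect (sc_ccs sc) _.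
have zs s y : L < `|y| -> f (x - (s, y)) = 0 by move=> yL; rewrite HL// yL orbT.
pose D n (y : R) := K1 w (t n, y) * f (x - (t n, y)) - K1 w (t n, y) * f (x - (0, y)).
have E n : flux_line (t n) - Rintegral (leb R) setT (fun y : R => K1 w (t n, y) * f (x - (0, y))) =
    Rintegral (leb R) `[(- L), L] (D n).
  rewrite -(RintegralB measurableT (iL _ n (cs (t n)) (zs (t n))) (iL _ n (cs 0) (zs 0))).
  rewrite (@Rint_supp R _ (- L) L)// => y /negP; rewrite -ler_norml -ltNge => yL.
  by rewrite !zs// !mulr0 subr0.
suff K : Rintegral (leb R) `[(- L), L] (D n) @[n --> \oo] --> Rintegral (leb R) `[(- L), L] (fun=> 0).
  rewrite Rintegral_cst// mul0r in K; apply: cvg_trans K; apply: near_eq_cvg; apply: nearW => n; by rewrite E.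
have lip s y : `|f (x - (s, y)) - f (x - (0, y))| <= B * `|s|.
  have := @mean_value_le R (fun s => f (x - (s, y))) (fun s => - f1 (x - (s, y))) 0 s B.
  rewrite subr0; apply.
    move=> u _; have D2 := @dComp R (fun v => f (v, x.2 - y)) (fun s => x.1 - s) u _ _ (sc_pd1 sc (x.1 - u, x.2 - y)) (dSub (dCst x.1 u) (dId u)).
    apply: is_derive_eq D2 _ => /=; ring.
  by move=> u _; rewrite normrN; exact: (HB _).1.
have Dle n y : y != 0 \/ True -> `|D n y| <= C * (1 + (enorm (t n, y))^-1) * (B * `|t n|).
  move=> _; have A1 : `|K1 w (t n, y)| <= C * (1 + (enorm (t n, y))^-1) by apply: HC; apply: pair_neq0; rewrite t0.
  by have A2 := lip (t n) y; rewrite /D -mulrBr (normrM (K1 w (t n, y))) ler_pM.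
have tn_small : \forall n \near \oo, `|t n| <= 1.
  by have /cvgrPdist_le/(_ 1 ltr01) := tc; apply: filterS => n; rewrite sub0r normrN.
apply: (@Rint_dct_except R `[(- L), L] 0 _ _ (fun=> C * B * 2)) => //.
- apply: filterS tn_small => n tn1; split.
    apply: continuous_itv_meas => y _; apply: cvgB; apply: cvgM.
    + by apply: (@continuous_line2 R (K1 w)); apply: has_grad_continuous; apply: H1; apply: pair_neq0; rewrite t0.
    + exact: cs.
    + by apply: (@continuous_line2 R (K1 w)); apply: has_grad_continuous; apply: H1; apply: pair_neq0; rewrite t0.
    + exact: cs.
  move=> y _ y0; apply: le_trans (Dle n y (or_introl y0)) _.
  have tp : 0 < `|t n| by rewrite normr_gt0.
  have te : `|t n| <= enorm (t n, y) := enorm_fst (t n, y).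
  have ep : 0 < enorm (t n, y) by exact: lt_le_trans te.
  rewrite mulrACA; apply: ler_wpM2l; first exact: mulr_ge0.
  rewrite mulrDl mul1r -[2]/(1 + 1) lerD//.
  by rewrite mulrC ler_pdivrMr// mul1r.
- move=> y _ y0; apply: (norm_cvg0 _ (h := fun n => C * (1 + `|y|^-1) * (B * `|t n|))).
    apply: nearW => n; apply: le_trans (Dle n y (or_introl y0)) _; apply: ler_wpM2r; first exact: mulr_ge0.
    apply: ler_wpM2l => //; rewrite lerD2l lef_pV2 ?posrE ?normr_gt0//.
      exact: (enorm_snd (t n, y)).
    by apply: enorm_gt0; apply: pair_neq0; rewrite y0 orbT.
  have a0 : `|t n| @[n --> \oo] --> (0 : R) by rewrite -(normr0 R); apply: cvg_norm.
  rewrite (_ : 0 = C * (1 + `|y|^-1) * (B * 0) :> R); last by rewrite !mulr0.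
  apply: cvgM; first exact: cvg_cst.
  by apply: cvgM => //; exact: cvg_cst.
- by apply: intble_continuous_itv => s _; exact: cvg_cst.
Qed.

(** The plane is exhausted, up to the support of the data, by the strips [u n <= |z.1| <= L]. The
    fluxes at distance L vanish, and the difference of the inner ones tends to - 2 pi f x. *)
Lemma flux_identity : volume_pot (K1 w) f1 x + volume_pot (K2 w) f2 x = w ^+ 2 * volume_pot (KA w) f x - 2 * pi * f x.
Proof.
have i1 := intble_vol x (locker_Kp false w0) (sc_ccs1 sc).
have i2 := intble_vol x (locker_Kp true w0) (sc_ccs2 sc).
have iA := intble_vol x (locker_KA w0) (sc_ccs sc).
have E : Rintegral (leb2 R) setT flux_density = volume_pot (K1 w) f1 x + volume_pot (K2 w) f2 x - w ^+ 2 * volume_pot (KA w) f x.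
  rewrite /volume_pot -(RintegralD measurableT i1 i2) -(RintegralZl (w ^+ 2) measurableT iA).
  by rewrite -(RintegralB measurableT (intbleD measurableT i1 i2) (intbleZ (w ^+ 2) measurableT iA)).
suff : Rintegral (leb2 R) setT flux_density = - (2 * pi * f x).
  by rewrite E => /eqP; rewrite subr_eq => /eqP ->; rewrite addrC.
have [L0 [L00 HL0]] := ccs_supp x (sc_ccs sc); have [La [La0 HLa]] := ccs_supp x (sc_ccs1 sc).
have [Lb [Lb0 HLb]] := ccs_supp x (sc_ccs2 sc).
pose L := L0 + La + Lb + 1.
have [LL0 LLa LLb L1] : [/\ L0 < L, La < L, Lb < L & 1 <= L] by rewrite /L; move: L00 La0 Lb0; clear -sc w0 x; split; lra.
have Lp : 0 < L by exact: lt_le_trans L1.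
pose u n : R := n.+1%:R^-1; have u0 n : 0 < u n by rewrite invr_gt0 ltr0Sn.
have uL n : u n <= L by rewrite (le_trans _ L1)// invf_le1 ?ltr0Sn// ler1n.
pose A n : set mR2 := `[u n, L]%classic `*` setT; pose A' n : set mR2 := `[(- L), (- u n)]%classic `*` setT.
have mA n : measurable (A n) by exact: measurableX.
have mA' n : measurable (A' n) by exact: measurableX.
have iG := intble_flux_density.
have iGA (D : set mR2) : measurable D -> intble (leb2 R) setT (flux_density \_ D).
  move=> mD; apply: (intble_dom measurableT _ (intble_norm measurableT iG)).
    by apply/(measurable_restrictT _ _).1 => //; apply: measurable_funTS; exact: intble_meas iG.
  by move=> z _; rewrite patchE; case: ifP => // _; rewrite normr0.
pose F n (z : mR2) := (flux_density \_ (A n)) z + (flux_density \_ (A' n)) z.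
have AE n z : (z \in A n) = (u n <= z.1 <= L) by apply/idP/idP; rewrite inE /A /= in_itv/=; [case|].
have AE' n z : (z \in A' n) = (- L <= z.1 <= - u n) by apply/idP/idP; rewrite inE /A' /= in_itv/=; [case|].
have cv1 : Rintegral (leb2 R) setT (F n) @[n --> \oo] --> Rintegral (leb2 R) setT flux_density.
  apply: (@Rint_dct _ _ _ (leb2 R) setT F flux_density (fun z => `|flux_density z|)) => //.
  - by move=> n; apply: measurable_funD; apply: intble_meas; apply: iGA.
  - exact: intble_meas iG.
  - apply: filterS (@axes_null R) => z [z1 z2] _; apply: cvg_near_cst.
    have [zL|zL] := leP `|z.1| L; last first.
      have G0 : flux_density z = 0.
        case: z zL {z1 z2} => s y /= sL; rewrite /flux_density HL0 ?HLa ?HLb ?mulr0 ?addr0 ?subr0//; by rewrite (lt_trans _ sL).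
      by apply: nearW => n; rewrite /F !patchE G0 !if_same addr0.
    have : \forall n \near \oo, u n <= `|z.1|.
      have zp : 0 < `|z.1| by rewrite normr_gt0.
      by have /cvgrPdist_le/(_ _ zp) := @cvg_harmonic R; apply: filterS => n; rewrite sub0r normrN gtr0_norm.
    apply: filterS => n unz; rewrite /F !patchE AE AE'.
    have := u0 n; have [zp|zp] := leP 0 z.1.
      rewrite (ger0_norm zp) in unz zL; rewrite unz zL/= => un; rewrite ifF ?addr0//.
      by apply/negbTE/negP => /andP[_]; move: zp un; clear -sc w0 x; lra.
    rewrite (ltr0_norm zp) in unz zL => un; rewrite ifF ?add0r ?ifT//.
      by move: unz zL; clear -sc w0 x; lra.
    by apply/negbTE/negP => /andP[+ _]; move: zp un; clear -sc w0 x; lra.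
  - exact: intble_norm.
  - move=> n z _; rewrite /F !patchE AE AE'; have := u0 n; case: ifPn => [/andP[z1 _]|_] un.
      rewrite ifF ?addr0//; by apply/negbTE/negP => /andP[_]; move: z1 un; clear -sc w0 x; lra.
    by rewrite add0r; case: ifP => // _; rewrite normr0.
have lineL t : `|t| = L -> flux_line t = 0.
  move=> tL; rewrite /flux_line (_ : (fun y : R => _) = (fun=> 0)); first by rewrite Rintegral_cst// mul0r.
  by apply/funext => y; rewrite HL0 ?mulr0// tL LL0.
have EF n : Rintegral (leb2 R) setT (F n) = flux_line (u n) - flux_line (- u n).
  rewrite /F (RintegralD measurableT (iGA _ (mA n)) (iGA _ (mA' n))).
  rewrite flux_strip ?uL//; last by left.
  rewrite flux_strip ?lerN2 ?uL//; last by right; rewrite oppr_lt0.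
  by rewrite (lineL L) ?gtr0_norm// (lineL (- L)) ?normrN ?gtr0_norm// subr0 sub0r.
have [PV HPV] := frozen_line_trace.
have uc : u n @[n --> \oo] --> (0 : R) := @cvg_harmonic R.
have uNc : - u n @[n --> \oo] --> (0 : R) by rewrite -oppr0; apply: cvgN.
have un0 n : u n != 0 by rewrite lt0r_neq0.
have unN0 n : - u n != 0 by rewrite oppr_eq0.
have K1' := HPV 1 u (or_introl erefl) uc (fun n => ltac:(rewrite mul1r; exact: u0)).
have K2' := HPV (-1) (fun n => - u n) (or_intror erefl) uNc (fun n => ltac:(rewrite mulrNN mul1r; exact: u0)).
pose G (t : R) := Rintegral (leb R) setT (fun y : R => K1 w (t, y) * f (x - (0, y))).
have M1 : flux_line (u n) - G (u n) + G (u n) @[n --> \oo] --> 0 + (PV - 1 * pi * f x).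
  by apply: cvgD; [exact: unfreeze_line|exact: K1'].
have M2 : flux_line (- u n) - G (- u n) + G (- u n) @[n --> \oo] --> 0 + (PV - -1 * pi * f x).
  by apply: cvgD; [exact: unfreeze_line|exact: K2'].
have cv2 : Rintegral (leb2 R) setT (F n) @[n --> \oo] --> - (2 * pi * f x).
  have -> : - (2 * pi * f x) = 0 + (PV - 1 * pi * f x) - (0 + (PV - -1 * pi * f x)) by ring.
  apply: cvg_trans (cvgB M1 M2); apply: near_eq_cvg; apply: nearW => n.
  by rewrite EF !fctE !subrK.
exact: (cvg_unique _ cv1 cv2).
Qed.

End ByParts.

(** * Spinors *)

Section RealParts.
Variable R : realType.
Notation rparts := (bool -> bool -> R).
Implicit Types (r s : rparts) (v : spinor R).

(* A spinor is given by four reals, indexed by the component ([true] is the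
   second one) and by the part ([true] is the imaginary one). *)
Definition spinor_of r : spinor R := \col_k (r (k != 0) false +i* r (k != 0) true).

Definition parts_of v : rparts := fun c b => let z := v (if c then 1 else 0) 0 in if b then complex.Im z else complex.Re z.

Lemma I2_cases (k : 'I_2) : k = 0 \/ k = 1.
Proof. by case: k => -[|[|//]] i; [left|right]; apply/val_inj. Qed.

Lemma spinor_ofK r c b : parts_of (spinor_of r) c b = r c b.
Proof. by rewrite /parts_of /spinor_of mxE; case: c; case: b. Qed.

Lemma parts_ofK v : spinor_of (parts_of v) = v.
Proof.
apply/matrixP => i j; rewrite mxE (ord1 j) /parts_of.
by case: (I2_cases i) => -> /=; case: (v _ 0).
Qed.

Lemma eq_spinor_of r s : (forall c b, r c b = s c b) -> spinor_of r = spinor_of s.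
Proof. by move=> H; apply/matrixP => i j; rewrite !mxE !H. Qed.

Lemma spinor_of_inj r s : spinor_of r = spinor_of s -> forall c b, r c b = s c b.
Proof. by move=> E c b; rewrite -(spinor_ofK r) E spinor_ofK. Qed.

Lemma spinor_ofD r s : spinor_of r + spinor_of s = spinor_of (fun c b => r c b + s c b).
Proof. by apply/matrixP => i j; rewrite !mxE; simpc. Qed.

Lemma spinor_ofB r s : spinor_of r - spinor_of s = spinor_of (fun c b => r c b - s c b).
Proof. by apply/matrixP => i j; rewrite !mxE; simpc. Qed.

Lemma spinor_ofZ (x y : R) r : (x +i* y : cplx R) *: spinor_of r =
  spinor_of (fun c b => if b then x * r c true + y * r c false else x * r c false - y * r c true).
Proof. by apply/matrixP => i j; rewrite !mxE; simpc. Qed.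

Lemma spinor_ofZr (x : R) r : (x%:C : cplx R) *: spinor_of r = spinor_of (fun c b => x * r c b).
Proof.
rewrite -[x%:C]/(x +i* 0) spinor_ofZ; apply: eq_spinor_of => c [];  by rewrite mul0r ?addr0 ?subr0.
Qed.

Lemma mx22_mk (a1 a2 b1 b2 c1 c2 d1 d2 : R) r :
  mx22 (a1 +i* a2) (b1 +i* b2) (c1 +i* c2) (d1 +i* d2) *m spinor_of r = spinor_of (fun c b => match c, b with
   | false, false => a1 * r false false - a2 * r false true + (b1 * r true false - b2 * r true true)
   | false, true => a1 * r false true + a2 * r false false + (b1 * r true true + b2 * r true false)
   | true, false => c1 * r false false - c2 * r false true + (d1 * r true false - d2 * r true true)
   | true, true => c1 * r false true + c2 * r false false + (d1 * r true true + d2 * r true false) end).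
Proof.
apply/matrixP => i j; rewrite !mxE !big_ord_recl big_ord0 !mxE /=.
by rewrite addr0; case: (I2_cases i) => -> /=; simpc.
Qed.

Lemma sint_mk d (T : measurableType d) (mu : {measure set T -> \bar R}) (A : set T) (g : T -> spinor R) (G : T -> rparts) :
  (forall t, g t = spinor_of (G t)) -> sint mu A g = spinor_of (fun c b => Rintegral mu A (fun t => G t c b)).
Proof.
move=> E; apply/matrixP => i j; rewrite !mxE.
congr (_ +i* _); congr Rintegral; apply/funext => t; rewrite /re_part /im_part E mxE //.
Qed.

(* Real form of (2 pi)^-1 (- i sigma1 k1 - i sigma2 k2 + (a sigma3 + E) k0). *)
Definition green_parts (a E : R) (k0 k1 k2 : rparts) : rparts := fun c b =>
  (2 * pi)^-1 * match c, b with
   | false, false => (a + E) * k0 false false + k1 true true - k2 true false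
   | false, true => (a + E) * k0 false true - k1 true false - k2 true true
   | true, false => (E - a) * k0 true false + k1 false true + k2 false false
   | true, true => (E - a) * k0 true true - k1 false false + k2 false true end.

Lemma sigma1E : sigma1 R = mx22 (0 +i* 0) (1 +i* 0) (1 +i* 0) (0 +i* 0).
Proof. by []. Qed.

Lemma sigma2E : sigma2 R = mx22 (0 +i* 0) (0 +i* -1) (0 +i* 1) (0 +i* 0).
Proof. by apply/matrixP => i j; rewrite !mxE; case: (_ == 0); case: (_ == 0) => //=; rewrite /imag; simpc. Qed.

Lemma sigma3E : sigma3 R = mx22 (1 +i* 0) (0 +i* 0) (0 +i* 0) (-1 +i* 0).
Proof. by apply/matrixP => i j; rewrite !mxE; case: (_ == 0); case: (_ == 0) => //=; simpc. Qed.

Definition green_spinor (a E : R) (s0 s1 s2 : spinor R) : spinor R :=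
  ((2 * pi)^-1)%:C *: (- imag R *: (sigma1 R *m s1) - imag R *: (sigma2 R *m s2) + a%:C *: (sigma3 R *m s0) + E%:C *: s0).

Lemma gmat_mk (a E : R) (k0 k1 k2 : rparts) : green_spinor a E (spinor_of k0) (spinor_of k1) (spinor_of k2) = spinor_of (green_parts a E k0 k1 k2).
Proof.
have NI : - imag R = 0 +i* -1 by rewrite /imag; simpc.
rewrite /green_spinor sigma1E sigma2E sigma3E !mx22_mk NI /imag.
rewrite !(spinor_ofZ, spinor_ofB, spinor_ofD); apply: eq_spinor_of => c b; rewrite /green_parts; case: c; case: b; ring.
Qed.

Variables (m E : R).

Lemma greenE j x y (k k1 k2 : R) : besselK0 (omega m E * enorm (x - y)) = k ->
  'D_(edir R false) (fun z : R * R => besselK0 (omega m E * enorm (z - y))) x = k1 ->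
  'D_(edir R true) (fun z : R * R => besselK0 (omega m E * enorm (z - y))) x = k2 ->
  forall v, green m E j x y *m v = green_spinor ((-1) ^+ j * m) E (k%:C *: v) (k1%:C *: v) (k2%:C *: v).
Proof.
move=> h0 h1 h2 v; rewrite /green /= h0 h1 h2 /green_spinor.
have M (a b : R) : ((a * b)%:C : cplx R) = (a%:C : cplx R) * (b%:C : cplx R) := rmorphM (real_complex R) a b.
rewrite -scalemxAl (M ((-1) ^+ j * m) k) (M E k); congr (_ *: _).
move: (sigma1 R) (sigma2 R) (sigma3 R) (imag R) (((-1) ^+ j * m)%:C : cplx R) (k%:C : cplx R) (k1%:C : cplx R) (k2%:C : cplx R) (E%:C : cplx R) => s1 s2 s3 i a z z1 z2 e.
by rewrite 3!mulmxDl mulNmx mul_scalar_mx -!scalemxAl -!scalemxAr !scalerA.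
Qed.

End RealParts.

(** * The kernel derivatives, including the coincident point *)

Section CoincidentPoint.
Variable R : realType.

(** The difference quotient of an even function at 0 is odd in h. If it converges, the limit equals
    its opposite; if not, the derivative takes the default value 0. *)
Lemma derive_even0 (k : R * R -> R) (v y : R * R) : (forall z, k (- z) = k z) ->
  'D_v (fun z => k (z - y)) y = 0.
Proof.
move=> ev; rewrite /derive.
set q := fun h : R => _.
have qE (h : R) : q (- h) = - q h.
  rewrite /q /= invrN scaleNr; congr (- (_ *: _)).
  rewrite !addrK -[in RHS]ev; congr (k _ - _).
  by rewrite scaleNr.
have [cq|ncq] := pselect (cvg (q @ 0^')); last by rewrite dvgP.
set l := lim _; have ql : q h @[h --> 0^'] --> l by exact: cq.
have qN : q (- h) @[h --> (0 : R)^'] --> l.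
  apply: (cvg_comp (fun h : R => - h) q _ ql).
  move=> A [e /= e0 H]; exists e => //= h hA h0; apply: H => /=.
    by rewrite sub0r opprK; move: hA; rewrite /= sub0r normrN.
  by rewrite oppr_eq0.
have qN' : q (- h) @[h --> (0 : R)^'] --> - l.
  have -> : (fun h => q (- h)) = (fun h => - q h) by apply/funext => h; exact: qE.
  exact: cvgN.
have : l = - l by exact: (cvg_unique _ qN qN').
by move=> /eqP; rewrite -subr_eq0 opprK -mulr2n mulrn_eq0 /= => /eqP.
Qed.

Lemma derive_besselK0 (w : R) (b : bool) (x y : R * R) : 0 < w ->
  'D_(edir R b) (fun z : R * R => besselK0 (w * enorm (z - y))) x = (if b then K2 w else K1 w) (x - y).
Proof.
move=> w0; have -> : (fun z : R * R => besselK0 (w * enorm (z - y))) = (fun z => KA w (z - y)).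
  by apply/funext => z; rewrite besselK0E.
have [xy|xy] := eqVneq x y.
  rewrite xy derive_even0; last by move=> z; rewrite /KA enormN.
  rewrite subrr; case: b; by rewrite /K1 /K2 /nx /ny /= mul0r !mulr0.
have xy0 : x - y != 0 by rewrite subr_eq0.
have [H _ _ _] := dker_KA w0.
rewrite (has_grad_derive _ (has_grad_shift (H _ xy0))).
by case: b; rewrite /edir /= ?mulr1 ?mulr0 ?addr0 ?add0r.
Qed.

End CoincidentPoint.

(** * The Dirac equation in real components *)

Section DiracEquation.
Variable R : realType.
Notation rparts := (bool -> bool -> R).

Lemma has_grad_lin (f g : R * R -> R) x (a b a' b' c : R) : has_grad f x a b -> has_grad g x a' b' ->
  has_grad (fun y => f y + c * g y) x (a + c * a') (b + c * b').
Proof.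
move=> H1 H2; apply: has_grad_uniq_eq (has_gradD H1 (has_gradM (has_grad_cst c x) H2)) _ _; ring.
Qed.

Lemma has_grad_gform (a E : R) (S0 S1 S2 : bool -> bool -> R * R -> R) (A0 A1 A2 B0 B1 B2 : rparts) x :
  (forall c b, has_grad (S0 c b) x (A0 c b) (B0 c b)) ->
  (forall c b, has_grad (S1 c b) x (A1 c b) (B1 c b)) ->
  (forall c b, has_grad (S2 c b) x (A2 c b) (B2 c b)) ->
  forall c b, has_grad (fun y => green_parts a E (fun c b => S0 c b y) (fun c b => S1 c b y) (fun c b => S2 c b y) c b) x
    (green_parts a E A0 A1 A2 c b) (green_parts a E B0 B1 B2 c b).
Proof.
move=> H0 H1 H2 c b.
have z := has_grad_cst (0 : R) x.
pose p : R := (2 * pi)^-1.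
have T (k l n : R) (f g h : R * R -> R) (af bf ag bg ah bh : R) : has_grad f x af bf -> has_grad g x ag bg -> has_grad h x ah bh ->
    has_grad (fun y => p * (k * f y + l * g y + n * h y)) x (p * (k * af + l * ag + n * ah)) (p * (k * bf + l * bg + n * bh)).
  move=> hf hg hh.
  have K := has_grad_lin p z (has_grad_lin n (has_grad_lin l (has_grad_lin k z hf) hg) hh).
  rewrite [X in has_grad X](_ : _ = (fun y => 0 + p * (0 + k * f y + l * g y + n * h y))); last first.
    by apply/funext => y; rewrite !add0r.
  by apply: has_grad_uniq_eq K _ _; rewrite !add0r.
rewrite /green_parts; case: c; case: b => /=.
- have K := T (E - a) (-1) 1 _ _ _ _ _ _ _ _ _ (H0 true true) (H1 false false) (H2 false true).
  rewrite [X in has_grad X](_ : _ = (fun y => p * ((E - a) * S0 true true y + -1 * S1 false false y + 1 * S2 false true y))); last first.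
    by apply/funext => y; rewrite mulN1r mul1r.
  by apply: has_grad_uniq_eq K _ _; rewrite mulN1r mul1r.
- have K := T (E - a) 1 1 _ _ _ _ _ _ _ _ _ (H0 true false) (H1 false true) (H2 false false).
  rewrite [X in has_grad X](_ : _ = (fun y => p * ((E - a) * S0 true false y + 1 * S1 false true y + 1 * S2 false false y))); last first.
    by apply/funext => y; rewrite !mul1r.
  by apply: has_grad_uniq_eq K _ _; rewrite !mul1r.
- have K := T (a + E) (-1) (-1) _ _ _ _ _ _ _ _ _ (H0 false true) (H1 true false) (H2 true true).
  rewrite [X in has_grad X](_ : _ = (fun y => p * ((a + E) * S0 false true y + -1 * S1 true false y + -1 * S2 true true y))); last first.
    by apply/funext => y; rewrite !mulN1r.
  by apply: has_grad_uniq_eq K _ _; rewrite !mulN1r.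
- have K := T (a + E) 1 (-1) _ _ _ _ _ _ _ _ _ (H0 false false) (H1 true true) (H2 true false).
  rewrite [X in has_grad X](_ : _ = (fun y => p * ((a + E) * S0 false false y + 1 * S1 true true y + -1 * S2 true false y))); last first.
    by apply/funext => y; rewrite mulN1r mul1r.
  by apply: has_grad_uniq_eq K _ _; rewrite mulN1r mul1r.
Qed.

Lemma has_grad_near (f g : R * R -> R) x (a b : R) : (\forall y \near x, f y = g y) ->
  has_grad g x a b -> has_grad f x a b.
Proof.
move=> fg Hg; have /nbhs_ballP[e /= e0 He] := fg.
have H0 : has_grad (fun y => f y - g y) x 0 0.
  apply: (@has_grad_quad _ _ _ _ _ 0 e e0) => h he.
  have Ex : f x = g x by apply: He; exact: ballxx.
  have Eh : f (x + h) = g (x + h) by apply: He; rewrite -ball_normE /= opprD addrA subrr sub0r normrN.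
  by rewrite Ex Eh !subrr !mul0r addr0 subr0 normr0.
have K := has_gradD Hg H0.
rewrite (_ : f = fun y => g y + (f y - g y)); last by apply/funext => y; rewrite addrC subrK.
by apply: has_grad_uniq_eq K _ _; rewrite addr0.
Qed.

Lemma re_im_mk (T : Type) (U : bool -> bool -> T -> R) (k : 'I_2) :
  re_part (fun y => spinor_of (fun c b => U c b y)) k = U (k != 0) false /\
  im_part (fun y => spinor_of (fun c b => U c b y)) k = U (k != 0) true.
Proof. by split; apply/funext => y; rewrite /re_part /im_part mxE. Qed.

(** With D = - i sigma . grad, the anticommutation of D and sigma3 gives (D + a sigma3 - E) (D + a
    sigma3 + E) = - Laplacian + a^2 - E^2. Applied to S0 / (2 pi) this leaves g, by the hypothesis
    on T11 + T22. *)
Lemma dirac_gform (a E w : R) (S0 S1 S2 : bool -> bool -> R * R -> R) (T11 T12 T22 g : rparts) x :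
  w ^+ 2 = a ^+ 2 - E ^+ 2 ->
  (forall c b, has_grad (S0 c b) x (S1 c b x) (S2 c b x)) ->
  (forall c b, has_grad (S1 c b) x (T11 c b) (T12 c b)) ->
  (forall c b, has_grad (S2 c b) x (T12 c b) (T22 c b)) ->
  (forall c b, T11 c b + T22 c b = w ^+ 2 * S0 c b x - 2 * pi * g c b) ->
  forall u : R * R -> spinor R,
  (\forall y \near x, u y = spinor_of (green_parts a E (fun c b => S0 c b y) (fun c b => S1 c b y) (fun c b => S2 c b y))) ->
  each_part (fun h => differentiable h x) u /\ dirac a u x - E%:C *: u x = spinor_of g.
Proof.
move=> w2 H0 H1 H2 HT u unear.
pose U c b y := parts_of (u y) c b.
have uE : u = (fun y => spinor_of (fun c b => U c b y)) by apply/funext => y; rewrite -[LHS]parts_ofK.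
have HU c b : has_grad (U c b) x (green_parts a E (fun c b => S1 c b x) T11 T12 c b) (green_parts a E (fun c b => S2 c b x) T12 T22 c b).
  apply: has_grad_near (has_grad_gform a E H0 H1 H2 c b).
  by apply: filterS unear => y E'; rewrite /U E' spinor_ofK.
split.
  by move=> k; have [r1 r2] := re_im_mk U k; rewrite uE r1 r2; split; exact: has_grad_differentiable (HU _ _).
have sd d (V : rparts) : (forall c b, 'D_(edir R d) (U c b) x = V c b) -> sderive (edir R d) u x = spinor_of V.
  move=> HV; apply/matrixP => i j; have [r1 r2] := re_im_mk U i.
  by rewrite !mxE uE r1 r2 !HV.
have ux : u x = spinor_of (green_parts a E (fun c b => S0 c b x) (fun c b => S1 c b x) (fun c b => S2 c b x)).
  exact: nbhs_singleton unear.
have D1 := sd false (green_parts a E (fun c b => S1 c b x) T11 T12) _.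
have D2 := sd true (green_parts a E (fun c b => S2 c b x) T12 T22) _.
rewrite /dirac D1; last by move=> c b; rewrite (has_grad_derive _ (HU c b)) /edir /= mulr1 mulr0 addr0.
rewrite D2; last by move=> c b; rewrite (has_grad_derive _ (HU c b)) /edir /= mulr1 mulr0 add0r.
have NI : - imag R = 0 +i* -1 by rewrite /imag; simpc.
rewrite ux sigma1E sigma2E sigma3E !mx22_mk NI /imag !(spinor_ofZ, spinor_ofB, spinor_ofD); apply: eq_spinor_of => c b.
have n0 : 2 * pi != 0 :> R by rewrite mulf_neq0// lt0r_neq0// pi_gt0.
have gE c' b' : g c' b' = (w ^+ 2 * S0 c' b' x - T11 c' b' - T22 c' b') * (2 * pi)^-1.
  apply: (mulIf n0); rewrite divfK//; have HH := HT c' b'.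
  have -> : w ^+ 2 * S0 c' b' x = T11 c' b' + T22 c' b' + 2 * pi * g c' b' by rewrite HH subrK.
  by move: (2 * pi) => q; ring.
rewrite gE w2 /green_parts; move: (2 * pi)^-1 => q; case: c; case: b => /=; ring.
Qed.

End DiracEquation.

(** * Oscillating densities *)

Section Oscillating.
Variables (R : realType) (E : R).
Notation mR := (measurableTypeR R).
Implicit Types (p q b h : R -> R).

(* b + i b2 behaves like e^(iE|t|) at both ends. *)
Record osc_ends b b' b2 b2' : Prop := OscEnds {
  oe_p1 : b' t + E * b2 t @[t --> +oo] --> (0 : R);
  oe_p2 : b2' t - E * b t @[t --> +oo] --> (0 : R);
  oe_m1 : - b' (- t) + E * b2 (- t) @[t --> +oo] --> (0 : R);
  oe_m2 : - b2' (- t) - E * b (- t) @[t --> +oo] --> (0 : R) }.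

Definition osc p q := C1fun p /\ C1fun q /\ exists a b b' a2 b2 b2',
  [/\ split_dens p a b b', split_dens q a2 b2 b2' & osc_ends b b' b2 b2'].

Lemma osc_dens p q : osc p q -> dens p /\ dens q.
Proof.
by move=> [cp [cq [a [b [b' [a2 [b2 [b2' [s1 s2 _]]]]]]]]]; split; split=> //; [exists a, b, b'|exists a2, b2, b2'].
Qed.

Lemma cvg0_eq (f g : R -> R) : (forall t, g t = f t) -> f t @[t --> +oo] --> (0 : R) -> g t @[t --> +oo] --> (0 : R).
Proof. by move=> H; have -> : g = f by apply/funext. Qed.

Lemma cvg0D (f g : R -> R) : f t @[t --> +oo] --> (0 : R) -> g t @[t --> +oo] --> (0 : R) ->
  f t + g t @[t --> +oo] --> (0 : R).
Proof. by move=> H1 H2; rewrite -(addr0 (0 : R)); apply: cvgD. Qed.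

Lemma cvg0_bounded (f g : R -> R) (B : R) : f t @[t --> +oo] --> (0 : R) -> (forall t, `|g t| <= B) ->
  g t * f t @[t --> +oo] --> (0 : R).
Proof.
move=> f0 gB; apply: (norm_cvg0 _ (h := fun t => B * `|f t|)).
  by apply: nearW => t; rewrite normrM ler_wpM2r.
rewrite -(mulr0 B); apply: cvgM; first exact: cvg_cst.
by rewrite -(normr0 R); apply: cvg_norm.
Qed.

Lemma C1funD p q : C1fun p -> C1fun q -> C1fun (fun t => p t + q t).
Proof.
move=> [p' [dp cp]] [q' [dq cq]]; exists (fun t => p' t + q' t); split; first by move=> t; exact: dAdd.
exact: ctD.
Qed.

Lemma C1funM p q : C1fun p -> C1fun q -> C1fun (fun t => p t * q t).
Proof.
move=> hp hq; have cp0 := C1fun_continuous hp; have cq0 := C1fun_continuous hq.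
case: hp => p' [dp cp]; case: hq => q' [dq cq].
exists (fun t => p' t * q t + p t * q' t); split; last by apply: ctD; exact: ctM.
by move=> t; apply: is_derive_eq (dMul (dp t) (dq t)) _; ring.
Qed.

Lemma split_densD p q a b b' a2 b2 b2' : split_dens p a b b' -> split_dens q a2 b2 b2' ->
  split_dens (fun t => p t + q t) (fun t => a t + a2 t) (fun t => b t + b2 t) (fun t => b' t + b2' t).
Proof.
move=> [e1 i1 [B1 H1] d1 c1] [e2 i2 [B2 H2] d2 c2]; split.
- by move=> t; rewrite e1 e2; ring.
- exact: intbleD.
- exists (B1 + B2) => t; have [u1 u2] := H1 t; have [v1 v2] := H2 t.
  by split; rewrite (le_trans (ler_normD _ _))// lerD.
- by move=> t; exact: dAdd.
- exact: ctD.
Qed.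

Lemma split_densN p a b b' : split_dens p a b b' ->
  split_dens (fun t => - p t) (fun t => - a t) (fun t => - b t) (fun t => - b' t).
Proof.
move=> [e1 i1 [B1 H1] d1 c1]; split.
- by move=> t; rewrite e1 opprD.
- exact: intbleN.
- by exists B1 => t; rewrite !normrN.
- by move=> t; exact: dNeg.
- exact: ctN.
Qed.

Lemma oscD p q p2 q2 : osc p q -> osc p2 q2 -> osc (fun t => p t + p2 t) (fun t => q t + q2 t).
Proof.
move=> [cp [cq [a [b [b' [a2 [b2 [b2' [s1 s2 [e1 e2 e3 e4]]]]]]]]]].
move=> [cp' [cq' [a3 [b3 [b3' [a4 [b4 [b4' [s3 s4 [e5 e6 e7 e8]]]]]]]]]].
split; first exact: C1funD; split; first exact: C1funD.
do 6 eexists; split; [exact: split_densD s1 s3|exact: split_densD s2 s4|split].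
- by apply: cvg0_eq (cvg0D e1 e5) => t; ring.
- by apply: cvg0_eq (cvg0D e2 e6) => t; ring.
- by apply: cvg0_eq (cvg0D e3 e7) => t; ring.
- by apply: cvg0_eq (cvg0D e4 e8) => t; ring.
Qed.

Lemma cvg0N (f : R -> R) : f t @[t --> +oo] --> (0 : R) -> - f t @[t --> +oo] --> (0 : R).
Proof. by move=> H; rewrite -oppr0; apply: cvgN. Qed.

(** Multiplication of p + i q by i. *)
Lemma osc_i p q : osc p q -> osc (fun t => - q t) p.
Proof.
move=> [cp [cq [a [b [b' [a2 [b2 [b2' [s1 s2 [e1 e2 e3 e4]]]]]]]]]].
split.
  case: cq => q' [dq cq']; exists (fun t => - q' t); split; last exact: ctN.
  by move=> t; exact: dNeg.
split=> //; do 6 eexists; split; [exact: split_densN s2|exact: s1|split].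
- by apply: cvg0_eq (cvg0N e2) => t; ring.
- by apply: cvg0_eq e1 => t; ring.
- by apply: cvg0_eq (cvg0N e4) => t; ring.
- by apply: cvg0_eq e3 => t; ring.
Qed.

(** Coefficients whose derivative vanishes at both ends: multiplying by them disturbs the
    oscillation only by h' b, which tends to 0. Constants and tangent components, the building
    blocks of [Vmx], are of this kind. *)
Definition slow h h' := [/\ forall t, is_derive (t : R) (1 : R) h (h' t), continuous h',
  exists B, forall t, `|h t| <= B /\ `|h' t| <= B, h' t @[t --> +oo] --> (0 : R) & h' (- t) @[t --> +oo] --> (0 : R)].

Lemma slow_cst (c : R) : slow (fun=> c) (fun=> 0).
Proof.
split; [by move=> t; exact: dCst|exact: ctC| |exact: cvg_cst|exact: cvg_cst].
by exists `|c| => t; rewrite normr0 lexx normr_ge0.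
Qed.

Lemma split_densM h h' p a b b' : slow h h' -> split_dens p a b b' ->
  split_dens (fun t => h t * p t) (fun t => h t * a t) (fun t => h t * b t) (fun t => h' t * b t + h t * b' t).
Proof.
move=> [dh ch' [H hH] _ _] [e1 i1 [B1 H1] d1 c1].
have ch : continuous h by move=> t; exact: is_derive_continuous (dh t).
have cb : continuous b by move=> t; exact: is_derive_continuous (d1 t).
have H0 : 0 <= H by have [+ _] := hH 0; apply: le_trans.
have B0 : 0 <= B1 by have [+ _] := H1 0; apply: le_trans.
split.
- by move=> t; rewrite e1 mulrDr.
- have ia : intble (leb R) setT (fun t : R => H * `|a t|) by apply: intbleZ => //; exact: intble_norm.
  apply: (intble_dom measurableT _ ia) => [|t _]; last by rewrite normrM ler_wpM2r// (hH t).1.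
  apply: measurable_funM; last exact: intble_meas i1.
  by have K := continuous_meas ch; exact: K.
- exists (H * B1 + H * B1) => t; have [u1 u2] := hH t; have [v1 v2] := H1 t; split.
    by rewrite normrM (le_trans (ler_pM _ _ u1 v1))// lerDl mulr_ge0.
  by rewrite (le_trans (ler_normD _ _))// !normrM lerD// ler_pM.
- by move=> t; apply: is_derive_eq (dMul (dh t) (d1 t)) _; ring.
- by apply: ctD; exact: ctM.
Qed.

Lemma osc_mul h h' p q : slow h h' -> osc p q -> osc (fun t => h t * p t) (fun t => h t * q t).
Proof.
move=> sh [cp [cq [a [b [b' [a2 [b2 [b2' [s1 s2 [e1 e2 e3 e4]]]]]]]]]].
have [dh ch' [H hH] p0 m0] := sh.
have Ch : C1fun h by exists h'.
split; first exact: C1funM; split; first exact: C1funM.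
do 6 eexists; split; [exact: split_densM sh s1|exact: split_densM sh s2|].
have [B1 HB1] := sd_bound s1; have [B2 HB2] := sd_bound s2.
split.
- apply: cvg0_eq (cvg0D (cvg0_bounded e1 (fun t => (hH t).1)) (cvg0_bounded p0 (fun t => (HB1 t).1))) => t; ring.
- apply: cvg0_eq (cvg0D (cvg0_bounded e2 (fun t => (hH t).1)) (cvg0_bounded p0 (fun t => (HB2 t).1))) => t; ring.
- apply: cvg0_eq (cvg0D (cvg0_bounded e3 (fun t => (hH (- t)).1)) (cvg0N (cvg0_bounded m0 (fun t => (HB1 (- t)).1)))) => t; ring.
- apply: cvg0_eq (cvg0D (cvg0_bounded e4 (fun t => (hH (- t)).1)) (cvg0N (cvg0_bounded m0 (fun t => (HB2 (- t)).1)))) => t; ring.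
Qed.

Lemma osc_L1 p q : C1fun p -> C1fun q -> intble (leb R) setT p -> intble (leb R) setT q -> osc p q.
Proof.
have S f : intble (leb R) setT f -> split_dens f f (fun=> 0) (fun=> 0).
  move=> fi; split => //; [by move=> t; rewrite addr0|by exists 0 => t; rewrite normr0|by move=> t; exact: dCst|exact: ctC].
move=> cp cq ip iq; split=> //; split=> //; do 6 eexists; split; [exact: S|exact: S|].
have z : (fun _ : R => 0 : R) t @[t --> +oo] --> (0 : R) by exact: cvg_cst.
by split; apply: cvg0_eq z => t; rewrite ?mulr0 ?oppr0 ?addr0 ?subr0.
Qed.

End Oscillating.

(** * Convolution with the outgoing exponential *)

Section Primitive.
Variable R : realType.
Notation mR := (measurableTypeR R).

Lemma halfline_primitive (phi : R -> R) : continuous phi -> intble (leb R) setT phi ->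
  let X t := Rintegral (leb R) `]-oo, t] phi in
  [/\ forall t, is_derive (t : R) (1 : R) X (phi t), exists B, forall t, `|X t| <= B,
   X t @[t --> +oo] --> Rintegral (leb R) setT phi & X (- t) @[t --> +oo] --> (0 : R)].
Proof.
move=> cphi iphi X.
have XE t : X t = Rintegral (leb R) setT (phi \_ `]-oo, t]) by rewrite /X Rint_mkcond.
have mphi := intble_meas iphi.
have mX t : measurable_fun [set: mR] (phi \_ `]-oo, t]).
  by apply/(measurable_restrictT _ _).1 => //; exact: measurable_funTS.
have dom t x : `|(phi \_ `]-oo, t]) x| <= `|phi x|.
  by rewrite patchE; case: ifP => // _; rewrite normr0.
have inorm := intble_norm measurableT iphi.
split.
- move=> t; have t1 : t < t + 1 by rewrite ltrDl.
  have [||D E] := @continuous_FTC1 R phi -oo%O t (t + 1) t1 _ _ (cphi t); last 2 first.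
  - exact: ltNyr.
  - by apply: DeriveDef; [exact: D|rewrite -derive1E; exact: E].
  by apply: (intble_sub (D := setT)) => //; exact: iphi.
- by exists (Rintegral (leb R) setT (fun x => `|phi x|)) => t; rewrite XE; apply: Rint_dom => // x _; exact: dom.
- apply: cvg_pinfty_seq => u uoo.
  have -> : (fun n => X (u n)) = (fun n => Rintegral (leb R) setT (phi \_ `]-oo, (u n)])) by apply/funext => n.
  apply: (@Rint_dct _ _ _ (leb R) setT _ phi (fun x => `|phi x|)) => //.
  apply: aeW => x _; apply: cvg_near_cst; move/cvgryPge : uoo => /(_ x).
  by apply: filterS => n xu; rewrite patchE ifT// inE/= in_itv/=.
- apply: cvg_pinfty_seq => u uoo.
  have -> : (fun n => X (- u n)) = (fun n => Rintegral (leb R) setT (phi \_ `]-oo, (- u n)])) by apply/funext => n.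
  rewrite -[0](_ : Rintegral (leb R) setT (fun=> 0) = 0); last by rewrite Rintegral_cst// mul0r.
  apply: (@Rint_dct _ _ _ (leb R) setT _ (fun=> 0) (fun x => `|phi x|)) => //.
  apply: aeW => x _; apply: cvg_near_cst; move/cvgryPgt : uoo => /(_ (- x)).
  apply: filterS => n xu; rewrite patchE ifF//; apply/negbTE; rewrite notin_setE /= in_itv/=; apply/negP.
  by rewrite -ltNge ltrNl.
Qed.

Variable E : R.
Variable r : R -> R.
Hypotheses (cr : continuous r) (ir : intble (leb R) setT r).

Definition cos_conv (t : R) := Rintegral (leb R) setT (fun s : R => cos (E * `|t - s|) * r s).
Definition sin_conv (t : R) := Rintegral (leb R) setT (fun s : R => sin (E * `|t - s|) * r s).

Lemma ccosE (c : R) : continuous (fun s : R => cos (c * s)).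
Proof. by apply: ctcomp; [exact: continuous_cos|apply: ctZ => y; exact: cvg_id]. Qed.
Lemma csinE (c : R) : continuous (fun s : R => sin (c * s)).
Proof. by apply: ctcomp; [exact: continuous_sin|apply: ctZ => y; exact: cvg_id]. Qed.

Lemma cos_abs_le1 (x : R) : `|cos x| <= 1.
Proof. by rewrite ler_norml cos_geN1 cos_le1. Qed.
Lemma sin_abs_le1 (x : R) : `|sin x| <= 1.
Proof. by rewrite ler_norml sin_geN1 sin_le1. Qed.

Lemma intble_osc (f : R -> R) : continuous f -> (forall s, `|f s| <= 1) -> intble (leb R) setT (fun s : R => f s * r s).
Proof.
move=> cf f1; apply: (intble_dom measurableT _ (intble_norm measurableT ir)).
  by have H := continuous_meas (ctM cf cr); exact: H.
by move=> s _; rewrite normrM ler_piMl.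
Qed.

Let phc (s : R) := cos (E * s) * r s.
Let phs (s : R) := sin (E * s) * r s.
Let ic : intble (leb R) setT phc. Proof. by apply: intble_osc; [exact: ccosE|move=> s; exact: cos_abs_le1]. Qed.
Let is_ : intble (leb R) setT phs. Proof. by apply: intble_osc; [exact: csinE|move=> s; exact: sin_abs_le1]. Qed.
Let cc := Rintegral (leb R) setT phc.
Let cs := Rintegral (leb R) setT phs.

Lemma CcosE t : cos_conv t = cos (E * t) * cc + sin (E * t) * cs.
Proof.
rewrite /cc /cs -(RintegralZl (cos (E * t)) measurableT ic) -(RintegralZl (sin (E * t)) measurableT is_).
rewrite -(RintegralD measurableT (intbleZ (cos (E * t)) measurableT ic) (intbleZ (sin (E * t)) measurableT is_)).
congr Rintegral; apply/funext => s; rewrite /phc /phs.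
have -> : cos (E * `|t - s|) = cos (E * t - E * s).
  by rewrite -mulrBr; have [st|st] := leP 0 (t - s); [rewrite ger0_norm|rewrite ltr0_norm// mulrN cosN].
by rewrite cosB; ring.
Qed.

(** sin (E |t - s|) equals sin (E (t - s)) for s <= t and its opposite beyond, so the integral is
    twice the one over the half-line minus the one over the line. The cosine is even and needs no
    such split. *)
Lemma CsinE t : sin_conv t = 2 * (sin (E * t) * Rintegral (leb R) `]-oo, t] phc - cos (E * t) * Rintegral (leb R) `]-oo, t] phs)
   - (sin (E * t) * cc - cos (E * t) * cs).
Proof.
pose g (s : R) := sin (E * t) * phc s - cos (E * t) * phs s.
have ig : intble (leb R) setT g by apply: intbleB => //; exact: intbleZ.
have gI D : measurable (D : set mR) -> Rintegral (leb R) D g = sin (E * t) * Rintegral (leb R) D phc - cos (E * t) * Rintegral (leb R) D phs.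
  move=> mD.
  have ic' : intble (leb R) D phc by exact: intble_sub ic.
  have is' : intble (leb R) D phs by exact: intble_sub is_.
  rewrite -(RintegralZl (sin (E * t)) mD ic') -(RintegralZl (cos (E * t)) mD is').
  by rewrite -(RintegralB mD (intbleZ (sin (E * t)) mD ic') (intbleZ (cos (E * t)) mD is')).
rewrite -gI// -[in X in _ - X](gI setT)// Rint_mkcond.
have igD : intble (leb R) setT (g \_ `]-oo, t]).
  by apply/(intble_mkcond _ _).1 => //; apply: intble_sub ig.
rewrite -(RintegralZl 2 measurableT igD) -(RintegralB measurableT (intbleZ 2 measurableT igD) ig).
congr Rintegral; apply/funext => s; rewrite patchE /g /phc /phs.
have [st|st] := leP s t.
  rewrite ifT ?inE/= ?in_itv//= ger0_norm ?subr_ge0// mulrBr sinB; ring.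
rewrite ifF; last by apply/negbTE; rewrite notin_setE /= in_itv/= leNgt st.
rewrite ltr0_norm ?subr_lt0// mulrN mulrBr sinN sinB -[X in 2 * X]/(0 : R); ring.
Qed.

(** With X and Y the primitives of cos (E s) r s and sin (E s) r s, the residues of [osc_ends] at
    +oo are 2 E times bounded combinations of X - cc and Y - cs, and at -oo of X and Y; all of these
    tend to 0 at the end in question. *)
Lemma osc_conv : osc E cos_conv sin_conv.
Proof.
have [dX [BX HX] pX mX] := halfline_primitive (ctM (@ccosE E) cr) ic.
have [dY [BY HY] pY mY] := halfline_primitive (ctM (@csinE E) cr) is_.
rewrite -/cc in pX; rewrite -/cs in pY.
pose X t := Rintegral (leb R) `]-oo, t] phc; pose Y t := Rintegral (leb R) `]-oo, t] phs.
have {}dX : forall t, is_derive (t : R) (1 : R) X (phc t) := dX.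
have {}dY : forall t, is_derive (t : R) (1 : R) Y (phs t) := dY.
have cX : continuous X by move=> t; exact: is_derive_continuous (dX t).
have cY : continuous Y by move=> t; exact: is_derive_continuous (dY t).
have dc (t : R) : is_derive t (1 : R) (fun t => cos (E * t)) (- sin (E * t) * E).
  by apply: is_derive_eq (dComp (is_derive_cos (E * t)) (dScale E (dId t))) _; rewrite mulr1.
have ds (t : R) : is_derive t (1 : R) (fun t => sin (E * t)) (cos (E * t) * E).
  by apply: is_derive_eq (dComp (is_derive_sin (E * t)) (dScale E (dId t))) _; rewrite mulr1.
pose C' t := E * (cos (E * t) * cs - sin (E * t) * cc).
pose S' t := E * (2 * (cos (E * t) * X t + sin (E * t) * Y t) - (cos (E * t) * cc + sin (E * t) * cs)).
have FC : cos_conv = fun t => cos (E * t) * cc + sin (E * t) * cs by apply/funext => t; exact: CcosE.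
have FS : sin_conv = fun t => 2 * (sin (E * t) * X t - cos (E * t) * Y t) - (sin (E * t) * cc - cos (E * t) * cs).
  by apply/funext => t; exact: CsinE.
have dC (t : R) : is_derive t (1 : R) cos_conv (C' t).
  rewrite FC; apply: is_derive_eq (dAdd (dMul (dc t) (dCst cc t)) (dMul (ds t) (dCst cs t))) _; rewrite /C'; ring.
have dS (t : R) : is_derive t (1 : R) sin_conv (S' t).
  rewrite FS; apply: is_derive_eq (dSub (dScale 2 (dSub (dMul (ds t) (dX t)) (dMul (dc t) (dY t)))) (dSub (dMul (ds t) (dCst cc t)) (dMul (dc t) (dCst cs t)))) _.
  rewrite /S' /phc /phs; ring.
have cC' : continuous C'.
  by apply: ctZ; apply: ctB; apply: ctM; first [exact: ccosE|exact: csinE|exact: ctC].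
have cS' : continuous S'.
  apply: ctZ; apply: ctB; last by apply: ctD; apply: ctM; first [exact: ccosE|exact: csinE|exact: ctC].
  by apply: ctZ; apply: ctD; apply: ctM => //; first [exact: ccosE|exact: csinE].
have BX0 : 0 <= BX by exact: le_trans (HX 0).
have BY0 : 0 <= BY by exact: le_trans (HY 0).
have tr (u v x y a b : R) : `|u| <= 1 -> `|v| <= 1 -> `|x| <= a -> `|y| <= b -> `|u * x + v * y| <= a + b.
  move=> u1 v1 xa yb; rewrite (le_trans (ler_normD _ _))// !normrM lerD// -[leRHS]mul1r ler_pM//.
have tr' (u v x y a b : R) : `|u| <= 1 -> `|v| <= 1 -> `|x| <= a -> `|y| <= b -> `|u * x - v * y| <= a + b.
  by move=> u1 v1 xa yb; rewrite -mulrN; apply: tr => //; rewrite normrN.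
pose Q := `|cc| + `|cs|; pose Z := BX + BY.
have Q0 : 0 <= Q by rewrite addr_ge0.
have Z0 : 0 <= Z by rewrite addr_ge0.
have bC t : `|cos_conv t| <= Q /\ `|C' t| <= `|E| * Q.
  rewrite FC /C'; split; first by apply: tr; rewrite ?cos_abs_le1 ?sin_abs_le1.
  rewrite normrM ler_wpM2l// /Q (addrC `|cc|); apply: tr'; by rewrite ?cos_abs_le1 ?sin_abs_le1.
have bS t : `|sin_conv t| <= 2 * Z + Q /\ `|S' t| <= `|E| * (2 * Z + Q).
  rewrite FS /S'; split.
    rewrite (le_trans (ler_normB _ _))// lerD//.
      rewrite normrM (ger0_norm (_ : 0 <= 2))// ler_wpM2l//.
      exact: tr' (sin_abs_le1 _) (cos_abs_le1 _) (HX t) (HY t).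
    by apply: tr'; rewrite ?cos_abs_le1 ?sin_abs_le1.
  rewrite normrM ler_wpM2l// (le_trans (ler_normB _ _))// lerD//.
    rewrite normrM (ger0_norm (_ : 0 <= 2))// ler_wpM2l//.
    exact: tr (cos_abs_le1 _) (sin_abs_le1 _) (HX t) (HY t).
  by apply: tr; rewrite ?cos_abs_le1 ?sin_abs_le1.
have C1C : C1fun cos_conv by exists C'. have C1S : C1fun sin_conv by exists S'.
split=> //; split=> //.
have i0 : intble (leb R) setT (fun _ : R => 0 : R) by have := intbleZ 0 measurableT ir; under eq_fun do rewrite mul0r.
exists (fun=> 0), cos_conv, C', (fun=> 0), sin_conv, S'; split.
- split=> //; first by move=> t; rewrite add0r.
  exists (Q + `|E| * Q) => t; have [b1 b2] := bC t; split.
    by rewrite (le_trans b1)// lerDl mulr_ge0.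
  by rewrite (le_trans b2)// lerDr.
- split=> //; first by move=> t; rewrite add0r.
  exists ((2 * Z + Q) + `|E| * (2 * Z + Q)) => t; have [b1 b2] := bS t.
  have W : 0 <= 2 * Z + Q by rewrite addr_ge0// mulr_ge0.
  split; first by rewrite (le_trans b1)// lerDl mulr_ge0.
  by rewrite (le_trans b2)// lerDr.
- have x0 : X t - cc @[t --> +oo] --> (0 : R) by rewrite -(subrr cc); apply: cvgB => //; exact: cvg_cst.
  have y0 : Y t - cs @[t --> +oo] --> (0 : R) by rewrite -(subrr cs); apply: cvgB => //; exact: cvg_cst.
  have lim (f g u v : R -> R) : f t @[t --> +oo] --> (0 : R) -> g t @[t --> +oo] --> (0 : R) ->
      (forall t, `|u t| <= 1) -> (forall t, `|v t| <= 1) -> 2 * E * (u t * f t + v t * g t) @[t --> +oo] --> (0 : R).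
    move=> f0 g0 u1 v1; have := cvg0_bounded (cvg0D (cvg0_bounded f0 u1) (cvg0_bounded g0 v1)) (g := fun=> 2 * E) (B := `|2 * E|).
    by apply.
  have c1 x : `|cos x| <= 1 := cos_abs_le1 x. have s1 x : `|sin x| <= 1 := sin_abs_le1 x.
  split.
  + apply: cvg0_eq (lim _ _ (fun t => sin (E * t)) (fun t => - cos (E * t)) x0 y0 _ _) => // t; last by rewrite normrN.
    rewrite FS /C'; ring.
  + apply: cvg0_eq (lim _ _ (fun t => cos (E * t)) (fun t => sin (E * t)) x0 y0 _ _) => // t.
    rewrite FC /S'; ring.
  + apply: cvg0_eq (lim _ _ (fun t => sin (E * - t)) (fun t => - cos (E * - t)) mX mY _ _) => // t; last by rewrite normrN.
    rewrite FS /C' -/(X (- t)) -/(Y (- t)); ring.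
  + apply: cvg0_eq (lim _ _ (fun t => - cos (E * - t)) (fun t => - sin (E * - t)) mX mY _ _) => // t; rewrite ?normrN//.
    rewrite FC /S' -/(X (- t)) -/(Y (- t)); ring.
Qed.

End Primitive.

(** * The densities of the integral equation *)

Section Densities.
Variable R : realType.
Notation mR := (measurableTypeR R).

(** Write |h| as e^(- alpha |t|) times e^(alpha |t|) |h|; a product u v is at most u^2 + v^2, and
    both squares are integrable. *)
Lemma weighted_intble (alpha : R) (h : R -> R) : 0 < alpha -> h \in Lfun (leb R) 2%:E ->
  (fun t => expR (alpha * `|t|) * h t) \in Lfun (leb R) 2%:E -> continuous h -> intble (leb R) setT h.
Proof.
move=> a0 _ hw ch.
have i1 : intble (leb R) setT (fun t : R => (expR (alpha * `|t|) * h t) ^+ 2) := Lfun2_integrable_sqr hw.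
have a20 : 0 < 2 * alpha by rewrite mulr_gt0.
have i2 := intble_exp_decay a20.
apply: (intble_dom measurableT _ (intbleD measurableT i1 i2)) => [|t _].
  by have H := continuous_meas ch; exact: H.
set x := expR (alpha * `|t|); have x0 : 0 < x by exact: expR_gt0.
have -> : expR (- (2 * alpha) * `|t|) = x^-1 ^+ 2.
  by rewrite /x -expRN -expRM_natl; congr expR; rewrite -[2%:R]/(2 : R); ring.
have -> : `|h t| = x^-1 * `|x * h t| by rewrite normrM (gtr0_norm x0) mulKf// lt0r_neq0.
rewrite -[(x * h t) ^+ 2]real_normK ?num_real//.
move: (x^-1) `|_| (normr_ge0 (x * h t)) => u v v0.
have := sqr_ge0 (u - v); have := sqr_ge0 u; have := sqr_ge0 v; rewrite sqrrB.
move: (u * v) (u ^+ 2) (v ^+ 2) => a b c; rewrite mulr2n; lra.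
Qed.

Lemma smooth_C1fun (h : R -> R) : @smooth_curve R R h -> C1fun h.
Proof.
move=> sm; exists (derive1 h); split.
  by move=> t; have D := sm 0%N t; rewrite derive1E; exact: DeriveDef.
by move=> t; have /derivable1_diffP := sm 1%N t; exact: differentiable_continuous.
Qed.

Variables (gamma : nat -> R -> R * R) (Omega : nat -> set (R * R)).
Hypothesis HI : interfaces gamma Omega.

Lemma exp_abs_cvg0 (C eta : R) : 0 < eta -> C * expR (- eta * `|t|) @[t --> +oo] --> (0 : R).
Proof.
move=> e0; apply/cvgrPdist_le => x x0.
have [t t0 Ht] := expRN_small (normr_ge0 C) e0 x0.
near=> s; rewrite sub0r normrN normrM (ger0_norm (expR_ge0 _)); apply: le_trans Ht.
rewrite ler_wpM2l// ler_expR !mulNr lerN2 ler_wpM2l ?(ltW e0)//.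
rewrite (le_trans _ (ler_norm s))//; near: s; exact/nbhs_pinfty_ge/num_real.
Unshelve. all: by end_near. Qed.

Lemma slow_tangent j : (1 <= j <= 2)%N ->
  slow (fun t => (tangent gamma j t).1) (fun t => (derive1n 2 (gamma j) t).1) /\
  slow (fun t => (tangent gamma j t).2) (fun t => (derive1n 2 (gamma j) t).2).
Proof.
move=> hj; have gc := interface_good_curve HI hj; have sm := gamma_smooth HI hj.
have ce : continuous (derive1n 2 (gamma j)).
  by move=> t; have /derivable1_diffP := sm 2%N t; exact: differentiable_continuous.
have [M [M0 HM]] := gc_bound2 gc.
have [C [eta [eta0 HC]]] := gc_decay gc.
have z := exp_abs_cvg0 C eta0.
have b t : `|(tangent gamma j t).1| <= 1 + M /\ `|(tangent gamma j t).2| <= 1 + M.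
  have u := gc_unit gc t; split; apply: (@le_trans _ _ 1); rewrite ?lerDl ?(ltW M0)//.
    by rewrite -u; exact: enorm_fst.
  by rewrite -u; exact: enorm_snd.
have dz (f : R -> R) : (forall t, `|f t| <= C * expR (- eta * `|t|)) -> f t @[t --> +oo] --> (0 : R) /\ f (- t) @[t --> +oo] --> (0 : R).
  move=> Hf; split; apply: (norm_cvg0 _ (h := fun t => C * expR (- eta * `|t|))) => //; apply: nearW => t; first exact: Hf.
  by have := Hf (- t); rewrite normrN.
have [p1 m1] := dz _ (fun t => le_trans (enorm_fst (derive1n 2 (gamma j) t)) (HC t)).
have [p2 m2] := dz _ (fun t => le_trans (enorm_snd (derive1n 2 (gamma j) t)) (HC t)).
split; split.
- exact: gc_e1 gc.
- by move=> t; apply: (cvg_comp _ fst (ce t)); exact: cvg_fst.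
- exists (1 + M) => t; split; first exact: (b t).1.
  by rewrite (le_trans (HM t).1)// lerDr.
- exact: p1.
- exact: m1.
- exact: gc_e2 gc.
- by move=> t; apply: (cvg_comp _ snd (ce t)); exact: cvg_snd.
- exists (1 + M) => t; split; first exact: (b t).2.
  by rewrite (le_trans (HM t).2)// lerDr.
- exact: p2.
- exact: m2.
Qed.

Variables (m E alpha : R).
Hypotheses (E0 : E != 0) (a0 : 0 < alpha).

(* The diagonal of 1 - M for j = 1, of M for j = 2. *)
Definition P_diag (j : nat) (c : bool) : R := if (j == 1%N) == (m < 0) then c%:R else (~~ c)%:R.

(** The prefactors 2 i m^2 and (2 i E)^-1 combine to the real number m^2 / E, and the matrix is
    diagonal, so each component is convolved on its own. *)
Lemma P_op_mk j (rho : R -> spinor R) (t : R) : (forall c b, continuous (fun t => parts_of (rho t) c b)) ->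
  (forall c b, intble (leb R) setT (fun t => parts_of (rho t) c b)) ->
  P_op m E j rho t = spinor_of (fun c b => parts_of (rho t) c b + P_diag j c * (m ^+ 2 / E) *
    (if b then sin_conv E (fun t => parts_of (rho t) c false) t + cos_conv E (fun t => parts_of (rho t) c true) t
     else cos_conv E (fun t => parts_of (rho t) c false) t - sin_conv E (fun t => parts_of (rho t) c true) t)).
Proof.
move=> cr ir; rewrite /P_op /R_op.
pose G (s : R) c b := if b then cos (E * `|t - s|) * parts_of (rho s) c true + sin (E * `|t - s|) * parts_of (rho s) c false
   else cos (E * `|t - s|) * parts_of (rho s) c false - sin (E * `|t - s|) * parts_of (rho s) c true.
have -> : sint (leb R) setT (fun s : R => expi (E * `|t - s|) *: rho s) = spinor_of (fun c b => Rintegral (leb R) setT (fun s : R => G s c b)).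
  by apply: sint_mk => s; rewrite -[X in _ *: X]parts_ofK /expi spinor_ofZ; apply: eq_spinor_of => c [].
set X := spinor_of _; pose z : cplx R := 2 * imag R * E%:C.
have z0 : z != 0.
  have -> : z = 0 +i* (2 * E) by rewrite /z /imag -[(2 : cplx R)]/(2%:R : cplx R) -(rmorph_nat (real_complex R)) /=; simpc.
  by rewrite eq_complex /= eqxx mulf_eq0 negb_or pnatr_eq0 E0.
have -> : 2 * imag R * (m ^+ 2)%:C = (m ^+ 2 / E)%:C * z.
  have e : ((m ^+ 2)%:C : cplx R) = ((m ^+ 2 / E)%:C : cplx R) * (E%:C : cplx R).
    by rewrite -(rmorphM (real_complex R)) divfK.
  by rewrite e /z mulrCA.
rewrite -/z -scalemxAr scalerA -mulrA divff// mulr1.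
have -> : (if j == 1%N then 1%:M - Mmx m else Mmx m) = mx22 ((P_diag j false) +i* 0) (0 +i* 0) (0 +i* 0) ((P_diag j true) +i* 0).
  apply/matrixP => k l; rewrite /P_diag /Mmx; case: (j == 1%N); case: (m < 0); rewrite !mxE;
    case: (I2_cases k) => ->; case: (I2_cases l) => -> //=; rewrite ?subrr ?subr0 ?sub0r ?oppr0//.
rewrite /X mx22_mk spinor_ofZr -[X in X + _]parts_ofK spinor_ofD; apply: eq_spinor_of => c b.
have ct : continuous (fun s : R => `|t - s|) by apply: ctnorm; apply: ctB; [exact: ctC|move=> y; exact: cvg_id].
have ii c' b' (f : R -> R) : continuous f -> (forall x, `|f x| <= 1) ->
    intble (leb R) setT (fun s : R => f (E * `|t - s|) * parts_of (rho s) c' b').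
  move=> cf f1; apply: (@intble_osc R _ (cr c' b') (ir c' b') (fun s => f (E * `|t - s|))) => [|s]; last exact: f1.
  by apply: ctcomp => //; exact: ctZ.
have ic c' b' := ii c' b' _ (@continuous_cos R) (@cos_abs_le1 R).
have is_ c' b' := ii c' b' _ (@continuous_sin R) (@sin_abs_le1 R).
have e1 c' : Rintegral (leb R) setT (fun s => G s c' false) = cos_conv E (fun t => parts_of (rho t) c' false) t - sin_conv E (fun t => parts_of (rho t) c' true) t.
  exact: RintegralB measurableT (ic c' false) (is_ c' true).
have e2 c' : Rintegral (leb R) setT (fun s => G s c' true) = sin_conv E (fun t => parts_of (rho t) c' false) t + cos_conv E (fun t => parts_of (rho t) c' true) t.
  by rewrite addrC; exact: RintegralD measurableT (ic c' true) (is_ c' false).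
by case: c; case: b; rewrite ?e1 ?e2 !mul0r ?subr0 ?addr0 ?add0r mulrCA mulrA; congr (_ + _); ring.
Qed.

Definition tau j (rho : R -> spinor R) (t : R) := parts_of (P_op m E j rho t).
Definition mudens j (rho : R -> spinor R) (t : R) := parts_of (Vmx gamma j t *m P_op m E j rho t).

Lemma tau_osc j (rho : R -> spinor R) c : L2_weighted alpha rho -> each_part (@smooth_curve R R) rho ->
  osc E (fun t => tau j rho t c false) (fun t => tau j rho t c true).
Proof.
move=> L2 sm.
have rk c' b : (fun t => parts_of (rho t) c' b) = (if b then im_part rho (if c' then 1 else 0) else re_part rho (if c' then 1 else 0)).
  by apply/funext => t; rewrite /parts_of; case: b.
have C1r c' b : C1fun (fun t => parts_of (rho t) c' b).
  rewrite rk; have [S1 S2] := sm (if c' then 1 else 0); case: b; [exact: smooth_C1fun S2|exact: smooth_C1fun S1].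
have cr c' b := C1fun_continuous (C1r c' b).
have ir c' b : intble (leb R) setT (fun t => parts_of (rho t) c' b).
  have [[L1 L1'] [L2' L2'']] := L2 (if c' then 1 else 0).
  have := cr c' b; rewrite rk; case: b => H; [exact: weighted_intble a0 L2' L2'' H|exact: weighted_intble a0 L1 L1' H].
have E1 := oscD (osc_conv E (cr c false) (ir c false)) (osc_i (osc_conv E (cr c true) (ir c true))).
have E2 := oscD (osc_L1 E (C1r c false) (C1r c true) (ir c false) (ir c true))
  (osc_mul (slow_cst (P_diag j c * (m ^+ 2 / E))) E1).
rewrite (_ : (fun t => tau j rho t c false) = (fun t => parts_of (rho t) c false + P_diag j c * (m ^+ 2 / E) *
   (cos_conv E (fun t => parts_of (rho t) c false) t + - sin_conv E (fun t => parts_of (rho t) c true) t))); last first.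
  by apply/funext => t; rewrite /tau P_op_mk// spinor_ofK.
rewrite (_ : (fun t => tau j rho t c true) = (fun t => parts_of (rho t) c true + P_diag j c * (m ^+ 2 / E) *
   (sin_conv E (fun t => parts_of (rho t) c false) t + cos_conv E (fun t => parts_of (rho t) c true) t))) //.
by apply/funext => t; rewrite /tau P_op_mk// spinor_ofK.
Qed.

Lemma Vmx_mk j (t : R) (r : bool -> bool -> R) : let n := normal gamma j t in
  Vmx gamma j t *m spinor_of r = spinor_of (fun c b => (Num.sqrt 2)^-1 * match c, b with
   | false, false => r false false + (n.2 * r true false - n.1 * r true true)
   | false, true => r false true + (n.2 * r true true + n.1 * r true false)
   | true, false => n.2 * r false false + n.1 * r false true - r true false
   | true, true => n.2 * r false true - n.1 * r false false - r true true end).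
Proof.
move=> n; rewrite /Vmx -/n -scalemxAl.
rewrite (_ : mx22 1 _ _ _ = mx22 (1 +i* 0) (n.2 +i* n.1) (n.2 +i* - n.1) (-1 +i* 0)); last first.
  by congr mx22; simpc.
by rewrite mx22_mk spinor_ofZr; apply: eq_spinor_of => c b; congr (_ * _); case: c; case: b; ring.
Qed.

Lemma mudens_osc j (rho : R -> spinor R) c : (1 <= j <= 2)%N -> L2_weighted alpha rho -> each_part (@smooth_curve R R) rho ->
  osc E (fun t => mudens j rho t c false) (fun t => mudens j rho t c true).
Proof.
move=> hj L2 sm; have T c' := tau_osc j c' L2 sm; have [s1 s2] := slow_tangent hj.
(* The signs are arranged so that each entry is literally built by [oscD], [osc_mul] and [osc_i];
   multiplication by - i is written as - 1 times i. *)
have ME b : (fun t => mudens j rho t c b) = (fun t => (Num.sqrt 2)^-1 * match c, b with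
   | false, false => tau j rho t false false + ((tangent gamma j t).1 * tau j rho t true false + (tangent gamma j t).2 * (-1 * - tau j rho t true true))
   | false, true => tau j rho t false true + ((tangent gamma j t).1 * tau j rho t true true + (tangent gamma j t).2 * (-1 * tau j rho t true false))
   | true, false => (tangent gamma j t).1 * tau j rho t false false + (tangent gamma j t).2 * - tau j rho t false true + -1 * tau j rho t true false
   | true, true => (tangent gamma j t).1 * tau j rho t false true + (tangent gamma j t).2 * tau j rho t false false + -1 * tau j rho t true true end).
  apply/funext => t; rewrite /mudens -[P_op _ _ _ _ _]parts_ofK Vmx_mk spinor_ofK -/(tau j rho t).
  by congr (_ * _); rewrite /normal /=; case: c; case: b; ring.
rewrite !ME; apply: (osc_mul (slow_cst _)).
clear ME; case: c; first exact: oscD (oscD (osc_mul s1 (T false)) (osc_mul s2 (osc_i (T false)))) (osc_mul (slow_cst (-1)) (T true)).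
exact: oscD (T false) (oscD (osc_mul s1 (T true)) (osc_mul s2 (osc_mul (slow_cst (-1)) (osc_i (T true))))).
Qed.

End Densities.

(** * The field in each region *)

Lemma curve_index j : (1 <= j <= 2)%N -> j = 1%N \/ j = 2%N.
Proof. by case: j => [|[|[|]]]//; auto. Qed.

Lemma has_grad_comb (R : realType) (f g : R * R -> R) x (a b a' b' k l : R) :
  (k != 0 -> has_grad f x a b) -> (l != 0 -> has_grad g x a' b') ->
  has_grad (fun y => k * f y + l * g y) x (k * a + l * a') (k * b + l * b').
Proof.
move=> Hf Hg.
have H (h : R * R -> R) (c u v : R) : (c != 0 -> has_grad h x u v) -> has_grad (fun y => c * h y) x (c * u) (c * v).
  have [->|c0] := eqVneq c 0 => Hh.
    rewrite (_ : (fun y => 0 * h y) = fun=> 0); last by apply/funext => y; rewrite mul0r.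
    by rewrite !mul0r; exact: has_grad_cst.
  have z := has_grad_cst (0 : R) x; have K := has_grad_lin c z (Hh isT).
  rewrite (_ : (fun y => c * h y) = fun y => 0 + c * h y); last by apply/funext => y; rewrite add0r.
  by apply: has_grad_uniq_eq K _ _; rewrite add0r.
exact: has_gradD (H _ _ _ _ Hf) (H _ _ _ _ Hg).
Qed.

(** * One potential formula per region *)

Section Potentials.
Variables (R : realType) (gamma : nat -> R -> R * R) (Omega : nat -> set (R * R)).
Hypothesis HI : interfaces gamma Omega.
Variable w : R.
Hypothesis w0 : 0 < w.
Variables F F1 F2 F11 F12 F22 : nat -> bool -> bool -> R * R -> R.
Hypothesis sc : forall k c b, (k <= 2)%N ->
  compact_C2 (F k c b) (F1 k c b) (F2 k c b) (F11 k c b) (F12 k c b) (F22 k c b).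
Variable p : nat -> bool -> bool -> R -> R.
Hypothesis dp : forall j c b, (1 <= j <= 2)%N -> dens (p j c b).

(* The indicator of the regions k = j - 1 and k = j that have curve j on their
   boundary. *)
Definition touches (j k : nat) : R := ((k == j) || (k.+1 == j))%:R.

Definition lays k K c b x : R :=
  touches 1 k * layer_pot (gamma 1%N) K (p 1 c b) x + touches 2 k * layer_pot (gamma 2%N) K (p 2 c b) x.

(** The expression makes sense on the whole plane, not only on region k. Both sides of a curve and
    all three regions are thus instances of one formula. *)
Definition pot k K c b x := volume_pot K (F k c b) x + lays k K c b x.

Let gc1 := interface_good_curve HI (isT : (1 <= 1 <= 2)%N).
Let gc2 := interface_good_curve HI (isT : (1 <= 2 <= 2)%N).

Lemma lays_has_grad k (K k1 k2 : R * R -> R) c b x : decaying_kernel w K k1 k2 -> off_curves gamma x ->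
  has_grad (lays k K c b) x (lays k k1 c b x) (lays k k2 c b x).
Proof.
move=> dk off; apply: has_grad_comb => _.
  by apply: (layer_has_grad w0 gc1 dk (@dp 1%N c b isT)) => t; exact: (off 1%N t isT).
by apply: (layer_has_grad w0 gc2 dk (@dp 2%N c b isT)) => t; exact: (off 2%N t isT).
Qed.

Lemma pot_has_grad0 k c b x : (k <= 2)%N -> off_curves gamma x ->
  has_grad (pot k (KA w) c b) x (pot k (K1 w) c b x) (pot k (K2 w) c b x).
Proof.
move=> k2 off; have s := sc c b k2.
apply: has_grad_uniq_eq (has_gradD (vol_has_grad x (locker_KA w0) s) (lays_has_grad k c b (dker_KA w0) off)) _ _.
  by congr (_ + _); apply: (vol_parts1 w0); [exact: sc_ccs s|exact: sc_ccs1 s|exact: sc_pd1 s].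
by congr (_ + _); apply: (vol_parts2 w0); [exact: sc_ccs s|exact: sc_ccs2 s|exact: sc_pd2 s].
Qed.

(** In the volume part one derivative stays on the density, because K_11 is of order |z|^(-2) and
    not locally integrable. *)
Definition pot11 k c b x := volume_pot (K1 w) (F1 k c b) x + lays k (K11 w) c b x.
Definition pot12 k c b x := volume_pot (K1 w) (F2 k c b) x + lays k (K12 w) c b x.
Definition pot22 k c b x := volume_pot (K2 w) (F2 k c b) x + lays k (K22 w) c b x.

Lemma pot_has_grad1 k c b x : (k <= 2)%N -> off_curves gamma x ->
  has_grad (pot k (K1 w) c b) x (pot11 k c b x) (pot12 k c b x).
Proof.
move=> k2 off; exact: has_gradD (vol_has_grad x (locker_Kp false w0) (sc c b k2)) (lays_has_grad k c b (dker_K1 w0) off).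
Qed.

(** Differentiation yields the volume potential of K_2 with [F1], whereas [pot12] has K_1 with [F2];
    both equal that of K with the mixed partial [F12]. *)
Lemma pot_has_grad2 k c b x : (k <= 2)%N -> off_curves gamma x ->
  has_grad (pot k (K2 w) c b) x (pot12 k c b x) (pot22 k c b x).
Proof.
move=> k2 off; have s := sc c b k2.
apply: has_grad_uniq_eq (has_gradD (vol_has_grad x (locker_Kp true w0) s) (lays_has_grad k c b (dker_K2 w0) off)) _ _ => //.
congr (_ + _).
rewrite -(vol_parts2 w0 x (sc_ccs1 s) (sc_ccs12 s) (sc_pd12 s)).
exact: (vol_parts1 w0 x (sc_ccs2 s) (sc_ccs12 s) (sc_pd21 s)).
Qed.

Lemma layer_pot_laplace g d e q x : good_curve g d e -> dens q -> (forall t, x <> g t) ->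
  layer_pot g (K11 w) q x + layer_pot g (K22 w) q x = w ^+ 2 * layer_pot g (KA w) q x.
Proof.
move=> gc dq off.
have [H0 D0 T1 T2] := dker_KA w0; have [H1 D1 T11 T12] := dker_K1 w0; have [H2 D2 T21 T22] := dker_K2 w0.
have [d1 [a1 [a2 [A1 _ _]]]] := T11; have [d2 [b1 [b2 [B1 _ _]]]] := T22.
have i0 := layer_bound w0 gc H0 D0 dq off.
have i1 := layer_bound w0 gc A1 d1 dq off.
have i2 := layer_bound w0 gc B1 d2 dq off.
rewrite /layer_pot -(RintegralD measurableT i1 i2) -(RintegralZl (w ^+ 2) measurableT i0).
congr Rintegral; apply/funext => t; rewrite -mulrDl laplace_K//; first by rewrite mulrA.
by rewrite subr_eq0; apply/eqP.
Qed.

Lemma pot_laplace k c b x : (k <= 2)%N -> off_curves gamma x ->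
  pot11 k c b x + pot22 k c b x = w ^+ 2 * pot k (KA w) c b x - 2 * pi * F k c b x.
Proof.
move=> k2 off; have fl := flux_identity w0 (sc c b k2) x.
have L1 := layer_pot_laplace gc1 (@dp 1%N c b isT) (fun t => off 1%N t isT).
have L2 := layer_pot_laplace gc2 (@dp 2%N c b isT) (fun t => off 2%N t isT).
rewrite /pot11 /pot22 /pot /lays.
have -> (v u a1 a2 b1 b2 t1 t2 : R) : v + (t1 * a1 + t2 * a2) + (u + (t1 * b1 + t2 * b2)) = v + u + (t1 * (a1 + b1) + t2 * (a2 + b2)) by ring.
by rewrite fl L1 L2; ring.
Qed.

Variables m E : R.
Hypothesis w2 : w ^+ 2 = m ^+ 2 - E ^+ 2.

Definition region_mass (k : nat) : R := if k == 1%N then - m else m.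

Definition fieldc k c b x := green_parts (region_mass k) E (fun c b => pot k (KA w) c b x)
  (fun c b => pot k (K1 w) c b x) (fun c b => pot k (K2 w) c b x) c b.

Definition field k x : spinor R := spinor_of (fun c b => fieldc k c b x).

Definition fieldd1 k c b x := green_parts (region_mass k) E (fun c b => pot k (K1 w) c b x)
  (fun c b => pot11 k c b x) (fun c b => pot12 k c b x) c b.
Definition fieldd2 k c b x := green_parts (region_mass k) E (fun c b => pot k (K2 w) c b x)
  (fun c b => pot12 k c b x) (fun c b => pot22 k c b x) c b.

Lemma fieldc_has_grad k c b x : (k <= 2)%N -> off_curves gamma x ->
  has_grad (fieldc k c b) x (fieldd1 k c b x) (fieldd2 k c b x).
Proof.
move=> k2 off; apply: has_grad_gform => c' b'.
- exact: pot_has_grad0.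
- exact: pot_has_grad1.
- exact: pot_has_grad2.
Qed.

Lemma field_dirac k (u : R * R -> spinor R) : (k <= 2)%N -> (forall x, Omega k x -> u x = field k x) ->
  solves_dirac E (region_mass k) (Omega k) u (fun x => spinor_of (fun c b => F k c b x)).
Proof.
move=> k2 uE x kx; have off := Omega_off HI k2 kx.
apply: (@dirac_gform R _ E w (pot k (KA w)) (pot k (K1 w)) (pot k (K2 w)) (fun c b => pot11 k c b x)
   (fun c b => pot12 k c b x) (fun c b => pot22 k c b x)).
- by rewrite w2 /region_mass; case: ifP => _ //; rewrite sqrrN.
- by move=> c b; exact: pot_has_grad0.
- by move=> c b; exact: pot_has_grad1.
- by move=> c b; exact: pot_has_grad2.
- by move=> c b; exact: pot_laplace.
- have : nbhs x (Omega k) by apply: open_nbhs_nbhs; split=> //; exact: (Omega_open HI k2).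
  by apply: filterS => y ky; exact: uE.
Qed.

End Potentials.

(** * The integrals of the statement as real potentials *)

Section Representation.
Variable R : realType.
Notation mR2 := (measurableTypeR R * measurableTypeR R)%type.

Lemma Rint_gform d (T : measurableType d) (mu : {measure set T -> \bar R}) (A : set T) (a E : R)
  (S0 S1 S2 : bool -> bool -> T -> R) : measurable A ->
  (forall c b, intble mu A (S0 c b)) -> (forall c b, intble mu A (S1 c b)) -> (forall c b, intble mu A (S2 c b)) ->
  forall c b, Rintegral mu A (fun t => green_parts a E (fun c b => S0 c b t) (fun c b => S1 c b t) (fun c b => S2 c b t) c b) =
    green_parts a E (fun c b => Rintegral mu A (S0 c b)) (fun c b => Rintegral mu A (S1 c b)) (fun c b => Rintegral mu A (S2 c b)) c b.
Proof.
move=> mA i0 i1 i2.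
have T3 (q k l n : R) (f g h : T -> R) : intble mu A f -> intble mu A g -> intble mu A h ->
    Rintegral mu A (fun t => q * (k * f t + l * g t + n * h t)) =
    q * (k * Rintegral mu A f + l * Rintegral mu A g + n * Rintegral mu A h).
  move=> jf jg jh.
  have jf' : intble mu A (fun t => k * f t) by exact: intbleZ.
  have jg' : intble mu A (fun t => l * g t) by exact: intbleZ.
  have jh' : intble mu A (fun t => n * h t) by exact: intbleZ.
  have j2 : intble mu A (fun t => k * f t + l * g t) by exact: intbleD.
  have j3 : intble mu A (fun t => k * f t + l * g t + n * h t) by exact: intbleD.
  have e1 : Rintegral mu A (fun t => q * (k * f t + l * g t + n * h t)) = _ := RintegralZl q mA j3.
  have e2 : Rintegral mu A (fun t => k * f t + l * g t + n * h t) = _ := RintegralD mA j2 jh'.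
  have e3 : Rintegral mu A (fun t => k * f t + l * g t) = _ := RintegralD mA jf' jg'.
  have e4 : Rintegral mu A (fun t => k * f t) = _ := RintegralZl k mA jf.
  have e5 : Rintegral mu A (fun t => l * g t) = _ := RintegralZl l mA jg.
  have e6 : Rintegral mu A (fun t => n * h t) = _ := RintegralZl n mA jh.
  by rewrite e1 e2 e3 e4 e5 e6.
rewrite /green_parts; case; case.
- have K := T3 (2 * pi)^-1 (E - a) (-1) 1 _ _ _ (i0 true true) (i1 false false) (i2 false true).
  by rewrite mulN1r mul1r in K; rewrite -K; congr Rintegral; apply/funext => t; rewrite mulN1r mul1r.
- have K := T3 (2 * pi)^-1 (E - a) 1 1 _ _ _ (i0 true false) (i1 false true) (i2 false false).
  by rewrite !mul1r in K; rewrite -K; congr Rintegral; apply/funext => t; rewrite !mul1r.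
- have K := T3 (2 * pi)^-1 (a + E) (-1) (-1) _ _ _ (i0 false true) (i1 true false) (i2 true true).
  by rewrite !mulN1r in K; rewrite -K; congr Rintegral; apply/funext => t; rewrite !mulN1r.
- have K := T3 (2 * pi)^-1 (a + E) 1 (-1) _ _ _ (i0 false false) (i1 true true) (i2 true false).
  by rewrite mulN1r mul1r in K; rewrite -K; congr Rintegral; apply/funext => t; rewrite mulN1r mul1r.
Qed.

Lemma green_mk (m E : R) j (x y : R * R) r : 0 < omega m E ->
  green m E j x y *m spinor_of r = spinor_of (green_parts ((-1) ^+ j * m) E (fun c b => KA (omega m E) (x - y) * r c b)
    (fun c b => K1 (omega m E) (x - y) * r c b) (fun c b => K2 (omega m E) (x - y) * r c b)).
Proof.
move=> w0.
have e0 : besselK0 (omega m E * enorm (x - y)) = KA (omega m E) (x - y) by rewrite besselK0E.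
have e1 := derive_besselK0 false x y w0; have e2 := derive_besselK0 true x y w0.
by rewrite (greenE j e0 e1 e2) !spinor_ofZr gmat_mk.
Qed.

Lemma layer_mk (m E : R) k (g : nat -> R -> R * R) j d e (mu : R -> spinor R) x : 0 < omega m E ->
  good_curve (g j) d e -> (forall c b, dens (fun t => parts_of (mu t) c b)) -> (forall t, x <> g j t) ->
  let w := omega m E in let P K c b := layer_pot (g j) K (fun t => parts_of (mu t) c b) x in
  layer m E g k j mu x = spinor_of (green_parts ((-1) ^+ k * m) E (P (KA w)) (P (K1 w)) (P (K2 w))).
Proof.
move=> w0 gc dm off w P.
have [H0 D0 _ _] := dker_KA w0; have [H1 D1 _ _] := dker_K1 w0; have [H2 D2 _ _] := dker_K2 w0.
pose G (t : R) := green_parts ((-1) ^+ k * m) E (fun c b => KA w (x - g j t) * parts_of (mu t) c b)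
   (fun c b => K1 w (x - g j t) * parts_of (mu t) c b) (fun c b => K2 w (x - g j t) * parts_of (mu t) c b).
have HG (t : R) : green m E k x (g j t) *m mu t = spinor_of (G t) by rewrite -[mu t in LHS]parts_ofK green_mk.
apply: (etrans (sint_mk (leb R) setT HG)); apply: eq_spinor_of => c b.
rewrite (@Rint_gform _ _ (leb R) setT _ E (fun c b t => KA w (x - g j t) * parts_of (mu t) c b)
   (fun c b t => K1 w (x - g j t) * parts_of (mu t) c b) (fun c b t => K2 w (x - g j t) * parts_of (mu t) c b))//.
- by move=> c' b'; have H := layer_bound w0 gc H0 D0 (dm c' b') off; exact: H.
- by move=> c' b'; have H := layer_bound w0 gc H1 D1 (dm c' b') off; exact: H.
- by move=> c' b'; have H := layer_bound w0 gc H2 D2 (dm c' b') off; exact: H.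
Qed.

(** As f vanishes outside A, the integral extends to the plane, where reflection turns it into the
    convolution [volume_pot]. *)
Lemma vol_mk (m E : R) j (A : set (R * R)) (f : R * R -> spinor R) x : 0 < omega m E -> open A ->
  (forall c b, compact_cont (fun y => parts_of (f y) c b)) -> (forall y, ~ A y -> f y = 0) ->
  let w := omega m E in let P K c b := volume_pot K (fun y => parts_of (f y) c b) x in
  sint (leb2 R) A (fun y => green m E j x y *m f y) = spinor_of (green_parts ((-1) ^+ j * m) E (P (KA w)) (P (K1 w)) (P (K2 w))).
Proof.
move=> w0 oA cf f0 w P.
have I K c b : weakly_singular K -> intble (leb2 R) setT (fun y : mR2 => K (x - y) * parts_of (f y) c b) /\
    Rintegral (leb2 R) setT (fun y : mR2 => K (x - y) * parts_of (f y) c b) = P K c b.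
  move=> lk; have [] := leb2_reflect x (intble_vol x lk (cf c b)).
  by under eq_fun do rewrite opprB addrCA subrr addr0.
have sA (g : mR2 -> R) : (forall y, ~ A y -> g y = 0) -> Rintegral (leb2 R) A g = Rintegral (leb2 R) setT g.
  move=> g0; rewrite Rintegral_mkcond; congr Rintegral; apply/funext => y.
  by rewrite patchE; case: ifPn => //; rewrite notin_setE => /g0 ->.
have l0 := locker_KA w0; have l1 : weakly_singular (K1 w) := locker_Kp false w0; have l2 : weakly_singular (K2 w) := locker_Kp true w0.
rewrite (@sint_mk R _ _ _ _ _ (fun y : mR2 => green_parts ((-1) ^+ j * m) E (fun c b => KA w (x - y) * parts_of (f y) c b)
   (fun c b => K1 w (x - y) * parts_of (f y) c b) (fun c b => K2 w (x - y) * parts_of (f y) c b))).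
  apply: eq_spinor_of => c b.
  rewrite sA; last first.
    move=> y nA; rewrite /green_parts f0// (_ : parts_of 0 = fun _ _ => 0).
      by case: c; case: b; rewrite !mulr0 ?addr0 ?subr0 ?mulr0.
    by apply/funext => c'; apply/funext => b'; rewrite /parts_of mxE; case: b'.
  rewrite (@Rint_gform _ _ (leb2 R) setT _ E (fun c b y => KA w (x - y) * parts_of (f y) c b)
     (fun c b y => K1 w (x - y) * parts_of (f y) c b) (fun c b y => K2 w (x - y) * parts_of (f y) c b))//.
  - rewrite /green_parts; by case: c; case: b; rewrite (I _ _ _ l0).2 (I _ _ _ l1).2 (I _ _ _ l2).2.
  - by move=> c' b'; exact: (I _ c' b' l0).1.
  - by move=> c' b'; exact: (I _ c' b' l1).1.
  - by move=> c' b'; exact: (I _ c' b' l2).1.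
by move=> y; rewrite -[f y in LHS]parts_ofK green_mk.
Qed.

End Representation.

(** * The total field in each region *)

Section TotalField.
Variables (R : realType) (gamma : nat -> R -> R * R) (Omega : nat -> set (R * R)).
Hypothesis HI : interfaces gamma Omega.
Variables m E : R.
Let w := omega m E.
Hypothesis w0 : 0 < omega m E.
Variable f : nat -> R * R -> spinor R.
Hypothesis cf : forall k c b, (k <= 2)%N -> compact_cont (fun y => parts_of (f k y) c b).
Hypothesis f0 : forall k y, (k <= 2)%N -> ~ Omega k y -> f k y = 0.
Variable mu : nat -> R -> spinor R.
Hypothesis dm : forall j c b, (1 <= j <= 2)%N -> dens (fun t => parts_of (mu j t) c b).

Definition comps (T : Type) (v : nat -> T -> spinor R) j c b t := parts_of (v j t) c b.

Definition volf k x : spinor R := let P K c b := volume_pot K (comps f k c b) x in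
  spinor_of (green_parts (region_mass m k) E (P (KA w)) (P (K1 w)) (P (K2 w))).

Definition layf k j x : spinor R := let P K c b := layer_pot (gamma j) K (comps mu j c b) x in
  spinor_of (green_parts (region_mass m k) E (P (KA w)) (P (K1 w)) (P (K2 w))).

Lemma region_in k l x : (k <= 2)%N -> (l <= 2)%N -> Omega k x -> (x \in Omega l) = (l == k).
Proof.
move=> k2 l2 kx; apply/idP/eqP => [|->]; last by rewrite inE.
by rewrite inE => lx; exact: (Omega_uniq HI l2 k2 lx kx).
Qed.

Lemma incident_field k x : (k <= 2)%N -> Omega k x -> incident m E Omega f x = volf k x.
Proof.
move=> k2 kx; rewrite /incident !(@region_in k _ x k2)//.
have V l j : (l <= 2)%N -> (-1) ^+ j * m = region_mass m l ->
    sint (leb2 R) (Omega l) (fun y => green m E j x y *m f l y) = volf l x.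
  move=> l2 a; rewrite /volf -a; apply: vol_mk => //.
  - exact: (Omega_open HI l2).
  - by move=> c b; exact: cf.
  - by move=> y; exact: f0.
case: k k2 kx => [|[|[|]]]// _ _ /=; apply: V => //; by rewrite /region_mass /= ?sqrrN ?expr1n ?mul1r// expr1 mulN1r.
Qed.

Lemma layer_field k i j x : (1 <= j <= 2)%N -> (forall t, x <> gamma j t) -> (-1) ^+ i * m = region_mass m k ->
  layer m E gamma i j (mu j) x = layf k j x.
Proof.
move=> hj off a; rewrite /layf -a; apply: (layer_mk i w0 (interface_good_curve HI hj)) => //.
by move=> c b; exact: dm.
Qed.

Lemma scattered_field k x : (k <= 2)%N -> Omega k x ->
  scattered m E gamma Omega mu x = (touches R 1 k)%:C *: layf k 1 x + (touches R 2 k)%:C *: layf k 2 x.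
Proof.
move=> k2 kx; have off := Omega_off HI k2 kx; rewrite /scattered !(@region_in k _ x k2)//.
have o1 t := off 1%N t isT; have o2 t := off 2%N t isT.
have m1 : (-1) ^+ 1 * m = region_mass m 1 by rewrite /region_mass /= expr1 mulN1r.
have m2 k' : k' != 1%N -> (-1) ^+ 2 * m = region_mass m k' by rewrite /region_mass sqrrN expr1n mul1r => /negbTE ->.
have c0 : ((0 : R)%:C : cplx R) = 0 by []. have c1 : ((1 : R)%:C : cplx R) = 1 by [].
case: k k2 kx => [|[|[|]]]// _ _; rewrite /touches /= c1 ?c0 !scale1r ?scale0r.
- by rewrite addr0; apply: layer_field => //; exact: m2.
- by rewrite addrC; congr (_ + _); apply: layer_field.
- by rewrite add0r; apply: layer_field => //; exact: m2.
Qed.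

Definition totalf k x := field gamma w (comps f) (comps mu) m E k x.

Lemma totalfE k x : totalf k x = volf k x + ((touches R 1 k)%:C *: layf k 1 x + (touches R 2 k)%:C *: layf k 2 x).
Proof.
rewrite /totalf /field /volf /layf !spinor_ofZr !spinor_ofD; apply: eq_spinor_of => c b.
rewrite /fieldc /pot /lays /green_parts; case: c; case: b; ring.
Qed.

Lemma total_field k x : (k <= 2)%N -> Omega k x ->
  incident m E Omega f x + scattered m E gamma Omega mu x = totalf k x.
Proof. by move=> k2 kx; rewrite totalfE (incident_field k2 kx) (scattered_field k2 kx). Qed.

End TotalField.

(** * Continuity across the curves *)

Lemma norm_complex_lt (R : realType) (a b x y : R) : `|a| < x -> `|b| < x -> 2 * x <= y -> `|a +i* b : cplx R| < y%:C.
Proof.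
move=> ax bx xy; rewrite normc_def ltcR.
have y0 : 0 <= y by apply: le_trans xy; rewrite mulr_ge0// (le_trans _ (ltW ax)).
rewrite -(ger0_norm y0) -(sqrtr_sqr y) ltr_sqrt.
  rewrite /= -(real_normK (num_real a)) -(real_normK (num_real b)).
  have := normr_ge0 a; have := normr_ge0 b; nra.
rewrite exprn_gt0//; have := normr_ge0 a; lra.
Qed.

Lemma cvg_mk (R : realType) (T : Type) (G : set_system T) (FG : Filter G) (u : T -> bool -> bool -> R) (l : bool -> bool -> R) :
  (forall c b, u t c b @[t --> G] --> l c b) -> spinor_of (u t) @[t --> G] --> spinor_of l.
Proof.
(* Radii of balls over [cplx R] are complex; positivity forces the imaginary part [ei] to be 0. *)
move=> H; apply/cvg_ballP => -[e ei] /[dup] e0; rewrite ltcE /= => /andP[/eqP ei0 e0'].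
have e4 : 0 < e / 2 by rewrite divr_gt0.
have N c b : \forall t \near G, `|l c b - u t c b| < e / 2.
  by have /cvgrPdist_lt := H c b; apply.
near=> t.
have n c b : `|l c b - u t c b| < e / 2.
  have n00 : `|l false false - u t false false| < e / 2 by near: t; exact: N.
  have n01 : `|l false true - u t false true| < e / 2 by near: t; exact: N.
  have n10 : `|l true false - u t true false| < e / 2 by near: t; exact: N.
  have n11 : `|l true true - u t true true| < e / 2 by near: t; exact: N.
  by case: c; case: b.
split=> [//|i j]; rewrite !mxE -ball_normE /=; simpc.
by rewrite ei0; apply: (norm_complex_lt (x := e / 2)); rewrite ?n// mulrC divfK.
Unshelve. all: by end_near.
Qed.

Lemma cvg_gform (R : realType) (T : Type) (G : set_system T) (FG : Filter G) (a E : R)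
  (u0 u1 u2 : bool -> bool -> T -> R) (l0 l1 l2 : bool -> bool -> R) :
  (forall c b, u0 c b t @[t --> G] --> l0 c b) -> (forall c b, u1 c b t @[t --> G] --> l1 c b) ->
  (forall c b, u2 c b t @[t --> G] --> l2 c b) ->
  forall c b, green_parts a E (fun c b => u0 c b t) (fun c b => u1 c b t) (fun c b => u2 c b t) c b @[t --> G] -->
    green_parts a E l0 l1 l2 c b.
Proof.
move=> H0 H1 H2; have Z (k : R) f (l : R) : f t @[t --> G] --> l -> k * f t @[t --> G] --> k * l.
  by move=> fl; apply: cvgM => //; exact: cvg_cst.
rewrite /green_parts; case; case; apply: (Z _ _ _).
- by apply: cvgD => //; apply: cvgB => //; exact: (Z _ _ _).
- by apply: cvgD => //; apply: cvgD => //; exact: (Z _ _ _).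
- by apply: cvgB => //; apply: cvgB => //; exact: (Z _ _ _).
- by apply: cvgB => //; apply: cvgD => //; exact: (Z _ _ _).
Qed.

(** * Matrix identities at an interface *)

Section InterfaceMatrices.
Variables (R : realType) (gamma : nat -> R -> R * R) (j : nat) (t : R).
Hypothesis unit_tangent : enorm (tangent gamma j t) = 1.
Let n := normal gamma j t.

Lemma normal_sqr : n.1 * n.1 + n.2 * n.2 = 1.
Proof.
have := sqr_enorm (tangent gamma j t); rewrite unit_tangent /n /normal /= => H.
by rewrite mulrNN addrC -!expr2 -H expr1n.
Qed.

Lemma Vmx_adjoint : adjoint (Vmx gamma j t) = Vmx gamma j t.
Proof.
apply/matrixP => a b; rewrite !mxE.
by case: (I2_cases a) => ->; case: (I2_cases b) => -> /=; simpc; rewrite ?mulr0 ?mul0r ?oppr0 ?opprK ?mulrN.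
Qed.

Lemma Vmx_invol (v : spinor R) : Vmx gamma j t *m (Vmx gamma j t *m v) = v.
Proof.
rewrite -[v in LHS]parts_ofK !Vmx_mk -[RHS]parts_ofK; apply: eq_spinor_of => c b.
have s2 : (Num.sqrt 2)^-1 * (Num.sqrt 2)^-1 = (2 : R)^-1.
  by rewrite -invfM -expr2 (sqr_sqrtr (_ : 0 <= 2)).
transitivity ((Num.sqrt 2)^-1 * (Num.sqrt 2)^-1 * ((n.1 * n.1 + n.2 * n.2 + 1) * parts_of v c b)).
  by rewrite -/n; case: c; case: b => /=; ring.
by rewrite s2 normal_sqr; field.
Qed.

Lemma insigma_mk r : insigma gamma j t *m spinor_of r = spinor_of (fun c b => match c, b with
  | false, false => n.2 * r true false - n.1 * r true true
  | false, true => n.1 * r true false + n.2 * r true true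
  | true, false => - (n.2 * r false false) - n.1 * r false true
  | true, true => n.1 * r false false - n.2 * r false true end).
Proof.
rewrite /insigma -/n -scalemxAl mulmxDl -!scalemxAl sigma1E sigma2E !mx22_mk /imag !(spinor_ofZ, spinor_ofD, spinor_ofZr).
by apply: eq_spinor_of => c b; case: c; case: b; ring.
Qed.

Lemma insigma_sqr (v : spinor R) : insigma gamma j t *m (insigma gamma j t *m v) = - v.
Proof.
have mkN r : - spinor_of r = spinor_of (fun c b => - r c b) by apply/matrixP => i k; rewrite !mxE; simpc.
rewrite -[v in LHS]parts_ofK !insigma_mk -[v in RHS]parts_ofK mkN; apply: eq_spinor_of => c b.
transitivity (- ((n.1 * n.1 + n.2 * n.2) * parts_of v c b)).
  by case: c; case: b; rewrite /=; ring.
by rewrite normal_sqr mul1r.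
Qed.

Lemma sigma3_mk r : sigma3 R *m spinor_of r = spinor_of (fun c b => if c then - r c b else r c b).
Proof. by rewrite sigma3E mx22_mk; apply: eq_spinor_of => c b; case: c; case: b => /=; ring. Qed.

(** Applying N V to the equation turns every term of the form V N z into - z, so all matrices but
    the one in front of x disappear. *)
Lemma flux_balance (x A B J : spinor R) (a b : cplx R) :
  let V := Vmx gamma j t in let N := insigma gamma j t in
  x - a *: (adjoint V *m N *m sigma3 R *m A) + b *: (adjoint V *m N *m B) = adjoint V *m N *m J ->
  N *m (V *m x) + a *: (sigma3 R *m A) - b *: B + J = 0.
Proof.
move=> V N.
have cancel (z : spinor R) : N *m (V *m (adjoint V *m N *m z)) = - z.
  by rewrite -mulmxA /V Vmx_adjoint Vmx_invol insigma_sqr.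
have lin c (y z : spinor R) : N *m (V *m (y + c *: z)) = N *m (V *m y) + c *: (N *m (V *m z)).
  by rewrite mulmxDr -scalemxAr mulmxDr -scalemxAr.
rewrite -scaleNr -(mulmxA (adjoint V *m N)) => H.
have := congr1 (fun z : spinor R => N *m (V *m z)) H.
rewrite cancel 2!lin 2!cancel scalerN scaleNr opprK scalerN => ->.
by rewrite addNr.
Qed.

End InterfaceMatrices.

Lemma near_within_eq (R : realType) (T : Type) (g h : R * R -> T) (A : set (R * R)) (x : R * R) : (forall y, A y -> g y = h y) ->
  \forall y \near within A (nbhs x), g y = h y.
Proof. by move=> H; rewrite near_withinE; apply: nearW => y; exact: H. Qed.

(** The two disjuncts are j = 1 and j = 2. V and W are the volume potentials of regions j and j - 1,
    A0, P1, P2 the trace of the own layer and the principal values of its derivatives, B the layer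
    of the other curve, and T, T' tell which of the two regions that curve touches. The principal
    values cancel, and the opposite masses leave the term with 2 m sigma3. *)
Lemma gform_jump (R : realType) (m E s s' T T' a a' : R) (n : R * R)
    (r V0 V1 V2 W0 W1 W2 A0 P1 P2 B0 B1 B2 : bool -> bool -> R) c b :
  [/\ s = -1, a = - m & a' = m] /\ [/\ T = 1, T' = 0 & s' = -1] \/
  [/\ s = 1, a = m & a' = - m] /\ [/\ T = 0, T' = 1 & s' = 1] ->
  let q := (2 * pi)^-1 in let r' c b := q * (2 * pi) * r c b in
  match c, b with
  | false, false => n.2 * r' true false - n.1 * r' true true
  | false, true => n.1 * r' true false + n.2 * r' true true
  | true, false => - (n.2 * r' false false) - n.1 * r' false true
  | true, true => n.1 * r' false false - n.2 * r' false true end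
  + s * (2 * m) * (if c then - (q * A0 c b) else q * A0 c b) - s' * green_parts (- m) E B0 B1 B2 c b
  + (green_parts a E V0 V1 V2 c b - green_parts a' E W0 W1 W2 c b) = 0 ->
  green_parts a' E (fun c b => W0 c b + (A0 c b + T' * B0 c b)) (fun c b => W1 c b + (P1 c b + pi * n.1 * r c b + T' * B1 c b))
    (fun c b => W2 c b + (P2 c b + pi * n.2 * r c b + T' * B2 c b)) c b =
  green_parts a E (fun c b => V0 c b + (A0 c b + T * B0 c b)) (fun c b => V1 c b + (P1 c b - pi * n.1 * r c b + T * B1 c b))
    (fun c b => V2 c b + (P2 c b - pi * n.2 * r c b + T * B2 c b)) c b.
Proof.
move=> facts q r' H; apply/esym/eqP; rewrite -subr_eq0 -H /green_parts /r' /q {H}.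
by case: facts => -[[-> -> ->] [-> -> ->]]; apply/eqP; case: c; case: b; ring.
Qed.

(** * Transmission at a point of an interface *)

Section Transmission.
Variables (R : realType) (gamma : nat -> R -> R * R) (Omega : nat -> set (R * R)).
Hypothesis HI : interfaces gamma Omega.
Variables m E : R.
Let w := omega m E.
Hypothesis w0 : 0 < omega m E.
Variable f : nat -> R * R -> spinor R.
Variables f1 f2 f11 f12 f22 : nat -> bool -> bool -> R * R -> R.
Hypothesis sc : forall k c b, (k <= 2)%N ->
  compact_C2 (comps f k c b) (f1 k c b) (f2 k c b) (f11 k c b) (f12 k c b) (f22 k c b).
Hypothesis f0 : forall k y, (k <= 2)%N -> ~ Omega k y -> f k y = 0.
Variable mu : nat -> R -> spinor R.
Hypothesis dm : forall j c b, (1 <= j <= 2)%N -> dens (comps mu j c b).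

Let cf k c b (k2 : (k <= 2)%N) : compact_cont (fun y => parts_of (f k y) c b) := sc_ccs (sc c b k2).

Lemma cvg_within_continuous (g : R * R -> R) (A : set (R * R)) x : {for x, continuous g} ->
  g y @[y --> within A (nbhs x)] --> g x.
Proof. by move=> H; apply: (cvg_trans _ H); apply: cvg_app; exact: cvg_within. Qed.

Lemma vol_continuous k K c b x : (k <= 2)%N -> weakly_singular K -> {for x, continuous (volume_pot K (comps f k c b))}.
Proof. by move=> k2 lk; exact: has_grad_continuous (vol_has_grad x lk (sc c b k2)). Qed.

Section AtPoint.
Variables (j : nat) (t0 : R).
Hypothesis hj : (1 <= j <= 2)%N.
Let x0 := gamma j t0.
Let l := (3 - j)%N.

Lemma other_index : (1 <= l <= 2)%N.
Proof. by rewrite /l; case: (curve_index hj) => ->. Qed.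

Lemma other_off t : x0 <> gamma l t.
Proof.
move=> e; have := curves_disjoint HI; apply/eqP/set0P; rewrite /x0 /l in e *.
by case: (curve_index hj) e => -> e; [exists (gamma 1%N t0)|exists (gamma 2%N t0)]; split;
  first [by exists t0|by exists t; rewrite -?e//; rewrite e].
Qed.

Lemma lays_own k K c b x : lays gamma (comps mu) k K c b x =
  touches R j k * layer_pot (gamma j) K (comps mu j c b) x + touches R l k * layer_pot (gamma l) K (comps mu l c b) x.
Proof. by rewrite /lays /l; case: (curve_index hj) => -> //=; rewrite addrC. Qed.

Lemma pot_cvg k (K ka kb : R * R -> R) c b (A : R) : k = j \/ k = j.-1 -> decaying_kernel w K ka kb -> weakly_singular K ->
  layer_pot (gamma j) K (comps mu j c b) y @[y --> within (Omega k) (nbhs x0)] --> A ->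
  pot gamma (comps f) (comps mu) k K c b y @[y --> within (Omega k) (nbhs x0)] -->
    volume_pot K (comps f k c b) x0 + (A + touches R l k * layer_pot (gamma l) K (comps mu l c b) x0).
Proof.
move=> kj dk lk HA; have hl := other_index.
have k2 : (k <= 2)%N by case: kj => ->; case: (curve_index hj) => ->.
have t1 : touches R j k = 1 by rewrite /touches; case: kj => ->; case: (curve_index hj) => ->.
have hg := layer_has_grad w0 (interface_good_curve HI hl) dk (dm c b hl) other_off.
have HB := @cvg_within_continuous _ (Omega k) x0 (has_grad_continuous hg).
have HV := @cvg_within_continuous _ (Omega k) x0 (@vol_continuous k K c b x0 k2 lk).
rewrite /pot (_ : (fun y => _) = (fun y => volume_pot K (comps f k c b) y + (layer_pot (gamma j) K (comps mu j c b) y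
   + touches R l k * layer_pot (gamma l) K (comps mu l c b) y))); last first.
  by apply/funext => y; rewrite lays_own t1 mul1r.
apply: cvgD => //; apply: cvgD => //; apply: cvgM => //; exact: cvg_cst.
Qed.

(** x0 lies in the closure of the region. Properness of the filter makes the [lim] in [jump] equal
    to the limit found. *)
Lemma region_proper k : k = j \/ k = j.-1 -> ProperFilter (within (Omega k) (nbhs x0)).
Proof.
move=> kj; apply: within_nbhs_proper.
have : boundary (Omega k) x0.
  have C i t : (1 <= i <= 2)%N -> curve gamma i (gamma i t) by exists t.
  rewrite /x0; case: kj => ->; case: (curve_index hj) => -> /=.
  - by rewrite (boundary_Omega1 HI); left; exact: C.
  - by rewrite (boundary_Omega2 HI); exact: C.
  - by rewrite (boundary_Omega0 HI); exact: C.
  - by rewrite (boundary_Omega1 HI); right; exact: C.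
by case.
Qed.

Lemma incident_cvg k : k = j \/ k = j.-1 ->
  incident m E Omega f y @[y --> within (Omega k) (nbhs x0)] --> volf m E f k x0.
Proof.
move=> kj; have k2 : (k <= 2)%N by case: kj => ->; case: (curve_index hj) => ->.
have FF := region_proper kj.
have H : volf m E f k y @[y --> within (Omega k) (nbhs x0)] --> volf m E f k x0.
  apply: cvg_mk => c b; apply: cvg_gform => c' b'; apply: cvg_within_continuous; apply: vol_continuous => //.
  - exact: locker_KA.
  - exact: (locker_Kp false).
  - exact: (locker_Kp true).
apply: cvg_trans H; apply: near_eq_cvg; apply: near_within_eq => y ky.
by rewrite (incident_field HI w0 cf f0 k2 ky).
Qed.

Lemma jump_incident : jump gamma Omega (incident m E Omega f) j t0 = volf m E f j x0 - volf m E f j.-1 x0.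
Proof.
have P1 := region_proper (or_introl (erefl j)); have P2 := region_proper (or_intror (erefl j.-1)).
rewrite /jump; congr (_ - _); apply: cvg_lim; try exact: norm_hausdorff.
  exact: incident_cvg (or_introl (erefl j)).
exact: incident_cvg (or_intror (erefl j.-1)).
Qed.

Definition own_trace : spinor R := spinor_of (fun c b => layer_pot (gamma j) (KA w) (comps mu j c b) x0).

Lemma field_side k (A0 A1 A2 : bool -> bool -> R) : k = j \/ k = j.-1 ->
  (forall c b, layer_pot (gamma j) (KA w) (comps mu j c b) y @[y --> within (Omega k) (nbhs x0)] --> A0 c b) ->
  (forall c b, layer_pot (gamma j) (K1 w) (comps mu j c b) y @[y --> within (Omega k) (nbhs x0)] --> A1 c b) ->
  (forall c b, layer_pot (gamma j) (K2 w) (comps mu j c b) y @[y --> within (Omega k) (nbhs x0)] --> A2 c b) ->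
  let P K (A : bool -> bool -> R) c b := volume_pot K (comps f k c b) x0 + (A c b + touches R l k * layer_pot (gamma l) K (comps mu l c b) x0) in
  totalf gamma m E f mu k y @[y --> within (Omega k) (nbhs x0)] -->
    (spinor_of (green_parts (region_mass m k) E (P (KA w) A0) (P (K1 w) A1) (P (K2 w) A2)) : spinor R).
Proof.
move=> kj H0 H1 H2 P; have FF := region_proper kj.
apply: cvg_mk => c b; apply: cvg_gform => c' b'.
- exact: (pot_cvg kj (dker_KA w0) (locker_KA w0) (H0 c' b')).
- exact: (pot_cvg kj (dker_K1 w0) (locker_Kp false w0) (H1 c' b')).
- exact: (pot_cvg kj (dker_K2 w0) (locker_Kp true w0) (H2 c' b')).
Qed.

Lemma field_balance : insigma gamma j t0 *m mu j t0 + ((-1) ^+ j * (2 * m))%:C *: (sigma3 R *m (((2 * pi)^-1)%:C *: own_trace))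
   - ((-1) ^+ l.-1)%:C *: layf gamma m E mu 1 l x0 + (volf m E f j x0 - volf m E f j.-1 x0) = 0 ->
  exists v : spinor R, totalf gamma m E f mu j y @[y --> within (Omega j) (nbhs x0)] --> v /\
    totalf gamma m E f mu j.-1 y @[y --> within (Omega j.-1) (nbhs x0)] --> v.
Proof.
move=> bal; have jj : j = j \/ j = j.-1 by left.
have jp : j.-1 = j \/ j.-1 = j.-1 by right.
have tw c b := trace_weak HI w0 t0 hj (dm c b hj).
have [PV1 ts1] := choice (fun cb : bool * bool => trace_strong HI w0 false t0 hj (dm cb.1 cb.2 hj)).
have [PV2 ts2] := choice (fun cb : bool * bool => trace_strong HI w0 true t0 hj (dm cb.1 cb.2 hj)).
have Fj := field_side jj (fun c b => (tw c b).1) (fun c b => (ts1 (c, b)).1) (fun c b => (ts2 (c, b)).1).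
have Fp := field_side jp (fun c b => (tw c b).2) (fun c b => (ts1 (c, b)).2) (fun c b => (ts2 (c, b)).2).
eexists; split; first exact: Fj.
have eqlim (u v : spinor R) (G : set_system (spinor R)) : G --> v -> v = u -> G --> u by move=> + <-.
apply: (eqlim _ _ _ Fp).
apply: eq_spinor_of => c b; have qpi : (2 * pi)^-1 * (2 * pi) = 1 :> R by rewrite mulVf// mulf_neq0// lt0r_neq0// pi_gt0.
(* The factor (2 pi)^-1 of the Green function meets the jump 2 pi of the layer derivatives; writing
   1 as this product makes the balance match [gform_jump]. *)
have muE : mu j t0 = spinor_of (fun c b => (2 * pi)^-1 * (2 * pi) * comps mu j c b t0).
  by rewrite -[LHS]parts_ofK; apply: eq_spinor_of => c' b'; rewrite qpi mul1r.
move: bal; rewrite muE insigma_mk /own_trace spinor_ofZr sigma3_mk spinor_ofZr /layf /volf /= spinor_ofZr spinor_ofB spinor_ofD !spinor_ofB spinor_ofD.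
have -> : (0 : spinor R) = spinor_of (fun _ _ => 0) by apply/matrixP => i k; rewrite !mxE.
move=> /spinor_of_inj bal; have {}bal := bal c b.
have facts : [/\ (-1) ^+ j = -1 :> R, region_mass m j = - m & region_mass m j.-1 = m] /\ [/\ touches R l j = 1, touches R l j.-1 = 0 & (-1) ^+ l.-1 = -1 :> R] \/
  [/\ (-1) ^+ j = 1 :> R, region_mass m j = m & region_mass m j.-1 = - m] /\ [/\ touches R l j = 0, touches R l j.-1 = 1 & (-1) ^+ l.-1 = 1 :> R].
  by rewrite /l; case: (curve_index hj) => ->; [left|right]; rewrite /touches /region_mass /= ?expr1 ?sqrrN ?expr1n.
have H := gform_jump (n := normal gamma j t0) (r := fun c b => comps mu j c b t0)
  (V0 := fun c b => volume_pot (KA w) (comps f j c b) x0) (V1 := fun c b => volume_pot (K1 w) (comps f j c b) x0)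
  (V2 := fun c b => volume_pot (K2 w) (comps f j c b) x0) (W0 := fun c b => volume_pot (KA w) (comps f j.-1 c b) x0)
  (W1 := fun c b => volume_pot (K1 w) (comps f j.-1 c b) x0) (W2 := fun c b => volume_pot (K2 w) (comps f j.-1 c b) x0)
  (A0 := fun c b => layer_pot (gamma j) (KA w) (comps mu j c b) x0)
  (B0 := fun c b => layer_pot (gamma l) (KA w) (comps mu l c b) x0) (B1 := fun c b => layer_pot (gamma l) (K1 w) (comps mu l c b) x0)
  (B2 := fun c b => layer_pot (gamma l) (K2 w) (comps mu l c b) x0)
  (fun c b => PV1 (c, b)) (fun c b => PV2 (c, b)) facts bal.
exact: H.
Qed.

End AtPoint.
End Transmission.

(** * Behaviour at infinity *)

Lemma edist_le (R : realType) (x y : R * R) (S : set (R * R)) : S y -> edist x S <= enorm (x - y).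
Proof.
move=> Sy; apply: ge_inf; last by exists y.
by exists 0 => _ [z _ <-]; exact: enorm_ge0.
Qed.

#[global] Instance far_filter (R : realType) (S : set (R * R)) : Filter (far S).
Proof.
apply: filter_from_filter; first by exists 0.
move=> D1 D2 _ _; exists (Num.max D1 D2) => // x /=; rewrite gt_max => /andP[h1 h2].
by split.
Qed.

Lemma far_cvg0 (R : realType) (S : set (R * R)) (F : R * R -> R) :
  (forall eps, 0 < eps -> exists D, forall x, D < edist x S -> `|F x| <= eps) -> F x @[x --> far S] --> (0 : R).
Proof.
move=> H; apply/cvgrPdist_le => eps e0; have [D HD] := H eps e0.
by exists D => // x /= xD; rewrite sub0r normrN; exact: HD.
Qed.

Lemma pinfty_cvg0 (R : realType) (F : R -> R) :
  (forall eps, 0 < eps -> exists T, forall t, T <= t -> `|F t| <= eps) -> F t @[t --> +oo] --> (0 : R).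
Proof.
move=> H; apply/cvgrPdist_le => eps e0; have [T HT] := H eps e0.
by exists T; split=> [|t tT]; rewrite ?num_real// sub0r normrN; apply: HT; exact: ltW.
Qed.

Lemma cvg0_mul_cvg (R : realType) (F G : R -> R) (l : R) : F t @[t --> +oo] --> (0 : R) -> G t @[t --> +oo] --> l ->
  F t * G t @[t --> +oo] --> (0 : R).
Proof. by move=> F0 G1; rewrite -(mul0r l); apply: cvgM. Qed.

(* Multiplication by - iE. *)
Definition rot (R : realType) (E : R) (v : bool -> bool -> R) (c b : bool) : R :=
  if b then - (E * v c false) else E * v c true.

Lemma gform0 (R : realType) (a E : R) c b : green_parts a E (fun _ _ => 0) (fun _ _ => 0) (fun _ _ => 0) c b = 0.
Proof. by rewrite /green_parts; case: c; case: b; rewrite !mulr0 ?addr0 ?subr0 ?mulr0. Qed.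

(** Complex linearity with constant coefficients: the derivative along the path and the
    multiplication by - i E pass through [green_parts]. *)
Lemma gform_rate (R : realType) (a E x y : R) (k0 k1 k2 k11 k12 k22 : bool -> bool -> R) c b :
  green_parts a E k1 k11 k12 c b * x + green_parts a E k2 k12 k22 c b * y + rot E (green_parts a E k0 k1 k2) c b =
  green_parts a E (fun c b => k1 c b * x + k2 c b * y + rot E k0 c b) (fun c b => k11 c b * x + k12 c b * y + rot E k1 c b)
    (fun c b => k12 c b * x + k22 c b * y + rot E k2 c b) c b.
Proof. by rewrite /green_parts /rot; case: c; case: b; ring. Qed.

Section Infinity.
Variables (R : realType) (gamma : nat -> R -> R * R) (Omega : nat -> set (R * R)).
Hypothesis HI : interfaces gamma Omega.
Variables m E : R.
Let w := omega m E.
Hypothesis w0 : 0 < omega m E.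
Variable f : nat -> R * R -> spinor R.
Variables f1 f2 f11 f12 f22 : nat -> bool -> bool -> R * R -> R.
Hypothesis sc : forall k c b, (k <= 2)%N ->
  compact_C2 (comps f k c b) (f1 k c b) (f2 k c b) (f11 k c b) (f12 k c b) (f22 k c b).
Variable mu : nat -> R -> spinor R.
Hypothesis mo : forall j c, (1 <= j <= 2)%N -> osc E (comps mu j c false) (comps mu j c true).

Let dm j c b (hj : (1 <= j <= 2)%N) : dens (comps mu j c b).
Proof. by have [d1 d2] := osc_dens (mo c hj); case: b. Qed.

Let Gam := curve gamma 1 `|` curve gamma 2.

Lemma curve_edist j t x : (1 <= j <= 2)%N -> edist x Gam <= enorm (x - gamma j t).
Proof.
by move=> hj; apply: edist_le; case: (curve_index hj) => ->; [left|right]; exists t.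
Qed.

Lemma vol_far K k c b : (k <= 2)%N -> decaying w K -> weakly_singular K -> volume_pot K (comps f k c b) x @[x --> far Gam] --> (0 : R).
Proof.
move=> k2 dK lK; apply: far_cvg0 => eps e0.
have [D HD] := vol_decay w0 dK lK (sc_ccs (sc c b k2)) e0.
exists (D + enorm (gamma 1%N 0)) => x xD; apply: HD.
have := @curve_edist 1%N 0 x isT; have := enorm_tri x 0 (gamma 1%N 0); rewrite !subr0 sub0r enormN.
by move: xD; clear -HI w0 sc mo; lra.
Qed.

Lemma lay_far j K ka kb c b : (1 <= j <= 2)%N -> decaying_kernel w K ka kb ->
  layer_pot (gamma j) K (comps mu j c b) x @[x --> far Gam] --> (0 : R).
Proof.
move=> hj [H0 D0 _ _]; apply: far_cvg0 => eps e0.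
have [D HD] := layer_far w0 (interface_good_curve HI hj) H0 D0 (dm c b hj) e0.
by exists D => x xD; apply: HD => t; rewrite (le_trans (ltW xD))// curve_edist.
Qed.

Lemma pot_far K ka kb k c b : (k <= 2)%N -> decaying_kernel w K ka kb -> weakly_singular K ->
  pot gamma (comps f) (comps mu) k K c b x @[x --> far Gam] --> (0 : R).
Proof.
move=> k2 dK lK; have [_ D0 _ _] := dK.
have Z (t : R) (G : R * R -> R) : G x @[x --> far Gam] --> (0 : R) -> t * G x @[x --> far Gam] --> (0 : R).
  by move=> G0; rewrite -(mulr0 t); apply: cvgM => //; exact: cvg_cst.
rewrite -(addr0 (0 : R)); apply: cvgD; first exact: vol_far.
rewrite -(addr0 (0 : R)); apply: cvgD; apply: (Z _ _ _); [exact: lay_far dK|exact: lay_far dK].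
Qed.

Lemma field_far k c b : (k <= 2)%N ->
  fieldc gamma w (comps f) (comps mu) m E k c b x @[x --> far Gam] --> (0 : R).
Proof.
move=> k2; rewrite -(gform0 (region_mass m k) E c b).
apply: cvg_gform => c' b'.
- exact: pot_far (dker_KA w0) (locker_KA w0).
- exact: pot_far (dker_K1 w0) (locker_Kp false w0).
- exact: pot_far (dker_K2 w0) (locker_Kp true w0).
Qed.

Variable u : R * R -> spinor R.
Hypothesis uE : forall k x, (k <= 2)%N -> Omega k x -> u x = totalf gamma m E f mu k x.

Lemma spinor_of0 : spinor_of (fun _ _ => 0) = (0 : spinor R).
Proof. by apply/matrixP => i j; rewrite !mxE. Qed.

Lemma total_far : u x @[x --> far Gam] --> (0 : spinor R).
Proof.
have -> : u = fun x => spinor_of (parts_of (u x)) by apply/funext => x; rewrite parts_ofK.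
rewrite -spinor_of0; apply: cvg_mk => c b.
(* The region of x is not known, so the three region fields, each defined on the whole plane, are
   bounded together. *)
apply: (norm_cvg0 _ (h := fun x => `|fieldc gamma w (comps f) (comps mu) m E 0 c b x| +
  `|fieldc gamma w (comps f) (comps mu) m E 1 c b x| + `|fieldc gamma w (comps f) (comps mu) m E 2 c b x|)).
  exists 0 => // x /= x0.
  have off : off_curves gamma x.
    move=> j t hj xt; have := curve_edist t x hj; rewrite xt subrr enorm0 => H.
    by move: x0; rewrite ltNge xt H.
  have [k k2 kx] := (offGE HI x).1 off.
  rewrite (uE k2 kx) /totalf /field spinor_ofK.
  have B (v : nat -> R) : `|v k| <= `|v 0%N| + `|v 1%N| + `|v 2%N|.
    have := @ler_norm_sum3 R `|v 0%N| `|v 1%N| `|v 2%N| `|v k|; rewrite !normr_id; apply.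
    by case: (k) k2 => [|[|[|]]]// _; auto.
  exact: (B (fun k => fieldc gamma w (comps f) (comps mu) m E k c b x)).
have N k : (k <= 2)%N -> `|fieldc gamma w (comps f) (comps mu) m E k c b x| @[x --> far Gam] --> (0 : R).
  by move=> k2; rewrite -(normr0 R); apply: cvg_norm; exact: field_far.
by rewrite -(addr0 (0 : R)); apply: cvgD; [rewrite -(addr0 (0 : R)); apply: cvgD|]; exact: N.
Qed.

End Infinity.

(** * Radiation condition at one end of an interface *)

Section CurveEnds.
Variables (R : realType) (gamma : nat -> R -> R * R) (Omega : nat -> set (R * R)).
Hypothesis HI : interfaces gamma Omega.
Variables m E : R.
Let w := omega m E.
Hypothesis w0 : 0 < omega m E.
Variable f : nat -> R * R -> spinor R.
Variables f1 f2 f11 f12 f22 : nat -> bool -> bool -> R * R -> R.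
Hypothesis sc : forall k c b, (k <= 2)%N ->
  compact_C2 (comps f k c b) (f1 k c b) (f2 k c b) (f11 k c b) (f12 k c b) (f22 k c b).
Variable mu : nat -> R -> spinor R.
Hypothesis dm : forall j c b, (1 <= j <= 2)%N -> dens (comps mu j c b).
Variable u : R * R -> spinor R.
Hypothesis uE : forall k x, (k <= 2)%N -> Omega k x -> u x = totalf gamma m E f mu k x.

(** g is [gamma j] or its reversal and sg the corresponding change of parameter, so that each end of
    the curve is studied at +oo; q is the density in the new parameter. *)
Variables (j : nat) (g d e : R -> R * R) (sg : R -> R) (r : R).
Hypothesis hj : (1 <= j <= 2)%N.
Hypothesis gc : good_curve g d e.
Hypothesis gE : forall t, g t = gamma j (sg t).
Hypothesis sgK : forall t, sg (sg t) = t.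
Hypothesis sgn : forall t, `|sg t| = `|t|.
Hypothesis r0 : r != 0.
Variable q : bool -> bool -> R -> R.
Hypothesis layq : forall K ka kb c b x, decaying_kernel w K ka kb -> off_curves gamma x ->
  [/\ layer_pot (gamma j) K (comps mu j c b) x = layer_pot g K (q c b) x,
      layer_pot (gamma j) ka (comps mu j c b) x = layer_pot g ka (q c b) x &
      layer_pot (gamma j) kb (comps mu j c b) x = layer_pot g kb (q c b) x].
Hypothesis qosc : forall c, exists a b b' a2 b2 b2', [/\ split_dens (q c false) a b b', split_dens (q c true) a2 b2 b2',
  b' t + E * b2 t @[t --> +oo] --> (0 : R) & b2' t - E * b t @[t --> +oo] --> (0 : R)].

Let P t := offset g d r t.
Let l := (3 - j)%N.

Let hl : (1 <= l <= 2)%N.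
Proof. by rewrite /l; case: (curve_index hj) => ->. Qed.

Lemma path_curve_dist t : enorm (P t - g t) = `|r|.
Proof. by rewrite /P /offset addrC addKr enormZ (enorm_nrm gc) mulr1. Qed.

Lemma path_growth : exists c C : R, 0 < c /\ forall t s, c * `|t| - C <= enorm (P t - gamma l s) /\ c * `|t| - C <= enorm (P t).
Proof.
have [c [C [c0 H]]] := interface_cross_growth HI.
have G t s : c * `|t| - C <= enorm (g t - gamma l s).
  have K : c * `|t| <= c * (`|sg t| + `|s|) by rewrite sgn ler_wpM2l ?(ltW c0)// lerDl.
  have K' : c * `|t| <= c * (`|s| + `|sg t|) by rewrite addrC.
  rewrite gE /l; case: (curve_index hj) => -> /=.
    by apply: le_trans (H _ _); rewrite lerD2r.
  by rewrite -enormN opprB; apply: le_trans (H _ _); rewrite lerD2r.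
exists c, (C + `|r| + enorm (gamma l 0)); split=> // t s.
have D0 := path_curve_dist t; have N0 := enorm_ge0 (gamma l 0).
have T1 := enorm_tri (g t) (P t) (gamma l s); have T2 := enorm_tri (g t) (P t) (gamma l 0).
have T3 := enorm_tri (P t) 0 (gamma l 0); rewrite subr0 sub0r enormN in T3.
rewrite -enormN opprB in D0; have G1 := G t s; have G2 := G t 0.
by move: D0 N0 T1 T2 T3 G1 G2; clear -HI w0 sc dm uE gc gE sgK sgn r0 layq qosc hj; split; lra.
Qed.

(** Towards the end, the parallel path avoids its own curve by [par_sep] and the other curve by
    linear growth of the distance between the two interfaces. *)
Lemma path_off : exists T : R, forall t, T <= t -> off_curves gamma (P t).
Proof.
have [T [dl [dl0 sep]]] := par_sep gc r0.
have [c [C [c0 H]]] := path_growth.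
exists (Num.max T ((`|C| + 1) / c)) => t; rewrite ge_max => /andP[tT tC] i s hi.
have [->|->] : i = j \/ i = l.
  by rewrite /l; case: (curve_index hi) => ->; case: (curve_index hj) => ->; auto.
  by rewrite -(sgK s) -gE; exact: par_off dl0 sep tT _.
move=> E'; have [+ _] := H t s; rewrite E' subrr enorm0.
have t0 : 0 <= t by apply: le_trans tC; rewrite divr_ge0 ?addr_ge0// ltW.
rewrite ger0_norm//; move: tC; rewrite ler_pdivrMr// => tC; have := ler_norm C.
by move: tC; clear -HI w0 sc dm uE gc gE sgK sgn r0 layq qosc hj; lra.
Qed.

Lemma path_cvg0 (F : R * R -> R) : (forall eps, 0 < eps -> exists D, forall x,
    (forall s, D <= enorm (x - gamma l s)) -> D <= enorm x -> `|F x| <= eps) ->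
  F (P t) @[t --> +oo] --> (0 : R).
Proof.
move=> H; apply: pinfty_cvg0 => eps e0; have [D HD] := H eps e0.
have [c [C [c0 HC]]] := path_growth; exists ((`|C| + `|D|) / c) => t tT.
have t0 : 0 <= t by apply: le_trans tT; rewrite divr_ge0 ?addr_ge0// ltW.
have K : D <= c * `|t| - C.
  move: tT; rewrite ler_pdivrMr// => tT; rewrite ger0_norm//; have := ler_norm C; have := ler_norm D.
  by move: tT; clear -HI w0 sc dm uE gc gE sgK sgn r0 layq qosc hj; lra.
apply: HD => [s|]; first exact: le_trans K (HC t s).1.
exact: le_trans K (HC t 0).2.
Qed.

Lemma vol_path K (F : R * R -> R) : decaying w K -> weakly_singular K -> compact_cont F -> volume_pot K F (P t) @[t --> +oo] --> (0 : R).
Proof.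
move=> dK lK cF; apply: path_cvg0 => eps e0; have [D HD] := vol_decay w0 dK lK cF e0.
by exists D => x _ /HD.
Qed.

Lemma lay_path K ka kb c b : decaying_kernel w K ka kb ->
  [/\ layer_pot (gamma l) K (comps mu l c b) (P t) @[t --> +oo] --> (0 : R),
      layer_pot (gamma l) ka (comps mu l c b) (P t) @[t --> +oo] --> (0 : R) &
      layer_pot (gamma l) kb (comps mu l c b) (P t) @[t --> +oo] --> (0 : R)].
Proof.
move=> [H0 D0 [d1 [a1 [a2 [A1 _ _]]]] [d2 [b1 [b2 [B1 _ _]]]]]; have gl := interface_good_curve HI hl.
have L k k1 k2 : (forall z, z != 0 -> has_grad k z (k1 z) (k2 z)) -> decaying w k ->
    layer_pot (gamma l) k (comps mu l c b) (P t) @[t --> +oo] --> (0 : R).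
  move=> Hk dk; apply: path_cvg0 => eps e0; have [D HD] := layer_far w0 gl Hk dk (dm c b hl) e0.
  by exists D => x Hx _; exact: HD.
by split; [exact: L H0 D0|exact: L A1 d1|exact: L B1 d2].
Qed.

(** [outgoing_layer] with c = E for the imaginary part and c = - E for the real part, the other part
    playing the role of q. *)
Lemma own_path K ka kb c b : decaying_kernel w K ka kb ->
  layer_pot g ka (q c b) (P t) * offset_d1 d e r t + layer_pot g kb (q c b) (P t) * offset_d2 d e r t +
    rot E (fun c b => layer_pot g K (q c b) (P t)) c b @[t --> +oo] --> (0 : R).
Proof.
move=> dk; have [a [b1 [b1' [a2 [b2 [b2' [s1 s2 L1 L2]]]]]]] := qosc c.
have L1' : b1' t - (- E) * b2 t @[t --> +oo] --> (0 : R).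
  by apply: cvg0_eq L1 => t; rewrite mulNr opprK.
case: b.
  have H := outgoing_layer w0 gc r0 dk s2 s1 L2.
  by apply: cvg0_eq H.
have H := outgoing_layer w0 gc r0 dk s1 s2 L1'.
by apply: cvg0_eq H => t; rewrite /rot mulNr opprK.
Qed.

Lemma path_speed_cvg : exists v : R * R, offset_d1 d e r t @[t --> +oo] --> v.1 /\ offset_d2 d e r t @[t --> +oo] --> v.2.
Proof.
have [v [D [eta [eta0 D0 Hv]]]] := tangent_limit gc.
by exists v; have H := par1_cvg gc r eta0 Hv; exact: H.
Qed.

Lemma rot_cvg0 (v : bool -> bool -> R -> R) c b : (forall b, v c b t @[t --> +oo] --> (0 : R)) ->
  rot E (fun c b => v c b t) c b @[t --> +oo] --> (0 : R).
Proof.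
move=> H; have Z b' : E * v c b' t @[t --> +oo] --> (0 : R).
  by rewrite -(mulr0 E); apply: cvgM => //; exact: cvg_cst.
by case: b; rewrite /rot; [apply: cvg0N|].
Qed.

(** The volume part and the layer of the other curve vanish along the path together with their
    gradients, and the velocity converges; only the own layer keeps oscillating, and [own_path]
    handles it. *)
Lemma pot_path k (K ka kb : R * R -> R) (V V1 V2 : bool -> bool -> R * R -> R) c b : (k <= 2)%N -> decaying_kernel w K ka kb ->
  (forall c b, V c b (P t) @[t --> +oo] --> (0 : R)) -> (forall c b, V1 c b (P t) @[t --> +oo] --> (0 : R)) ->
  (forall c b, V2 c b (P t) @[t --> +oo] --> (0 : R)) ->
  (V1 c b (P t) + lays gamma (comps mu) k ka c b (P t)) * offset_d1 d e r t +
  (V2 c b (P t) + lays gamma (comps mu) k kb c b (P t)) * offset_d2 d e r t +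
  rot E (fun c b => V c b (P t) + lays gamma (comps mu) k K c b (P t)) c b @[t --> +oo] --> (0 : R).
Proof.
move=> k2 dk H0 H1 H2; have [v [p1 p2]] := path_speed_cvg.
have L c b := lay_path c b dk.
have Z (s : R) (F : R -> R) : F t @[t --> +oo] --> (0 : R) -> s * F t @[t --> +oo] --> (0 : R).
  by move=> F0; rewrite -(mulr0 s); apply: cvgM => //; exact: cvg_cst.
have T0 : V1 c b (P t) * offset_d1 d e r t + V2 c b (P t) * offset_d2 d e r t + rot E (fun c b => V c b (P t)) c b @[t --> +oo] --> (0 : R).
  apply: cvg0D; first by apply: cvg0D; [exact: cvg0_mul_cvg (H1 c b) p1|exact: cvg0_mul_cvg (H2 c b) p2].
  by apply: (rot_cvg0 (v := fun c b t => V c b (P t))).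
have Tl : layer_pot (gamma l) ka (comps mu l c b) (P t) * offset_d1 d e r t + layer_pot (gamma l) kb (comps mu l c b) (P t) * offset_d2 d e r t +
    rot E (fun c b => layer_pot (gamma l) K (comps mu l c b) (P t)) c b @[t --> +oo] --> (0 : R).
  apply: cvg0D; first by have [_ La Lb] := L c b; apply: cvg0D; [exact: cvg0_mul_cvg La p1|exact: cvg0_mul_cvg Lb p2].
  by apply: (rot_cvg0 (v := fun c b t => layer_pot (gamma l) K (comps mu l c b) (P t))) => b'; have [] := L c b'.
have To := own_path c b dk; have [T off] := path_off.
have := cvg0D T0 (cvg0D (Z (touches R j k) _ To) (Z (touches R l k) _ Tl)).
apply: cvg_trans; apply: near_eq_cvg; exists T; split=> [|t tT]; first exact: num_real.
have o := off t (ltW tT).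
have [_ e1 e2] := layq c b dk o.
have eL b' : layer_pot g K (q c b') (P t) = layer_pot (gamma j) K (comps mu j c b') (P t) by have [] := layq c b' dk o.
rewrite !(lays_own gamma mu hj) -/l -e1 -e2.
have -> : rot E (fun c b => V c b (P t) + lays gamma (comps mu) k K c b (P t)) c b =
  rot E (fun c b => V c b (P t)) c b + (touches R j k * rot E (fun c b => layer_pot g K (q c b) (P t)) c b +
    touches R l k * rot E (fun c b => layer_pot (gamma l) K (comps mu l c b) (P t)) c b).
  rewrite /rot !(lays_own gamma mu hj) -/l !eL; case: (b); ring.
ring.
Qed.

Definition field_rate k c b t := fieldd1 gamma w (comps f) f1 f2 (comps mu) m E k c b (P t) * offset_d1 d e r t +
  fieldd2 gamma w (comps f) f2 (comps mu) m E k c b (P t) * offset_d2 d e r t +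
  rot E (fun c b => fieldc gamma w (comps f) (comps mu) m E k c b (P t)) c b.

Lemma field_rate_cvg0 k c b : (k <= 2)%N -> field_rate k c b t @[t --> +oo] --> (0 : R).
Proof.
move=> k2; have [_ D0 _ _] := dker_KA w0; have [_ D1 _ _] := dker_K1 w0; have [_ D2 _ _] := dker_K2 w0.
have l0 := locker_KA w0; have l1 : weakly_singular (K1 w) := locker_Kp false w0; have l2 : weakly_singular (K2 w) := locker_Kp true w0.
have Q0 c b := pot_path (V := fun c b => volume_pot (KA w) (comps f k c b)) (V1 := fun c b => volume_pot (K1 w) (comps f k c b))
  (V2 := fun c b => volume_pot (K2 w) (comps f k c b)) c b k2 (dker_KA w0) (fun c b => vol_path D0 l0 (sc_ccs (sc c b k2)))
  (fun c b => vol_path D1 l1 (sc_ccs (sc c b k2))) (fun c b => vol_path D2 l2 (sc_ccs (sc c b k2))).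
have Q1 c b := pot_path (V := fun c b => volume_pot (K1 w) (comps f k c b)) (V1 := fun c b => volume_pot (K1 w) (f1 k c b))
  (V2 := fun c b => volume_pot (K1 w) (f2 k c b)) c b k2 (dker_K1 w0) (fun c b => vol_path D1 l1 (sc_ccs (sc c b k2)))
  (fun c b => vol_path D1 l1 (sc_ccs1 (sc c b k2))) (fun c b => vol_path D1 l1 (sc_ccs2 (sc c b k2))).
have Q2 c b := pot_path (V := fun c b => volume_pot (K2 w) (comps f k c b)) (V1 := fun c b => volume_pot (K1 w) (f2 k c b))
  (V2 := fun c b => volume_pot (K2 w) (f2 k c b)) c b k2 (dker_K2 w0) (fun c b => vol_path D2 l2 (sc_ccs (sc c b k2)))
  (fun c b => vol_path D1 l1 (sc_ccs2 (sc c b k2))) (fun c b => vol_path D2 l2 (sc_ccs2 (sc c b k2))).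
have := @cvg_gform R R (pinfty_nbhs R) _ (region_mass m k) E _ _ _ _ _ _ Q0 Q1 Q2 c b; rewrite gform0 => H.
apply: cvg0_eq (H _) => t.
exact: gform_rate.
Qed.

Let U c b t := parts_of (u (P t)) c b.

Lemma is_derive_path k c b t : (k <= 2)%N -> Omega k (P t) -> is_derive (t : R) (1 : R) (U c b)
  (fieldd1 gamma w (comps f) f1 f2 (comps mu) m E k c b (P t) * offset_d1 d e r t +
   fieldd2 gamma w (comps f) f2 (comps mu) m E k c b (P t) * offset_d2 d e r t).
Proof.
move=> k2 kx; have off := Omega_off HI k2 kx.
have hg := fieldc_has_grad HI w0 sc dm m E c b k2 off.
have hu : has_grad (fun y => parts_of (u y) c b) (P t) (fieldd1 gamma w (comps f) f1 f2 (comps mu) m E k c b (P t))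
    (fieldd2 gamma w (comps f) f2 (comps mu) m E k c b (P t)).
  apply: has_grad_near hg; have : nbhs (P t) (Omega k) by apply: open_nbhs_nbhs; split=> //; exact: (Omega_open HI k2).
  by apply: filterS => y ky; rewrite (uE k2 ky) /totalf /field spinor_ofK.
have H := @has_grad_curve _ (fun y => parts_of (u y) c b) (fun s => (P s).1) (fun s => (P s).2) t _ _ _ _ hu
  (is_derive_par1 gc r t) (is_derive_par2 gc r t).
by rewrite (_ : U c b = fun s => parts_of (u ((P s).1, (P s).2)) c b)//; apply/funext => s; rewrite -surjective_pairing.
Qed.

Lemma path_outgoing : (exists T : R, forall t c b, T <= t -> derivable (U c b) t 1) /\
  forall c b, 'D_1 (U c b) t + rot E (fun c b => U c b t) c b @[t --> +oo] --> (0 : R).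
Proof.
have [T off] := path_off; split.
  exists T => t c b /off /(offGE HI)[k k2 kx].
  by have [] := is_derive_path c b k2 kx.
move=> c b.
(* The region found for [P t] may depend on t, so the sum of the three rates is used as a bound. *)
apply: (norm_cvg0 _ (h := fun t => `|field_rate 0 c b t| + `|field_rate 1 c b t| + `|field_rate 2 c b t|)).
  exists T; split=> [|t /ltW /off /(offGE HI)[k k2 kx]]; first exact: num_real.
  have [_ ->] := is_derive_path c b k2 kx.
  have E1 c' b' : U c' b' t = fieldc gamma w (comps f) (comps mu) m E k c' b' (P t).
    by rewrite /U (uE k2 kx) /totalf /field spinor_ofK.
  have -> : rot E (fun c b => U c b t) c b = rot E (fun c b => fieldc gamma w (comps f) (comps mu) m E k c b (P t)) c b.
    by rewrite /rot !E1.
  have := @ler_norm_sum3 R `|field_rate 0 c b t| `|field_rate 1 c b t| `|field_rate 2 c b t| `|field_rate k c b t|.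
  rewrite !normr_id; apply; by case: (k) k2 => [|[|[|]]]// _; auto.
have N k : (k <= 2)%N -> `|field_rate k c b t| @[t --> +oo] --> (0 : R).
  by move=> k2; rewrite -(normr0 R); apply: cvg_norm; exact: field_rate_cvg0.
by apply: cvg0D; [apply: cvg0D|]; exact: N.
Qed.

End CurveEnds.

(** * Passing between spinors and their real parts *)

Section SpinorParts.
Variable R : realType.

Lemma part_sp (T : Type) (v : T -> spinor R) (k : 'I_2) :
  re_part v k = (fun t => parts_of (v t) (k != 0) false) /\ im_part v k = (fun t => parts_of (v t) (k != 0) true).
Proof. by split; apply/funext => t; rewrite /re_part /im_part /parts_of; case: (I2_cases k) => ->. Qed.

Lemma each_part_sp (T : Type) (P : (T -> R) -> Prop) (v : T -> spinor R) :
  (forall c b, P (fun t => parts_of (v t) c b)) <-> each_part P v.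
Proof.
split=> [H k|H c b].
  by have [-> ->] := part_sp v k; split; exact: H.
have [H1 H2] := H (if c then 1 else 0); have [e1 e2] := part_sp v (if c then 1 else 0).
rewrite e1 in H1; rewrite e2 in H2; by case: c b H1 H2 {e1 e2} => -[].
Qed.

Lemma sderive_mk (V : normedModType R) (x y : V) (v : V -> spinor R) :
  sderive x v y = spinor_of (fun c b => 'D_x (fun t => parts_of (v t) c b) y).
Proof.
by apply/matrixP => i k; rewrite !mxE; have [-> ->] := part_sp v i.
Qed.

Lemma outgoing_residual (E : R) (D v : bool -> bool -> R) :
  spinor_of D - (imag R * E%:C) *: spinor_of v = spinor_of (fun c b => D c b + rot E v c b).
Proof.
have -> : imag R * E%:C = 0 +i* E by rewrite /imag; simpc.
by rewrite spinor_ofZ spinor_ofB; apply: eq_spinor_of => c b; rewrite /rot; case: b; ring.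
Qed.

(** The substitution t -> - t turns the condition with - d/dt at -oo into the one with d/dt at +oo,
    so a single real statement, indexed by the direction s, covers both ends. *)
Lemma outgoing_sp (E : R) (v : R -> spinor R) :
  (forall s : bool, let V c b (t : R) := parts_of (v (if s then - t else t)) c b in
    (exists T : R, forall t c b, T <= t -> derivable (V c b) t 1) /\
    forall c b, 'D_1 (V c b) t + rot E (fun c b => V c b t) c b @[t --> +oo] --> (0 : R)) ->
  outgoing E v.
Proof.
move=> H; have [[T1 d1] l1] := H false; have [[T2 d2] l2] := H true => {H}.
have dN t : T2 <= t -> forall c b, is_derive (- t) (1 : R) (fun t => parts_of (v t) c b) (- 'D_1 (fun t => parts_of (v (- t)) c b) t).
  move=> tT c b; have := d2 t c b tT => /derivableP dt.
  have nt : is_derive (- t) (1 : R) (fun s : R => - s) (- 1) by exact: dNeg (dId _).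
  have dt' : is_derive (- (- t)) (1 : R) (fun t => parts_of (v (- t)) c b) ('D_1 (fun t => parts_of (v (- t)) c b) t) by rewrite opprK.
  have := dComp dt' nt; rewrite mulrN1.
  by under eq_fun do rewrite opprK.
split.
- exists T1; split=> [|t tT]; first exact: num_real.
  by apply/each_part_sp => c b; apply: d1; exact: ltW.
- have -> : (fun t : R => sderive (1 : R) v t - (imag R * E%:C) *: v t) = fun t => spinor_of (fun c b => 'D_1 (fun t => parts_of (v t) c b) t + rot E (parts_of (v t)) c b).
    by apply/funext => t; rewrite sderive_mk -[v t]parts_ofK outgoing_residual parts_ofK.
  by rewrite -spinor_of0; apply: cvg_mk => c b; exact: l1.
- exists (- T2); split=> [|t tT]; first exact: num_real.
  apply/each_part_sp => c b; have tT' : T2 <= - t by rewrite lerNr; exact: ltW.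
  by have [] := dN _ tT' c b; rewrite opprK.
apply/cvgNy_compNP; rewrite -spinor_of0.
have H : spinor_of (fun c b => 'D_1 (fun t => parts_of (v (- t)) c b) t + rot E (parts_of (v (- t))) c b) @[t --> +oo] --> (spinor_of (fun _ _ => 0) : spinor R).
  by apply: cvg_mk => c b; exact: l2.
apply: cvg_trans H; apply: near_eq_cvg; exists T2; split=> [|t tT]; first exact: num_real.
rewrite /= sderive_mk -outgoing_residual parts_ofK; congr (_ - _).
apply/matrixP => i k; rewrite !mxE.
have D c b : 'D_1 (fun t => parts_of (v t) c b) (- t) = - 'D_1 (fun t => parts_of (v (- t)) c b) t by have [_ ->] := dN t (ltW tT) c b.
by rewrite !D; simpc; rewrite ?opprK.
Qed.

Lemma test_spinor_comps (A : set (R * R)) (f : R * R -> spinor R) : test_spinor A f ->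
  (forall c b, bump (fun y => parts_of (f y) c b)) /\ forall y, ~ A y -> f y = 0.
Proof.
move=> [sf cK sub]; have Z y : ~ closure [set x | f x != 0] y -> f y = 0.
  by move=> nc; apply/eqP; apply/negP => /negP fy; apply: nc; exact: subset_closure.
split=> [c b|y nA]; last by apply: Z => /sub.
split; first by move: c b; apply/each_part_sp.
by exists (closure [set x | f x != 0]); split=> // y /Z ->; rewrite /parts_of mxE; case: b.
Qed.

Lemma split_dens_flip (p a b b' : R -> R) : split_dens p a b b' ->
  split_dens (fun t => p (- t)) (fun t => a (- t)) (fun t => b (- t)) (fun t => - b' (- t)).
Proof.
move=> [pE ia [B HB] db cb]; split.
- by move=> t; exact: pE.
- exact: (Rint_opp ia).1.
- by exists B => t; rewrite normrN; exact: HB.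
- move=> t; have nt : is_derive (t : R) (1 : R) (fun s : R => - s) (- 1) by exact: dNeg (dId _).
  by have := dComp (db (- t)) nt; rewrite mulrN1.
- by apply: ctN; apply: (ctcomp cb); apply: ctN => t; exact: cvg_id.
Qed.

End SpinorParts.

(** * Both ends of each interface *)

Section Ends.
Variables (R : realType) (gamma : nat -> R -> R * R) (Omega : nat -> set (R * R)).
Hypothesis HI : interfaces gamma Omega.
Variables m E : R.
Let w := omega m E.
Hypothesis w0 : 0 < omega m E.
Variable f : nat -> R * R -> spinor R.
Variables f1 f2 f11 f12 f22 : nat -> bool -> bool -> R * R -> R.
Hypothesis sc : forall k c b, (k <= 2)%N ->
  compact_C2 (comps f k c b) (f1 k c b) (f2 k c b) (f11 k c b) (f12 k c b) (f22 k c b).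
Variable mu : nat -> R -> spinor R.
Hypothesis mo : forall j c, (1 <= j <= 2)%N -> osc E (comps mu j c false) (comps mu j c true).
Variable u : R * R -> spinor R.
Hypothesis uE : forall k x, (k <= 2)%N -> Omega k x -> u x = totalf gamma m E f mu k x.

Let dm j c b (hj : (1 <= j <= 2)%N) : dens (comps mu j c b).
Proof. by have [d1 d2] := osc_dens (mo c hj); case: b. Qed.

Lemma layer_pot_flip (K ka kb : R * R -> R) j c b x : (1 <= j <= 2)%N ->
  (forall z, z != 0 -> has_grad K z (ka z) (kb z)) -> decaying w K -> off_curves gamma x ->
  layer_pot (gamma j) K (comps mu j c b) x = layer_pot (fun t => gamma j (- t)) K (fun t => comps mu j c b (- t)) x.
Proof.
move=> hj HK dK off; have gc := interface_good_curve HI hj.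
by have [_ /esym] := Rint_opp (layer_bound w0 gc HK dK (dm c b hj) (fun t => off j t hj)).
Qed.

Lemma total_outgoing j r : (1 <= j <= 2)%N -> r != 0 ->
  outgoing E (fun t => u (gamma j t + r *: normal gamma j t)).
Proof.
move=> hj r0; have gc := interface_good_curve HI hj; apply: outgoing_sp => -[] V.
(* Traversing the curve backwards reverses the tangent and with it [rot90], so the same points are
   offsets by [- r]. *)
- have rN : - r != 0 by rewrite oppr_eq0.
  have VE : V = fun c b t => parts_of (u (offset (fun t => gamma j (- t)) (fun t => - tangent gamma j (- t)) (- r) t)) c b.
    apply/funext => c; apply/funext => b; apply/funext => t; rewrite /V /offset /rot90 /normal; congr (parts_of (u (_ + _)) _ _).
    by rewrite scaleNr -scalerN; congr (_ *: _); rewrite /=; congr (_, _); rewrite ?opprK.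
  rewrite VE; apply: (path_outgoing HI w0 sc dm uE hj (good_curve_flip gc) (fun t => erefl) (@opprK R) (@normrN _ R) rN
    (q := fun c b t => comps mu j c b (- t))).
  + move=> K ka kb c b x [H0 D0 [d1 [a1 [a2 [A1 _ _]]]] [d2 [b1 [b2 [B1 _ _]]]]] off.
    by split; [exact: layer_pot_flip H0 D0 off|exact: layer_pot_flip A1 d1 off|exact: layer_pot_flip B1 d2 off].
  + move=> c; have [_ [_ [a [b [b' [a2 [b2 [b2' [s1 s2 [_ _ L1 L2]]]]]]]]]] := mo c hj.
    exists (fun t => a (- t)), (fun t => b (- t)), (fun t => - b' (- t)),
      (fun t => a2 (- t)), (fun t => b2 (- t)), (fun t => - b2' (- t)).
    by split; [exact: split_dens_flip s1|exact: split_dens_flip s2| |].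
apply: (path_outgoing HI w0 sc dm uE hj gc (sg := id) _ _ _ r0 (q := comps mu j)) => //.
move=> c; have [_ [_ [a [b [b' [a2 [b2 [b2' [s1 s2 [L1 L2 _ _]]]]]]]]]] := mo c hj.
by exists a, b, b', a2, b2, b2'.
Qed.

End Ends.

(** * From the integral equation to the balance at an interface *)

Section Balance.
Variables (R : realType) (gamma : nat -> R -> R * R) (Omega : nat -> set (R * R)).
Hypothesis HI : interfaces gamma Omega.
Variables m E : R.
Hypothesis w0 : 0 < omega m E.
Variables (f : nat -> R * R -> spinor R) (tau mu : nat -> R -> spinor R).
Hypothesis muE : forall j t, mu j t = Vmx gamma j t *m tau j t.

Lemma L_op_own j t : L_op m E gamma j (tau j) t = tau j t - ((-1) ^+ j * (2 * m))%:C *: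
    (adjoint (Vmx gamma j t) *m insigma gamma j t *m sigma3 R *m (((2 * pi)^-1)%:C *: own_trace gamma m E mu j t)).
Proof.
rewrite /L_op; congr (_ - _ *: (_ *m (_ *: _))).
have G t' : (besselK0 (omega m E * enorm (gamma j t - gamma j t')))%:C *: (Vmx gamma j t' *m tau j t') =
    spinor_of (fun c b => KA (omega m E) (gamma j t - gamma j t') * comps mu j c b t').
  by rewrite -muE -[mu j t' in LHS]parts_ofK spinor_ofZr besselK0E.
exact: (sint_mk (leb R) setT G).
Qed.

Lemma K_op_layer j t : K_op m E gamma j (tau j) t = (-1) ^+ j.-1 *: (adjoint (Vmx gamma (3 - j) t) *m
    insigma gamma (3 - j) t *m layer m E gamma 1 j (mu j) (gamma (3 - j)%N t)).
Proof.
rewrite /K_op; congr (_ *: (_ *m _)); congr sint; apply/funext => t'.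
by rewrite muE.
Qed.

Lemma equation_balance j t J : (1 <= j <= 2)%N ->
  L_op m E gamma j (tau j) t + K_op m E gamma (3 - j) (tau (3 - j)%N) t =
    adjoint (Vmx gamma j t) *m insigma gamma j t *m J ->
  insigma gamma j t *m mu j t + ((-1) ^+ j * (2 * m))%:C *: (sigma3 R *m (((2 * pi)^-1)%:C *: own_trace gamma m E mu j t))
   - ((-1) ^+ (3 - j).-1)%:C *: layer m E gamma 1 (3 - j) (mu (3 - j)%N) (gamma j t) + J = 0.
Proof.
move=> hj; rewrite L_op_own K_op_layer.
have -> : (3 - (3 - j) = j)%N by case: (curve_index hj) => ->.
have -> : (((-1) ^+ (3 - j).-1 : R)%:C : cplx R) = (-1) ^+ (3 - j).-1.
  by case: (curve_index hj) => -> /=; rewrite ?expr0// expr1 rmorphN1.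
by move=> /(flux_balance (gamma_arclength HI t hj)) /=; rewrite muE.
Qed.

End Balance.

Theorem theorem7 (R : realType)
    (gamma : nat -> R -> R * R) (Omega : nat -> set (R * R))
    (m E : R) (f : nat -> R * R -> spinor R)
    (alpha : R) (rho : nat -> R -> spinor R) :
  interfaces gamma Omega ->
  0 < `|E| -> `|E| < `|m| ->
  (forall k, (k <= 2)%N -> test_spinor (Omega k) (f k)) ->
  0 < alpha ->
  (forall j, (1 <= j <= 2)%N ->
     L2_weighted alpha (rho j) /\ each_part (@smooth_curve R R) (rho j)) ->
  integral_equation m E gamma Omega f rho ->
  let mu j t := Vmx gamma j t *m P_op m E j (rho j) t in
  let u x := incident m E Omega f x + scattered m E gamma Omega mu x in
  [/\ solves_dirac E m (Omega 2%N) u (f 2%N),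
      solves_dirac E (- m) (Omega 1%N) u (f 1%N) &
      solves_dirac E m (Omega 0%N) u (f 0%N)] /\
  continuous_across (Omega 2%N) (Omega 1%N) (curve gamma 2%N) u /\
  continuous_across (Omega 1%N) (Omega 0%N) (curve gamma 1%N) u /\
  (forall j (r : R), (1 <= j <= 2)%N -> r != 0 ->
     outgoing E (fun t => u (gamma j t + r *: normal gamma j t))) /\
  u x @[x --> far (curve gamma 1%N `|` curve gamma 2%N)] --> (0 : spinor R).
Proof.
move=> HI E0 Em tf a0 rhoP IE mu u.
have EN0 : E != 0 by rewrite -normr_gt0.
have mE : 0 < m ^+ 2 - E ^+ 2.
  by rewrite subr_gt0 -(real_normK (num_real E)) -(real_normK (num_real m)) ltr_pXn2r ?nnegrE.
have w0 : 0 < omega m E by rewrite /omega sqrtr_gt0.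
have w2 : omega m E ^+ 2 = m ^+ 2 - E ^+ 2 by rewrite /omega sqr_sqrtr// ltW.
have mo j c : (1 <= j <= 2)%N -> osc E (comps mu j c false) (comps mu j c true).
  by move=> hj; have [L2 sm] := rhoP j hj; exact: (mudens_osc HI m EN0 a0 c hj L2 sm).
have dm j c b (hj : (1 <= j <= 2)%N) : dens (comps mu j c b).
  by have [d1 d2] := osc_dens (mo j c hj); case: b.
have f0 k y (k2 : (k <= 2)%N) : ~ Omega k y -> f k y = 0.
  by have [_] := test_spinor_comps (tf k k2); apply.
(* [choice] fixes the partials of all the real components at once; indices k > 2 receive constant
   functions. *)
have [F HF] : exists F : nat * bool * bool -> (R * R -> R) * (R * R -> R) * (R * R -> R) * (R * R -> R) * (R * R -> R),
    forall i, (i.1.1 <= 2)%N -> compact_C2 (comps f i.1.1 i.1.2 i.2) (F i).1.1.1.1 (F i).1.1.1.2 (F i).1.1.2 (F i).1.2 (F i).2.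
  pose Q (i : nat * bool * bool) (h : (R * R -> R) * (R * R -> R) * (R * R -> R) * (R * R -> R) * (R * R -> R)) :=
    (i.1.1 <= 2)%N -> compact_C2 (comps f i.1.1 i.1.2 i.2) h.1.1.1.1 h.1.1.1.2 h.1.1.2 h.1.2 h.2.
  have exQ i : exists h, Q i h.
    rewrite /Q; have [k2|nk] := boolP (i.1.1 <= 2)%N; last by exists (cst 0, cst 0, cst 0, cst 0, cst 0).
    have [f1 [f2 [f11 [f12 [f22 H]]]]] := bump_smoothc ((test_spinor_comps (tf _ k2)).1 i.1.2 i.2).
    by exists (f1, f2, f11, f12, f22).
  by have [F HF] := choice exQ; exists F.
have sc k c b (k2 : (k <= 2)%N) := HF (k, c, b) k2; rewrite /= in sc.
have cf k c b (k2 : (k <= 2)%N) : compact_cont (fun y => parts_of (f k y) c b) := sc_ccs (sc k c b k2).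
have uE k x (k2 : (k <= 2)%N) (kx : Omega k x) : u x = totalf gamma m E f mu k x.
  exact: (total_field HI w0 cf f0 dm k2 kx).
have dirac k (k2 : (k <= 2)%N) : solves_dirac E (region_mass m k) (Omega k) u (f k).
  have H := field_dirac HI w0 sc dm w2 k2 (fun x => uE k x k2).
  by move=> x kx; have := H x kx; rewrite [spinor_of _]parts_ofK.
have cont j (hj : (1 <= j <= 2)%N) : continuous_across (Omega j) (Omega j.-1) (curve gamma j) u.
  move=> _ [t _ <-].
  have j2 : (j <= 2)%N by case/andP: hj. have j1 : (j.-1 <= 2)%N by exact: leq_trans (leq_pred _) j2.
  have eq : L_op m E gamma j (P_op m E j (rho j)) t + K_op m E gamma (3 - j) (P_op m E (3 - j) (rho (3 - j)%N)) t =
      adjoint (Vmx gamma j t) *m insigma gamma j t *m jump gamma Omega (incident m E Omega f) j t.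
    have [e1 e2] := IE t; case: (curve_index hj) => ->.
      by rewrite -[(3 - 1)%N]/2%N; exact: e1.
    by rewrite -[(3 - 2)%N]/1%N addrC; exact: e2.
  have := @equation_balance _ gamma Omega HI m E (fun j => P_op m E j (rho j)) mu (fun _ _ => erefl) j t _ hj eq.
  rewrite (jump_incident HI w0 sc f0 t hj) (layer_field HI w0 dm (k := 1) (other_index hj) (fun s => other_off HI hj (t:=s))); last first.
    by rewrite /region_mass /= expr1 mulN1r.
  move=> /(field_balance HI w0 sc dm hj)[v [v1 v2]]; exists v; split.
    by apply: cvg_trans v1; apply: near_eq_cvg; apply: near_within_eq => y yj; rewrite (uE j).
  by apply: cvg_trans v2; apply: near_eq_cvg; apply: near_within_eq => y yj; rewrite (uE j.-1).
split; first by split; [exact: (dirac 2%N)|exact: (dirac 1%N)|exact: (dirac 0%N)].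
split; first exact: (cont 2%N).
split; first exact: (cont 1%N).
split; first by move=> j r hj r0; exact: (total_outgoing HI w0 sc mo uE hj r0).
exact: (total_far HI w0 sc mo uE).
Qed.
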